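(* Let $\Omega$, $q$, $A$, $\mu$ be as in the context, let $p>0$ and let the damping be $g(s)=|s|^ps$. Assume $q>p+2$, $u_0\in H_0^1(\Omega)$, $u_1\in L^2(\Omega)$, $a(u_0,u_0)>r_*^2$, $0<E(0)<M$ and $$\int_\Omega u_0u_1\,dx>\frac{p+1}{p+2}\left(\frac{B_7^2}{2\varepsilon'a_0\mu_0}\right)^{\frac1{p+1}}E(0),$$ where $\varepsilon'\in(0,1)$ is a solution of the equation $$\frac{p+1}{p+2}\left(\frac{B_7^2}{2\varepsilon'a_0\mu_0}\right)^{\frac1{p+1}}=\frac{q(1-\varepsilon')}{2\sqrt{\frac{a_0\mu_0}{B_7}\left(1+\frac{q(1-\varepsilon')}{2}\right)\left(\frac{q(1-\varepsilon')}{2}-1\right)}}$$ (the right-hand side being a well-defined real number), and $B_7$ is the best constant in the inequality $\|u\|_2^2\le B_7\|\nabla u\|_2^2$, $u\in H_0^1(\Omega)$. Then the weak solution $u$ of $$u_{tt}-\mu(t)\,\mathrm{div}(A(x)\nabla u)+|u_t|^pu_t=|u|^{q-2}u\log|u|\ \text{ in }\Omega,\ t>0,\qquad u=0\ \text{ on }\partial\Omega,\qquad u(\cdot,0)=u_0,\ u_t(\cdot,0)=u_1$$ blows up in finite time.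
   Context: Setting. $\Omega\subset\mathbb{R}^n$ ($n\ge1$) is a bounded domain with smooth boundary. $q$ is a constant with $2<q<2^*$, where $2^*=\frac{2n}{n-2}$ if $n\ge3$ and $2^*=+\infty$ if $n=1,2$. Functions are real valued; $|s|^{q-2}s\log|s|$ and $|s|^q\log|s|$ are $0$ at $s=0$; $\|\cdot\|_s$ is the norm of $L^s(\Omega)$; $e$ is Euler's number. Assumption on $A$: $A(x)=(a_{ij}(x))$ is a symmetric matrix with $a_{ij}\in C^1(\bar\Omega)$, and $a_0>0$ is a constant with $\sum_{i,j=1}^n a_{ij}(x)w_iw_j\ge a_0|w|^2$ for all $x\in\bar\Omega$, $w\in\mathbb{R}^n$. Assumption on $\mu$: $\mu\in C^1(0,\infty)\cap W^{1,\infty}(0,\infty)$, and $\mu(t)\ge\mu_0>0$, $\mu'(t)<0$ for a.e. $t\in[0,\infty)$, where $\mu_0$ is a constant. Notation: $a(u,v)=\int_\Omega A\nabla u\cdot\nabla v\,dx$ for $u,v\in H_0^1(\Omega)$. The energy is $E(t)=\frac12\|u_t\|_2^2+\frac12\mu(t)a(u,u)-\frac1q\int_\Omega|u|^q\log|u|\,dx+\frac1{q^2}\|u\|_q^q$; $E(0)$ is its value at $t=0$ with $(u,u_t)=(u_0,u_1)$. For $\gamma\in(0,2^*-q)$ let $K_0=K_0(\gamma)$ be a constant with $\|u\|_{q+\gamma}\le C_{q+\gamma}\|\nabla u\|_2\le K_0[a(u,u)]^{1/2}$ for all $u\in H_0^1(\Omega)$ ($C_{q+\gamma}$ a Sobolev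 embedding constant), and set $$r_*=\sup_{\gamma\in(0,2^*-q)}\left(\frac{\mu_0e\gamma}{K_0^{q+\gamma}}\right)^{\frac1{q+\gamma-2}},\qquad M=\frac{q-2}{2q}\mu_0r_*^2 .$$ Weak solution: $u$ is a weak solution on $\Omega\times[0,T]$ if $u\in C([0,T];H_0^1(\Omega))\cap C^1([0,T];L^2(\Omega))$, $u_t\in L^{p+2}([0,T]\times\Omega)\cap L^2([0,T];H_0^1(\Omega))$, $(u(0),u_t(0))=(u_0,u_1)$, and for every $\phi\in H_0^1(\Omega)$ and a.e. $t\in[0,T]$, with $g(s)=|s|^ps$, $$\int_\Omega u_t(t)\phi\,dx-\int_\Omega u_1\phi\,dx+\int_0^t\mu(s)a(u(s),\phi)\,ds+\int_0^t\!\int_\Omega g(u_t)\phi\,dx\,ds=\int_0^t\!\int_\Omega|u|^{q-2}u\log|u|\,\phi\,dx\,ds.$$ A unique weak solution exists on some interval $[0,T]$, $T>0$. ''Blows up in finite time'' means that this solution cannot be extended to a weak solution on the whole interval $[0,+\infty)$ (its lifespan is finite). *)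

(* Defs.v *)
From HB Require Import structures.
From mathcomp Require Import all_boot all_order all_algebra.
From mathcomp Require Import all_classical all_reals all_analysis.

Set Implicit Arguments.
Unset Strict Implicit.
Unset Printing Implicit Defensive.
Import Order.TTheory GRing.Theory Num.Theory.
Import numFieldNormedType.Exports.

Local Open Scope classical_set_scope.
Local Open Scope ring_scope.

(* Product sigma-algebra on row vectors (the Borel sets), as the library does
   for tuples. *)
Definition measure_rV_display : measure_display -> measure_display.
Proof. exact. Qed.

Section measurable_rV.
Context {R : realType} {n : nat}.

Definition rV_coord (i : 'I_n) (x : 'rV[R]_n) : measurableTypeR R := x ord0 i.

Let rV_set0 : g_sigma_preimage rV_coord set0.
Proof. exact: sigma_algebra0. Qed.

Let rV_setC A : g_sigma_preimage rV_coord A -> g_sigma_preimage rV_coord (~` A).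
Proof. exact: sigma_algebraC. Qed.

Let rV_bigcup (F : _^nat) : (forall i, g_sigma_preimage rV_coord (F i)) ->
  g_sigma_preimage rV_coord (\bigcup_i (F i)).
Proof. exact: sigma_algebra_bigcup. Qed.

HB.instance Definition _ := @isMeasurable.Build
  (measure_rV_display default_measure_display)
  'rV[R]_n (g_sigma_preimage rV_coord) rV_set0 rV_setC rV_bigcup.

Lemma measurable_rV_coord (i : 'I_n) : measurable_fun [set: 'rV[R]_n] (rV_coord i).
Proof.
move=> _ Y mY; rewrite setTI; apply: sub_sigma_algebra => /=.
rewrite -bigcup_seq/=; exists i => /=; first by rewrite mem_index_enum.
by exists Y => //; rewrite setTI.
Qed.

Lemma measurable_rV_coordP d (T : measurableType d) (f : T -> 'rV[R]_n) :
  (forall i, measurable_fun [set: T] (rV_coord i \o f)) ->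
  measurable_fun [set: T] f.
Proof.
move=> mf _ A mA; rewrite setTI.
suff: measurable `<=` [set A | measurable (f @^-1` A)] by exact.
apply: smallest_sub.
  split => //=; first by rewrite preimage_set0.
    by move=> B mB; rewrite setTD preimage_setC; exact: measurableC.
  by move=> F mF; rewrite preimage_bigcup; exact: bigcupT_measurable.
move=> B; rewrite -bigcup_seq => -[i _ [C mC <-]] /=.
by rewrite setTI -comp_preimage -[_ @^-1` _]setTI; exact: mf.
Qed.

End measurable_rV.

Section lebesgue_rV.
Context {R : realType}.
Local Notation leb1 := (@lebesgue_measure R).

Definition rV_cons n (z : measurableTypeR R * 'rV[R]_n) : 'rV[R]_n.+1 :=
  row_mx (z.1 : R)%:M z.2.

Definition rV_uncons n (x : 'rV[R]_n.+1) : measurableTypeR R * 'rV[R]_n :=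
  (x ord0 ord0, @rsubmx R 1 1 n x).

Lemma rV_consK n : cancel (@rV_cons n) (@rV_uncons n).
Proof.
move=> [t v]; rewrite /rV_uncons /rV_cons /= row_mxKr; congr pair.
have -> : ord0 = lshift n (ord0 : 'I_1) by exact/val_inj.
by apply: etrans (row_mxEl _ _ _ _) _; rewrite mxE eqxx mulr1n.
Qed.

Lemma measurable_rV_cons n : measurable_fun setT (@rV_cons n).
Proof.
apply: measurable_rV_coordP => i.
rewrite -[i](@splitK 1 n); case: (@fintype.split 1 n i) => j /=.
  apply: (eq_measurable_fun fst) => // -[t v] _ /=.
  apply: esym; apply: etrans (row_mxEl _ _ _ _) _.
  by rewrite [j]ord1 mxE mulr1n.
apply: (eq_measurable_fun (rV_coord j \o snd)).
  by move=> [t v] _ /=; apply/esym/row_mxEr.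
exact: measurableT_comp (measurable_rV_coord j) measurable_snd.
Qed.

Lemma measurable_rV_uncons n : measurable_fun setT (@rV_uncons n).
Proof.
apply: measurable_fun_pair => /=; first exact: (measurable_rV_coord ord0).
apply: measurable_rV_coordP => i.
apply: (eq_measurable_fun (@rV_coord R n.+1 (@rshift 1 n i))).
  by move=> x _ /=; rewrite /rV_coord mxE.
exact: measurable_rV_coord.
Qed.

Section step.
Context n (m : {sigma_finite_measure set 'rV[R]_n -> \bar R}).

Definition lebesgue_step : set 'rV[R]_n.+1 -> \bar R :=
  pushforward (leb1 \x m)%E (@rV_cons n).

Let step0 : lebesgue_step set0 = 0%E.
Proof. by rewrite /lebesgue_step /pushforward preimage_set0 measure0. Qed.

Let step_ge0 A : (0 <= lebesgue_step A)%E.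
Proof. by rewrite /lebesgue_step /pushforward; exact: measure_ge0. Qed.

Let step_sigma_additive : semi_sigma_additive lebesgue_step.
Proof.
move=> F mF tF mUF; rewrite /lebesgue_step /pushforward preimage_bigcup.
have mc B : measurable B -> measurable (@rV_cons n @^-1` B).
  by move=> mB; rewrite -[X in measurable X]setTI; exact: measurable_rV_cons.
apply: measure_semi_sigma_additive.
- by move=> k; exact: mc.
- apply/trivIsetP => /= i j _ _ ij; rewrite -preimage_setI.
  by move/trivIsetP : tF => /(_ _ _ _ _ ij) ->//; rewrite preimage_set0.
- by rewrite -preimage_bigcup; exact: mc.
Qed.

HB.instance Definition _ := isMeasure.Build _ _ _ lebesgue_step
  step0 step_ge0 step_sigma_additive.

Let step_sigma_finite : sigma_finite setT lebesgue_step.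
Proof.
have /sigma_finiteP[F [FT ndF F1]] := @sigma_finiteT _ _ _ leb1.
have /sigma_finiteP[G [GT ndG G1]] := @sigma_finiteT _ _ _ m.
have mFG k : measurable (F k `*` G k).
  by apply: measurableX; [exact: (F1 k).1|exact: (G1 k).1].
exists (fun k => @rV_uncons n @^-1` (F k `*` G k)).
  apply/esym/seteqP; split => // x _.
  have [i _ Fi] : (\bigcup_k F k) (rV_uncons x).1 by rewrite -FT.
  have [j _ Gj] : (\bigcup_k G k) (rV_uncons x).2 by rewrite -GT.
  exists (maxn i j) => //; split => /=.
    by move: (ndF _ _ (leq_maxl i j)) => /subsetPset; exact.
  by move: (ndG _ _ (leq_maxr i j)) => /subsetPset; exact.
move=> k; split.
  by rewrite -[X in measurable X]setTI; exact: measurable_rV_uncons.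
rewrite /lebesgue_step /pushforward.
rewrite (_ : _ @^-1` _ = F k `*` G k); last first.
  rewrite -comp_preimage (_ : _ \o _ = id) ?preimage_id//.
  by apply/funext => z; exact: rV_consK.
rewrite product_measure1E; [|exact: (F1 k).1|exact: (G1 k).1].
by apply: lte_mul_pinfty; rewrite ?ge0_fin_numE ?measure_ge0//;
  [exact: (F1 k).2|exact: (G1 k).2].
Qed.

HB.instance Definition _ := Measure_isSigmaFinite.Build _ _ _ lebesgue_step
  step_sigma_finite.

End step.

Fixpoint lebesgue_rV n : {sigma_finite_measure set 'rV[R]_n -> \bar R} :=
  match n with
  | 0 => \d_(0 : 'rV[R]_0)
  | k.+1 => lebesgue_step (lebesgue_rV k)
  end.

End lebesgue_rV.

(* Functions on Omega are represented by total functions, read on Omega only and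
   up to equality almost everywhere. *)
Section sobolev.
Context {R : realType} {n : nat}.
Local Notation V := 'rV[R]_n.
Local Notation leb := (@lebesgue_rV R n).
Implicit Types (Omega U : set V) (f u v phi : V -> R).

Definition basis_vec (i : 'I_n) : V := delta_mx ord0 i.

Definition partial (i : 'I_n) f : V -> R := fun x => 'D_(basis_vec i) f x.

(* C^infty on an open set U: all iterated partial derivatives exist and are
   continuous on U. *)
Definition smooth_on U f := forall (s : seq 'I_n) (x : V), U x ->
  (forall i, derivable (foldr partial f s) x (basis_vec i)) /\
  {for x, continuous (foldr partial f s)}.

Definition smooth_boundary Omega := forall x0, (closure Omega `\` Omega) x0 ->
  exists (U : set V) (psi : V -> R),
    [/\ open U, U x0, smooth_on U psi,
        forall x, U x -> exists i, partial i psi x != 0 &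
        forall x, U x -> (Omega x <-> psi x < 0)].

Definition smooth_bounded_domain Omega :=
  [/\ Omega !=set0, open Omega, connected Omega, bounded_set Omega &
      smooth_boundary Omega].

Definition C1_closure Omega f := {within closure Omega, continuous f} /\
  forall i, exists g : V -> R, {within closure Omega, continuous g} /\
    forall x, Omega x -> derivable f x (basis_vec i) /\ partial i f x = g x.

Definition test_function Omega phi := [/\ smooth_on setT phi,
  compact (closure [set x | phi x != 0]) &
  closure [set x | phi x != 0] `<=` Omega].

Definition Lpnorm Omega (s : R) u : \bar R :=
  'N[leb]_(s%:E)[EFin \o (u \_ Omega)].

Definition in_Lp Omega (s : R) u :=
  measurable_fun Omega u /\ (Lpnorm Omega s u < +oo)%E.

Definition ae_eq_on Omega u v := {ae leb, forall x, Omega x -> u x = v x}.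

Definition enorm (w : V) : R := Num.sqrt (\sum_(i < n) w ord0 i ^+ 2).

Definition is_weak_gradient Omega u (G : V -> V) :=
  forall i phi, test_function Omega phi ->
    (\int[leb]_(x in Omega) (u x * partial i phi x))%R =
    - (\int[leb]_(x in Omega) (G x ord0 i * phi x))%R.

Definition L2_weak_gradient Omega u (G : V -> V) :=
  (forall i, in_Lp Omega 2 (fun x => G x ord0 i)) /\ is_weak_gradient Omega u G.

Definition in_H1 Omega u :=
  in_Lp Omega 2 u /\ exists G, L2_weak_gradient Omega u G.

(* A choice of the weak gradient, unique up to equality a.e. on Omega. *)
Definition wgrad Omega u : V -> V := get [set G | L2_weak_gradient Omega u G].

Definition grad_norm Omega u : \bar R :=
  Lpnorm Omega 2 (fun x => enorm (wgrad Omega u x)).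

Definition H1norm Omega u : \bar R :=
  ((Lpnorm Omega 2 u `^ 2 + grad_norm Omega u `^ 2) `^ 2^-1)%E.

Definition in_H01 Omega u := in_H1 Omega u /\
  exists phi : nat -> V -> R, (forall k, test_function Omega (phi k)) /\
    H1norm Omega (u \- phi k) @[k --> \oo] --> 0%E.

Definition a_form Omega (A : V -> 'M[R]_n) u v : R :=
  (\int[leb]_(x in Omega) (\sum_(i < n) \sum_(j < n)
     A x i j * wgrad Omega u x ord0 j * wgrad Omega v x ord0 i))%R.

Definition elliptic_matrix Omega (A : V -> 'M[R]_n) (a0 : R) :=
  [/\ 0 < a0,
      forall x, closure Omega x -> (A x)^T = A x,
      forall i j, C1_closure Omega (fun x => A x i j) &
      forall x, closure Omega x -> forall w : V,
        a0 * enorm w ^+ 2 <=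
          \sum_(i < n) \sum_(j < n) A x i j * w ord0 i * w ord0 j].

End sobolev.

(* mu 0 is the limit of mu at 0+, which exists because W^{1,oo}(0,oo) functions
   are Lipschitz. *)
Definition admissible_mu {R : realType} (mu : R -> R) (mu0 : R) :=
  [/\ forall t, 0 < t -> derivable mu t 1 /\ {for t, continuous (derive1 mu)},
      ('N[lebesgue_measure]_+oo[EFin \o (mu \_ `]0%R, +oo[)] < +oo)%E,
      ('N[lebesgue_measure]_+oo[EFin \o (derive1 mu \_ `]0%R, +oo[)] < +oo)%E,
      mu x @[x --> 0^'+] --> mu 0 &
      0 < mu0 /\ {ae lebesgue_measure, forall t : R, 0 <= t ->
                   mu0 <= mu t /\ derive1 mu t < 0}].

(* ln 0 = 0 and 0 `^ r = 0 for r != 0, so that these vanish at s = 0. *)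
Definition log_source {R : realType} (q s : R) : R :=
  `|s| `^ (q - 2) * s * ln `|s|.

Definition damping {R : realType} (p s : R) : R := `|s| `^ p * s.

Section evolution.
Context {R : realType} {n : nat}.
Local Notation V := 'rV[R]_n.
Local Notation leb := (@lebesgue_rV R n).
Local Notation leb1 := (@lebesgue_measure R).
Variable Omega : set V.
Implicit Types (u v : R -> V -> R).

(* The space C([0,T]; X), where X is given by a membership predicate and a
   norm. *)
Definition C_into (X : (V -> R) -> Prop) (N : (V -> R) -> \bar R) (T : R) u :=
  forall t, 0 <= t <= T ->
    X (u t) /\ N (u s \- u t) @[s --> within `[0, T] (nbhs t)] --> 0%E.

Definition L2_time_derivative (T : R) u v := forall t, 0 <= t <= T ->
  Lpnorm Omega 2 (fun x => (s - t)^-1 * (u s x - u t x) - v t x)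
    @[s --> within `[0, T] t^'] --> 0%E.

Definition in_Lp_cylinder (s T : R) v :=
  exists w : measurableTypeR R * V -> R,
    [/\ measurable_fun (`[0, T] `*` Omega) w,
        ('N[(leb1 \x leb)%E]_(s%:E)[EFin \o (w \_ (`[0%R, T] `*` Omega))] < +oo)%E &
        {ae leb1, forall t : R, 0 <= t <= T ->
           ae_eq_on Omega (fun x => w (t, x)) (v t)}].

Definition H01_simple (T : R) u := exists m (B : 'I_m -> set (measurableTypeR R))
    (f : 'I_m -> V -> R),
  (forall i, measurable (B i) /\ in_H01 Omega (f i)) /\
  forall t x, 0 <= t <= T -> u t x = \sum_(i < m) \1_(B i) t * f i x.

(* Bochner space: a.e. limits of simple functions, with square integrable
   norm. *)
Definition in_L2_H01 (T : R) v :=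
  [/\ {ae leb1, forall t : R, 0 <= t <= T -> in_H01 Omega (v t)},
      exists s : nat -> R -> V -> R, (forall k, H01_simple T (s k)) /\
        {ae leb1, forall t : R, 0 <= t <= T ->
           H1norm Omega (s k t \- v t) @[k --> \oo] --> 0%E} &
      (\int[leb1]_(t in `[0%R, T]) (H1norm Omega (v t) `^ 2) < +oo)%E].

Variables (A : V -> 'M[R]_n) (mu : R -> R) (p q : R) (u0 u1 : V -> R).

Record weak_solution_deriv (T : R) (u ut : R -> V -> R) : Prop := {
  ws_C_H01 : C_into (in_H01 Omega) (H1norm Omega) T u;
  ws_C_L2 : C_into (in_Lp Omega 2) (Lpnorm Omega 2) T ut;
  ws_deriv : L2_time_derivative T u ut;
  ws_Lp : in_Lp_cylinder (p + 2) T ut;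
  ws_L2_H01 : in_L2_H01 T ut;
  ws_init : ae_eq_on Omega (u 0) u0 /\ ae_eq_on Omega (ut 0) u1;
  ws_eq : forall phi, in_H01 Omega phi ->
    {ae leb1, forall t : R, 0 <= t <= T ->
      ((\int[leb]_(x in Omega) (ut t x * phi x))
       - (\int[leb]_(x in Omega) (u1 x * phi x))
       + (\int[leb1]_(s in `[0%R, t]) (mu s * a_form Omega A (u s) phi))
       + (\int[leb1]_(s in `[0%R, t])
            (\int[leb]_(x in Omega) (damping p (ut s x) * phi x)))
       = \int[leb1]_(s in `[0%R, t])
            (\int[leb]_(x in Omega) (log_source q (u s x) * phi x)))%R} }.

Definition weak_solution (T : R) u := exists ut, weak_solution_deriv T u ut.

Definition global_weak_solution u := forall T, 0 < T -> weak_solution T u.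

Definition blows_up_in_finite_time (T : R) u := ~ exists U,
  global_weak_solution U /\ forall t, 0 <= t <= T -> ae_eq_on Omega (U t) (u t).

Definition energy (t : R) (u ut : V -> R) : R :=
  2^-1 * fine (Lpnorm Omega 2 ut) ^+ 2 + 2^-1 * mu t * a_form Omega A u u
  - q^-1 * (\int[leb]_(x in Omega) (`|u x| `^ q * ln `|u x|))%R
  + (q ^+ 2)^-1 * fine (Lpnorm Omega q u) `^ q.

End evolution.

Section constants.
Context {R : realType} {n : nat}.
Local Notation V := 'rV[R]_n.

Definition critical_exponent (m : nat) : \bar R :=
  if (3 <= m)%N then ((2 * m%:R) / (m%:R - 2))%:E else +oo%E.

Definition gamma_range (q : R) : set R :=
  [set g | 0 < g /\ ((q + g)%:E < critical_exponent n)%E].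

Definition embedding_constants (Omega : set V) (A : V -> 'M[R]_n) (q : R)
    (C K0 : R -> R) :=
  forall g, gamma_range q g -> forall u, in_H01 Omega u ->
    (Lpnorm Omega (q + g) u <= (C g)%:E * grad_norm Omega u)%E /\
    ((C g)%:E * grad_norm Omega u
       <= (K0 g * Num.sqrt (a_form Omega A u u))%:E)%E.

Definition r_star (q mu0 : R) (K0 : R -> R) : R :=
  sup [set (mu0 * expR 1 * g / K0 g `^ (q + g)) `^ ((q + g - 2)^-1)
      | g in gamma_range q].

Definition M_const (q mu0 : R) (K0 : R -> R) : R :=
  (q - 2) / (2 * q) * mu0 * r_star q mu0 K0 ^+ 2.

Definition poincare_constant (Omega : set V) (B : R) :=
  forall u, in_H01 Omega u ->
    fine (Lpnorm Omega 2 u) ^+ 2 <= B * fine (grad_norm Omega u) ^+ 2.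

Definition best_poincare_constant (Omega : set V) (B : R) :=
  poincare_constant Omega B /\ forall B', poincare_constant Omega B' -> B <= B'.

End constants.

Arguments gamma_range {R} n q.
Arguments r_star {R} n q mu0 K0.
Arguments M_const {R} n q mu0 K0.

(* Main.v *)
(** The hypotheses on [eps] and [B7] serve only to make the initial value of the
    pairing <u, u_t> positive, and a single exponent gamma whose well depth exceeds
    E(0) replaces the supremum in r_*.

    The energy inequality E(t) + D(t) <= E(0), with D the dissipation, is proved by
    testing the equation with centred difference quotients of u. With
    |s|^q log|s| <= |s|^(q+gamma) / (e gamma) and the embedding constant, it shows
    that a(u,u) never returns to the critical value r^2: there the potential energy
    would be at least M > E(0). In this unstable region
    <f(u), u> - mu a(u,u) dominates the L^q norm of u, the kinetic energy and
    H = h0 + D for a suitable h0 > 0. Since q > p + 2, the damping term is absorbed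
    by adding a multiple of H^(1-sigma) to the pairing: G = <u, u_t> + c H^(1-sigma)
    has increments at least c' G^(1/(1-sigma)) per unit of time, and G(0) > 0. Hence
    G becomes infinite before a time that depends only on the data. *)
Require Import Defs.
From HB Require Import structures.
From mathcomp Require Import all_boot all_order all_algebra.
From mathcomp Require Import all_classical all_reals all_analysis.
From mathcomp Require Import measurable_realfun.
From mathcomp Require Import ring lra.
Import Order.TTheory GRing.Theory Num.Theory.
Import numFieldNormedType.Exports.
Set Implicit Arguments.
Unset Strict Implicit.
Unset Printing Implicit Defensive.
Local Open Scope classical_set_scope.
Local Open Scope ring_scope.

(** The velocity is not an admissible test function. The equation is tested with fixed elements of
    H^1_0, for almost every time, and |u_t|^p u_t lies only in L^((p+2)/(p+1)), so that its work
    against u_t is recovered only up to a tail. Hence only increments are compared: D is continuous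
    and nondecreasing but need not be Lipschitz, and the H-variation of u is bounded by the
    primitive of an integrable bound for the H^1 norm of u_t. Each differential inequality becomes
    an inequality between increments over short intervals, with an error that is a small multiple of
    the increment of a monotone function; such errors add up. The exponent sigma obeys two
    constraints. By sigma <= 1/2 - 1/q, the Cauchy-Schwarz bound of <u, u_t> is a power 1 - sigma of
    the quantity that drives G. By sigma <= (1 - (p+2)/q)/(p+1), the Young remainder of the damping
    is an increment of H^(1-sigma); this second bound is positive exactly when q > p + 2. *)

(** * Growth read off from increments *)

(** The tolerance [d] is uniform, so the interval can be cut into steps shorter than [d]. The errors
    of the steps add up to the same multiple of the total increment of [K], and [e] is arbitrary.
    This takes the place of the sign of a derivative, which [z] need not have. *)
Lemma local_increment_homo (R : realType) (z K : R -> R) (a b : R) :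
  (forall s t, a <= s -> s <= t -> t <= b -> K s <= K t) ->
  (forall e, 0 < e -> exists2 d, 0 < d & forall s t, a <= s -> s <= t ->
     t <= b -> t - s < d -> - e * (K t - K s) <= z t - z s) ->
  forall s t, a <= s -> s <= t -> t <= b -> z s <= z t.
Proof.
move=> Kh zK s t as_ st tb.
suff key e : 0 < e -> - e * (K t - K s) <= z t - z s.
  rewrite -subr_ge0; apply/ler_addgt0Pr => e e0.
  have Kst := Kh _ _ as_ st tb.
  have e'0 : 0 < e / (1 + (K t - K s)) by rewrite divr_gt0//; lra.
  have := key _ e'0.
  have : e / (1 + (K t - K s)) * (K t - K s) <= e.
    rewrite -mulrAC ler_pdivrMr; last lra.
    by rewrite ler_pM2l//; lra.
  lra.
move=> e0; have [d d0 hd] := zK _ e0.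
have ts : 0 <= t - s by lra.
pose N := Num.bound ((t - s) / d).
have hN : (t - s) / d < N%:R.
  by apply: archi_boundP; rewrite divr_ge0// ltW.
have N0 : 0 < N%:R :> R by apply: le_lt_trans hN; rewrite divr_ge0// ltW.
pose h := (t - s) / N%:R.
have h0 : 0 <= h by rewrite divr_ge0// ltW.
have hd' : h < d.
  by rewrite /h ltr_pdivrMr// mulrC -ltr_pdivrMr.
have NhE : N%:R * h = t - s by rewrite /h mulrC divfK// gt_eqF.
have ind (k : nat) : (k <= N)%N ->
    - e * (K (s + k%:R * h) - K s) <= z (s + k%:R * h) - z s.
  elim: k => [|k ih] kN; first by rewrite mul0r addr0 !subrr mulr0.
  have {}ih := ih (ltnW kN).
  have kh : 0 <= k%:R * h by rewrite mulr_ge0.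
  have : k.+1%:R * h <= N%:R * h by rewrite ler_wpM2r// ler_nat.
  rewrite NhE -natr1 mulrDl mul1r => kt.
  have := hd (s + k%:R * h) (s + (k%:R * h + h)).
  rewrite !opprD addrACA subrr add0r addrAC subrr add0r.
  move=> /(_ _ _ _ hd'); move=> /(_ ltac:(lra) ltac:(lra) ltac:(lra)).
  lra.
by have := ind N (leqnn _); rewrite NhE subrKC.
Qed.

Lemma powRX (R : realType) (a b : R) (k : nat) : 0 <= a ->
  (a `^ b) ^+ k = (a ^+ k) `^ b.
Proof.
move=> a0; rewrite -(powR_mulrn k a0) -(powR_mulrn k (powR_ge0 a b)).
by rewrite -powRrM -powRrM mulrC. Qed.

(** The increment form of G' >= c G^(1+b). Once G is at least 2^k G(0), a time proportional to
    2^(-kb) is enough to double it; these times form a geometric series, whose sum is the bound.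
    Past that time G would exceed every 2^k G(0). *)
Lemma superlinear_growth_bound (R : realType) (G : R -> R) (c b T : R) :
  0 < c -> 0 < b -> 0 < G 0 ->
  (forall s t, 0 <= s -> s <= t -> t <= T ->
     c * (t - s) * G s `^ (1 + b) <= G t - G s) ->
  T <= G 0 `^ (- b) / c / (1 - 2 `^ (- b)).
Proof.
move=> c0 b0 G0 hG; rewrite leNgt; apply/negP => hT.
set x := 2 `^ (- b) in hT.
have x0 : 0 < x by rewrite powR_gt0.
have x1 : x < 1.
  rewrite /x /powR gt_eqF// expR_lt1 mulNr oppr_lt0 mulr_gt0// ln_gt0//; lra.
set A := G 0 `^ (- b) / c in hT.
have A0 : 0 < A by rewrite divr_gt0// powR_gt0.
(* The sum of the first [k] doubling times [A * x ^+ j]. *)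
pose tau (k : nat) := A * (1 - x ^+ k) / (1 - x).
have xk0 k : 0 < x ^+ k by rewrite exprn_gt0.
have xk1 k : x ^+ k <= 1 by rewrite exprn_ile1 ?ltW.
have tau0 k : 0 <= tau k.
  by apply: divr_ge0; [apply: mulr_ge0; [exact: ltW|rewrite subr_ge0]|rewrite subr_ge0 ltW].
have tauT k : tau k <= T.
  apply/ltW/le_lt_trans/hT; rewrite ler_pM2r ?invr_gt0; last lra.
  by have := mulr_gt0 A0 (xk0 k); lra.
have tauS k : tau k.+1 - tau k = A * x ^+ k.
  by rewrite /tau exprS; field; lra.
have ind k : 2 ^+ k * G 0 <= G (tau k).
  elim: k => [|k ih]; first by rewrite /tau !expr0 subrr mulr0 mul0r mul1r.
  have := hG (tau k) (tau k.+1) (tau0 _).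
  have Axk := mulr_gt0 A0 (xk0 k).
  move=> /(_ ltac:(by rewrite -subr_ge0 tauS ltW) (tauT _)).
  have kG : 0 < 2 ^+ k * G 0 by rewrite mulr_gt0// exprn_gt0.
  have : (2 ^+ k * G 0) `^ (1 + b) <= G (tau k) `^ (1 + b).
    by apply: ge0_ler_powR; rewrite ?nnegrE; lra.
  rewrite tauS => /(ler_wpM2l (ltW Axk)).
  have -> : A * x ^+ k * (2 ^+ k * G 0) `^ (1 + b) = 2 ^+ k * G 0 / c.
    rewrite powRD; last by rewrite (gt_eqF kG) implybT.
    rewrite powRr1; last exact: ltW.
    rewrite powRM ?exprn_ge0 ?ltW// /A /x.
    have -> : 2 `^ (- b) ^+ k = ((2 ^+ k) `^ b)^-1.
      rewrite powRN exprVn; congr (_^-1).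
      by rewrite powRX.
    rewrite powRN; field.
    by rewrite gt_eqF// ?gt_eqF// ?powR_gt0// ?exprn_gt0.
  have -> : c * (A * x ^+ k) * G (tau k) `^ (1 + b)
          = (A * x ^+ k * G (tau k) `^ (1 + b)) * c by ring.
  rewrite ler_pdivrMr// => h1 h2.
  by rewrite exprS; lra.
have GT k : 2 ^+ k * G 0 <= G T.
  apply: le_trans (ind k) _; rewrite -subr_ge0.
  apply: le_trans (hG _ _ (tau0 k) (tauT k) (lexx _)).
  by rewrite !mulr_ge0 ?powR_ge0//; [lra|rewrite subr_ge0].
pose N := Num.bound (G T / G 0).
have GT0 : 0 <= G T by apply: le_trans (GT 0%N); rewrite expr0; lra.
have : G T / G 0 < N%:R by apply: archi_boundP; rewrite divr_ge0//; lra.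
rewrite ltr_pdivrMr// => hN.
have : N%:R <= 2 ^+ N :> R by rewrite -natrX ler_nat ltnW// ltn_expl.
by move=> /(ler_wpM2r (ltW G0)) ?; have := GT N; lra.
Qed.

(** * Moduli of continuity and symmetric forms *)

(** [dist] is arbitrary: it stands for |f t - f s| as well as for the various norms of u t - u s. *)
Definition modulus_on {R : realType} (a b : R) (dist : R -> R -> R) :=
  forall e, 0 < e -> exists2 d, 0 < d & forall s t, a <= s <= b -> a <= t <= b ->
    `|t - s| < d -> dist s t <= e.

Lemma modulus_onW {R : realType} {a b : R} {f g : R -> R -> R} (C : R) :
  0 <= C -> (forall s t, a <= s <= b -> a <= t <= b -> f s t <= C * g s t) ->
  modulus_on a b g -> modulus_on a b f.
Proof.
move=> C0 fg hg e e0.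
have e'0 : 0 < e / (1 + C) by rewrite divr_gt0//; lra.
have [d d0 hd] := hg _ e'0; exists d => // s t sab tab st.
apply: le_trans (fg _ _ sab tab) _.
apply: le_trans (ler_wpM2l C0 (hd _ _ sab tab st)) _.
rewrite mulrCA ger_pMr// ler_pdivrMr; lra.
Qed.

Lemma modulus_onM {R : realType} {a b : R} {g : R -> R -> R} (C : R) :
  0 <= C -> modulus_on a b g -> modulus_on a b (fun s t => C * g s t).
Proof. by move=> C0; apply: modulus_onW C0 _. Qed.

Section bilinear_on.
Context {R : realType} {X : lmodType R}.

Record subspace (H : X -> Prop) := {
  subspaceB : forall x y, H x -> H y -> H (x - y);
  subspaceZ : forall c x, H x -> H (c *: x) }.

Record linear_on (H : X -> Prop) (f : X -> R) := {
  linear_onB : forall x y, H x -> H y -> f (x - y) = f x - f y;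
  linear_onZ : forall c x, H x -> f (c *: x) = c * f x }.

(** Only semidefinite: the elements will be total functions, and those that vanish almost everywhere
    on the domain are isotropic. For the same reason [norm_on] describes a seminorm. *)
Record form_on (H : X -> Prop) (b : X -> X -> R) := {
  form_onl : forall x, H x -> linear_on H (b x);
  form_onC : forall x y, H x -> H y -> b x y = b y x;
  form_on_ge0 : forall x, H x -> 0 <= b x x }.

Record norm_on (H : X -> Prop) (N : X -> R) := {
  norm_on_ge0 : forall x, 0 <= N x;
  norm_onB : forall x y, H x -> H y -> N (x - y) <= N x + N y;
  norm_onZ : forall c x, H x -> N (c *: x) = `|c| * N x }.

Context {H : X -> Prop} (hH : subspace H).

Lemma subspaceD x y : H x -> H y -> H (x + y).
Proof.
move=> Hx Hy; rewrite -[y]opprK; apply: subspaceB => //.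
by rewrite -scaleN1r; apply: subspaceZ.
Qed.

Context {b : X -> X -> R} (hb : form_on H b).

Lemma formBr x y z : H x -> H y -> H z -> b x (y - z) = b x y - b x z.
Proof. by move=> Hx Hy Hz; rewrite (linear_onB (form_onl hb Hx)). Qed.

Lemma formZr c x y : H x -> H y -> b x (c *: y) = c * b x y.
Proof. by move=> Hx Hy; rewrite (linear_onZ (form_onl hb Hx)). Qed.

Lemma formBl x y z : H x -> H y -> H z -> b (y - z) x = b y x - b z x.
Proof.
move=> Hx Hy Hz; rewrite (form_onC hb)//; last exact: subspaceB.
by rewrite formBr// (form_onC hb)// (form_onC hb Hx Hz).
Qed.

Lemma formZl c x y : H x -> H y -> b (c *: y) x = c * b y x.
Proof.
move=> Hx Hy; rewrite (form_onC hb)//; last exact: subspaceZ.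
by rewrite formZr// (form_onC hb).
Qed.

Lemma formB2 x y : H x -> H y -> b (x - y) (x - y) = b x x - 2 * b x y + b y y.
Proof.
move=> Hx Hy; have Hxy := subspaceB hH Hx Hy.
rewrite formBl// !formBr// (form_onC hb Hy Hx)//; ring.
Qed.

Lemma form_CS x y : H x -> H y -> b x y ^+ 2 <= b x x * b y y.
Proof.
move=> Hx Hy.
have key t : 0 <= b x x - 2 * t * b x y + t ^+ 2 * b y y.
  have Hty := subspaceZ hH t Hy.
  have := form_on_ge0 hb (subspaceB hH Hx Hty).
  rewrite formB2// formZr// formZl// formZr//.
  by congr (_ <= _); ring.
have b0 := form_on_ge0 hb Hy.
have [yy0|yy0] := eqVneq (b y y) 0.
  have [xy0|xy0] := eqVneq (b x y) 0; first by rewrite xy0 yy0 expr0n mulr0.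
  (* The quadratic polynomial has degenerated to an affine one, and this argument gives it the value
     -1. *)
  have := key ((b x x + 1) / (2 * b x y)).
  rewrite yy0 mulr0 addr0.
  have -> : 2 * ((b x x + 1) / (2 * b x y)) * b x y = b x x + 1 by field.
  lra.
have yp : 0 < b y y by rewrite lt_neqAle eq_sym yy0.
have := key (b x y / b y y).
have -> : b x x - 2 * (b x y / b y y) * b x y + (b x y / b y y) ^+ 2 * b y y
   = b x x - b x y ^+ 2 / b y y by field.
by rewrite subr_ge0 ler_pdivrMr.
Qed.

Lemma form_CS_sqrt x y : H x -> H y ->
  `|b x y| <= Num.sqrt (b x x) * Num.sqrt (b y y).
Proof.
move=> Hx Hy; rewrite -sqrtrM ?(form_on_ge0 hb)//.
by rewrite -sqrtr_sqr ler_sqrt ?form_CS// ?mulr_ge0 ?(form_on_ge0 hb).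
Qed.

(** Take [y = x] and divide by the norm. Duality is what turns information obtained by testing with
    fixed elements into bounds in norm. *)
Lemma form_norm_le x M : H x -> 0 <= M ->
  (forall y, H y -> b x y <= M * Num.sqrt (b y y)) -> b x x <= M ^+ 2.
Proof.
move=> Hx M0 h; have := h _ Hx; have b0 := form_on_ge0 hb Hx.
have s0 := sqrtr_ge0 (b x x); rewrite -{1 3}(sqr_sqrtr b0).
have [->|sn] := eqVneq (Num.sqrt (b x x)) 0.
  by rewrite expr0n/= => _; rewrite exprn_ge0.
have sp : 0 < Num.sqrt (b x x) by rewrite lt_neqAle eq_sym sn.
by rewrite expr2 ler_pM2r// => h1; rewrite -expr2 lerXn2r.
Qed.

Lemma form_sqrtB x y : H x -> H y ->
  `|Num.sqrt (b x x) - Num.sqrt (b y y)| <= Num.sqrt (b (x - y) (x - y)).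
Proof.
move=> Hx Hy; have Hxy := subspaceB hH Hx Hy.
rewrite -sqrtr_sqr ler_sqrt ?(form_on_ge0 hb)// formB2// sqrrB.
rewrite !sqr_sqrtr ?(form_on_ge0 hb)//.
have := le_trans (ler_norm _) (form_CS_sqrt Hx Hy); lra.
Qed.

End bilinear_on.

(** * Small errors, telescoping sums and shifts *)

Lemma modulus_onD {R : realType} {a b : R} {f g : R -> R -> R} :
  modulus_on a b f -> modulus_on a b g ->
  modulus_on a b (fun s t => f s t + g s t).
Proof.
move=> hf hg e e0; have e2 : 0 < e / 2 by lra.
have [d1 d10 h1] := hf _ e2; have [d2 d20 h2] := hg _ e2.
exists (Num.min d1 d2); first by rewrite lt_min d10.
move=> s t sab tab; rewrite lt_min => /andP[st1 st2].
by have := h1 _ _ sab tab st1; have := h2 _ _ sab tab st2; lra.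
Qed.

(** Allowing only [e <= 1] lets errors quadratic in [e] be counted as linear ones. *)
Lemma le_of_small {R : realType} (x y C : R) : 0 <= C ->
  (forall e, 0 < e -> e <= 1 -> x <= y + C * e) -> x <= y.
Proof.
move=> C0 h; apply/ler_addgt0Pr => e e0.
have m0 : 0 < Num.min 1 (e / (1 + C)).
  by rewrite lt_min ltr01 divr_gt0//; lra.
have := h _ m0; rewrite ge_min lexx => /(_ isT) xy.
apply: (le_trans xy); rewrite lerD2l.
apply: le_trans (_ : C * (e / (1 + C)) <= _).
  by rewrite ler_wpM2l// ge_min lexx orbT.
by rewrite mulrCA ger_pMr// ler_pdivrMr; lra.
Qed.

Lemma telescope2 {R : realType} (p : nat -> R) (M : nat) :
  \sum_(k < M) (p k.+2 - p k) = p M.+1 + p M - p 1%N - p 0%N.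
Proof.
elim: M => [|M ih]; first by rewrite big_ord0; lra.
by rewrite big_ord_recr/= ih; lra.
Qed.

Lemma telescope1 {R : realType} (p : nat -> R) (M : nat) :
  \sum_(k < M) (p k.+1 - p k) = p M - p 0%N.
Proof.
elim: M => [|M ih]; first by rewrite big_ord0; lra.
by rewrite big_ord_recr/= ih; lra.
Qed.

(** The mean value theorem is applied to the sum, so that a single shift [r] serves all summands.
    The time intervals shifted by [r] are then adjacent, and the dissipation over them
    telescopes. *)
Lemma MVT_sum {R : realType} (M : nat) (y dy : nat -> R -> R) (h : R) : 0 <= h ->
  (forall k, (k < M)%N -> forall r, r \in `]0, h[ -> is_derive r 1 (y k) (dy k r)) ->
  (forall k, (k < M)%N -> {within `[0, h], continuous (y k)}) ->
  exists2 r, 0 <= r <= h &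
    \sum_(k < M) (y k h - y k 0) = h * \sum_(k < M) dy k r.
Proof.
move=> h0 hd hc.
pose Y r := \sum_(k < M) y k r; pose dY r := \sum_(k < M) dy k r.
have dYh r : r \in `]0, h[ -> is_derive r 1 Y (dY r).
  move=> rh; rewrite /Y /dY.
  elim: (M) (hd) => [|m ih] hm.
    under eq_fun do rewrite big_ord0.
    by rewrite big_ord0; exact: is_derive_cst.
  under eq_fun do rewrite big_ord_recr/=.
  rewrite big_ord_recr/=; apply: is_deriveD; last exact: hm.
  by apply: ih => k km; apply: hm; exact: ltnW.
have Yc : {within `[0, h], continuous Y}.
  rewrite /Y; elim: (M) (hc) => [|m ih] hm.
    rewrite (_ : (fun _ => _) = cst 0); last by apply/funext => r; rewrite big_ord0.
    by move=> x; exact: cst_continuous.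
  rewrite (_ : (fun _ => _) = (fun r => \sum_(k < m) y k r) + y m); last first.
    by apply/funext => r; rewrite big_ord_recr.
  move=> x; apply: continuousD; last exact: hm.
  by apply: ih => k km; apply: hm; exact: ltnW.
have [r rh E] := MVT_segment h0 dYh Yc.
exists r; first by rewrite in_itv/= in rh.
by rewrite sumrB -/(Y h) -/(Y 0) E subr0 mulrC.
Qed.

Lemma within_shift {R : realType} (f : R -> R) (a b c h : R) :
  a <= c -> c + h <= b ->
  {within `[a, b], continuous f} -> {within `[0, h], continuous (fun r => f (c + r))}.
Proof.
move=> ac chb; move/(_ _) => fc.
apply/subspace_continuousP => x /=; rewrite in_itv/= => /andP[x0 xh].
have /subspace_continuousP /(_ (c + x)) := fc.
rewrite /= in_itv/= => /(_ _) fcx.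
have {}fcx : f z @[z --> within `[a, b] (nbhs (c + x))] --> f (c + x).
  by apply: fcx; apply/andP; split; lra.
apply/cvgrPdist_lt => e e0.
move/cvgrPdist_lt : fcx => /(_ _ e0).
rewrite /prop_near1 !nbhs_nearE !near_withinE -!nbhs_nearE.
move=> /nbhs_ballP[d d0 hd]; apply/nbhs_ballP; exists d => // z zx /=.
rewrite in_itv/= => /andP[z0 zh]; apply: hd.
  rewrite /ball/= in zx *.
  by have -> : c + x - (c + z) = x - z by ring.
by rewrite /= in_itv/=; apply/andP; split; lra.
Qed.

Lemma is_derive_shift {R : realType} (f : R -> R) (c r df : R) :
  is_derive (c + r) 1 f df -> is_derive r 1 (fun x => f (c + x)) df.
Proof.
move=> hf.
have h1 : is_derive r 1 (fun x : R => c + x) (0 + 1) by apply: is_deriveD.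
rewrite add0r in h1.
have := is_derive1_comp hf h1.
by rewrite mulr1.
Qed.

Lemma sqr_le_near {R : realType} (x y e : R) : 0 <= x -> 0 <= y -> 0 < e ->
  y <= x + e -> y ^+ 2 <= x ^+ 2 + 2 * (y * e).
Proof.
move=> x0 y0 e0 yxe; have [ye|ye] := leP y e.
  have : y * y <= y * e by rewrite ler_wpM2l.
  by have := sqr_ge0 x; rewrite -expr2; have := mulr_ge0 y0 (ltW e0); lra.
have : (y - e) ^+ 2 <= x ^+ 2 by rewrite lerXn2r ?nnegrE//; lra.
by have := sqr_ge0 e; rewrite sqrrB -mulr_natr; lra.
Qed.

(** * The energy inequality *)

(* A weak solution [u] with velocity [v], abstractly: [H] and [L] stand for H^1_0
   and L^2, [aa] for the form a, [ff u phi] for the source tested with [phi] and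
   [FF] for its primitive, [Ip] for the integral of |.|^(p+2), [P t phi] for the
   damping tested with [phi] and integrated up to [t], [D t] for the energy
   dissipated up to [t]. As [u] need not be differentiable with values in [H], its
   [H]-variation is only controlled by the increments of [K] ([ev_K]). [ev_diss]
   says that [P] with a test function close to [v] recovers [D]; the error [rho]
   is the tail of the dissipation over large velocities. *)
Record evolution {R : realType} {X : lmodType R} (H L : X -> Prop)
    (ip : X -> X -> R) (nh : X -> R) (aa : X -> X -> R) (CA : R)
    (ff : X -> X -> R) (FF Ip : X -> R) (mu : R -> R) (T : R)
    (u v : R -> X) (P : R -> X -> R) (D K : R -> R) (CJ : R) : Prop := {
  evH : subspace H;
  evL : subspace L;
  evHL : forall x, H x -> L x;
  ev_ip : form_on L ip;
  ev_nh : norm_on H nh;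
  ev_aa : form_on H aa;
  ev_CA : 0 <= CA;
  ev_aa_le : forall x y, H x -> H y -> `|aa x y| <= CA * nh x * nh y;
  ev_ff : forall x, H x -> linear_on H (ff x);
  ev_ff0 : forall x, H x -> ff 0 x = 0;
  ev_ff_lip : forall B, exists2 Lam, 0 <= Lam & forall x y phi, H x -> H y ->
    H phi -> nh x <= B -> nh y <= B ->
    `|ff x phi - ff y phi| <= Lam * nh (x - y) * nh phi;
  ev_FF : forall B, exists2 Lam, 0 <= Lam & forall x y, H x -> H y ->
    nh x <= B -> nh y <= B ->
    `|FF y - FF x - ff x (y - x)| <= Lam * nh (y - x) ^+ 2;
  ev_T : 0 < T;
  ev_u : forall t, 0 <= t <= T -> H (u t);
  ev_v : forall t, 0 <= t <= T -> L (v t);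
  ev_mod_u : modulus_on 0 T (fun s t => nh (u t - u s));
  ev_mod_v : modulus_on 0 T (fun s t => Num.sqrt (ip (v t - v s) (v t - v s)));
  ev_mod_mu : modulus_on 0 T (fun s t => `|mu t - mu s|);
  ev_mu : forall s t, 0 <= s -> s <= t -> t <= T -> mu t <= mu s;
  ev_mu_ge0 : forall t, 0 <= t <= T -> 0 <= mu t;
  ev_K : forall s t, 0 <= s -> s <= t -> t <= T -> nh (u t - u s) <= K t - K s;
  ev_der : forall psi, L psi -> forall t, t \in `]0, T[ ->
    is_derive t 1 (fun t => ip (u t) psi) (ip (v t) psi);
  ev_cont : forall psi, L psi ->
    {within `[0, T], continuous (fun t => ip (u t) psi)};
  ev_eqn : forall phi s t, H phi -> 0 <= s -> s <= t -> t <= T ->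
    exists2 r, s <= r <= t & ip (v t - v s) phi + (P t phi - P s phi)
      = (t - s) * (- (mu r * aa (u r) phi) + ff (u r) phi);
  ev_D : forall s t, 0 <= s -> s <= t -> t <= T -> D s <= D t;
  ev_mod_D : modulus_on 0 T (fun s t => `|D t - D s|);
  ev_diss : forall e, 0 < e -> exists C (rho : R -> R),
    [/\ 0 <= C,
        forall s t, 0 <= s -> s <= t -> t <= T -> rho s <= rho t,
        rho T - rho 0 <= e &
        forall phi s t th, H phi -> 0 <= s -> s <= t -> t <= T ->
          (forall r, s <= r <= t -> ip (phi - v r) (phi - v r) <= th) ->
          D t - D s - (t - s) * (e + C * th + e * Ip phi) - (rho t - rho s)
            <= P t phi - P s phi];
  ev_CJ : 0 <= CJ;
  ev_jensen : forall s t, 0 <= s -> s < t -> t <= T ->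
    (t - s) * Ip ((t - s)^-1 *: (u t - u s)) <= CJ * (D t - D s) }.

Section energy_inequality.
Context {R : realType} {X : lmodType R} {H L : X -> Prop}
    {ip : X -> X -> R} {nh : X -> R} {aa : X -> X -> R} {CA : R}
    {ff : X -> X -> R} {FF Ip : X -> R} {mu : R -> R} {T : R}
    {u v : R -> X} {P : R -> X -> R} {D K : R -> R} {CJ : R}.
Context (ev : evolution H L ip nh aa CA ff FF Ip mu T u v P D K CJ).
Let sH := evH ev.
Let sL := evL ev.
Let HL := evHL ev.
Let ipF := ev_ip ev.
Let nhN := ev_nh ev.
Let aaF := ev_aa ev.
Let Hu := ev_u ev.
Let Lv := ev_v ev.
Let Kh := ev_K ev.
Let T0 := ev_T ev.
Let CA0 := ev_CA ev.
Let aale := ev_aa_le ev.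
Let ffL := ev_ff ev.
Let muh := ev_mu ev.
Let mu0 := ev_mu_ge0 ev.
Let nh0 x : 0 <= nh x. Proof. exact: norm_on_ge0 nhN x. Qed.

Definition load r phi := - (mu r * aa (u r) phi) + ff (u r) phi.
Definition potential t := 2^-1 * mu t * aa (u t) (u t) - FF (u t).
Definition evol_energy t := 2^-1 * ip (v t) (v t) + potential t.

Ltac lin_clear := clear -sH sL HL ipF nhN aaF Hu Lv Kh T0 CA0 aale ffL muh mu0 nh0.
Tactic Notation "lin" hyp_list(l) := revert l; lin_clear; lra.
Tactic Notation "lin2" hyp_list(l) :=
  revert l; lin_clear; intros; apply/andP; split; lra.

Lemma K_homo s t : 0 <= s -> s <= t -> t <= T -> K s <= K t.
Proof. by move=> s0 st tT; rewrite -subr_ge0 (le_trans _ (Kh s0 st tT)). Qed.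

Lemma nh_symm x y : H x -> H y -> nh (x - y) = nh (y - x).
Proof.
move=> Hx Hy; have -> : x - y = -1 *: (y - x) by rewrite scaleN1r opprB.
by rewrite (norm_onZ nhN) ?normrN1 ?mul1r//; exact: (subspaceB sH).
Qed.

Lemma nh_bound t : 0 <= t <= T -> nh (u t) <= nh (u 0) + (K T - K 0).
Proof.
move=> /andP[t0 tT]; have H0 : H (u 0) by apply: Hu; rewrite lexx ltW.
have Ht : H (u t) by apply: Hu; rewrite t0.
have -> : u t = (u t - u 0) - (- u 0) by rewrite opprK subrK.
have := norm_onB nhN (subspaceB sH Ht H0) (subspaceZ sH (-1) H0).
rewrite (norm_onZ nhN)// normrN1 mul1r scaleN1r.
have := Kh (lexx 0) t0 tT.
have := K_homo t0 tT (lexx T); lra.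
Qed.

(** The intermediate time depends on [psi]; for the vector-valued [u] itself no mean value theorem
    holds. *)
Lemma u_mean_value psi s t : L psi -> 0 <= s -> s <= t -> t <= T ->
  exists2 r, s <= r <= t & ip (u t - u s) psi = (t - s) * ip (v r) psi.
Proof.
move=> Lpsi s0 st tT.
have [||r rr E] := @MVT_segment R (fun t => ip (u t) psi) (fun r => ip (v r) psi) _ _ st.
- move=> r; rewrite in_itv/= => /andP[sr rt].
  by apply: (ev_der ev) => //; rewrite in_itv/=; apply/andP; split; lra.
- apply: continuous_subspaceW (ev_cont ev Lpsi).
  move=> r /=; rewrite !in_itv/= => /andP[sr rt]; apply/andP; split; lra.
- move: rr; rewrite in_itv/= => rr; exists r => //.
  have Ht : L (u t) by apply/HL/Hu; apply/andP; split; lra.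
  have Hs : L (u s) by apply/HL/Hu; apply/andP; split; lra.
  by rewrite (formBl sL ipF)// E mulrC.
Qed.

(** Against each test element the difference quotient acts like some [v r']. The time [r'] depends
    on the test element, but [v r'] is always within [e] of [v r], and duality gives the bound in
    norm. *)
Lemma quotient_close s t r e : 0 <= s -> s < t -> t <= T -> s <= r <= t -> 0 <= e ->
  (forall r', s <= r' <= t -> Num.sqrt (ip (v r' - v r) (v r' - v r)) <= e) ->
  ip ((t - s)^-1 *: (u t - u s) - v r) ((t - s)^-1 *: (u t - u s) - v r) <= e ^+ 2.
Proof.
move=> s0 st tT srt e0 hv; set w := _ *: _.
have Hw : H w.
  by apply: (subspaceZ sH); apply: (subspaceB sH); apply: Hu; apply/andP; split; lra.
have rT : 0 <= r <= T by move: srt => /andP[? ?]; apply/andP; split; lra.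
have Lwr : L (w - v r) by apply: (subspaceB sL); [exact: HL|exact: Lv].
apply: (form_norm_le ipF) => // y Ly.
have [r' sr' E] := u_mean_value Ly s0 (ltW st) tT.
have r'T : 0 <= r' <= T by move: sr' => /andP[? ?]; apply/andP; split; lra.
have Luts : L (u t - u s).
  by apply: HL; apply: (subspaceB sH); apply: Hu; apply/andP; split; lra.
rewrite (formBl sL ipF)//; [|exact: HL|exact: Lv].
rewrite /w (formZl sL ipF)// E mulKf ?gt_eqF ?subr_gt0//.
rewrite -(formBl sL ipF)//; [|exact: Lv|exact: Lv].
apply: le_trans (ler_norm _) _; apply: le_trans (form_CS_sqrt sL ipF _ Ly) _.
  by apply: (subspaceB sL); exact: Lv.
by rewrite ler_wpM2r ?sqrtr_ge0// hv.
Qed.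

(** One modulus for all [phi]: the test element will be a difference quotient, which changes with
    the step size. *)
Lemma load_modulus : exists2 g, modulus_on 0 T g &
  forall s r phi, 0 <= s <= T -> 0 <= r <= T -> H phi ->
    `|load r phi - load s phi| <= g s r * nh phi.
Proof.
set B := nh (u 0) + (K T - K 0).
have [Lam Lam0 hL] := ev_ff_lip ev B.
have zT : (0:R) <= 0 <= T by apply/andP; split; [exact: lexx|exact: ltW].
have B0 : 0 <= B := le_trans (nh0 _) (nh_bound zT).
exists (fun s r => (CA * B) * `|mu r - mu s| + (mu 0 * CA + Lam) * nh (u r - u s)).
  apply: modulus_onD.
    by apply: modulus_onM (ev_mod_mu ev); rewrite mulr_ge0.
  apply: modulus_onM (ev_mod_u ev).
  by rewrite addr_ge0// mulr_ge0// mu0// lexx ltW.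
move=> s r phi sT rT Hp.
have Hs := Hu sT; have Hr := Hu rT.
have Hrs := subspaceB sH Hr Hs.
have -> : load r phi - load s phi = - ((mu r - mu s) * aa (u r) phi)
    - mu s * aa (u r - u s) phi + (ff (u r) phi - ff (u s) phi).
  by rewrite (formBl sH aaF)// /load; ring.
apply: le_trans (ler_normD _ _) _;
have -> : (CA * B * `|mu r - mu s| + (mu 0 * CA + Lam) * nh (u r - u s)) * nh phi
  = CA * B * `|mu r - mu s| * nh phi + mu 0 * CA * nh (u r - u s) * nh phi
    + Lam * nh (u r - u s) * nh phi by ring.
apply: lerD; last first.
  by apply: hL => //; exact: nh_bound.
apply: le_trans (ler_normB _ _) _; rewrite normrN !normrM; apply: lerD.
  have -> : CA * B * `|mu r - mu s| * nh phi = `|mu r - mu s| * (CA * B * nh phi) by ring.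
  rewrite ler_wpM2l//; apply: le_trans (aale Hr Hp) _.
  by rewrite ler_wpM2r// ler_wpM2l// nh_bound.
rewrite ger0_norm ?mu0// -!mulrA; apply: ler_pM => //.
- by rewrite mu0.
- by apply: muh => //; move: sT => /andP[].
- by rewrite mulrA; exact: aale.
Qed.

Lemma potential_modulus : modulus_on 0 T (fun s t => `|potential t - potential s|).
Proof.
set B := nh (u 0) + (K T - K 0).
have [Lam Lam0 hL] := ev_ff_lip ev B.
have [Lam' Lam'0 hL'] := ev_FF ev B.
have zT : (0:R) <= 0 <= T by apply/andP; split; [exact: lexx|exact: ltW].
have B0 : 0 <= B := le_trans (nh0 _) (nh_bound zT).
pose C1 := CA * B ^+ 2; pose C2 := mu 0 * CA * B + Lam * B + 2 * Lam' * B.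
have C10 : 0 <= C1 by rewrite mulr_ge0// exprn_ge0.
have C20 : 0 <= C2 by rewrite !addr_ge0 ?mulr_ge0// mu0.
have hm : modulus_on 0 T (fun s t => C1 * `|mu t - mu s| + C2 * nh (u t - u s)).
  apply: modulus_onD.
    exact: modulus_onM (ev_mod_mu ev).
  exact: modulus_onM (ev_mod_u ev).
apply: (modulus_onW (ler01)) hm => // s r sT rT; rewrite mul1r.
have Hs := Hu sT; have Hr := Hu rT.
have Hrs := subspaceB sH Hr Hs.
have -> : potential r - potential s = 2^-1 * ((mu r - mu s) * aa (u r) (u r))
    + 2^-1 * (mu s * (aa (u r - u s) (u r) + aa (u s) (u r - u s)))
    - ((FF (u r) - FF (u s) - ff (u s) (u r - u s)) + ff (u s) (u r - u s)).
  rewrite (formBl sH aaF)// (formBr aaF)// /potential; ring.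
have nr := nh_bound rT; have ns := nh_bound sT; rewrite -/B in nr ns.
have nrs : nh (u r - u s) <= 2 * B.
  by apply: le_trans (norm_onB nhN Hr Hs) _; lra.
have ms : 0 <= mu s <= mu 0.
  by rewrite mu0//= muh//; move: sT => /andP[].
have e1 : `|(mu r - mu s) * aa (u r) (u r)| <= C1 * `|mu r - mu s|.
  rewrite normrM mulrC ler_wpM2r//; apply: le_trans (aale Hr Hr) _.
  by rewrite /C1 -mulrA ler_wpM2l// expr2 ler_pM.
have e2 : `|mu s * (aa (u r - u s) (u r) + aa (u s) (u r - u s))|
    <= 2 * (mu 0 * CA * B * nh (u r - u s)).
  rewrite normrM ger0_norm; last by case/andP: ms.
  have h1 : `|aa (u r - u s) (u r) + aa (u s) (u r - u s)| <= 2 * (CA * B * nh (u r - u s)).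
    apply: le_trans (ler_normD _ _) _; rewrite mulr2n mulrDl mul1r; apply: lerD.
      apply: le_trans (aale Hrs Hr) _.
      by rewrite -!mulrA ler_wpM2l// mulrC ler_wpM2r.
    apply: le_trans (aale Hs Hrs) _.
    by rewrite ler_wpM2r// ler_wpM2l.
  have -> : 2 * (mu 0 * CA * B * nh (u r - u s)) = mu 0 * (2 * (CA * B * nh (u r - u s))) by ring.
  by apply: ler_pM => //; case/andP: ms.
have e3 := hL' _ _ Hs Hr ns nr.
have e4 : nh (u r - u s) ^+ 2 <= 2 * B * nh (u r - u s) by rewrite expr2 ler_wpM2r.
(* The source is bounded by its Lipschitz estimate between [u s] and 0, where it vanishes. *)
have e5 : `|ff (u s) (u r - u s)| <= Lam * B * nh (u r - u s).
  have H0 : H 0 by rewrite -(subrr (u s)); exact: (subspaceB sH).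
  have nz : nh 0 = 0 by rewrite -(scale0r (u s)) (norm_onZ nhN)// normr0 mul0r.
  have := hL (u s) 0 (u r - u s) Hs H0 Hrs ns; rewrite nz => /(_ B0).
  rewrite subr0 (ev_ff0 ev)// subr0 => h.
  by apply: le_trans h _; rewrite ler_wpM2r// ler_wpM2l.
have e6 := ler_wpM2l Lam'0 e4.
apply: le_trans (ler_normB _ _) _.
apply: le_trans (lerD (ler_normD _ _) (ler_normD _ _)) _.
rewrite !(normrM 2^-1) (ger0_norm (_ : 0 <= 2^-1))// /C2.
have e7 : 0 <= C1 * `|mu r - mu s| by rewrite mulr_ge0.
lra.
Qed.

(** Here [x] belongs to the middle time, [y] to the later and [z] to the earlier one. By
    polarization 2 aa x (y - z) is aa y y - aa z z up to the squares of y - x and z - x, the latter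
    with a favourable sign, and [FF] is linearized at [x]. Since mu does not increase, replacing
    [m1] by [my] and by [mz] goes in the right direction. *)
Lemma potential_step B Lam (x y z : X) (m1 my mz : R) :
  (forall x y, H x -> H y -> nh x <= B -> nh y <= B ->
    `|FF y - FF x - ff x (y - x)| <= Lam * nh (y - x) ^+ 2) ->
  H x -> H y -> H z -> nh x <= B -> nh y <= B -> nh z <= B ->
  0 <= my -> my <= m1 -> m1 <= mz ->
  - (m1 * aa x (y - z)) + ff x (y - z) <=
    - ((2^-1 * my * aa y y - FF y) - (2^-1 * mz * aa z z - FF z))
    + (2^-1 * m1 * CA + Lam) * nh (y - x) ^+ 2 + Lam * nh (z - x) ^+ 2.
Proof.
move=> hF Hx Hy Hz nx ny nz my0 mym mmz.
have Hyx := subspaceB sH Hy Hx; have Hzx := subspaceB sH Hz Hx.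
have f1 := ler_norm (ff x (y - x) - (FF y - FF x)).
have f2 := ler_norm (FF z - FF x - ff x (z - x)).
rewrite distrC in f1.
have {}f1 := le_trans f1 (hF _ _ Hx Hy nx ny).
have {}f2 := le_trans f2 (hF _ _ Hx Hz nx nz).
have -> : ff x (y - z) = ff x (y - x) - ff x (z - x).
  by rewrite -(linear_onB (ffL Hx))// opprB addrA subrK.
have a1 := formB2 sH aaF Hy Hx; have a2 := formB2 sH aaF Hz Hx.
rewrite (form_onC aaF Hy Hx)// in a1; rewrite (form_onC aaF Hz Hx)// in a2.
rewrite (formBr aaF)//.
have p1 := form_on_ge0 aaF Hzx.
have p2 : aa (y - x) (y - x) <= CA * nh (y - x) ^+ 2.
  by rewrite expr2 mulrA; apply: le_trans (ler_norm _) _; exact: aale.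
have m10 : 0 <= m1 by lra.
have q1 := mulr_ge0 m10 p1; have q2 := ler_wpM2l m10 p2.
have q3 : my * aa y y <= m1 * aa y y by rewrite ler_wpM2r// (form_on_ge0 aaF).
have q4 : m1 * aa z z <= mz * aa z z by rewrite ler_wpM2r// (form_on_ge0 aaF).
rewrite a1 in q2; rewrite a2 in q1; lra.
Qed.

(** The mean of two consecutive quotients makes each summand a difference of half squares; this is
    what dictates the centred quotient as test element. *)
Lemma kinetic_telescope (w : nat -> X) (M : nat) : (forall k, L (w k)) ->
  \sum_(k < M) ip (w k.+1 - w k) (2^-1 *: (w k.+1 + w k))
    = 2^-1 * ip (w M) (w M) - 2^-1 * ip (w 0%N) (w 0%N).
Proof.
move=> Lw; rewrite -(telescope1 (fun k => 2^-1 * ip (w k) (w k))).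
apply: eq_bigr => k _.
have Lsum := subspaceD sL (Lw k.+1) (Lw k).
rewrite (formZr ipF)//; last exact: (subspaceB sL).
rewrite (formBl sL ipF)//.
have hN (x : X) : L x -> - x = (-1) *: x by move=> _; rewrite scaleN1r.
have -> : w k.+1 + w k = w k.+1 - (-1) *: w k by rewrite scaleN1r opprK.
rewrite !(formBr ipF) ?(formZr ipF)//; try exact: (subspaceZ sL).
rewrite (form_onC ipF (Lw k) (Lw k.+1)); ring.
Qed.

(* Testing with the centred quotient (u_(k+2) - u_k) / (2 h) makes the kinetic and
   the potential parts telescope up to errors controlled by the increments of [K]
   and [D]; hence no regularization in time is needed. *)
Lemma energy_step (s h r d e C Lam B : R) (g : R -> R -> R) (rho : R -> R) :
  0 <= s -> 0 < h -> s + h + h <= T -> 0 <= r -> r <= h ->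
  0 <= d -> d <= e -> C * d ^+ 2 <= e -> 0 <= Lam ->
  (forall a b, s <= a <= s + h + h -> s <= b <= s + h + h ->
     [/\ nh (u b - u a) <= d, Num.sqrt (ip (v b - v a) (v b - v a)) <= d
       & g a b <= d]) ->
  (forall r, 0 <= r <= T -> nh (u r) <= B) ->
  (forall x y, H x -> H y -> nh x <= B -> nh y <= B ->
    `|FF y - FF x - ff x (y - x)| <= Lam * nh (y - x) ^+ 2) ->
  (forall s r phi, 0 <= s <= T -> 0 <= r <= T -> H phi ->
    `|load r phi - load s phi| <= g s r * nh phi) ->
  (forall phi s t th, H phi -> 0 <= s -> s <= t -> t <= T ->
      (forall r, s <= r <= t -> ip (phi - v r) (phi - v r) <= th) ->
      D t - D s - (t - s) * (e + C * th + e * Ip phi) - (rho t - rho s)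
        <= P t phi - P s phi) ->
  ip (v (s + h + r) - v (s + r)) ((2 * h)^-1 *: (u (s + h + h) - u s)) <=
    - 2^-1 * (potential (s + h + h) - potential s)
    + 2^-1 * (1 + (2^-1 * mu 0 * CA + Lam) + Lam) * e * (K (s + h + h) - K s)
    - (D (s + h + r) - D (s + r))
    + h * (e + e) + e * (2^-1 * CJ * (D (s + h + h) - D s))
    + (rho (s + h + r) - rho (s + r)).
Proof.
move=> s0 h0 sT r0 rh d0 de Cde Lam0 near nB hF hg hdiss.
have e0 : 0 <= e by lin d0 de.
have h20 : 0 < 2 * h by lin h0.
have Tk0 : 0 <= s <= T by lin2 s0 h0 sT.
have Tk1 : 0 <= s + h <= T by lin2 s0 h0 sT.
have Tk2 : 0 <= s + h + h <= T by lin2 s0 h0 sT.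
have I0 : s <= s <= s + h + h by lin2 h0.
have I1 : s <= s + h <= s + h + h by lin2 h0.
have I2 : s <= s + h + h <= s + h + h by lin2 h0.
have l01 : s <= s + h by lin h0.
have l12 : s + h <= s + h + h by lin h0.
have l02 : s <= s + h + h by lin h0.
have s1_0 : 0 <= s + h by lin s0 h0.
have s1_T : s + h <= T by lin sT h0.
set a := s + r; set b := s + h + r.
have ab : b - a = h by rewrite /a /b; ring.
have aT0 : 0 <= a by rewrite /a; lin s0 r0.
have leab : a <= b by rewrite /a /b; lin h0.
have bT : b <= T by rewrite /b; lin rh sT.
have a_lb : s <= a by rewrite /a; lin r0.
have b_ub : b <= s + h + h by rewrite /b; lin rh.
set U0 := u s; set U1 := u (s + h); set U2 := u (s + h + h).
have HU0 : H U0 by exact: Hu. have HU1 : H U1 by exact: Hu. have HU2 : H U2 by exact: Hu.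
have HU20 := subspaceB sH HU2 HU0.
set phi := _ *: _; have Hphi : H phi by exact: (subspaceZ sH).
have h2E : 2 * h = s + h + h - s by ring.
have phn : 2 * h * nh phi <= K (s + h + h) - K s.
  rewrite (norm_onZ nhN)// ger0_norm ?invr_ge0 ?(ltW h20)// mulVKf ?gt_eqF//.
  exact: Kh.
have ldE : 2 * h * load (s + h) phi = load (s + h) (U2 - U0).
  rewrite /load (formZr aaF)// (linear_onZ (ffL HU1))//.
  by field; rewrite gt_eqF.
(* The weak equation between the shifted times [a] and [b]. Its load sits at an unknown time [q] and
   is moved to the middle time [s + h], where the potential part is linearized. *)
have [q /andP[aq qb] Eq] := ev_eqn ev Hphi aT0 leab bT.
have qT : 0 <= q <= T by lin2 aT0 aq qb bT.
have qI : s <= q <= s + h + h by lin2 a_lb b_ub aq qb.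
have ld1 : load q phi <= load (s + h) phi + d * nh phi.
  rewrite -lerBlDl; apply: le_trans (ler_norm _) _.
  apply: le_trans (hg _ _ _ Tk1 qT Hphi) _; rewrite ler_wpM2r//.
  by have [] := near _ _ I1 qI.
have [nu1 _ _] := near _ _ I1 I2; have [nu2 _ _] := near _ _ I1 I0.
have K01 : nh (U0 - U1) <= K (s + h) - K s by rewrite nh_symm//; exact: Kh.
have K12 : nh (U2 - U1) <= K (s + h + h) - K (s + h) by exact: Kh.
have p01 := le_trans (nh0 (U0 - U1)) K01; have p12 := le_trans (nh0 (U2 - U1)) K12.
set K20 := K (s + h + h) - K s in phn *.
have K20E : K20 = (K (s + h + h) - K (s + h)) + (K (s + h) - K s) by rewrite /K20; ring.
have K0c : nh (U0 - U1) <= K20 by lin K20E K01 p12.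
have K2c : nh (U2 - U1) <= K20 by lin K20E K12 p01.
have nu1e := le_trans nu1 de; have nu2e := le_trans nu2 de.
(* One factor is small by continuity, the other is at most an increment of [K]; so the sum of the
   squares is small although [u] need not be Lipschitz with values in [H]. *)
have sq1 : nh (U2 - U1) ^+ 2 <= e * K20 by rewrite expr2; exact: ler_pM.
have sq0 : nh (U0 - U1) ^+ 2 <= e * K20 by rewrite expr2; exact: ler_pM.
have mul1 : mu (s + h) <= mu 0 by exact: muh.
have mul0 : 0 <= mu (s + h) by exact: mu0.
have PS : load (s + h) (U2 - U0) <= - (potential (s + h + h) - potential s)
    + (2^-1 * mu (s + h) * CA + Lam) * nh (U2 - U1) ^+ 2 + Lam * nh (U0 - U1) ^+ 2.
  have muh1 : mu (s + h + h) <= mu (s + h) by apply: muh => //; case/andP: Tk2.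
  have muh2 : mu (s + h) <= mu s by exact: muh.
  apply: (potential_step hF HU1 HU2 HU0 (nB _ Tk1) (nB _ Tk2) (nB _ Tk0) _ muh1 muh2).
  exact: mu0.
have c1 : (2^-1 * mu (s + h) * CA + Lam) * nh (U2 - U1) ^+ 2
    <= (2^-1 * mu 0 * CA + Lam) * (e * K20).
  apply: ler_pM; rewrite ?sqr_ge0// ?addr_ge0 ?mulr_ge0//.
  by rewrite lerD2r ler_wpM2r// ler_wpM2l.
have c0 : Lam * nh (U0 - U1) ^+ 2 <= Lam * (e * K20) by rewrite ler_wpM2l.
have dph : 2 * h * (d * nh phi) <= e * K20.
  by rewrite mulrCA; apply: ler_pM => //; rewrite mulr_ge0// ltW.
have dis : D b - D a - (b - a) * (e + C * d ^+ 2 + e * Ip phi) - (rho b - rho a)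
    <= P b phi - P a phi.
  apply: hdiss => // s1 /andP[as1 s1b].
  have s1I : s <= s1 <= s + h + h by lin2 a_lb b_ub as1 s1b.
  rewrite /phi h2E; apply: quotient_close => //; first by lin h0.
  by move=> s2 s2I; have [] := near _ _ s1I s2I.
(* The integral [Ip] of the test quotient, which enters with a factor [e], is paid for by the
   dissipation. *)
have jen : 2 * h * Ip phi <= CJ * (D (s + h + h) - D s).
  rewrite /phi h2E; apply: (ev_jensen ev) => //; first by lin h0.
have jen2 : h * (e * Ip phi) <= e * (2^-1 * CJ * (D (s + h + h) - D s)).
  have -> : h * (e * Ip phi) = e * (2^-1 * (2 * h * Ip phi)) by field.
  by rewrite ler_wpM2l// -(mulrA 2^-1 CJ) ler_wpM2l.
have hC : h * (C * d ^+ 2) <= h * e by rewrite ler_wpM2l// ltW.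
have hl := ler_wpM2l (ltW h0) ld1.
rewrite ab -/(load q phi) in Eq dis.
by lin Eq hl ldE PS c1 c0 dph dis jen2 hC.
Qed.

(** Summed over a uniform grid, the centred steps leave averages of the potential over the last two
    and over the first two grid points, and quotients in place of the end velocities. The moduli of
    continuity replace these by the values at [t] and 0; all errors together are at most
    [Cst * e]. *)
Lemma energy_le t : 0 <= t <= T -> evol_energy t + D t <= evol_energy 0 + D 0.
Proof.
move=> tT'; move/andP: (tT') => [t0' tT].
have [->//|tn0] := eqVneq t 0.
have t0 : 0 < t by rewrite lt_neqAle eq_sym tn0.
set B := nh (u 0) + (K T - K 0).
have nB r : 0 <= r <= T -> nh (u r) <= B by exact: nh_bound.
have [Lam Lam0 hF] := ev_FF ev B.
have [g mg hg] := load_modulus.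
have CJ0 := ev_CJ ev; have DD := ev_D ev.
have zT : (0:R) <= 0 <= T by apply/andP; split; [exact: lexx|exact: ltW].
set qt := Num.sqrt (ip (v t) (v t)); set q0 := Num.sqrt (ip (v 0) (v 0)).
have KT : 0 <= K T - K 0 by rewrite subr_ge0 K_homo// ltW.
have DT : 0 <= D T - D 0 by rewrite subr_ge0 DD// ltW.
have qt0 : 0 <= qt by exact: sqrtr_ge0.
have q00 : 0 <= q0 by exact: sqrtr_ge0.
have CA20 : 0 <= 2^-1 * mu 0 * CA + Lam by rewrite addr_ge0// !mulr_ge0// mu0.
pose cK := 1 + (2^-1 * mu 0 * CA + Lam) + Lam.
have cK0 : 0 <= cK by rewrite /cK; lin CA20 Lam0.
pose Cst := (qt + q0 + 1) + cK * (K T - K 0) + (2 * T + CJ * (D T - D 0) + 1) + 4.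
apply: (@le_of_small _ _ _ Cst).
  by rewrite /Cst !addr_ge0// mulr_ge0// ltW.
move=> e e0 e1; have [C [rho [C0 rhoh rhoe hdiss]]] := ev_diss ev e0.
(* This choice gives both [d <= e] and, as [e <= 1], [C * d ^+ 2 <= e]. *)
pose d := e / (1 + C).
have C10 : 0 < 1 + C by lin C0.
have d0 : 0 < d by rewrite divr_gt0.
have de : d <= e by rewrite ler_pdivrMr// ler_peMr ?(ltW e0)//; lin C0.
have Cde : C * d ^+ 2 <= e.
  have -> : C * d ^+ 2 = e * (d * (C / (1 + C))) by rewrite /d; field; rewrite gt_eqF.
  rewrite ger_pMr// mulr_ile1//; [exact: ltW|by rewrite divr_ge0// ltW|exact: le_trans e1|].
  by rewrite ler_pdivrMr// mul1r; lin C0.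
have [d1 d10 h1] := ev_mod_u ev d0; have [d2 d20 h2] := ev_mod_v ev d0.
have [d3 d30 h3] := mg _ d0; have [d4 d40 h4] := ev_mod_D ev d0.
have [d5 d50 h5] := potential_modulus d0.
pose dd := Num.min (Num.min d1 d2) (Num.min (Num.min d3 d4) d5).
have dd0 : 0 < dd by rewrite !lt_min d10 d20 d30 d40 d50.
pose M := (Num.bound (2 * t / dd)).+1.
have hM : 2 * t / dd < M.+1%:R.
  apply: lt_trans (_ : (Num.bound (2 * t / dd))%:R < _).
    by apply: archi_boundP; rewrite divr_ge0 ?mulr_ge0// ltW.
  by rewrite ltr_nat.
pose h := t / M.+1%:R.
have h0 : 0 < h by rewrite divr_gt0.
have hdd : 2 * h < dd.
  by rewrite /h mulrA ltr_pdivrMr// [dd * _]mulrC -ltr_pdivrMr.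
have hT : M.+1%:R * h = t by rewrite /h mulrC divfK// gt_eqF.
pose tk (k : nat) := k%:R * h.
have tkS k : tk k.+1 = tk k + h by rewrite /tk -natr1 mulrDl mul1r.
have tk0 k : 0 <= tk k by rewrite mulr_ge0// ltW.
have tkt k : (k <= M.+1)%N -> tk k <= t by move=> kM; rewrite -hT ler_wpM2r ?ler_nat// ltW.
have tkT k : (k <= M.+1)%N -> 0 <= tk k <= T by move=> kM; rewrite tk0/= (le_trans (tkt _ kM)).
have near r s : 0 <= r <= T -> 0 <= s <= T -> - (2 * h) <= s - r <= 2 * h ->
   [/\ nh (u s - u r) <= d, Num.sqrt (ip (v s - v r) (v s - v r)) <= d,
       g r s <= d, `|D s - D r| <= d & `|potential s - potential r| <= d].
  move=> rT sT; rewrite -ler_norml => rs; have := le_lt_trans rs hdd.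
  by rewrite !lt_min => /andP[/andP[? ?] /andP[/andP[? ?] ?]]; split;
    [apply: h1|apply: h2|apply: h3|apply: h4|apply: h5].
(* Clamping the indices at [M.+1] keeps every [w k] in [H]; beyond the grid it is 0. *)
pose w k := h^-1 *: (u (tk (minn k.+1 M.+1)) - u (tk (minn k M.+1))).
have Huk k : H (u (tk (minn k M.+1))) by apply/Hu/tkT; exact: geq_minr.
have Hw k : H (w k) by apply: (subspaceZ sH); exact: (subspaceB sH).
have Lw k : L (w k) by exact: HL.
have mk j : (j <= M.+1)%N -> minn j M.+1 = j by move/minn_idPl.
pose phi k := 2^-1 *: (w k.+1 + w k).
have Hphi k : H (phi k) by apply: (subspaceZ sH); exact: (subspaceD sH).
have phiE k : (k < M)%N -> phi k = (2 * h)^-1 *: (u (tk k.+2) - u (tk k)).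
  move=> kM; rewrite /phi /w -scalerDr scalerA -invfM; congr (_ *: _).
  rewrite (mk k.+2 kM) (mk k.+1 (ltnW kM)) (mk k (leqW (ltnW kM))).
  by rewrite addrA subrK.
(* The increment of [Y k] over [0, h] contains a second difference of [u], which is [h] times a
   difference of quotients; its derivative pairs an increment of the velocity. Thus the equation
   enters without differentiating [v]. *)
pose Y k r := ip (u (tk k.+1 + r) - u (tk k + r)) (phi k).
pose dY k r := ip (v (tk k.+1 + r) - v (tk k + r)) (phi k).
have rng k r : (k <= M)%N -> 0 <= r <= h -> 0 <= tk k + r <= T.
  move=> kM /andP[r0 rh]; have tk1 := tkt k.+1 kM; rewrite tkS in tk1.
  have tkk := tk0 k; by lin2 tkk tk1 tT r0 rh.
have rng' k r : (k <= M)%N -> 0 < r < h -> 0 < tk k + r < T.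
  move=> kM /andP[r0 rh]; have tk1 := tkt k.+1 kM; rewrite tkS in tk1.
  have tkk := tk0 k; by lin2 tkk tk1 tT r0 rh.
have [r rh EY] : exists2 r, 0 <= r <= h &
    \sum_(k < M) (Y k h - Y k 0) = h * \sum_(k < M) dY k r.
  pose Y' k r := ip (u (tk k.+1 + r)) (phi k) - ip (u (tk k + r)) (phi k).
  have YY' k r : (k < M)%N -> 0 <= r <= h -> Y k r = Y' k r.
    move=> kM rh; rewrite /Y (formBl sL ipF)//; apply: HL => //; apply: Hu; apply: rng => //.
    exact: ltnW.
  have hh : 0 <= h <= h by rewrite lexx ltW.
  have zh : (0:R) <= 0 <= h by apply/andP; split; [exact: lexx|exact: ltW].
  have [||r rh E] := @MVT_sum R M Y' dY h (ltW h0).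
  - move=> k kM r; rewrite in_itv/= => r0h.
    have r0h' : 0 <= r <= h by case/andP: r0h => ? ?; rewrite !ltW.
    rewrite /dY (formBl sL ipF)//; try by [exact: HL|apply: Lv; apply: rng; rewrite ?(ltnW kM)].
    apply: is_deriveB.
      apply: (@is_derive_shift _ (fun t => ip (u t) (phi k))).
      by apply: (ev_der ev); [exact: HL|rewrite in_itv/= rng'].
    apply: (@is_derive_shift _ (fun t => ip (u t) (phi k))).
    by apply: (ev_der ev); [exact: HL|rewrite in_itv/= rng'// ltnW].
  - move=> k kM x.
    have tkk := tk0 k; have tkk1 := tk0 k.+1.
    have c1 : tk k.+1 + h <= T by rewrite -tkS; case/andP: (tkT k.+2 kM).
    have c0 : tk k + h <= T by rewrite -tkS; case/andP: (tkT k.+1 (ltnW kM)).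
    apply: continuousB.
      apply: (@within_shift _ (fun t => ip (u t) (phi k)) 0 T (tk k.+1)) => //.
      by apply: (ev_cont ev); exact: HL.
    apply: (@within_shift _ (fun t => ip (u t) (phi k)) 0 T (tk k)) => //.
    by apply: (ev_cont ev); exact: HL.
  - exists r => //; rewrite -E; apply: eq_bigr => k _; rewrite !YY'//; exact: ltn_ord.
have kin : \sum_(k < M) dY k r = 2^-1 * ip (w M) (w M) - 2^-1 * ip (w 0%N) (w 0%N).
  apply: (mulfI (_ : h != 0)); first by rewrite gt_eqF.
  rewrite -EY -kinetic_telescope// mulr_sumr; apply: eq_bigr => k _.
  have kM := ltn_ord k.
  rewrite /Y -tkS -!tkS !addr0 -(formBl sL ipF); first last.
  - by apply: HL; apply: (subspaceB sH); apply/Hu/tkT; [exact: ltnW|exact/leqW/ltnW].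
  - by apply: HL; apply: (subspaceB sH); apply/Hu/tkT; [exact: kM|exact: ltnW].
  - by apply: HL.
  rewrite -(formZl sL ipF h (HL (Hphi k)) (subspaceB sL (Lw k.+1) (Lw k))).
  congr (ip _ _); rewrite /w (mk k.+2 kM) (mk k.+1 (ltnW kM)) (mk k (leqW (ltnW kM))).
  by rewrite -scalerBr scalerA mulfV ?gt_eqF// scale1r.
move/andP: (rh) => [r0 rh1].
have step k : (k < M)%N -> dY k r <=
    - 2^-1 * (potential (tk k.+2) - potential (tk k))
    + 2^-1 * cK * e * (K (tk k.+2) - K (tk k))
    - (D (tk k.+1 + r) - D (tk k + r))
    + h * (e + e) + e * (2^-1 * CJ * (D (tk k.+2) - D (tk k)))
    + (rho (tk k.+1 + r) - rho (tk k + r)).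
  move=> kM; rewrite /dY phiE// !tkS.
  have k2T : tk k + h + h <= T by rewrite -!tkS; case/andP: (tkT k.+2 kM).
  apply: (energy_step (tk0 k) h0 k2T r0 rh1 (ltW d0) de Cde Lam0 _ nB hF hg hdiss).
  have tkk := tk0 k.
  move=> a b /andP[a1 a2] /andP[b1 b2].
  have aT : 0 <= a <= T by lin2 a1 a2 tkk k2T.
  have bT : 0 <= b <= T by lin2 b1 b2 tkk k2T.
  have ab : - (2 * h) <= b - a <= 2 * h by lin2 a1 a2 b1 b2.
  by have [] := near _ _ aT bT ab.
have sm : \sum_(k < M) dY k r <= - 2^-1 * (potential (tk M.+1)
  + potential (tk M) - potential (tk 1%N) - potential (tk 0%N))
    + 2^-1 * cK * e * (K (tk M.+1) + K (tk M) - K (tk 1%N) - K (tk 0%N))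
    - (D (tk M + r) - D (tk 0%N + r))
    + M%:R * (h * (e + e)) + e * (2^-1 * CJ * (D (tk M.+1) + D (tk M) - D (tk 1%N) - D (tk 0%N)))
    + (rho (tk M + r) - rho (tk 0%N + r)).
  rewrite -(telescope2 (fun k => potential (tk k))) -(telescope2 (fun k => K (tk k))).
  rewrite -(telescope2 (fun k => D (tk k))) -(telescope1 (fun k => D (tk k
    + r))) -(telescope1 (fun k => rho (tk k + r))).
  have -> : M%:R * (h * (e + e)) = \sum_(k < M) (h * (e + e)).
    by rewrite sumr_const card_ord mulr_natl.
  rewrite !mulr_sumr -!sumrN -!big_split/=.
  by apply: ler_sum => k _; exact: step (ltn_ord k).
have tM1 : tk M.+1 = t by exact: hT.
have t00 : tk 0%N = 0 by rewrite /tk mul0r.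
have t10 : tk 1%N = h by rewrite tkS t00 add0r.
have tMh : tk M = t - h by rewrite -tM1 tkS addrK.
rewrite kin tM1 t00 t10 add0r in sm.
have htl : h <= t by rewrite -hT -{1}[h]mul1r ler_wpM2r ?(ltW h0)// ler1n.
have hlT := le_trans htl tT.
have hT' : 0 <= h <= T by rewrite (ltW h0).
have tMT : 0 <= tk M <= T by apply: tkT; exact: leqnSn.
have rT : 0 <= r <= T by rewrite r0 (le_trans rh1).
have MrT : 0 <= tk M + r <= T by apply: rng.
have tMr : - (2 * h) <= tk M + r - t <= 2 * h by rewrite tMh; lin2 r0 rh1 h0.
have [_ _ _ _ n1] := near t (tk M) tT' tMT ltac:(rewrite tMh; lin2 h0).
have [_ _ _ _ n2] := near 0 h zT hT' ltac:(lin2 h0).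
have [_ _ _ n3 _] := near t (tk M + r) tT' MrT tMr.
have [_ _ _ n4 _] := near 0 r zT rT ltac:(lin2 r0 rh1 h0).
move: n1 n2 n3 n4; rewrite !ler_norml => /andP[n1a n1b] /andP[n2a n2b] /andP[n3a n3b] /andP[n4a
  n4b].
(* At both ends the quotient is close to the velocity there, which turns the telescoped squares into
   the kinetic energies at [t] and 0. *)
have wM : Num.sqrt (ip (w M - v t) (w M - v t)) <= d.
  rewrite -(ger0_norm (ltW d0)) -sqrtr_sqr ler_sqrt ?sqr_ge0//.
  have -> : w M = (t - tk M)^-1 *: (u t - u (tk M)).
    by rewrite /w minnn (mk _ (leqnSn M)) tM1 tMh; congr (_^-1 *: _); ring.
  apply: quotient_close => //; [by rewrite tMh; lin h0|by rewrite lexx andbT tMh;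
    lin h0|exact: ltW|].
  move=> s2; rewrite tMh => /andP[s2a s2b].
  have s2T : 0 <= s2 <= T by lin2 s2a s2b htl tT.
  by have [] := near t s2 tT' s2T ltac:(lin2 s2a s2b h0).
have w0 : Num.sqrt (ip (w 0%N - v 0) (w 0%N - v 0)) <= d.
  rewrite -(ger0_norm (ltW d0)) -sqrtr_sqr ler_sqrt ?sqr_ge0//.
  have -> : w 0%N = (h - 0)^-1 *: (u h - u 0).
    by rewrite /w (mk 1%N)// (mk 0%N)// t10 t00 subr0.
  apply: quotient_close => //; [by apply/andP; split; [exact: lexx|exact: ltW]|exact: ltW|].
  move=> s2 /andP[s2a s2b]; have s2T : 0 <= s2 <= T by lin2 s2a s2b hlT.
  by have [] := near 0 s2 zT s2T ltac:(lin2 s2a s2b h0).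
have hwM := le_trans (form_sqrtB sL ipF (Lw M) (Lv tT')) wM.
have hw0 := le_trans (form_sqrtB sL ipF (Lw 0%N) (Lv zT)) w0.
move: hwM hw0; set qM := Num.sqrt (ip (w M) (w M)) ; set qw := Num.sqrt (ip (w 0%N) (w 0%N)).
rewrite -/qt -/q0 !ler_norml => /andP[hwM _] /andP[_ hw0].
have sqE x : L x -> ip x x = Num.sqrt (ip x x) ^+ 2.
  by move=> Lx; rewrite sqr_sqrtr// (form_on_ge0 ipF).
rewrite (sqE _ (Lw M)) (sqE _ (Lw 0%N)) -/qM -/qw in sm.
have qM0 : 0 <= qM by exact: sqrtr_ge0.
have qw0 : 0 <= qw by exact: sqrtr_ge0.
have kM : qt ^+ 2 <= qM ^+ 2 + 2 * (qt * e).
  by apply: sqr_le_near => //; lin hwM de.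
have hw0' : qw <= q0 + e by lin hw0 de.
have k0 := sqr_le_near q00 qw0 e0 hw0'.
have k0' : qw * e <= (q0 + 1) * e by rewrite ler_wpM2r ?(ltW e0)//; lin hw0' e1.
have kinE1 := sqE _ (Lv tT'); have kinE2 := sqE _ (Lv zT); rewrite -/qt in kinE1;
  rewrite -/q0 in kinE2.
have Kb : K t + K (tk M) - K h - K 0 <= 2 * (K T - K 0).
  have kb1 := K_homo t0' tT (lexx T); have /andP[_ tMT2] := tMT.
  have kb2 := K_homo (tk0 M) tMT2 (lexx T).
  have kb3 := K_homo (lexx 0) (ltW h0) hlT; by lin kb1 kb2 kb3.
have Db : D t + D (tk M) - D h - D 0 <= 2 * (D T - D 0).
  have kb1 := DD _ _ t0' tT (lexx T); have /andP[_ tMT2] := tMT.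
  have kb2 := DD _ _ (tk0 M) tMT2 (lexx T).
  have kb3 := DD _ _ (lexx 0) (ltW h0) hlT; by lin kb1 kb2 kb3.
have Rb : rho (tk M + r) - rho r <= e.
  move/andP: MrT => [m1 m2]; move/andP: rT => [m3 m4].
  have rb1 := rhoh _ _ m1 m2 (lexx T); have rb2 := rhoh _ _ (lexx 0) m3 m4.
  by lin rb1 rb2 rhoe.
have Mb : M%:R * (h * (e + e)) <= 2 * T * e.
  have -> : M%:R * (h * (e + e)) = tk M * (2 * e) by rewrite /tk; ring.
  have -> : 2 * T * e = T * (2 * e) by ring.
  rewrite ler_wpM2r//; first by lin e0.
  by case/andP: tMT.
have cKe0 : 0 <= 2^-1 * cK * e by rewrite !mulr_ge0// ltW.
have Kb' := ler_wpM2l cKe0 Kb.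
have cD0 : 0 <= e * (2^-1 * CJ) by rewrite !mulr_ge0// ltW.
have Db' := ler_wpM2l cD0 Db.
rewrite /evol_energy kinE1 kinE2 /Cst.
by lin sm kM k0 k0' Kb' Db' Rb Mb n1a n1b n2a n2b n3a n3b n4a n4b de.
Qed.

End energy_inequality.

(** * The blow-up inequality *)

Lemma modulus_continuous {R : realType} (a b : R) (f : R -> R) :
  modulus_on a b (fun s t => `|f t - f s|) -> {within `[a, b], continuous f}.
Proof.
move=> hf; apply/subspace_continuousP => x /=; rewrite in_itv/= => xab.
apply/cvgrPdist_le => e e0; have [d d0 hd] := hf _ e0.
rewrite !near_withinE; apply/nbhs_ballP; exists d => // z zx /=.
rewrite in_itv/= => zab; rewrite distrC; apply: hd => //.
by rewrite distrC.
Qed.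

Lemma powRD_gt0 {R : realType} (x s t : R) : 0 < x ->
  x `^ (s + t) = x `^ s * x `^ t.
Proof. by move=> x0; rewrite powRD// (gt_eqF x0) implybT. Qed.

Lemma powR_MVT {R : realType} (s x y : R) : 0 < x -> x <= y ->
  exists2 c, x <= c <= y & y `^ s - x `^ s = s * c `^ (s - 1) * (y - x).
Proof.
move=> x0 xy.
have hd z : z \in `]x, y[ -> is_derive z 1 ((@powR R)^~ s) (s * z `^ (s - 1)).
  by rewrite in_itv/= => /andP[xz _]; apply: is_derive1_powR; lra.
have [|c cxy E] := MVT_segment xy hd.
  apply: derivable_within_continuous => z; rewrite in_itv/= => /andP[xz _].
  have z0 : 0 < z by lra.
  by have := @is_derive1_powR R s z z0.
by exists c => //; rewrite in_itv/= in cxy.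
Qed.

(** The derivative of x^(1-s) decreases, so it is smallest at the right end. The next lemma bounds
    the cost of taking the weight x^(-s) at the left end instead. *)
Lemma powR_concave_increment {R : realType} (s x y : R) : 0 < x -> x <= y ->
  0 < s -> s < 1 -> (1 - s) * y `^ (- s) * (y - x) <= y `^ (1 - s) - x `^ (1 - s).
Proof.
move=> x0 xy s0 s1; have [c /andP[xc cy] ->] := powR_MVT (1 - s) x0 xy.
rewrite ler_wpM2r ?subr_ge0// ler_wpM2l; [by []|lra|].
have -> : 1 - s - 1 = - s by ring.
rewrite !powRN lef_pV2 ?posrE ?powR_gt0//; try lra.
by rewrite ge0_ler_powR ?nnegrE//; lra.
Qed.

Lemma powR_inv_increment {R : realType} (s x0 x y : R) : 0 < x0 -> x0 <= x ->
  x <= y -> 0 < s -> x `^ (- s) - y `^ (- s) <= s * x0 `^ (- s - 1) * (y - x).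
Proof.
move=> x00 x0x xy s0; have xp : 0 < x by lra.
have [c /andP[xc cy] E] := powR_MVT (- s) xp xy.
have -> : x `^ (- s) - y `^ (- s) = s * c `^ (- s - 1) * (y - x).
  by rewrite -opprB E; ring.
rewrite ler_wpM2r ?subr_ge0// ler_wpM2l; [by []|lra|].
have -> : - s - 1 = - (s + 1) by ring.
rewrite !powRN lef_pV2 ?posrE ?powR_gt0//; try lra.
by rewrite ge0_ler_powR ?nnegrE//; lra.
Qed.

(* The scalar inequalities of the blow-up argument: [x] stands for the source
   term, [y] for the kinetic term and [h] for the auxiliary function. *)
Section blowup_constants.
Context {R : realType} (q p eta V C1 h0 : R).

Definition bu_ok :=
  [/\ 2 < q, 0 < p, p + 2 < q, 0 < eta & [/\ 0 <= V, 0 <= C1 & 0 < h0]].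

(** Since [x] is at least [q * h0], the additive constant in [Q <= C1 + x] can be turned into this
    factor. *)
Definition bu_C2 := 1 + C1 / (q * h0).
Definition bu_C3 := V + bu_C2.
(** Raising [bu_lam x] to the power -(p+2)/(p+1) leaves x to the power [- bu_s0]. *)
Definition bu_s0 := (1 - (p + 2) / q) / (p + 1).
(** The exponent sigma. The second bound is needed because the pairing <u, u_t> has order S^(1/2 +
    1/q) and must stay below S^(1 - sigma). *)
Definition bu_s := Num.min bu_s0 (2^-1 - q^-1).
Definition bu_Ce := (eta / bu_C3) `^ (- (p + 1)^-1) * h0 `^ (bu_s - bu_s0).
(** The Young parameter for which [bu_lam x] to the power p + 2, times the bound
    [bu_C3 * x ^ ((p + 2) / q)] of the test function, is exactly [eta * x]. *)
Definition bu_lam (x : R) := (eta / bu_C3 * x `^ (1 - (p + 2) / q)) `^ ((p + 2)^-1).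
Definition bu_C5 := Num.sqrt bu_C3 * eta `^ (- q^-1) *
    (eta * q * h0) `^ (2^-1 + q^-1 - (1 - bu_s))
  + bu_Ce / (1 - bu_s) * (eta * q) `^ (- (1 - bu_s)).

Lemma bu_C2_ge1 : bu_ok -> 1 <= bu_C2.
Proof.
move=> ok; have [q2 p0 pq eta0 [V0 C10 h00]] := ok; have q0 : 0 < q by lra.
by rewrite lerDl divr_ge0// mulr_ge0// ltW. Qed.

Lemma bu_C3_gt0 : bu_ok -> 0 < bu_C3.
Proof.
move=> ok; have [q2 p0 pq eta0 [V0 C10 h00]] := ok; have q0 : 0 < q by lra.
by rewrite /bu_C3; have := (bu_C2_ge1 ok); lra. Qed.

Lemma bu_s0_gt0 : bu_ok -> 0 < bu_s0.
Proof.
move=> ok; have [q2 p0 pq eta0 [V0 C10 h00]] := ok; have q0 : 0 < q by lra.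
by rewrite divr_gt0 ?subr_gt0 ?ltr_pdivrMr//; lra. Qed.

Lemma bu_s_gt0 : bu_ok -> 0 < bu_s.
Proof.
move=> ok; have [q2 p0 pq eta0 [V0 C10 h00]] := ok; have q0 : 0 < q by lra.
by rewrite lt_min (bu_s0_gt0 ok) subr_gt0 ltf_pV2 ?posrE//. Qed.

Lemma bu_s_lt : bu_ok -> bu_s <= 2^-1 - q^-1.
Proof.
move=> ok; have [q2 p0 pq eta0 [V0 C10 h00]] := ok; have q0 : 0 < q by lra.
by rewrite ge_min lexx orbT. Qed.

Lemma bu_s_lt1 : bu_ok -> bu_s < 1.
Proof.
move=> ok; have [q2 p0 pq eta0 [V0 C10 h00]] := ok; have q0 : 0 < q by lra.
have := (bu_s_lt ok); have : 0 < q^-1 by rewrite invr_gt0.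
have : 2^-1 < 1 :> R by rewrite invf_lt1//; lra.
lra.
Qed.

Lemma bu_Ce_ge0 : bu_ok -> 0 <= bu_Ce.
Proof.
move=> ok; have [q2 p0 pq eta0 [V0 C10 h00]] := ok; have q0 : 0 < q by lra.
by rewrite mulr_ge0 ?powR_ge0. Qed.

Lemma bu_C5_gt0 : bu_ok -> 0 < bu_C5.
Proof.
move=> ok; have [q2 p0 pq eta0 [V0 C10 h00]] := ok; have q0 : 0 < q by lra.
rewrite ltr_wpDr//; last first.
  by rewrite !mulr_gt0 ?powR_gt0 ?sqrtr_gt0 ?(bu_C3_gt0 ok) ?mulr_gt0.
by rewrite mulr_ge0 ?powR_ge0// divr_ge0 ?(bu_Ce_ge0 ok)// subr_ge0 ltW// (bu_s_lt1 ok).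
Qed.

Lemma bu_lam_gt0 x : bu_ok -> 0 < x -> 0 < bu_lam x.
Proof.
move=> ok; have [q2 p0 pq eta0 [V0 C10 h00]] := ok; have q0 : 0 < q by lra.
by move=> x0; rewrite powR_gt0// mulr_gt0 ?powR_gt0// divr_gt0// (bu_C3_gt0 ok). Qed.

(** For L = x^(1/q) both terms become multiples of x^(r/q). *)
Lemma bu_lower_order (r x Q I : R) : bu_ok -> 0 < r -> r < q -> q * h0 <= x ->
  Q <= C1 + x -> (forall L, 0 < L -> I <= V * L `^ r + L `^ (r - q) * Q) ->
  I <= bu_C3 * x `^ (r / q).
Proof.
move=> ok; have [q2 p0 pq eta0 [V0 C10 h00]] := ok; have q0 : 0 < q by lra.
move=> r0 rq hx hQ hI.
have x0 : 0 < x by apply: lt_le_trans hx; rewrite mulr_gt0.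
have L0 : 0 < x `^ q^-1 by rewrite powR_gt0.
apply: le_trans (hI _ L0) _.
rewrite -!powRrM mulrDl [q^-1 * r]mulrC lerD2l.
have Qx : Q <= bu_C2 * x.
  apply: le_trans hQ _; rewrite mulrDl mul1r addrC lerD2l.
  by rewrite mulrAC ler_pdivlMr ?mulr_gt0// ler_wpM2l.
apply: le_trans (ler_wpM2l (powR_ge0 _ _) Qx) _.
rewrite mulrCA ler_wpM2l ?(le_trans ler01 (bu_C2_ge1 ok))//.
rewrite -{2}(powRr1 (ltW x0)) -powRD_gt0//.
by have -> : q^-1 * (r - q) + 1 = r / q by field; rewrite gt_eqF.
Qed.

Lemma bu_lamE1 x I : bu_ok -> 0 < x -> I <= bu_C3 * x `^ ((p + 2) / q) ->
  bu_lam x `^ (p + 2) * I <= eta * x.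
Proof.
move=> ok; have [q2 p0 pq eta0 [V0 C10 h00]] := ok; have q0 : 0 < q by lra.
move=> x0 hI; have C3 := (bu_C3_gt0 ok).
rewrite /bu_lam -powRrM mulVf ?gt_eqF//; last lra.
rewrite powRr1; last by rewrite mulr_ge0 ?powR_ge0// divr_ge0// ltW.
have e0 : 0 <= eta / bu_C3 * x `^ (1 - (p + 2) / q).
  by rewrite mulr_ge0 ?powR_ge0// divr_ge0// ltW.
apply: le_trans (ler_wpM2l e0 hI) _.
have -> : eta / bu_C3 * x `^ (1 - (p + 2) / q) * (bu_C3 * x `^ ((p + 2) / q))
   = eta * (x `^ (1 - (p + 2) / q) * x `^ ((p + 2) / q)) by field; rewrite gt_eqF.
rewrite -powRD_gt0//.
by rewrite subrK powRr1// ltW.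
Qed.

(** The second Young factor is a multiple of x^(-s0), and h0 <= h <= x together with s <= s0 makes
    it at most a multiple of h^(-s). Times an increment of h, this is controlled by an increment of
    h^(1-s). *)
Lemma bu_lamE2 x h : bu_ok -> h0 <= h -> q * h <= x ->
  bu_lam x `^ (- ((p + 2) / (p + 1))) <= bu_Ce * h `^ (- bu_s).
Proof.
move=> ok; have [q2 p0 pq eta0 [V0 C10 h00]] := ok; have q0 : 0 < q by lra.
move=> hh hx; have C3 := (bu_C3_gt0 ok).
have h0' : 0 < h by lra.
have xh : h <= x by apply: le_trans hx; rewrite ler_peMl//; lra.
have x0 : 0 < x by lra.
have s00 := (bu_s0_gt0 ok).
have E : bu_lam x `^ (- ((p + 2) / (p + 1))) = (eta / bu_C3) `^ (- (p + 1)^-1) * x `^ (- bu_s0).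
  rewrite /bu_lam -powRrM powRM ?powR_ge0//; last by rewrite divr_ge0// ltW.
  rewrite -powRrM; congr (_ `^ _ * _ `^ _); first by field; lra.
  by rewrite /bu_s0; field; rewrite !gt_eqF//; lra.
rewrite E /bu_Ce -mulrA ler_wpM2l ?powR_ge0//.
apply: le_trans (_ : h `^ (- bu_s0) <= _).
  by rewrite !powRN lef_pV2 ?posrE ?powR_gt0// ge0_ler_powR ?nnegrE//; lra.
have -> : h `^ (- bu_s0) = h `^ (bu_s - bu_s0) * h `^ (- bu_s).
  by rewrite -powRD_gt0//; congr (_ `^ _); ring.
rewrite ler_wpM2r ?powR_ge0//.
have ss : bu_s <= bu_s0 by rewrite ge_min lexx.
rewrite -opprB !powRN lef_pV2 ?posrE ?powR_gt0// ge0_ler_powR ?nnegrE//; lra.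
Qed.

(** Everything is compared with S = k + eta x: the root of k is at most S^(1/2), the root of y has
    order S^(1/q), and h is at most S / (eta q). The exponent 1/2 + 1/q does not exceed 1 - s, and
    the missing power of S is bounded because S >= eta q h0. *)
Lemma bu_upper (x k n y h : R) : bu_ok -> h0 <= h -> q * h <= x -> 0 <= k ->
  n <= Num.sqrt k * Num.sqrt y -> y <= bu_C3 * x `^ (2 / q) ->
  n + bu_Ce / (1 - bu_s) * h `^ (1 - bu_s) <= bu_C5 * (k + eta * x) `^ (1 - bu_s).
Proof.
move=> ok; have [q2 p0 pq eta0 [V0 C10 h00]] := ok; have q0 : 0 < q by lra.
move=> hh hx k0 hn hy; have C3 := (bu_C3_gt0 ok); have s1 := (bu_s_lt1 ok);
  have s0 := (bu_s_gt0 ok).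
have h0' : 0 < h by lra.
have xh : h <= x by apply: le_trans hx; rewrite ler_peMl//; lra.
have x0 : 0 < x by lra.
have ex0 : 0 < eta * x by rewrite mulr_gt0.
set S := k + eta * x.
have S0 : 0 < S by rewrite /S; lra.
have exS : eta * x <= S by rewrite /S; lra.
have ehS : eta * q * h <= S.
  by apply: le_trans exS; rewrite -mulrA ler_wpM2l// ltW.
have eh0S : eta * q * h0 <= S.
  by apply: le_trans ehS; rewrite ler_wpM2l// mulr_ge0// ltW.
rewrite /bu_C5 mulrDl; apply: lerD.
  apply: le_trans hn _.
  have y1 : Num.sqrt y <= Num.sqrt bu_C3 * (eta `^ (- q^-1) * S `^ q^-1).
    apply: le_trans (ler_wsqrtr hy) _.
    rewrite sqrtrM ?(ltW C3)// ler_wpM2l ?sqrtr_ge0//.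
    rewrite -powR12_sqrt ?powR_ge0// -powRrM.
    have -> : 2 / q * 2^-1 = q^-1 by field; rewrite gt_eqF.
    have -> : x = eta^-1 * (eta * x) by rewrite mulKf ?gt_eqF.
    rewrite powRM ?invr_ge0 ?(ltW eta0) ?(ltW ex0)// -{1}(powR_inv1 (ltW eta0)) -powRrM mulN1r.
    by rewrite ler_wpM2l ?powR_ge0//
      ge0_ler_powR ?nnegrE ?invr_ge0 ?(ltW q0) ?(ltW ex0) ?(ltW S0).
  have k1 : Num.sqrt k <= S `^ 2^-1.
    by rewrite powR12_sqrt ?(ltW S0)// ler_wsqrtr// /S; lra.
  apply: le_trans (ler_pM (sqrtr_ge0 _) (sqrtr_ge0 _) k1 y1) _.
  rewrite mulrCA -!mulrA ler_wpM2l ?sqrtr_ge0//.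
  rewrite mulrCA ler_wpM2l ?powR_ge0//.
  rewrite -powRD_gt0//.
  have -> : S `^ (2^-1 + q^-1) = S `^ (2^-1 + q^-1 - (1 - bu_s)) * S `^ (1 - bu_s).
    by rewrite -powRD_gt0//; congr (_ `^ _); ring.
  rewrite ler_wpM2r ?powR_ge0//.
  have hs := (bu_s_lt ok).
  have -> : 2^-1 + q^-1 - (1 - bu_s) = - (1 - bu_s - 2^-1 - q^-1) by ring.
  rewrite !powRN lef_pV2 ?posrE ?powR_gt0 ?mulr_gt0//.
  rewrite -mulrA in eh0S; rewrite ge0_ler_powR ?nnegrE ?mulr_ge0 ?(ltW eta0) ?(ltW q0) ?(ltW h00)
    ?(ltW S0)//; lra.
rewrite -(mulrA (bu_Ce / _)) ler_wpM2l ?divr_ge0 ?(bu_Ce_ge0 ok) ?subr_ge0 ?(ltW s1)//.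
have eq0 : 0 < eta * q by rewrite mulr_gt0.
rewrite powRN mulrC ler_pdivlMr ?powR_gt0// -powRM ?(ltW eq0) ?(ltW h0')//.
rewrite ge0_ler_powR ?nnegrE ?mulr_ge0 ?(ltW eta0) ?(ltW q0) ?(ltW h0') ?(ltW S0)//; first lra.
by rewrite mulrC.
Qed.

End blowup_constants.

(** * Invariance of the unstable set and blow-up *)

Section blowup.
Context {R : realType} {X : lmodType R} {H L : X -> Prop}
    {ip : X -> X -> R} {nh : X -> R} {aa : X -> X -> R} {CA : R}
    {ff : X -> X -> R} {FF Ip : X -> R} {mu : R -> R} {T : R}
    {u v : R -> X} {P : R -> X -> R} {D K : R -> R} {CJ : R}.
Context (ev : evolution H L ip nh aa CA ff FF Ip mu T u v P D K CJ).
Let sH := evH ev.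
Let ipF := ev_ip ev.
Let nhN := ev_nh ev.
Let aaF := ev_aa ev.
Let Hu := ev_u ev.
Let Lv := ev_v ev.

Local Notation ener := (@evol_energy R X ip aa FF mu u v).
Local Notation load := (@load R X aa ff mu u).

Lemma aa_continuous : {within `[0, T], continuous (fun t => aa (u t) (u t))}.
Proof.
have CA0 := ev_CA ev; have T0 := ev_T ev.
apply: modulus_continuous.
set B := nh (u 0) + (K T - K 0).
apply: (modulus_onW (_ : 0 <= CA * B + CA * B)) (ev_mod_u ev).
  have z0 : 0 <= B.
    by apply: le_trans (norm_on_ge0 nhN (u 0)) (nh_bound ev _); rewrite ?(ltW T0)// lexx.
  by rewrite addr_ge0// mulr_ge0.
move=> s t sT tT; have Hs := Hu sT; have Ht := Hu tT.
have Hts := subspaceB sH Ht Hs.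
have -> : aa (u t) (u t) - aa (u s) (u s) = aa (u t) (u t - u s) + aa (u s) (u t - u s).
  by rewrite !(formBr aaF)// (form_onC aaF Hs Ht); ring.
have b1 := ev_aa_le ev Ht Hts; have b2 := ev_aa_le ev Hs Hts.
have n0 := norm_on_ge0 nhN (u t - u s).
have c1 : CA * nh (u t) * nh (u t - u s) <= CA * B * nh (u t - u s).
  by rewrite ler_wpM2r// ler_wpM2l// (nh_bound ev).
have c2 : CA * nh (u s) * nh (u t - u s) <= CA * B * nh (u t - u s).
  by rewrite ler_wpM2r// ler_wpM2l// (nh_bound ev).
by apply: le_trans (ler_normD _ _) _; rewrite mulrDl; lra.
Qed.

Lemma well_invariance (q m0 r2 : R) (Q : X -> R) :
  2 < q -> D 0 = 0 ->
  (forall t, 0 <= t <= T -> m0 <= mu t) ->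
  (forall x, H x -> 0 <= Q x) ->
  (forall x, H x -> FF x = ff x x / q - Q x / q ^+ 2) -> 0 <= r2 ->
  (forall x, H x -> aa x x = r2 -> ff x x <= m0 * r2) ->
  ener 0 < (q - 2) / (2 * q) * m0 * r2 ->
  r2 < aa (u 0) (u 0) -> forall t, 0 <= t <= T -> r2 < aa (u t) (u t).
Proof.
move=> q2 D0 hm hQ hFF r20 hwell E0 h0 t /andP[t0 tT].
rewrite ltNge; apply/negP => ht.
have ct : {within `[0, t], continuous (fun t => aa (u t) (u t))}.
  apply: continuous_subspaceW aa_continuous => x /=.
  by rewrite !in_itv/= => /andP[-> xt]/=; exact: le_trans xt tT.
(* The hypothesis [hwell] concerns only the level [aa x x = r2], so a time is needed at which this
   level is attained exactly. *)
have [|c] := @IVT R _ 0 t r2 t0 ct.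
  by rewrite ge_min le_max ht orbT (ltW h0).
rewrite in_itv/= => /andP[c0 ct'] Ec.
have cT : 0 <= c <= T by rewrite c0 (le_trans ct').
have hE := energy_le ev cT; rewrite D0 addr0 in hE.
have Dc : 0 <= D c by rewrite -D0 (ev_D ev)// ; case/andP: cT.
have Hc := Hu cT; have fc := hFF _ Hc; have wc := hwell _ Hc Ec.
have k0 := form_on_ge0 ipF (Lv cT).
have q0 : 0 < q by lra.
have Qc : 0 <= Q (u c) / q ^+ 2 by rewrite divr_ge0 ?hQ// exprn_ge0// ltW.
have mc : m0 * r2 <= mu c * r2 by rewrite ler_wpM2r// hm.
have wc' : ff (u c) (u c) / q <= m0 * r2 / q by rewrite ler_pM2r// invr_gt0.
have Eq : (q - 2) / (2 * q) * m0 * r2 = 2^-1 * (m0 * r2) - m0 * r2 / q by field; lra.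
rewrite Eq in E0; rewrite /evol_energy /potential Ec fc in hE;
  rewrite /evol_energy /potential in E0.
lra.
Qed.

End blowup.

(* [Tmax] is chosen before [X], [T] and the solution: two weak solutions on
   different intervals may have different velocities [v]. *)
Lemma no_long_evolution {R : realType} (q p m0 r2 C1 V E0 N0 : R) :
  2 < q -> 0 < p -> p + 2 < q -> 0 < m0 -> 0 < r2 -> 0 <= V -> 0 <= C1 ->
  E0 < (q - 2) / (2 * q) * m0 * r2 -> 0 < N0 ->
  exists Tmax : R, forall (X : lmodType R) (H L : X -> Prop) ip nh aa CA ff FF Ip
      mu T u v P D K CJ (Q : X -> R),
    evolution H L ip nh aa CA ff FF Ip mu T u v P D K CJ ->
    D 0 = 0 -> @evol_energy R X ip aa FF mu u v 0 = E0 -> ip (u 0) (v 0) = N0 ->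
    r2 < aa (u 0) (u 0) ->
    (forall t, 0 <= t <= T -> m0 <= mu t) ->
    (forall x, H x -> 0 <= Q x) ->
    (forall x, H x -> FF x = ff x x / q - Q x / q ^+ 2) ->
    (forall x, H x -> Q x <= C1 + ff x x) ->
    (forall x, H x -> forall l, 0 < l ->
       Ip x <= V * l `^ (p + 2) + l `^ (p + 2 - q) * Q x) ->
    (forall x, H x -> forall l, 0 < l ->
       ip x x <= V * l `^ 2 + l `^ (2 - q) * Q x) ->
    (forall x, H x -> aa x x = r2 -> ff x x <= m0 * r2) ->
    (forall phi s t l, H phi -> 0 <= s -> s <= t -> t <= T -> 0 < l ->
       P t phi - P s phi <= (t - s) * (l `^ (p + 2) * Ip phi)
         + l `^ (- ((p + 2) / (p + 1))) * (D t - D s)) ->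
    T <= Tmax.
Proof.
move=> q2 p0 pq m00 r20 V0 C10 hE0 N00.
have q0 : 0 < q by lra.
have mr : 0 < m0 * r2 by rewrite mulr_gt0.
have Eq : (q - 2) / (2 * q) * m0 * r2 = 2^-1 * (m0 * r2) - m0 * r2 / q by field; lra.
rewrite Eq in hE0.
have mrq : 0 < m0 * r2 / q by rewrite divr_gt0.
(* The largest constant for which the energy inequality, in the region [r2 < aa (u t) (u t)], gives
   [q * (h0 + D t) <= ff (u t) (u t)]. *)
pose h0 := 2^-1 * (m0 * r2) - E0.
have h00 : 0 < h0 by rewrite /h0; lra.
pose g0 := q * (2^-1 * (m0 * r2) - m0 * r2 / q - E0).
have g00 : 0 < g0 by rewrite mulr_gt0// subr_gt0.
have W0 : 0 < q * h0 by rewrite mulr_gt0.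
(* The first bound keeps 2 eta q h0 below [g0], which is q times the gap between the well depth and
   [E0]; the second keeps (1 - 2 eta) q / 2 at least 1. Both are what [drive] requires. *)
pose eta := Num.min (g0 / (2 * (q * h0))) ((q - 2) / (2 * q)).
have eta0 : 0 < eta by rewrite lt_min !divr_gt0 ?mulr_gt0//; lra.
have eta1 : 2 * eta * (q * h0) <= g0.
  have : eta <= g0 / (2 * (q * h0)) by rewrite ge_min lexx.
  by rewrite ler_pdivlMr ?mulr_gt0//; lra.
have eta2 : 1 <= (1 - 2 * eta) * (q / 2).
  have : eta <= (q - 2) / (2 * q) by rewrite ge_min lexx orbT.
  by rewrite ler_pdivlMr ?mulr_gt0//; lra.
have ok : bu_ok q p eta V C1 h0 by [].
pose s := bu_s q p; pose Ce := bu_Ce q p eta V C1 h0; pose C5 := bu_C5 q p eta V C1 h0.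
have s0 : 0 < s := bu_s_gt0 ok. have s1 : s < 1 := bu_s_lt1 ok.
have s1' : 0 < 1 - s by lra.
have Ce0 : 0 <= Ce := bu_Ce_ge0 ok. have C50 : 0 < C5 := bu_C5_gt0 ok.
(* Then 1 + b = 1/(1 - s), and G <= C5 S^(1-s) becomes S >= c G^(1+b). *)
pose b := s / (1 - s).
have b0 : 0 < b by rewrite divr_gt0.
have bE : 1 + b = (1 - s)^-1 by rewrite /b; field; lra.
pose c := C5 `^ (- (1 + b)).
have c0 : 0 < c by rewrite powR_gt0.
pose G0 := N0 + Ce / (1 - s) * h0 `^ (1 - s).
exists (G0 `^ (- b) / c / (1 - 2 `^ (- b))).
move=> X H L ip nh aa CA ff FF Ip mu T u v P D K CJ Q ev D0 E0E N0E a0 hm hQ hFF hQ1 hI hip hwell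
  hP.
have T0 := ev_T ev; have sH := evH ev; have sL := evL ev; have HL := evHL ev.
have ipF := ev_ip ev; have nhN := ev_nh ev.
have zT : (0:R) <= 0 <= T by apply/andP; split; [exact: lexx|exact: ltW].
have hwi := well_invariance ev q2 D0 hm hQ hFF (ltW r20) hwell.
rewrite E0E Eq in hwi; have {}hwi := hwi hE0 a0.
pose Hh t := h0 + D t.
pose N t := ip (u t) (v t).
pose G t := N t + Ce / (1 - s) * Hh t `^ (1 - s).
pose k t := ip (v t) (v t).
pose S t := k t + eta * ff (u t) (u t).
have DD : forall s t, 0 <= s -> s <= t -> t <= T -> D s <= D t := ev_D ev.
have Hh0 t : 0 <= t <= T -> h0 <= Hh t.
  by move=> /andP[t0 tT]; rewrite lerDl -D0 DD.
have k0 t : 0 <= t <= T -> 0 <= k t by move=> tT; apply: (form_on_ge0 ipF); exact: (ev_v ev).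
have hE t : 0 <= t <= T -> 2^-1 * k t + 2^-1 * (m0 * r2) + D t - ff (u t) (u t) / q <= E0 /\
    2^-1 * k t + 2^-1 * (mu t * aa (u t) (u t)) - ff (u t) (u t) / q <= E0 /\
    m0 * r2 <= mu t * aa (u t) (u t).
  move=> tT; have := energy_le ev tT; rewrite D0 addr0 E0E /evol_energy /potential -/(k t).
  have Ht := ev_u ev tT; rewrite hFF//.
  have Qt : 0 <= Q (u t) / q ^+ 2 by rewrite divr_ge0 ?hQ// exprn_ge0// ltW.
  have Dt : 0 <= D t by rewrite -D0 DD//; case/andP: tT.
  have mt : m0 * r2 <= mu t * aa (u t) (u t).
    by apply: ler_pM; rewrite ?hm// ltW// hwi.
  by move=> h; split; [lra|split=> //; lra].
have fH t : 0 <= t <= T -> q * Hh t <= ff (u t) (u t).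
  move=> tT; have [h _] := hE _ tT; have kt := k0 _ tT.
  by rewrite mulrC -ler_pdivlMr// /Hh /h0; lra.
have fp t : 0 <= t <= T -> 0 < ff (u t) (u t).
  move=> tT; apply: lt_le_trans (fH _ tT); rewrite mulr_gt0//.
  exact: lt_le_trans (Hh0 _ tT).
have fh0 t : 0 <= t <= T -> q * h0 <= ff (u t) (u t).
  by move=> tT; apply: le_trans (fH _ tT); rewrite ler_wpM2l ?(ltW q0)// Hh0.
have S0 t : 0 <= t <= T -> 0 <= S t.
  by move=> tT; rewrite addr_ge0 ?k0// mulr_ge0 ?ltW// fp.
(* It has to be shown that mu a <= (1 - 2 eta) ff. The energy inequality bounds ff below by q (k/2 +
   mu a/2 - E0); the resulting condition is affine and monotone in mu a, hence worst at m0 r2, where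
   it reduces to the bound of 2 eta q h0 by [g0]. *)
have drive t : 0 <= t <= T ->
    S t <= k t - mu t * aa (u t) (u t) + (1 - eta) * ff (u t) (u t).
  move=> tT; have [_ [h mt]] := hE _ tT; have kt := k0 _ tT.
  have h' : q * (2^-1 * k t + 2^-1 * (mu t * aa (u t) (u t)) - E0) <= ff (u t) (u t).
    by rewrite mulrC -ler_pdivlMr//; lra.
  have e2 : 0 <= 1 - 2 * eta.
    rewrite leNgt; apply/negP => e2.
    have : (1 - 2 * eta) * (q / 2) < 0 by rewrite pmulr_llt0 ?divr_gt0.
    by lra.
  have h2 := ler_wpM2l e2 h'.
  have h3 : (1 - 2 * eta) * (q / 2) * k t >= 0 by rewrite mulr_ge0//; lra.
  have h4 : 0 <= ((1 - 2 * eta) * (q / 2) - 1) * (mu t * aa (u t) (u t) - m0 * r2).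
    by rewrite mulr_ge0// subr_ge0.
  have h5 : q * (m0 * r2 / q) = m0 * r2 by field; rewrite gt_eqF.
  rewrite /S; rewrite /g0 /h0 in eta1; nra.
have ipu t : 0 <= t <= T -> ip (u t) (u t) <= bu_C3 q V C1 h0 * ff (u t) (u t) `^ (2 / q).
  move=> tT; have Ht := ev_u ev tT.
  exact: (bu_lower_order ok (ltr0Sn _ 1) q2 (fh0 _ tT) (hQ1 _ Ht) (hip _ Ht)).
have Ipu t : 0 <= t <= T -> Ip (u t) <= bu_C3 q V C1 h0 * ff (u t) (u t) `^ ((p + 2) / q).
  move=> tT; have Ht := ev_u ev tT.
  by apply: (bu_lower_order ok _ pq (fh0 _ tT) (hQ1 _ Ht) (hI _ Ht)); lra.
have upper t : 0 <= t <= T -> G t <= C5 * S t `^ (1 - s).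
  move=> tT; apply: (bu_upper ok (Hh0 _ tT) (fH _ tT) (k0 _ tT) _ (ipu _ tT)).
  rewrite mulrC; apply: le_trans (ler_norm _) _; apply: (form_CS_sqrt sL ipF).
    exact/HL/(ev_u ev).
  exact: (ev_v ev).
have low t : 0 <= t <= T -> 0 <= G t -> c * G t `^ (1 + b) <= S t.
  move=> tT Gt; have up := upper _ tT; have St := S0 _ tT.
  have : G t `^ (1 + b) <= (C5 * S t `^ (1 - s)) `^ (1 + b).
    by apply: ge0_ler_powR; rewrite ?nnegrE ?mulr_ge0 ?powR_ge0 ?(ltW C50)//; lra.
  rewrite powRM ?powR_ge0 ?(ltW C50)// -powRrM bE mulfV ?gt_eqF// powRr1//.
  by move=> hh; rewrite /c bE powRN mulrC ler_pdivrMr ?powR_gt0// [S t * _]mulrC.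
clearbody c b.
(* The Young parameter is frozen at its value for the left end of the interval. *)
have hP' s' t : 0 <= s' -> s' <= t -> t <= T -> P t (u s') - P s' (u s') <=
    (t - s') * (eta * ff (u s') (u s')) + Ce * Hh s' `^ (- s) * (D t - D s').
  move=> s'0 s't tT; have s'T : 0 <= s' <= T by rewrite s'0 (le_trans s't).
  have Hs' := ev_u ev s'T; have fs := fp _ s'T.
  have l0 := bu_lam_gt0 ok fs.
  apply: le_trans (hP _ _ _ _ Hs' s'0 s't tT l0) _; apply: lerD.
    by rewrite ler_wpM2l ?subr_ge0//; apply: (bu_lamE1 ok fs); exact: Ipu.
  rewrite ler_wpM2r ?subr_ge0 ?DD//; apply: (bu_lamE2 ok) => //; [exact: Hh0|exact: fH].
pose B := nh (u 0) + (K T - K 0).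
have nB t : 0 <= t <= T -> nh (u t) <= B by exact: (nh_bound ev).
have B0 : 0 <= B := le_trans (norm_on_ge0 nhN _) (nB _ zT).
have [tm tm0 htm] : exists2 tm, 0 <= tm <= T &
    forall t, 0 <= t <= T -> Num.sqrt (k t) <= Num.sqrt (k tm).
  have kc : {within `[0, T], continuous (fun t => Num.sqrt (k t))}.
    apply: modulus_continuous; apply: (modulus_onW ler01) (ev_mod_v ev) => s' t s'T tT.
    by rewrite mul1r; apply: (form_sqrtB sL ipF); apply: (ev_v ev).
  have [tm] := EVT_max (ltW T0) kc; rewrite in_itv/= => tmT htm.
  by exists tm => // t tT; apply: htm; rewrite in_itv.
set Vb := Num.sqrt (k tm) in htm.
have Vb0 : 0 <= Vb by exact: sqrtr_ge0.
have [g mg hg] := load_modulus ev.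
pose ch := Ce * (s * h0 `^ (- s - 1)).
have ch0 : 0 <= ch by rewrite !mulr_ge0 ?powR_ge0 ?(ltW s0).
(* The local form of G' >= S. The error is measured by the increment of t + D t and not of t alone,
   since the damping leaves products of a small factor with an increment of [D]. *)
have Gloc e : 0 < e -> exists2 d, 0 < d & forall s' t, 0 <= s' -> s' <= t -> t <= T ->
    t - s' < d -> (t - s') * S s' - e * ((t + D t) - (s' + D s')) <= G t - G s'.
  move=> e0; pose e1 := e / (1 + B + 2 * Vb + ch).
  have den0 : 0 < 1 + B + 2 * Vb + ch.
    by rewrite ltr_wpDr// ltr_wpDr ?mulr_ge0// ltr_wpDr.
  have e10 : 0 < e1 by rewrite divr_gt0.
  have e1E : e1 * (1 + B + 2 * Vb + ch) = e by rewrite divfK// gt_eqF.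
  have [d1 d10 h1] := mg _ e10; have [d2 d20 h2] := ev_mod_v ev e10.
  have [d3 d30 h3] := ev_mod_D ev e10.
  exists (Num.min d1 (Num.min d2 d3)); first by rewrite !lt_min d10 d20.
  move=> s' t s'0 s't tT; rewrite !lt_min => /and3P[td1 td2 td3].
  have s'T : 0 <= s' <= T by rewrite s'0 (le_trans s't).
  have tT' : 0 <= t <= T by rewrite tT (le_trans s'0).
  have Hs := ev_u ev s'T; have Ht := ev_u ev tT'.
  have Ls := HL _ Hs; have Lt := HL _ Ht.
  have Lvs := ev_v ev s'T; have Lvt := ev_v ev tT'.
  have ts0 : 0 <= t - s' by rewrite subr_ge0.
  have nt' (x y : R) : `|x| <= y -> - y <= x by rewrite ler_norml => /andP[].
  have [r1 /andP[sr1 r1t] Er1] := ev_eqn ev Hs s'0 s't tT.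
  have r1T : 0 <= r1 <= T by rewrite (le_trans s'0)// (le_trans r1t).
  have r1s : `|r1 - s'| < d1 by rewrite ger0_norm ?subr_ge0//; apply: le_lt_trans td1;
    rewrite lerD2r.
  have ld := nt' _ _ (hg _ _ _ s'T r1T Hs).
  have ld2 : g s' r1 * nh (u s') <= e1 * B.
    apply: le_trans (_ : e1 * nh (u s') <= _).
      by rewrite ler_wpM2r ?(norm_on_ge0 nhN)//; exact: h1.
    by rewrite ler_wpM2l ?(ltW e10)// nB.
  have [r2' /andP[sr2 r2t] Er2] := u_mean_value ev Lvt s'0 s't tT.
  have r2T : 0 <= r2' <= T by rewrite (le_trans s'0)// (le_trans r2t).
  have Lvr := ev_v ev r2T.
  have r2s : `|r2' - s'| < d2 by rewrite ger0_norm ?subr_ge0//; apply: le_lt_trans td2;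
    rewrite lerD2r.
  have kk : k s' - 2 * (e1 * Vb) <= ip (v r2') (v t).
    have Lrs := subspaceB sL Lvr Lvs; have Lts := subspaceB sL Lvt Lvs.
    have b1 : - (e1 * Vb) <= ip (v r2' - v s') (v t).
      apply: nt'; apply: le_trans (form_CS_sqrt sL ipF Lrs Lvt) _.
      by apply: ler_pM; rewrite ?sqrtr_ge0 ?htm//; exact: h2.
    have b2 : - (e1 * Vb) <= ip (v t - v s') (v s').
      apply: nt'; apply: le_trans (form_CS_sqrt sL ipF Lts Lvs) _.
      apply: ler_pM; rewrite ?sqrtr_ge0 ?htm//; apply: h2 => //.
      by rewrite ger0_norm.
    rewrite (formBl sL ipF)// in b1; rewrite (formBl sL ipF)// in b2.
    by rewrite (form_onC ipF Lvs Lvt) in b1; move: b1 b2; rewrite -/(k s'); clear; lra.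
  (* A discrete product rule: the equation is tested with the old [u s'], the mean value theorem for
     [u] with the new [v t]. *)
  have NE : N t - N s' = ip (v t - v s') (u s') + ip (u t - u s') (v t).
    rewrite /N (formBl sL ipF)// (formBl sL ipF)//.
    by rewrite (form_onC ipF Lvt Ls) (form_onC ipF Lvs Ls); ring.
  have pp := hP' _ _ s'0 s't tT.
  have dD : 0 <= D t - D s' by rewrite subr_ge0 DD.
  have Hss := Hh0 _ s'T; have Hst : Hh s' <= Hh t by rewrite lerD2l DD.
  have Hs0 : 0 < Hh s' by exact: lt_le_trans Hss.
  have HD : Hh t - Hh s' = D t - D s' by rewrite /Hh; ring.
  have q1 := powR_concave_increment Hs0 Hst s0 s1.
  have q2' := powR_inv_increment h00 Hss Hst s0.
  rewrite HD in q1 q2'.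
  have dDe : D t - D s' <= e1.
    by apply: le_trans (ler_norm _) _; apply: h3 => //; rewrite ger0_norm.
  have q3 : Ce * Hh t `^ (- s) * (D t - D s') <= Ce / (1 - s)
    * (Hh t `^ (1 - s) - Hh s' `^ (1 - s)).
    have -> : Ce * Hh t `^ (- s) * (D t - D s') = Ce / (1 - s) * ((1 - s) * Hh t `^ (- s)
      * (D t - D s')).
      by field; rewrite gt_eqF.
    by rewrite ler_wpM2l// divr_ge0// ltW.
  (* Moving the weight from [s'] to [t] costs a square of the increment of [D], one factor of which
     is at most [e1]. *)
  have q4 : Ce * Hh s' `^ (- s) * (D t - D s') <= Ce * Hh t `^ (- s) * (D t - D s') + ch * e1
    * (D t - D s').
    rewrite -mulrDl ler_wpM2r// -lerBlDl -mulrBr.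
    apply: le_trans (ler_wpM2l Ce0 q2') _; rewrite mulrA -/ch ler_wpM2l//.
  have r1' : (t - s') * (@load R X aa ff mu u s' (u s') - e1 * B)
    <= (t - s') * @load R X aa ff mu u r1 (u s').
    by rewrite ler_wpM2l//; move: ld ld2; clear; lra.
  have r2'' := ler_wpM2l ts0 kk.
  have dr := ler_wpM2l ts0 (drive _ s'T).
  have e1b : 0 <= (t - s') * (e - e1 * B - 2 * (e1 * Vb)).
    rewrite mulr_ge0//; have := mulr_ge0 (ltW e10) ch0.
    by move: (ltW e10) e1E; clear; lra.
  have e1c : 0 <= (e - ch * e1) * (D t - D s').
    rewrite mulr_ge0//; have := mulr_ge0 (ltW e10) Vb0; have := mulr_ge0 (ltW e10) B0.
    by move: (ltW e10) e1E; clear; lra.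
  rewrite -/(@load R X aa ff mu u r1 (u s')) in Er1.
  rewrite /load in r1'; rewrite /load in Er1.
  have -> : G t - G s' = (N t - N s') + Ce / (1 - s) * (Hh t `^ (1 - s) - Hh s' `^ (1 - s)).
    by rewrite /G; ring.
  rewrite NE Er2; move: Er1 pp q3 q4 r1' r2'' dr e1b e1c.
  clear; lra.
have Kmono a' s' t : 0 <= a' -> a' <= s' -> s' <= t -> t <= T -> s' + D s' <= t + D t.
  by move=> a0' as' st tT; apply: lerD => //; apply: DD => //; exact: le_trans as'.
have Gmono s' t : 0 <= s' -> s' <= t -> t <= T -> G s' <= G t.
  move=> s'0 s't tT; apply: (@local_increment_homo R G (fun t => t
    + D t) 0 T _ _ s' t s'0 s't tT).
    by move=> s3 t3; exact: Kmono.
  move=> e e0; have [d d0 hd] := Gloc _ e0; exists d => // s2 t2 s20 st2 t2T td.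
  have := hd _ _ s20 st2 t2T td; have s2T : 0 <= s2 <= T by rewrite s20 (le_trans st2).
  have : 0 <= (t2 - s2) * S s2 by rewrite mulr_ge0 ?subr_ge0 ?S0.
  by clear; lra.
have G0E : G 0 = G0 by rewrite /G /Hh /N D0 addr0 N0E.
have G00 : 0 < G 0.
  by rewrite G0E /G0 ltr_wpDr// mulr_ge0 ?powR_ge0// divr_ge0// ltW.
rewrite -G0E; apply: (superlinear_growth_bound c0 b0 G00) => s' t s'0 s't tT.
have Gs : 0 <= G s' by apply: le_trans (ltW G00) _; apply: Gmono => //; exact: le_trans tT.
(* As G increases, S stays above [cc] on [s', t]. Hence G t - cc t increases there too, and this is
   the growth hypothesis with the value of G at the left end. *)
set cc := c * G s' `^ (1 + b).
have cc0 : 0 <= cc by rewrite mulr_ge0 ?powR_ge0// ltW.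
suff : G s' - cc * s' <= G t - cc * t.
  have -> : c * (t - s') * G s' `^ (1 + b) = cc * t - cc * s' by rewrite /cc; ring.
  by clear; lra.
apply: (@local_increment_homo R (fun t => G t - cc * t) (fun t => t
  + D t) s' T _ _ s' t (lexx _) s't tT).
  by move=> s2 t2; exact: Kmono.
move=> e e0; have [d d0 hd] := Gloc _ e0; exists d => // s2 t2 s20 st2 t2T td.
have s2_0 := le_trans s'0 s20; have := hd _ _ s2_0 st2 t2T td.
have s2T : 0 <= s2 <= T by rewrite s2_0 (le_trans st2).
have GG : G s' <= G s2 by apply: Gmono => //; exact: le_trans t2T.
have Ss : cc <= S s2.
  apply: le_trans (low _ s2T (le_trans Gs GG)); apply: ler_wpM2l; first exact: ltW.
  apply: ge0_ler_powR => //; first by rewrite addr_ge0// ltW.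
  by rewrite nnegrE (le_trans Gs GG).
have : (t2 - s2) * cc <= (t2 - s2) * S s2 by rewrite ler_wpM2l ?subr_ge0.
by clear; lra.
Qed.

(** * Lebesgue measure on row vectors *)

Section rV_topology.
Context {R : realType} {n : nat}.
Local Notation V := 'rV[R]_n.

Definition obox (a b : 'I_n -> R) : set V :=
  [set x | forall i, a i < x ord0 i < b i].
Definition cbox (a b : 'I_n -> R) : set V :=
  [set x | forall i, a i <= x ord0 i <= b i].

Lemma measurable_coord_preimage (B : set R) (i : 'I_n) :
  measurable B -> measurable [set x : V | B (x ord0 i)].
Proof.
move=> mB; have := @measurable_rV_coord R n i.
by move=> /(_ measurableT _ mB); rewrite setTI.
Qed.

Lemma box_bigcap (P : 'I_n -> set R) :
  [set x : V | forall i, P i (x ord0 i)] = \bigcap_(i in setT) [set x | P i (x ord0 i)].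
Proof. by apply/seteqP; split => x /= h i => [_|]; exact: h. Qed.

Lemma measurable_obox a b : measurable (obox a b).
Proof.
have -> : obox a b = \bigcap_(i in setT) [set x : V | [set y | a i < y < b i] (x ord0 i)].
  exact: (box_bigcap (fun i => [set y | a i < y < b i])).
apply: fin_bigcap_measurable => // i _.
have -> : [set y | a i < y < b i] = `]a i, b i[%classic.
  by apply/seteqP; split => y /=; rewrite in_itv.
by apply: measurable_coord_preimage; exact: measurable_itv.
Qed.

Lemma measurable_cbox a b : measurable (cbox a b).
Proof.
have -> : cbox a b = \bigcap_(i in setT) [set x : V | [set y | a i <= y <= b i] (x ord0 i)].
  exact: (box_bigcap (fun i => [set y | a i <= y <= b i])).
apply: fin_bigcap_measurable => // i _.
have -> : [set y | a i <= y <= b i] = `[a i, b i]%classic.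
  by apply/seteqP; split => y /=; rewrite in_itv.
by apply: measurable_coord_preimage; exact: measurable_itv.
Qed.

(** Boxes of half-width 1/(k+1) around rational centres: a countable family that serves as a base of
    the topology. *)
Definition rat_lo (q : 'rV[rat]_n * nat) (i : 'I_n) : R := ratr (q.1 ord0 i) - q.2.+1%:R^-1.
Definition rat_hi (q : 'rV[rat]_n * nat) (i : 'I_n) : R := ratr (q.1 ord0 i) + q.2.+1%:R^-1.

Lemma nbhs_rat_box (x : V) (U : set V) : nbhs x U ->
  exists q, obox (rat_lo q) (rat_hi q) x /\ cbox (rat_lo q) (rat_hi q) `<=` U.
Proof.
move=> /nbhs_ballP[e /= e0 he].
have [k hk] : exists k : nat, (k.+1%:R : R)^-1 * 3 < e.
  exists (Num.bound (3 / e)).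
  rewrite mulrC ltr_pdivrMr// mulrC -ltr_pdivrMr//.
  apply: lt_trans (_ : (Num.bound (3 / e))%:R < _); last by rewrite ltr_nat.
  by apply: archi_boundP; rewrite divr_ge0// ltW.
have k0 : 0 < (k.+1%:R : R)^-1 by rewrite invr_gt0.
set r : R := k.+1%:R^-1 in hk k0.
have hq i : exists q : rat, ratr q \in `](x ord0 i - r), (x ord0 i + r)[.
  by apply: rat_in_itvoo; lra.
pose q i := projT1 (cid (hq i)).
have qP i : x ord0 i - r < ratr (q i) < x ord0 i + r.
  by have := projT2 (cid (hq i)); rewrite in_itv.
exists (\row_i q i, k); split.
  by move=> i; rewrite /rat_lo /rat_hi/= mxE -/r; have /andP[? ?] := qP i; apply/andP; split; lra.
move=> y hy; apply: he; suff : @mx_ball 1 n R R x e y by []; split => // i j.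
rewrite [i]ord1; have := hy j; rewrite /rat_lo /rat_hi/= mxE -/r => /andP[y1 y2].
have /andP[q1 q2] := qP j.
by rewrite /ball/= ltr_norml; apply/andP; split; lra.
Qed.

Lemma open_rat_boxes (U : set V) : open U ->
  U = \bigcup_(q in [set q | cbox (rat_lo q) (rat_hi q) `<=` U]) obox (rat_lo q) (rat_hi q).
Proof.
move=> oU; apply/seteqP; split => [x Ux|x [q /= qU qx]].
  have [q [qx qU]] := nbhs_rat_box (open_nbhs_nbhs (conj oU Ux)).
  by exists q.
by apply: qU => i; have /andP[? ?] := qx i; rewrite !ltW.
Qed.

(** The sigma-algebra is generated by the coordinates and not by the topology; the link is the
    countable union of rational boxes. *)
Lemma open_measurable_rV (U : set V) : open U -> measurable U.
Proof.
move=> /open_rat_boxes ->; rewrite bigcup_mkcond.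
apply: countable_bigcupT_measurable; first exact: countableP.
by move=> q; case: ifP => // _; exact: measurable_obox.
Qed.

Lemma continuous_measurable_rV (U : set V) (f : V -> R) : open U ->
  (forall x, U x -> {for x, continuous f}) -> measurable_fun U f.
Proof.
move=> oU cf mU; apply: (measurability _ (@measurable_realfun.RGenOInfty.measurableE R)) => //.
move=> _ [_ [a ->] <-]; apply: open_measurable_rV.
rewrite openE => x [Ux /=]; rewrite in_itv/= andbT => ax.
apply: filterI; first exact: open_nbhs_nbhs.
have na : nbhs (f x) [set y | a < y] by exact: open_nbhs_nbhs.
have fa : nbhs x (f @^-1` [set y | a < y]) := cf _ Ux _ na.
by apply: filterS fa => y /=; rewrite in_itv/= andbT.
Qed.

Lemma bounded_rV_cbox (U : set V) : bounded_set U ->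
  exists M, U `<=` cbox (fun _ => - M) (fun _ => M).
Proof.
case=> M [Mr hM]; exists (M + 1) => x Ux i.
have := hM (M + 1) ltac:(lra) _ Ux; rewrite /= -ler_norml => nx.
apply: le_trans nx; rewrite [leRHS]/Num.norm/= mx_normrE.
exact: (le_bigmax _ (fun ij : 'I_1 * 'I_n => `|x ij.1 ij.2|) (ord0, i)).
Qed.

End rV_topology.

(** * Slicing off the first coordinate *)

Section rV_cons_calculus.
Context {R : realType} {n : nat}.

Lemma rV_cons0 (t : R) (v : 'rV[R]_n) : rV_cons (t, v) ord0 ord0 = t.
Proof.
have -> : (ord0 : 'I_n.+1) = @lshift 1 n ord0 by exact/val_inj.
by apply: etrans (row_mxEl _ _ _ _) _; rewrite mxE eqxx mulr1n.
Qed.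

Lemma rV_consS (t : R) (v : 'rV[R]_n) (j : 'I_n) :
  rV_cons (t, v) ord0 (@rshift 1 n j) = v ord0 j.
Proof. exact: row_mxEr. Qed.

Lemma rV_coord_cases (P : 'I_n.+1 -> Prop) :
  P ord0 -> (forall j : 'I_n, P (@rshift 1 n j)) -> forall i, P i.
Proof.
move=> P0 PS i; rewrite -[i](@splitK 1 n); case: (@fintype.split 1 n i) => j /=.
  by have -> : @lshift 1 n j = ord0 by apply/val_inj; rewrite /= [j]ord1.
exact: PS.
Qed.

Lemma rV_consD0 (t h : R) (v : 'rV[R]_n) :
  rV_cons (h + t : R, v) = h *: @basis_vec R n.+1 ord0 + rV_cons (t, v).
Proof.
apply/rowP; apply: rV_coord_cases => [|j]; rewrite [RHS]mxE ?rV_cons0 ?rV_consS !mxE.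
  by rewrite eqxx mulr1.
by rewrite /= mulr0 add0r.
Qed.

Lemma rV_consDS (t h : R) (v : 'rV[R]_n) (j : 'I_n) :
  rV_cons (t, h *: basis_vec j + v) = h *: basis_vec (@rshift 1 n j) + rV_cons (t, v).
Proof.
apply/rowP; apply: rV_coord_cases => [|k]; rewrite [RHS]mxE ?rV_cons0 ?rV_consS !mxE.
  by rewrite /= mulr0 add0r.
by congr (_ * (_ == _)%:R + _).
Qed.

Lemma continuous_rV_consr (f : 'rV[R]_n.+1 -> R) (t : R) (v : 'rV[R]_n) :
  {for rV_cons (t, v), continuous f} -> {for v, continuous (fun v => f (rV_cons (t, v)))}.
Proof.
move=> cf U Uf; have := cf U Uf; rewrite !nbhs_simpl/= => /nbhs_ballP[e e0 he].
apply/nbhs_ballP; exists e => // w vw; apply: he.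
suff : @mx_ball 1 n.+1 R R (rV_cons (t, v)) e (rV_cons (t, w)) by [].
have [_ vw'] : @mx_ball 1 n R R v e w := vw.
split => // i j; rewrite [i]ord1; move: j; apply: rV_coord_cases => [|j].
  by rewrite !rV_cons0; exact: ballxx.
by rewrite !rV_consS; exact: vw'.
Qed.

Lemma continuous_rV_consl (f : 'rV[R]_n.+1 -> R) (t : R) (v : 'rV[R]_n) :
  {for rV_cons (t, v), continuous f} -> {for t, continuous (fun t : R => f (rV_cons (t, v)))}.
Proof.
move=> cf U Uf; have := cf U Uf; rewrite !nbhs_simpl/= => /nbhs_ballP[e e0 he].
apply/nbhs_ballP; exists e => // w vw; apply: he.
suff : @mx_ball 1 n.+1 R R (rV_cons (t, v)) e (rV_cons (w, v)) by [].
split => // i j; rewrite [i]ord1; move: j; apply: rV_coord_cases => [|j].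
  by rewrite !rV_cons0.
by rewrite !rV_consS; exact: ballxx.
Qed.

Lemma partial_rV_consr (f : 'rV[R]_n.+1 -> R) (t : R) (v : 'rV[R]_n) (j : 'I_n) :
  let g := fun v => f (rV_cons (t, v)) in
  (derivable g v (basis_vec j) <->
     derivable f (rV_cons (t, v)) (basis_vec (@rshift 1 n j))) /\
  partial j g v = partial (@rshift 1 n j) f (rV_cons (t, v)).
Proof.
move=> g; rewrite /partial /derivable /derive.
suff -> : (fun h : R => h^-1 *: ((g \o shift v) (h *: basis_vec j) - g v))
  = (fun h : R => h^-1 *: ((f \o shift (rV_cons (t, v))) (h *: basis_vec (@rshift 1 n j)) - f
    (rV_cons (t, v)))) by [].
by apply/funext => h; rewrite /g /= rV_consDS.
Qed.

Lemma partial_rV_consl (f : 'rV[R]_n.+1 -> R) (t : R) (v : 'rV[R]_n) :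
  let g := fun t : R => f (rV_cons (t, v)) in
  (derivable g t 1 <-> derivable f (rV_cons (t, v)) (basis_vec ord0)) /\
  derive1 g t = partial ord0 f (rV_cons (t, v)).
Proof.
move=> g; rewrite derive1E /partial /derivable /derive.
suff -> : (fun h : R => h^-1 *: ((g \o shift t) (h *: 1) - g t))
  = (fun h : R => h^-1 *: ((f \o shift (rV_cons (t, v))) (h *: basis_vec ord0) - f (rV_cons (t,
    v)))) by [].
by apply/funext => h; rewrite /g /= -rV_consD0 [h *: 1]mulr1.
Qed.

End rV_cons_calculus.

Lemma lebesgue_rV_cbox_fin (R : realType) (n : nat) (M : R) :
  (lebesgue_rV n (cbox (fun _ : 'I_n => - M)%R (fun _ => M)) < +oo)%E.
Proof.
elim: n => [|n ih].
  by rewrite /= diracE; exact: ltry.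
rewrite /= /lebesgue_step /pushforward.
have -> : @rV_cons R n @^-1` cbox (fun _ : 'I_n.+1 => - M) (fun _ => M)
    = `[- M, M]%classic `*` cbox (fun _ : 'I_n => - M) (fun _ => M).
  apply/seteqP; split => -[t v] /=.
    move=> h; split => /=; first by have := h ord0; rewrite rV_cons0 in_itv.
    by move=> j; have := h (@rshift 1 n j); rewrite rV_consS.
  rewrite in_itv/= => -[ht hv]; apply: rV_coord_cases => [|j].
    by rewrite rV_cons0.
  by rewrite rV_consS.
rewrite product_measure1E; [|exact: measurable_itv|exact: measurable_cbox].
apply: lte_mul_pinfty => //; rewrite ?ge0_fin_numE//.
by rewrite /= lebesgue_measure_itv/=; case: ifP => _; rewrite ltry.
Qed.

Lemma bounded_lebesgue_rV_fin (R : realType) (n : nat) (U : set 'rV[R]_n) :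
  measurable U -> bounded_set U -> (lebesgue_rV n U < +oo)%E.
Proof.
move=> mU /bounded_rV_cbox[M UM]; apply: le_lt_trans (lebesgue_rV_cbox_fin n M).
by apply: le_measure => //; rewrite inE//; exact: measurable_cbox.
Qed.

Lemma integrable_image {R : realType} {d1 d2 : measure_display}
    {X : measurableType d1} {Y : measurableType d2} (phi : X -> Y)
    (m1 : {measure set X -> \bar R}) (m2 : {measure set Y -> \bar R}) (f : Y -> \bar R) :
  measurable_fun setT phi -> m2 = pushforward m1 phi :> (set Y -> \bar R) ->
  m2.-integrable setT f ->
  m1.-integrable setT (f \o phi) /\
  (\int[m2]_y f y = \int[m1]_x f (phi x))%E.
Proof.
move=> mphi m2E intf; have mf := measurable_int _ intf.
have int' : m1.-integrable setT (f \o phi).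
  apply/integrableP; split; first exact: measurableT_comp.
  move/integrableP : intf => [_]; apply: le_lt_trans.
  rewrite m2E [leRHS](@ge0_integral_pushforward _ _ _ _ _ _ mphi)//.
  exact: measurableT_comp.
by split => //; rewrite m2E [LHS](@integral_pushforward _ _ _ _ _ _ mphi) ?preimage_setT.
Qed.

Lemma integral_rV_cons (R : realType) (n : nat) (f : 'rV[R]_n.+1 -> \bar R) :
  (lebesgue_rV n.+1).-integrable setT f ->
  ((lebesgue_measure \x lebesgue_rV n)%E).-integrable setT (f \o @rV_cons R n) /\
  (\int[lebesgue_rV n.+1]_x f x
    = \int[(lebesgue_measure \x lebesgue_rV n)%E]_z f (rV_cons z))%E.
Proof. by move=> intf; apply: (integrable_image (@measurable_rV_cons R n)). Qed.

Section rV_partial_integral.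
Context {R : realType}.

(** A coordinatewise substitute for compact support, inherited by slices and by partial
    derivatives. *)
Definition zero_outside {n : nat} (M : R) (f : 'rV[R]_n -> R) :=
  forall (x : 'rV[R]_n) i, M < `|x ord0 i| -> f x = 0.

Lemma zero_outside_partial {n : nat} (M : R) (f : 'rV[R]_n -> R) i :
  zero_outside M f -> zero_outside M (partial i f).
Proof.
move=> fM x j xj; rewrite /partial.
rewrite -[RHS](derive_cst (0 : R^o) x (basis_vec i)).
apply: near_eq_derive; apply/nbhs_ballP.
exists (`|x ord0 j| - M); first by rewrite /= subr_gt0.
move=> y xy /=; apply: (fM _ j).
have [_ /(_ ord0 j) h] : @mx_ball 1 n R R x (`|x ord0 j| - M) y := xy.
have := ler_normD (x ord0 j - y ord0 j) (y ord0 j); rewrite subrK.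
by move: h; rewrite /ball/=; lra.
Qed.

Lemma zero_outside_bounded {n : nat} (M : R) (f : 'rV[R]_n -> R) :
  continuous f -> zero_outside M f -> exists B, forall x, `|f x| <= B.
Proof.
move=> cf fM; pose K := [set x : 'rV[R]_n | forall i, `|x ord0 i| <= M].
have bK : bounded_set K.
  exists (`|M|); split => // x Mx y Ky /=.
  rewrite [leLHS]/Num.norm/= mx_normrE; apply: bigmax_le.
    by apply: le_trans (ltW Mx).
  move=> [i j] _ /=; rewrite [i]ord1; apply: le_trans (Ky j) _.
  by apply: le_trans (ler_norm M) (ltW Mx).
have clK : closed K.
  rewrite (_ : K = \bigcap_(i in setT) [set x : 'rV[R]_n | `|x ord0 i| <= M]); last first.
    by apply/seteqP; split => x /= h i => [_|]; exact: h.
  apply: closed_bigI => i _.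
  rewrite (_ : [set _ | _] = (fun x : 'rV[R]_n => `|x ord0 i|) @^-1` [set y | y <= M])//.
  apply: closed_comp => [x _|]; last exact: closed_le.
  apply: continuous_comp; last exact: norm_continuous.
  exact: coord_continuous.
have cptK := bounded_closed_compact bK clK.
have [B [Br hB]] : bounded_set (f @` K).
  apply: compact_bounded; apply: continuous_compact => //.
  exact: continuous_subspaceT.
exists (Num.max 0 (B + 1)) => x.
have [Kx|nKx] := pselect (K x).
  rewrite le_max; apply/orP; right; apply: (hB (B + 1)); first lra.
  by exists x.
have [i xi] : exists i, M < `|x ord0 i|.
  by move/existsNP : nKx => [i /negP]; rewrite -ltNge => ?; exists i.
by rewrite (fM _ _ xi) normr0 le_max lexx.
Qed.

Lemma zero_outside_integrable {n : nat} (M : R) (f : 'rV[R]_n -> R) :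
  continuous f -> zero_outside M f -> (lebesgue_rV n).-integrable setT (EFin \o f).
Proof.
move=> cf fM; have [B hB] := zero_outside_bounded cf fM.
have mf : measurable_fun setT f.
  by apply: continuous_measurable_rV; [exact: openT|move=> x _; exact: cf].
set K : set 'rV[R]_n := cbox (fun _ => - M) (fun _ => M).
have mK : measurable K by exact: measurable_cbox.
have -> : EFin \o f = (EFin \o f) \_ K.
  apply/funext => x; rewrite patchE; case: ifPn => //; rewrite notin_setE => nKx.
  have [i xi] : exists i, M < `|x ord0 i|.
    by move/existsNP : nKx => [i /negP]; rewrite -ler_norml -ltNge => ?; exists i.
  by rewrite /= (fM _ _ xi).
apply/(integrable_mkcond _ mK).
apply: measurable_bounded_integrable => //; first exact: lebesgue_rV_cbox_fin.
  exact: measurable_funS mf.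
exists B; split; first exact: num_real.
move=> y By x _ /=; exact: le_trans (hB x) (ltW By).
Qed.

Lemma integral_derive1_0 (M : R) (f df : R -> R) : 0 < M ->
  (forall t, derivable f t 1 /\ derive1 f t = df t) -> continuous df ->
  (forall t, M <= `|t| -> f t = 0) -> (forall t, M < `|t| -> df t = 0) ->
  (\int[lebesgue_measure]_t (df t)%:E = 0)%E.
Proof.
move=> M0 fd cdf f0 df0.
rewrite (_ : (fun t => (df t)%:E) = (EFin \o df) \_ (`[- M, M]%classic)); last first.
  apply/funext => t; rewrite patchE; case: ifPn => //; rewrite notin_setE/= in_itv/=.
  by move=> /negP; rewrite -ler_norml -ltNge => /df0 ->.
rewrite -integral_mkcond.
have MM : - M < M by lra.
have cf t : {for t, continuous f}.
  by apply: differentiable_continuous; apply/derivable1_diffP; exact: (fd t).1.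
rewrite (@continuous_FTC2 R df f (- M) M MM).
- by rewrite !f0 ?normrN ?(gtr0_norm M0)// -EFinB subrr.
- exact: continuous_subspaceT.
- split; [by move=> t _; exact: (fd t).1|..].
    by apply: cvg_at_right_filter; exact: cf.
  by apply: cvg_at_left_filter; exact: cf.
- by move=> t _; exact: (fd t).2.
Qed.

(** By Fubini. In the direction of the first coordinate the inner integral is that of the derivative
    of a compactly supported function; in any other direction the slices satisfy the induction
    hypothesis. *)
Lemma integral_partial0 {n : nat} (M : R) (f : 'rV[R]_n -> R) (i : 'I_n) : 0 < M ->
  (forall x, derivable f x (basis_vec i)) -> continuous f -> continuous (partial i f) ->
  zero_outside M f -> (\int[lebesgue_rV n]_x (partial i f x)%:E = 0)%E.
Proof.
move=> M0; elim: n f i => [f [] //|n ih f i fd cf cpf fM].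
have pM : zero_outside M (partial i f) by exact: zero_outside_partial.
have pint := zero_outside_integrable cpf pM.
have [pint' ->] := integral_rV_cons pint.
have inner0 (t : R) (v : 'rV[R]_n) k : M < `|v ord0 k| -> f (rV_cons (t, v)) = 0.
  by move=> h; apply: (fM _ (@rshift 1 n k)); rewrite rV_consS.
move: i fd cpf pM pint pint'; apply: rV_coord_cases => [|j] fd cpf pM pint pint'.
  rewrite -(integral21_prod_meas1 pint') /fubini_G /=.
  apply: integral0_eq => v _.
  pose g (t : R) := f (rV_cons (t, v)).
  pose dg (t : R) := partial ord0 f (rV_cons (t, v)).
  (* [zero_outside] says nothing about coordinates of absolute value exactly [M], hence the larger
     bound. *)
  apply: (@integral_derive1_0 (M + 1) g dg).
  - lra.
  - move=> t; have [h1 h2] := partial_rV_consl f t v.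
    by split; [exact/h1/fd|exact: h2].
  - by move=> t; apply: (continuous_rV_consl (f := partial ord0 f)); exact: cpf.
  - by move=> t ht; apply: (fM _ ord0); rewrite rV_cons0; lra.
  - by move=> t ht; apply: (pM _ ord0); rewrite rV_cons0; lra.
rewrite -(integral12_prod_meas1 pint') /fubini_F /=.
apply: integral0_eq => t _.
rewrite -(ih (fun v => f (rV_cons (t, v))) j).
- by apply: eq_integral => v _; have [_ ->] := partial_rV_consr f t v j.
- by move=> v; have [h1 _] := partial_rV_consr f t v j; apply/h1/fd.
- by move=> v; apply: continuous_rV_consr; exact: cf.
- rewrite (_ : partial j _ = (fun v => partial (@rshift 1 n j) f (rV_cons (t, v)))).
    by move=> v; apply: (continuous_rV_consr (f := partial (@rshift 1 n j) f)); exact: cpf.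
  by apply/funext => v; have [_ ->] := partial_rV_consr f t v j.
- by move=> v k; exact: inner0.
Qed.

End rV_partial_integral.

(** * The fundamental lemma of the calculus of variations *)

Section bump.
Context {R : realType}.
Implicit Types (a b C x t : R) (p : {poly R}) (k : nat).

Definition bump_arg a b x := ((x - a) * (b - x))^-1.

(** The factors p and y^k make the family closed under differentiation, where y is [bump_arg a b x].
    For p = 1 and k = 0 it is exp(-C y), which tends to the indicator of the open interval as C
    tends to 0. *)
Definition bump a b C p k x :=
  if (a < x) && (x < b) then p.[x] * bump_arg a b x ^+ k * expR (- (C * bump_arg a b x)) else 0.

Definition bump_poly a b : {poly R} := ('X - a%:P) * (b%:P - 'X).

(* The derivative of y = 1/((x-a)(b-x)) is - l y^2 with l = a + b - 2x, so that
   (p y^k e^{-Cy})' = (p' z^2 - k p l z + C p l) y^{k+2} e^{-Cy} with z = 1/y. *)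
Definition bump_deriv a b C p k : {poly R} :=
  let z := bump_poly a b in let l := (a + b)%:P - 2%:P * 'X in
  p^`() * z ^+ 2 - k%:R%:P * p * l * z + C%:P * p * l.

Lemma bump_poly_horner a b x : (bump_poly a b).[x] = (x - a) * (b - x).
Proof. by rewrite /bump_poly !hornerE. Qed.

Lemma bump_deriv_horner a b C p k x : (bump_deriv a b C p k).[x] =
  p^`().[x] * ((x - a) * (b - x)) ^+ 2
  - k%:R * p.[x] * (a + b - 2 * x) * ((x - a) * (b - x)) + C * p.[x] * (a + b - 2 * x).
Proof.
by rewrite /bump_deriv !(hornerD, hornerN, hornerM, hornerC, hornerX, horner_exp,
  bump_poly_horner).
Qed.

Lemma is_derive_bump_inside a b C p k x : a < x -> x < b ->
  is_derive x 1 (fun x => p.[x] * bump_arg a b x ^+ k * expR (- (C * bump_arg a b x)))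
    ((bump_deriv a b C p k).[x] * bump_arg a b x ^+ k.+2 * expR (- (C * bump_arg a b x))).
Proof.
move=> ax xb; have z0 : (bump_poly a b).[x] != 0.
  by rewrite bump_poly_horner mulf_neq0// subr_eq0 gt_eqF.
have hy : is_derive x 1 (bump_arg a b) (- (bump_poly a b).[x] ^- 2 *: (bump_poly a b)^`().[x]).
  rewrite (_ : bump_arg a b = (fun x => ((bump_poly a b).[x])^-1)); last first.
    by apply/funext => t; rewrite bump_poly_horner.
  by apply: is_deriveV => //; exact: is_derive_poly.
have hyk := is_deriveX k hy.
have hCy : is_derive x 1 (fun x => - (C * bump_arg a b x)) (- (C *: (- (bump_poly a b).[x] ^- 2
  *: (bump_poly a b)^`().[x]))).
  by apply: is_deriveN; apply: is_deriveZ.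
have he := is_derive1_comp (is_derive_expR _) hCy.
have := is_deriveM (is_deriveM (is_derive_poly p x) hyk) he.
rewrite /=; set F := (_ * _ * _ : R -> R).
have -> : F = (fun x => p.[x] * bump_arg a b x ^+ k * expR (- (C * bump_arg a b x))).
  by apply/funext => t; rewrite /F !fctE.
move=> hF; apply: is_derive_eq hF _.
have scE (v w : R) : (v : R^o) *: (w : R^o) = v * w by [].
rewrite !scE !fctE.
have -> : bump_arg a b x = ((bump_poly a b).[x])^-1 by rewrite bump_poly_horner.
set e := expR _.
have -> : (bump_poly a b)^`().[x] = a + b - 2 * x.
  by rewrite /bump_poly derivM !(derivB, derivC, derivX) !hornerE; ring.
rewrite bump_deriv_horner bump_poly_horner; rewrite bump_poly_horner in z0.
move: z0; rewrite mulf_eq0 negb_or => /andP[xa bx].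
case: k {hyk F} => [|k]; first by rewrite !expr0; clearbody e; field; rewrite xa bx.
change k.+1.-1 with k.
set y := ((x - a) * (b - x))^-1.
rewrite (exprS y k.+2) (exprS y k.+1) (exprS y k) -natr1.
set w := y ^+ k; clearbody w e; rewrite /y.
by field; rewrite xa bx.
Qed.

(** The exponential beats the power: y^k exp(-C y) is at most K y^(-2), and y^(-2) is (t - a)^2 (b -
    t)^2. Quadratic decay at both ends yields the derivative 0 there. *)
Lemma bump_quadratic_bound a b C p k : a < b -> 0 < C ->
  exists M, forall t, `|bump a b C p k t| <= M * (t - a) ^+ 2 /\
    `|bump a b C p k t| <= M * (b - t) ^+ 2.
Proof.
move=> ab C0.
have [B hB] : exists B, forall t, a <= t <= b -> `|p.[t]| <= B.
  have [|c _ hc] := @EVT_max R (fun t => `|p.[t]|) a b (ltW ab).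
    apply: continuous_subspaceT => t; apply: continuous_comp; last exact: norm_continuous.
    exact: continuous_horner.
  by exists `|p.[c]| => t tab; apply: hc; rewrite in_itv.
(* The constant comes from the term of order k + 2 in the exponential series. *)
pose K := (k.+2)`!%:R / C ^+ k.+2 : R.
have K0 : 0 < K by rewrite divr_gt0 ?exprn_gt0// ltr0n fact_gt0.
have hy y : 0 < y -> y ^+ k * expR (- (C * y)) <= K * y^-1 ^+ 2.
  move=> y0; have Cy : 0 < C * y by rewrite mulr_gt0.
  rewrite expRN; have h := @expR_ge1Dxn R (C * y) k.+1 (ltW Cy).
  have f0 : 0 < (k.+2)`!%:R :> R by rewrite ltr0n fact_gt0.
  have h2 : (C * y) ^+ k.+2 / (k.+2)`!%:R <= expR (C * y) by lra.
  rewrite ler_pdivrMr ?expR_gt0//; apply: le_trans (ler_wpM2l _ h2); last first.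
    by rewrite mulr_ge0 ?(ltW K0)// exprn_ge0// invr_ge0 ltW.
  rewrite /K exprMn exprVn !exprS le_eqVlt; apply/orP; left; apply/eqP; field.
  by rewrite !gt_eqF ?exprn_gt0.
exists (`|B| * (K * (b - a) ^+ 2)) => t; rewrite /bump; case: ifPn => [/andP[at_ tb]|_];
  last first.
  have KK : 0 <= `|B| * (K * (b - a) ^+ 2).
    by rewrite mulr_ge0// mulr_ge0 ?sqr_ge0// ltW.
  by rewrite normr0; split; rewrite mulr_ge0 ?sqr_ge0.
have y0 : 0 < bump_arg a b t by rewrite invr_gt0 mulr_gt0// subr_gt0.
have := hy _ y0; rewrite /bump_arg invrK exprMn => h.
have hp : `|p.[t]| <= `|B| by apply: le_trans (hB _ _) (ler_norm _); rewrite !ltW.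
have e1 : `|p.[t] * bump_arg a b t ^+ k * expR (- (C * bump_arg a b t))|
    <= `|B| * (K * ((t - a) ^+ 2 * (b - t) ^+ 2)).
  rewrite -mulrA normrM; apply: ler_pM => //.
  by rewrite ger0_norm// mulr_ge0 ?expR_ge0// exprn_ge0// ltW.
have q1 : (t - a) ^+ 2 <= (b - a) ^+ 2 by rewrite lerXn2r ?nnegrE//; lra.
have q2 : (b - t) ^+ 2 <= (b - a) ^+ 2 by rewrite lerXn2r ?nnegrE//; lra.
split; apply: le_trans e1 _; rewrite -(mulrA `|B|) ler_wpM2l// -(mulrA K) ler_wpM2l ?(ltW K0)//.
  by rewrite mulrC ler_wpM2r ?sqr_ge0.
by rewrite ler_wpM2r ?sqr_ge0.
Qed.

Lemma is_derive_quadratic_bound (g : R -> R) x M :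
  (forall t, `|g t| <= M * (t - x) ^+ 2) -> is_derive x 1 g 0.
Proof.
move=> hg; have gx : g x = 0.
  by apply/eqP; rewrite -normr_le0; have := hg x; rewrite subrr expr0n mulr0.
have lim : (fun h : R => h^-1 *: ((g \o shift x) (h *: 1) - g x)) @ 0^' --> (0 : R).
  apply/cvgrPdist_le => e e0; rewrite near_withinE; apply/nbhs_ballP.
  exists (e / (1 + `|M|)); first by rewrite /= divr_gt0// ltr_wpDr.
  move=> h /=; rewrite /ball/= !sub0r !normrN => hh h0.
  rewrite gx subr0 /GRing.scale/= mulr1 normrM normfV.
  rewrite mulrC ler_pdivrMr ?normr_gt0//; apply: le_trans (hg _) _.
  rewrite addrK; apply: le_trans (_ : (1 + `|M|) * `|h| * `|h| <= _).
    rewrite -mulrA -expr2 real_normK ?num_real// ler_wpM2r ?sqr_ge0//.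
    by have := ler_norm M; lra.
  rewrite ler_wpM2r//; move: hh; rewrite ltr_pdivlMr; last by rewrite ltr_wpDr.
  by move=> /ltW; rewrite mulrC.
by apply: DeriveDef; [apply/cvg_ex; exists 0|exact: cvg_lim].
Qed.

Lemma is_derive_bump a b C p k x : a < b -> 0 < C ->
  is_derive x 1 (bump a b C p k) (bump a b C (bump_deriv a b C p k) k.+2 x).
Proof.
move=> ab C0; have [M hM] := bump_quadratic_bound p k ab C0.
have M0 : 0 <= M.
  have [h _] := hM b; have := le_trans (normr_ge0 _) h.
  by rewrite pmulr_lge0// exprn_gt0// subr_gt0.
have [xa|ax] := leP x a.
  rewrite {2}/bump ltNge xa/=; apply: (@is_derive_quadratic_bound _ _ M) => t.
  have [ta|ta] := leP t a.
    by rewrite /bump ltNge ta/= normr0 mulr_ge0// sqr_ge0.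
  by apply: le_trans (hM t).1 _; rewrite ler_wpM2l// lerXn2r ?nnegrE//; lra.
have [bx|xb] := leP b x.
  rewrite {2}/bump [x < b]ltNge bx/= andbF; apply: (@is_derive_quadratic_bound _ _ M) => t.
  have [ta|ta] := leP b t.
    by rewrite /bump [t < b]ltNge ta/= andbF normr0 mulr_ge0// sqr_ge0.
  apply: le_trans (hM t).2 _; rewrite ler_wpM2l// -[leRHS]sqrrN opprB lerXn2r ?nnegrE//; lra.
rewrite {2}/bump ax xb/=.
have [d1 d2] := is_derive_bump_inside C p k ax xb.
set G := (fun x => _) in d1 d2.
have near_G : \forall t \near x, G t = bump a b C p k t.
  have : \forall t \near x, t \in `]a, b[ by apply: near_in_itvoo; rewrite in_itv/= ax.
  by apply: filterS => t; rewrite in_itv/= /bump => ->.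
apply: DeriveDef; first exact: near_eq_derivable d1.
by rewrite -d2; apply/esym; exact: near_eq_derive.
Qed.

Lemma bump_ge0_le1 a b C x : 0 < C -> 0 <= bump a b C 1 0 x <= 1.
Proof.
move=> C0; rewrite /bump; case: ifPn => [/andP[ax xb]|_]; last by rewrite lexx ler01.
rewrite hornerC expr0 !mul1r expR_ge0/= expR_le1 oppr_le0 mulr_ge0 ?(ltW C0)//.
by rewrite invr_ge0 mulr_ge0// subr_ge0 ltW.
Qed.

Lemma bump_cvg a b x : bump a b (harmonic m) 1 0 x @[m --> \oo] -->
  (if (a < x) && (x < b) then 1 else 0 : R).
Proof.
rewrite /bump; case: ifPn => _; last exact: cvg_cst.
have h : - (harmonic m * bump_arg a b x) @[m --> \oo] --> (0 : R).
  rewrite -[X in _ --> X]oppr0; apply: cvgN.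
  rewrite -[X in _ --> X](mul0r (bump_arg a b x)); apply: cvgM; last exact: cvg_cst.
  exact: cvg_harmonic.
have := cvg_comp _ _ h (@continuous_expR R 0); rewrite expR0.
suff <- : (fun m => (1 : {poly R}).[x] * bump_arg a b x ^+ 0 * expR (- (harmonic m * bump_arg a b
  x)))
  = expR \o (fun m => - (harmonic m * bump_arg a b x)) by [].
by apply/funext => m; rewrite /= hornerC expr0 !mul1r.
Qed.

End bump.

Section product_bump.
Context {R : realType} {n : nat}.
Local Notation V := 'rV[R]_n.
Variables (a b : 'I_n -> R) (C : R).

(** One polynomial and one exponent per coordinate. A partial derivative changes the data of a
    single factor, so all iterated partial derivatives have the same form. *)
Definition pbump (q : 'I_n -> {poly R} * nat) (x : V) : R :=
  \prod_(i < n) bump (a i) (b i) C (q i).1 (q i).2 (x ord0 i).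

Definition pbump_partial (j : 'I_n) (q : 'I_n -> {poly R} * nat) : 'I_n -> {poly R} * nat :=
  fun i => if i == j then (bump_deriv (a i) (b i) C (q i).1 (q i).2, (q i).2.+2) else q i.

Lemma pbump_quotient q j x (h : R) :
  h^-1 *: ((pbump q \o shift x) (h *: basis_vec j) - pbump q x) =
  (\prod_(i < n | i != j) bump (a i) (b i) C (q i).1 (q i).2 (x ord0 i)) *
  (h^-1 *: ((bump (a j) (b j) C (q j).1 (q j).2 \o shift (x ord0 j)) (h *: 1)
     - bump (a j) (b j) C (q j).1 (q j).2 (x ord0 j))).
Proof.
rewrite /pbump /= (bigD1 j)//= [X in _ - X](bigD1 j)//=.
rewrite !mxE !eqxx mulr1.
have -> : \prod_(i < n | i != j)
    bump (a i) (b i) C (q i).1 (q i).2 ((h *: basis_vec j + x : V) ord0 i)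
  = \prod_(i < n | i != j) bump (a i) (b i) C (q i).1 (q i).2 (x ord0 i).
  by apply: eq_bigr => i /negbTE ij; rewrite !mxE ij andbF mulr0 add0r.
by rewrite /GRing.scale/= mulr1; ring.
Qed.

Hypotheses (ab : forall i, a i < b i) (C0 : 0 < C).

Lemma is_derive_pbump q j x :
  is_derive x (basis_vec j) (pbump q) (pbump (pbump_partial j q) x).
Proof.
have [] := is_derive_bump (q j).1 (q j).2 (x ord0 j) (ab j) C0.
set g := bump _ _ _ _ _; set P := \prod_(i < n | i != j) bump (a i) (b i) C (q i).1 (q i).2 (x
  ord0 i).
move=> /cvg_ex[/= l hl] hd.
have lE : l = bump (a j) (b j) C (bump_deriv (a j) (b j) C (q j).1 (q j).2) (q j).2.+2 (x ord0 j).
  by rewrite -hd; apply/esym/cvg_lim.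
have E : pbump (pbump_partial j q) x = P * l.
  rewrite lE /pbump (bigD1 j)//= mulrC; congr (_ * _).
    by apply: eq_bigr => i /negbTE ij; rewrite /pbump_partial ij.
  by rewrite /pbump_partial eqxx.
have lim : h^-1 *: ((pbump q \o shift x) (h *: basis_vec j) - pbump q x) @[h --> 0^'] --> P * l.
  rewrite (_ : (fun h : R => _) = (fun h : R => P
    * (h^-1 *: ((g \o shift (x ord0 j)) (h *: 1) - g (x ord0 j))))); last first.
    by apply/funext => h; exact: pbump_quotient.
  by apply: cvgM hl; exact: cvg_cst.
by rewrite E; apply: DeriveDef; [apply/cvg_ex; exists (P * l)|exact: cvg_lim].
Qed.

Lemma partial_pbump q j : partial j (pbump q) = pbump (pbump_partial j q).
Proof. by apply/funext => x; rewrite /partial; have [_ ->] := is_derive_pbump q j x. Qed.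

Lemma continuous_pbump q : continuous (pbump q).
Proof.
move=> x; rewrite /pbump.
suff : forall s : seq 'I_n, {for x, continuous (fun x :
  V => \prod_(i <- s) bump (a i) (b i) C (q i).1 (q i).2 (x ord0 i))}.
  exact.
elim=> [|i s ih].
  rewrite (_ : (fun _ => _) = cst 1); last by apply/funext => y; rewrite big_nil.
  exact: cst_continuous.
rewrite (_ : (fun _ => _) = (fun x : V => bump (a i) (b i) C (q i).1 (q i).2 (x ord0 i)) *
   (fun x : V => \prod_(i <- s) bump (a i) (b i) C (q i).1 (q i).2 (x ord0 i))); last first.
  by apply/funext => y; rewrite big_cons.
apply: continuousM => //.
apply: (@continuous_comp _ _ _ (fun x : V => x ord0 i) (bump (a i) (b i) C (q i).1 (q i).2)).
  exact: coord_continuous.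
apply: differentiable_continuous; apply/derivable1_diffP.
by have [] := is_derive_bump (q i).1 (q i).2 (x ord0 i) (ab i) C0.
Qed.

Lemma smooth_pbump q : smooth_on setT (pbump q).
Proof.
move=> s x _; have [q' ->] : exists q', foldr partial (pbump q) s = pbump q'.
  elim: s => [|j s [q' ih]]; first by exists q.
  by exists (pbump_partial j q'); rewrite /= ih partial_pbump.
split; last exact: continuous_pbump.
by move=> i; have [] := is_derive_pbump q' i x.
Qed.

End product_bump.

Lemma real_dominated_convergence {d : measure_display} {T : measurableType d} {R : realType}
    (mu : {measure set T -> \bar R}) (D : set T) (f_ : nat -> T -> R) (f g : T -> R) :
  measurable D -> (forall m, measurable_fun D (f_ m)) -> measurable_fun D f ->
  (forall x, D x -> f_ m x @[m --> \oo] --> f x) ->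
  mu.-integrable D (EFin \o g) -> (forall m x, D x -> `|f_ m x| <= g x) ->
  mu.-integrable D (EFin \o f) /\
  (\int[mu]_(x in D) (f_ m x)%:E)%E @[m --> \oo] --> (\int[mu]_(x in D) (f x)%:E)%E.
Proof.
move=> mD mf_ mf cf ig fg.
have [||||h1 _ h3] := @dominated_convergence _ _ _ mu _ mD (fun m => EFin \o f_ m) (EFin \o f)
  (EFin \o g) _ _ _ ig.
- by move=> m; apply/measurable_EFinP.
- by apply/measurable_EFinP.
- by apply: aeW => x Dx; apply: cvg_EFin; [exact: nearW|exact: cf].
- by apply: aeW => x m Dx /=; rewrite lee_fin fg.
- by split.
Qed.

Section fundamental_lemma.
Context {R : realType} {n : nat}.
Local Notation V := 'rV[R]_n.
Local Notation leb := (@lebesgue_rV R n).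

Lemma closed_cbox (a b : 'I_n -> R) : closed (cbox a b : set V).
Proof.
rewrite (_ : cbox a b = \bigcap_(i in setT) [set x : V | a i <= x ord0 i <= b i]); last first.
  by apply/seteqP; split => x /= h i => [_|]; exact: h.
apply: closed_bigI => i _.
rewrite (_ : [set _ | _] = (fun x : V => x ord0 i) @^-1` `[a i, b i]%classic); last first.
  by apply/seteqP; split => x /=; rewrite in_itv.
apply: closed_comp => [x _|]; last exact: itv_closed.
exact: coord_continuous.
Qed.

Lemma bounded_cbox (a b : 'I_n -> R) : bounded_set (cbox a b : set V).
Proof.
pose M := \sum_(i < n) (`|a i| + `|b i|).
exists M; split; first exact: num_real.
move=> y My x hx /=.
rewrite [leLHS]/Num.norm/= mx_normrE; apply: bigmax_le.
  by apply: le_trans (ltW My); rewrite sumr_ge0// => i _; rewrite addr_ge0.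
move=> [i j] _ /=; rewrite [i]ord1.
have /andP[h1 h2] := hx j.
apply: le_trans (ltW My); rewrite /M (bigD1 j)//=.
have s0 : 0 <= \sum_(i < n | i != j) (`|a i| + `|b i|) by rewrite sumr_ge0// => k _;
  rewrite addr_ge0.
have := ler_norm (b j); have := ler_norm (- a j); rewrite normrN; have := normr_ge0 (a j);
  have := normr_ge0 (b j).
by move: s0 h1 h2; rewrite ler_norml; clear; intros; apply/andP; split; lra.
Qed.

Lemma test_function_pbump (Omega : set V) (a b : 'I_n -> R) (C : R) :
  (forall i, a i < b i) -> 0 < C -> cbox a b `<=` Omega ->
  test_function Omega (pbump a b C (fun _ => (1, 0%N))).
Proof.
move=> ab C0 abO.
have sub : closure [set x | pbump a b C (fun=> (1, 0%N)) x != 0] `<=` cbox a b.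
  rewrite [X in _ `<=` X](closure_id _).1; last exact: closed_cbox.
  apply: closure_subset => x /= hx i.
  move: hx; rewrite /pbump (bigD1 i)//= mulf_eq0 negb_or => /andP[+ _].
  by rewrite /bump; case: ifPn => [/andP[h1 h2] _|_]; rewrite ?eqxx// !ltW.
split; first exact: smooth_pbump.
  apply: bounded_closed_compact; last exact: closed_closure.
  have [M [Mr hM]] := bounded_cbox a b.
  by exists M; split => // y My x /sub; exact: hM.
exact: subset_trans sub abO.
Qed.

Lemma pbump_cvg (a b : 'I_n -> R) (x : V) :
  pbump a b (harmonic m) (fun=> (1, 0%N)) x @[m --> \oo] --> (\1_(obox a b) x : R).
Proof.
rewrite /pbump.
have -> : \1_(obox a b) x = \prod_(i < n) (if (a i < x ord0 i)
  && (x ord0 i < b i) then 1 else 0) :> R.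
  rewrite indicE; case: (boolP (x \in _)); rewrite ?inE ?notin_setE => hx.
    by rewrite big1// => i _; rewrite hx.
  have [i /negP hi] : exists i, ~ (a i < x ord0 i < b i).
    by move/existsNP : hx => [i hi]; exists i.
  by rewrite (bigD1 i)//= (negbTE hi) mul0r.
elim: (index_enum _) => [|i s ih].
  rewrite big_nil; under eq_fun do rewrite big_nil.
  exact: cvg_cst.
rewrite big_cons; under eq_fun do rewrite big_cons.
by apply: cvgM => //; exact: bump_cvg.
Qed.

Lemma obox_empty (a b : 'I_n -> R) i : b i <= a i -> obox a b = set0 :> set V.
Proof.
move=> bai; apply/seteqP; split => // x /(_ i) /andP[h1 h2].
by have := lt_trans h1 h2; rewrite ltNge bai.
Qed.

(** The bumps live in the closed box, hence are test functions, and tend to the indicator of the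
    open box; [|g|] dominates since they take values in [0, 1]. *)
Lemma integral_obox_0 (Omega : set V) (g : V -> R) (a b : 'I_n -> R) :
  measurable Omega -> leb.-integrable Omega (EFin \o g) ->
  (forall phi, test_function Omega phi -> (\int[leb]_(x in Omega) (g x * phi x)%:E = 0)%E) ->
  cbox a b `<=` Omega -> (\int[leb]_(x in obox a b) (g x)%:E = 0)%E.
Proof.
move=> mO ig hg abO.
have [[i bai]|nab] := pselect (exists i, b i <= a i).
  by rewrite (obox_empty bai) integral_set0.
have ab i : a i < b i by rewrite ltNge; apply/negP => h; apply: nab; exists i.
have mg : measurable_fun Omega g by apply/measurable_EFinP; exact: measurable_int ig.
pose f_ m x := g x * pbump a b (harmonic m) (fun=> (1, 0%N)) x.
pose f x := g x * \1_(obox a b) x.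
have h0 m : 0 < (harmonic m : R) by exact: harmonic_gt0.
have mf_ m : measurable_fun Omega (f_ m).
  apply: measurable_funM => //.
  apply: measurable_funTS; apply: continuous_measurable_rV; first exact: openT.
  by move=> x _; exact: continuous_pbump.
have mf : measurable_fun Omega f.
  apply: measurable_funM => //.
  by apply: measurable_funTS; apply: measurable_indic; exact: measurable_obox.
have ag : leb.-integrable Omega (EFin \o (fun x => `|g x|)) by exact: integrable_norm.
have [||_ lim] := @real_dominated_convergence _ _ _ leb Omega f_ f _ mO mf_ mf _ ag.
- by move=> x _; apply: cvgM; [exact: cvg_cst|exact: pbump_cvg].
- move=> m x _; rewrite normrM ler_piMr// /pbump ger0_norm.
    apply: prodr_ile1 => i _; exact: bump_ge0_le1.
  by apply: prodr_ge0 => i _; case/andP: (bump_ge0_le1 (a i) (b i) (x ord0 i) (h0 m)).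
- have z m : (\int[leb]_(x in Omega) (f_ m x)%:E = 0)%E.
    by apply: hg; exact: test_function_pbump.
  have l0 : (\int[leb]_(x in Omega) (f x)%:E = 0)%E.
    have E : (fun m => (\int[leb]_(x in Omega) (f_ m x)%:E)%E) = (fun=> 0%E).
      by apply/funext => m; exact: z.
    by rewrite E in lim; apply: cvg_unique lim (cvg_cst _).
  rewrite -l0; have sub : obox a b `<=` Omega.
    by move=> x hx; apply: abO => i; have /andP[? ?] := hx i; rewrite !ltW.
  rewrite integral_mkcond [RHS]integral_mkcond; apply: eq_integral => x _.
  rewrite !patchE /f indicE; case: (boolP (x \in obox a b)) => hx.
    have -> : x \in Omega by move: hx; rewrite !inE; exact: sub.
    by rewrite mulr1.
  by rewrite mulr0; case: ifP.
Qed.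

Definition oboxes : set (set V) := [set A | exists a b, A = obox a b].

Lemma oboxI (a b a' b' : 'I_n -> R) : obox a b `&` obox a' b' =
  obox (fun i => Num.max (a i) (a' i)) (fun i => Num.min (b i) (b' i)) :> set V.
Proof.
apply/seteqP; split => x /=.
  by move=> [h h'] i; rewrite gt_max lt_min; have /andP[-> ->] := h i; have /andP[-> ->] := h' i.
move=> h; split => i; have := h i; rewrite gt_max lt_min => /andP[/andP[h1 h2] /andP[h3 h4]].
  by rewrite h1.
by rewrite h2.
Qed.

Lemma oboxes_setI : setI_closed oboxes.
Proof. by move=> _ _ [a [b ->]] [a' [b' ->]]; rewrite oboxI; do 2 eexists. Qed.

(** A half-space in one coordinate is a countable union of growing boxes. *)
Lemma measurable_rV_oboxes (A : set V) : measurable A -> <<s oboxes >> A.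
Proof.
suff : (measurable : set (set V)) `<=` <<s oboxes >> by exact.
apply: smallest_sub; first exact: smallest_sigma_algebra.
move=> B; rewrite -bigcup_seq => -[i _ [D mD <-]] /=.
pose coord (x : g_sigma_algebraType oboxes) : R := (x : V) ord0 i.
have mc : measurable_fun setT coord.
  apply: (measurability _ (RGenOInfty.measurableE R)) => _ [_ [r ->] <-].
  rewrite setTI (_ : _ @^-1` _ = \bigcup_k obox (fun j => if j == i then r else - k%:R) (fun _ =>
    k%:R)).
    apply: bigcup_measurable => k _; apply: sub_sigma_algebra.
    by exists (fun j => if j == i then r else - k%:R), (fun _ => k%:R).
  apply/seteqP; split => x /=; rewrite in_itv/= andbT; last first.
    by move=> [k _ /(_ i)]; rewrite eqxx => /andP[].
  move=> rx; pose S := \sum_(j < n) `|x ord0 j|.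
  have hS j : `|x ord0 j| <= S by rewrite /S (bigD1 j)//= lerDl sumr_ge0.
  have S0 : 0 <= S by rewrite sumr_ge0.
  exists (Num.bound S) => // j; have := archi_boundP S0 => hb.
  have := le_lt_trans (hS j) hb; rewrite ltr_norml => /andP[h1 h2].
  by case: (eqVneq j i) h1 h2 => [->|_] h1 h2; rewrite ?rx ?h1 h2.
exact: mc.
Qed.

(** On a rational box whose closed box lies in [Omega], a pi-lambda argument extends the vanishing
    of the integral from boxes to all measurable subsets; the subsets where [g] is nonnegative and
    negative then give [g = 0] almost everywhere. Countably many such boxes cover [Omega]. *)
Lemma ae_eq0_oboxes (Omega : set V) (g : V -> R) : open Omega ->
  leb.-integrable Omega (EFin \o g) ->
  (forall a b, cbox a b `<=` Omega -> (\int[leb]_(x in obox a b) (g x)%:E = 0)%E) ->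
  {ae leb, forall x, Omega x -> g x = 0}.
Proof.
move=> oO ig hg; have mO := open_measurable_rV oO.
have mg : measurable_fun Omega g by apply/measurable_EFinP; exact: measurable_int ig.
have box0 q : cbox (rat_lo q) (rat_hi q) `<=` Omega ->
    leb.-negligible (obox (rat_lo q) (rat_hi q) `&` [set x | g x != 0]).
  move=> qO; set B := obox (rat_lo q) (rat_hi q).
  have mB : measurable B by exact: measurable_obox.
  have BO : B `<=` Omega.
    by move=> x hx; apply: qO => i; have /andP[? ?] := hx i; rewrite !ltW.
  have igB : leb.-integrable B (EFin \o g) by exact: integrableS ig.
  have B0 : (\int[leb]_(x in B) (g x)%:E = 0)%E by exact: hg.
  pose HH := [set A : set V | measurable A /\ (\int[leb]_(x in A `&` B) (g x)%:E = 0)%E].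
  have dynHH : dynkin HH.
    split.
    - by split; [exact: measurableT|rewrite setTI].
    - move=> A [mA A0]; split; first exact: measurableC.
      have mCA : measurable (~` A) by exact: measurableC.
      have UB : (A `&` B) `|` (~` A `&` B) = B by rewrite -setIUl setUv setTI.
      have E : (\int[leb]_(x in B) (g x)%:E =
          \int[leb]_(x in A `&` B) (g x)%:E + \int[leb]_(x in ~` A `&` B) (g x)%:E)%E.
        rewrite -[in LHS]UB; apply: integral_setU => //.
        + exact: measurableI.
        + exact: measurableI.
        + by rewrite UB; exact: measurable_int igB.
        + by apply/disj_setPS; rewrite setIACA setICr set0I.
      by move: E; rewrite B0 A0 add0e => <-.
    - move=> F tF HF; split; first by apply: bigcupT_measurable => k; exact: (HF k).1.
      rewrite setI_bigcupl integral_bigcup//.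
      + by apply: eseries0 => k _ _; exact: (HF k).2.
      + exact: trivIset_setIr.
      + by move=> k; apply: measurableI => //; exact: (HF k).1.
      + apply: integrableS igB => //.
          by apply: bigcupT_measurable => k; apply: measurableI => //; exact: (HF k).1.
        by apply: bigcup_sub => k _ x [].
  have subHH : oboxes `<=` HH.
    move=> _ [a [b ->]]; split; first exact: measurable_obox.
    rewrite oboxI; apply: hg => x hx; apply: qO => i; have := hx i.
    by rewrite ge_max le_min => /andP[/andP[_ ->] /andP[_ ->]].
  have allHH A : measurable A -> (\int[leb]_(x in A `&` B) (g x)%:E = 0)%E.
    move=> mA; suff : HH A by case.
    have := lambda_system_subset oboxes_setI ((dynkin_lambda_system _).1 dynHH) subHH.
    by move=> /(_ (fun _ _ => subsetT _)); apply; exact: measurable_rV_oboxes.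
  pose Pp := B `&` [set x | 0 <= g x]; pose Pn := B `&` [set x | g x < 0].
  have mgB : measurable_fun B g by exact: measurable_funS mg.
  have mPp : measurable Pp.
    rewrite /Pp (_ : [set x | 0 <= g x] = g @^-1` `[0, +oo[); last first.
      by apply/seteqP; split => x /=; rewrite in_itv/= andbT.
    by apply: mgB => //; exact: measurable_itv.
  have mPn : measurable Pn.
    rewrite /Pn (_ : [set x | g x < 0] = g @^-1` `]-oo, 0[)//.
    by apply: mgB => //; exact: measurable_itv.
  have nB : (\int[leb]_(x in B) `|(g x)%:E| = 0)%E.
    have BE : B = Pp `|` Pn.
      rewrite /Pp /Pn -setIUr (_ : _ `|` _ = setT) ?setIT//.
      by apply/seteqP; split => // x _ /=; case: (leP 0 (g x)); [left|right].
    have dPP : [disjoint Pp & Pn].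
      apply/disj_setPS => x [[_ /= h1] [_ /= h2]]; move: h1; rewrite leNgt h2//.
    have ign : leb.-integrable (Pp `|` Pn) (abse \o (EFin \o g)) by rewrite -BE;
      exact: integrable_abse.
    rewrite BE (@integral_setU _ _ _ leb Pp Pn (abse \o (EFin \o g)))//;
      last exact: measurable_int ign.
    have z1 : (\int[leb]_(x in Pp) (g x)%:E = 0)%E.
      by have := allHH _ mPp; rewrite (_ : Pp `&` B = Pp)//; apply/setIidl; exact: subIsetl.
    have z2 : (\int[leb]_(x in Pn) (g x)%:E = 0)%E.
      by have := allHH _ mPn; rewrite (_ : Pn `&` B = Pn)//; apply/setIidl; exact: subIsetl.
    rewrite (_ : (\int[leb]_(x in Pp) _)%E = 0%E); last first.
      rewrite -[RHS]z1; apply: eq_integral => x; rewrite inE => -[_ /= h].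
      by rewrite ger0_norm.
    rewrite (_ : (\int[leb]_(x in Pn) _)%E = 0%E) ?add0e//.
    rewrite -[RHS](mule0 (-1)%:E) -z2 -(integralZl mPn).
      by apply: eq_integral => x; rewrite inE => -[_ /= h]; rewrite ltr0_norm// -EFinM mulN1r.
    by apply: integrableS igB => //; exact: subIsetl.
  have mEg : measurable_fun B (EFin \o g) by apply/measurable_EFinP.
  have [h _] := ae_eq_integral_abs leb mB mEg.
  apply: negligibleS (h nB) => x /= [Bx gx] /= hx; move: gx.
  by have := hx Bx => -[->]; rewrite eqxx.
pose F k := if unpickle k is Some q then
   (if `[< cbox (rat_lo q) (rat_hi q) `<=` Omega >] then obox (rat_lo q) (rat_hi q) `&` [set x |
     g x != 0] else set0)
   else set0.
have nF k : leb.-negligible (F k).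
  rewrite /F; case: unpickle => [q|]; last exact: negligible_set0.
  by case: asboolP => [h|_]; [exact: box0|exact: negligible_set0].
apply: negligibleS (negligible_bigcup nF) => x /= /not_implyP[Ox gx].
have [q [qx qO]] := nbhs_rat_box (open_nbhs_nbhs (conj oO Ox)).
exists (pickle q) => //; rewrite /F pickleK; case: asboolP => // _.
by split => //; apply/eqP.
Qed.

End fundamental_lemma.

(** * Square-integrable functions *)

Lemma cvge0_near {R : realType} {T : Type} {F : set_system T} {FF : Filter F}
    (f : T -> \bar R) (e : R) :
  f x @[x --> F] --> 0%E -> 0 < e -> \forall x \near F, (f x < e%:E)%E.
Proof.
move=> cv e0; have : nbhs (0%E : \bar R) [set y | (y < e%:E)%E].
  by apply: open_nbhs_nbhs; split; [exact: open_ereal_lt_ereal|rewrite /= lte_fin].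
by move=> /cv.
Qed.

Section L2_space.
Context {d : measure_display} {T : measurableType d} {R : realType}.
Variables (mu : {measure set T -> \bar R}) (D : set T).
Hypothesis mD : measurable D.
Implicit Types f g : T -> R.

Definition rintegrable f := mu.-integrable D (EFin \o f).

Definition L2 f := measurable_fun D f /\ rintegrable (fun x => f x ^+ 2).

(* Locked, like the other forms below: failed conversion checks between
   integrals are otherwise prohibitively expensive. *)
Definition ip2 := locked (fun f g => \int[mu]_(x in D) (f x * g x))%R.

Lemma ip2E f g : ip2 f g = (\int[mu]_(x in D) (f x * g x))%R.
Proof. by rewrite /ip2 -lock. Qed.

Lemma rintegrable_measurable f : rintegrable f -> measurable_fun D f.
Proof. by move=> h; apply/measurable_EFinP; exact: measurable_int h. Qed.

Lemma rintegrable_le f g : measurable_fun D f -> rintegrable g ->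
  (forall x, D x -> `|f x| <= g x) -> rintegrable f.
Proof.
move=> mf ig fg; apply: (le_integrable mD _ _ ig); first exact/measurable_EFinP.
move=> x Dx /=; rewrite lee_fin; apply: le_trans (fg _ Dx) (ler_norm _).
Qed.

Lemma rintegrableD f g : rintegrable f -> rintegrable g -> rintegrable (fun x => f x + g x).
Proof. by move=> h1 h2; exact: (integrableD mD h1 h2). Qed.

Lemma rintegrableB f g : rintegrable f -> rintegrable g -> rintegrable (fun x => f x - g x).
Proof. by move=> h1 h2; exact: (integrableB mD h1 h2). Qed.

Lemma rintegrableZ c f : rintegrable f -> rintegrable (fun x => c * f x).
Proof.
move=> h; have := integrableZl mD c h.
by apply: eq_integrable => // x _ /=; rewrite EFinM.
Qed.

Lemma rintegrable_sum (I : Type) (s : seq I) (f : I -> T -> R) :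
  (forall i, rintegrable (f i)) -> rintegrable (fun x => \sum_(i <- s) f i x).
Proof.
move=> h; have := integrable_sum mD s (fun i (_ : true) => h i).
by apply: eq_integrable => // x _ /=; rewrite -sumEFin.
Qed.

Lemma Rintegral_sum (I : Type) (s : seq I) (f : I -> T -> R) :
  (forall i, rintegrable (f i)) ->
  (\int[mu]_(x in D) \sum_(i <- s) f i x = \sum_(i <- s) \int[mu]_(x in D) f i x)%R.
Proof.
move=> h; elim: s => [|i s ih].
  rewrite big_nil -[RHS](Rintegral_set0 mu (fun=> 0)) /Rintegral integral_set0.
  by congr fine; apply: integral0_eq => x _; rewrite big_nil.
rewrite big_cons -ih -RintegralD//; [|exact: h|exact: rintegrable_sum].
by apply: eq_Rintegral => x _; rewrite big_cons.
Qed.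

Lemma L2_mul f g : L2 f -> L2 g -> rintegrable (fun x => f x * g x).
Proof.
move=> [mf If] [mg Ig]; apply: (rintegrable_le _ (rintegrableD If Ig)).
  exact: measurable_funM.
move=> x _; rewrite normrM; have := sqr_ge0 (`|f x| - `|g x|).
by rewrite sqrrB !real_normK ?num_real// -mulr_natr; have := sqr_ge0 (f x);
  have := sqr_ge0 (g x); lra.
Qed.

Lemma L2B f g : L2 f -> L2 g -> L2 (f - g).
Proof.
move=> h1 h2; have [mf If] := h1; have [mg Ig] := h2; split; first exact: measurable_funB.
rewrite (_ : (fun x => (f - g) x ^+ 2) = (fun x => (f x ^+ 2 - 2 * (f x * g x)) + g x ^+ 2));
  last first.
  by apply/funext => x; rewrite !fctE; ring.
apply: rintegrableD => //; apply: rintegrableB => //; apply: rintegrableZ; exact: L2_mul.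
Qed.

Lemma L2Z c f : L2 f -> L2 (c *: f).
Proof.
move=> [mf If]; split; first exact: measurable_funM.
rewrite (_ : (fun x => (c *: f) x ^+ 2) = (fun x => c ^+ 2 * f x ^+ 2)); last first.
  by apply/funext => x; rewrite -exprMn.
exact: rintegrableZ.
Qed.

Lemma subspace_L2 : subspace L2.
Proof. by split; [exact: L2B|exact: L2Z]. Qed.

Lemma form_ip2 : form_on L2 ip2.
Proof.
split.
- move=> f Lf; split => [g h Lg Lh|c g Lg].
    rewrite !ip2E -RintegralB//; [|exact: L2_mul|exact: L2_mul].
    by apply: eq_Rintegral => x _; rewrite mulrBr.
  rewrite !ip2E -RintegralZl//; last exact: L2_mul.
  by apply: eq_Rintegral => x _; rewrite mulrCA.
- by move=> f g _ _; rewrite !ip2E; apply: eq_Rintegral => x _; rewrite mulrC.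
- by move=> f _; rewrite ip2E; apply: Rintegral_ge0 => x _; rewrite -expr2 sqr_ge0.
Qed.

(** The maximum of [f] and [g] equals [g] almost everywhere and lies above [f] everywhere. *)
Lemma le_Rintegral_ae f g : rintegrable f -> rintegrable g ->
  {ae mu, forall x, D x -> f x <= g x} ->
  (\int[mu]_(x in D) f x <= \int[mu]_(x in D) g x)%R.
Proof.
move=> If Ig fg; have Im : rintegrable (fun x => Num.max (f x) (g x)).
  apply: (rintegrable_le _ (rintegrableD (integrable_norm If) (integrable_norm Ig))).
    by apply: measurable_maxr; exact: rintegrable_measurable.
  move=> x _ /=; have := normr_ge0 (f x); have := normr_ge0 (g x).
  by rewrite /Num.max; case: ifP => _; lra.
have -> : (\int[mu]_(x in D) g x = \int[mu]_(x in D) Num.max (f x) (g x))%R.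
  congr fine; apply: ae_eq_integral => //; [exact: measurable_int Ig|exact: measurable_int Im|].
  by apply: filterS fg => x h Dx; rewrite /= (max_idPr (h Dx)).
by apply: le_Rintegral => // x _; rewrite le_max lexx.
Qed.

Lemma eq_Rintegral_ae f g : measurable_fun D f -> measurable_fun D g ->
  {ae mu, forall x, D x -> f x = g x} ->
  (\int[mu]_(x in D) f x = \int[mu]_(x in D) g x)%R.
Proof.
move=> mf mg fg; congr fine; apply: ae_eq_integral => //; try exact/measurable_EFinP.
by apply: filterS fg => x h Dx; rewrite /= h.
Qed.

Hypothesis Dfin : (mu D < +oo)%E.

Lemma rintegrable_cst c : rintegrable (fun _ => c).
Proof.
apply: measurable_bounded_integrable => //; exists `|c|; split; first exact: num_real.
by move=> y cy x _ /=; exact: ltW.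
Qed.

Lemma L2_rintegrable f : L2 f -> rintegrable f.
Proof.
move=> [mf If]; apply: (rintegrable_le mf (rintegrableD (rintegrable_cst 1) If)).
move=> x _; have := sqr_ge0 (`|f x| - 1).
by rewrite sqrrB real_normK ?num_real// expr1n mulr1 -mulr_natr; have := sqr_ge0 (f x); lra.
Qed.

Lemma L2_bounded f B : measurable_fun D f -> (forall x, D x -> `|f x| <= B) -> L2 f.
Proof.
move=> mf fB; split => //; apply: (rintegrable_le _ (rintegrable_cst (B ^+ 2))).
  exact: measurable_funX.
by move=> x Dx; rewrite normrX lerXn2r ?nnegrE ?fB// (le_trans (normr_ge0 _) (fB _ Dx)).
Qed.

End L2_space.

Section Lnorm_real.
Context {d : measure_display} {T : measurableType d} {R : realType}.
Variables (mu : {measure set T -> \bar R}) (D : set T).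
Hypothesis mD : measurable D.
Implicit Types f g : T -> R.
Local Notation "'N_ p [ f ]" := (Lnorm mu p f).

Lemma Lnorm_patch (s : R) f : 0 < s -> ('N_s%:E[EFin \o (f \_ D)] =
  (\int[mu]_(x in D) (`|f x| `^ s)%:E) `^ s^-1)%E.
Proof.
move=> s0; rewrite unlock /Lnorm; apply: (congr1 (poweR^~ s^-1)).
rewrite [RHS]integral_mkcond; apply: eq_integral => x _.
by rewrite [RHS]patchE /= patchE; case: ifP => _ //; rewrite normr0 powR0// gt_eqF.
Qed.

Lemma Lnorm_fin_rintegrable (s : R) f : 0 < s -> measurable_fun D f ->
  ('N_s%:E[EFin \o (f \_ D)] < +oo)%E <-> rintegrable mu D (fun x => `|f x| `^ s).
Proof.
move=> s0 mf; rewrite Lnorm_patch//.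
have mfs : measurable_fun D (fun x => `|f x| `^ s).
  by apply: (measurableT_comp (measurable_powR s)); exact: measurableT_comp.
have I0 : (0 <= \int[mu]_(x in D) (`|f x| `^ s)%:E)%E.
  by apply: integral_ge0 => x _; rewrite lee_fin powR_ge0.
split=> h; last first.
  have /integrable_fin_num := h; move=> /(_ mD).
  rewrite -(fineK (integrable_fin_num mD h)).
  by move=> _; rewrite poweR_EFin ltry.
apply/integrableP; split; first exact/measurable_EFinP.
under eq_integral do rewrite /= ger0_norm ?powR_ge0//.
move: h; case: (\int[mu]_(x in D) _)%E I0 => [r||]//= _.
  by rewrite !ltry.
by rewrite invr_eq0 gt_eqF.
Qed.

Lemma Lnorm_rintegrable (s : R) f : 0 < s -> rintegrable mu D (fun x => `|f x| `^ s) ->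
  'N_s%:E[EFin \o (f \_ D)] = ((\int[mu]_(x in D) (`|f x| `^ s))%R `^ s^-1)%:E.
Proof.
move=> s0 h; rewrite Lnorm_patch// -poweR_EFin; congr (_ `^ _)%E.
by rewrite /Rintegral fineK//; exact: integrable_fin_num.
Qed.

Lemma Lnorm2_L2 f : measurable_fun D f ->
  ('N_2%:E[EFin \o (f \_ D)] < +oo)%E <-> rintegrable mu D (fun x => f x ^+ 2).
Proof.
move=> mf; have -> : (fun x => f x ^+ 2) = (fun x => `|f x| `^ 2).
  by apply/funext => x; rewrite powR_mulrn// real_normK ?num_real.
exact: Lnorm_fin_rintegrable.
Qed.

Lemma Lnorm2E f : L2 mu D f -> 'N_2%:E[EFin \o (f \_ D)] = (Num.sqrt (ip2 mu D f f))%:E.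
Proof.
move=> [mf If]; rewrite Lnorm_rintegrable//; last first.
  by move/(Lnorm2_L2 mf) : If => /(Lnorm_fin_rintegrable _ mf); exact.
rewrite powR12_sqrt; last by apply: Rintegral_ge0 => x _; exact: powR_ge0.
rewrite ip2E; congr (Num.sqrt _)%:E; apply: eq_Rintegral => x _.
by rewrite powR_mulrn// real_normK ?num_real// expr2.
Qed.

End Lnorm_real.

(** * Weak gradients and Sobolev spaces *)

Section test_functions.
Context {R : realType} {n : nat}.
Local Notation V := 'rV[R]_n.
Local Notation leb := (@lebesgue_rV R n).
Variable Omega : set V.
Hypothesis (oO : open Omega) (bO : bounded_set Omega).
Implicit Types (f g phi psi : V -> R).

Lemma measurable_domain : measurable Omega.
Proof. exact: open_measurable_rV. Qed.
Let mO := measurable_domain.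

Lemma domain_fin : (leb Omega < +oo)%E.
Proof. exact: bounded_lebesgue_rV_fin. Qed.

Lemma smooth_derivable phi i x : smooth_on setT phi -> derivable phi x (basis_vec i).
Proof. by move=> h; have [] := h [::] x I. Qed.

Lemma smooth_continuous phi : smooth_on setT phi -> continuous phi.
Proof. by move=> h x; have [] := h [::] x I. Qed.

Lemma smooth_partial phi i : smooth_on setT phi -> smooth_on setT (partial i phi).
Proof. by move=> h s x _; have := h (rcons s i) x I; rewrite foldr_rcons. Qed.

Lemma smoothB phi psi : smooth_on setT phi -> smooth_on setT psi -> smooth_on setT (phi - psi).
Proof.
move=> h1 h2.
have E s : foldr partial (phi - psi) s = foldr partial phi s - foldr partial psi s.
  elim: s => [//|i s ih] /=; rewrite ih; apply/funext => x; rewrite /partial deriveB//.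
    by have [] := h1 s x I.
  by have [] := h2 s x I.
move=> s x _; rewrite E; have [d1 c1] := h1 s x I; have [d2 c2] := h2 s x I.
by split; [move=> i; exact: derivableB|exact: continuousB].
Qed.

Lemma smoothZ c phi : smooth_on setT phi -> smooth_on setT (c *: phi).
Proof.
move=> h1.
have E s : foldr partial (c *: phi) s = c *: foldr partial phi s.
  elim: s => [//|i s ih] /=; rewrite ih; apply/funext => x; rewrite /partial deriveZ//.
  by have [] := h1 s x I.
move=> s x _; rewrite E; have [d1 c1] := h1 s x I.
by split; [move=> i; exact: derivableZ|apply: (@continuousM _ _ (cst c)) => //;
  exact: cst_continuous].
Qed.

Lemma test_function_subset phi psi : smooth_on setT psi -> test_function Omega phi ->
  closure [set x | psi x != 0] `<=` closure [set x | phi x != 0] -> test_function Omega psi.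
Proof.
move=> sp [_ kp pO] h; split => //; last exact: subset_trans h pO.
by apply: subclosed_compact kp h; exact: closed_closure.
Qed.

Lemma test_function_partial phi i : test_function Omega phi
  -> test_function Omega (partial i phi).
Proof.
move=> tp; have [sp _ _] := tp; apply: test_function_subset tp _; first exact: smooth_partial.
rewrite [X in _ `<=` X](closure_id _).1; last exact: closed_closure.
apply: closure_subset => x /= /negP px.
apply: contrapT => nx; apply: px; apply/eqP.
have : \forall y \near x, phi y = 0.
  have := @closed_openC _ _ (@closed_closure V [set x | phi x != 0]).
  move=> oc; have : nbhs x (~` closure [set x | phi x != 0]) by apply: open_nbhs_nbhs.
  apply: filterS => y /= ny; apply: contrapT => /eqP py; apply: ny.
  exact: subset_closure.
rewrite /partial -[RHS](derive_cst (0 : R^o) x (basis_vec i)) => h.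
exact: near_eq_derive.
Qed.

Lemma test_functionB phi psi : test_function Omega phi -> test_function Omega psi ->
  test_function Omega (phi - psi).
Proof.
move=> [s1 k1 c1] [s2 k2 c2].
have sub : closure [set x | (phi - psi) x != 0] `<=`
    closure [set x | phi x != 0] `|` closure [set x | psi x != 0].
  rewrite [X in _ `<=` X](closure_id _).1; last by apply: closedU; exact: closed_closure.
  apply: closure_subset => x /= h.
  have [p0|p0] := eqVneq (phi x) 0; last by left; apply: subset_closure.
  right; apply: subset_closure => /=; apply: contra h => /eqP q0.
  by rewrite !fctE p0 q0 subrr.
split; first exact: smoothB.
  apply: subclosed_compact (compactU k1 k2) sub; exact: closed_closure.
by move=> x /sub[/c1|/c2].
Qed.

Lemma test_functionZ c phi : test_function Omega phi -> test_function Omega (c *: phi).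
Proof.
move=> tp; have [sp _ _] := tp; apply: test_function_subset tp _; first exact: smoothZ.
by apply: closureS => x /=; apply: contra => /eqP h; rewrite !fctE h scaler0.
Qed.

Lemma test_function_out phi x : test_function Omega phi -> ~ Omega x -> phi x = 0.
Proof.
move=> [_ _ h] nO; apply: contrapT => /eqP px; apply: nO; apply: h.
exact: subset_closure.
Qed.

Lemma domain_radius : exists2 M, 0 < M & forall f, (forall x, ~ Omega x -> f x = 0)
  -> zero_outside M f.
Proof.
have [M hM] := bounded_rV_cbox bO; exists (Num.max 1 M).
  by rewrite lt_max ltr01.
move=> f f0 x i Mx; apply: f0 => /hM /(_ i); rewrite -ler_norml.
by move: Mx; rewrite gt_max => /andP[_ Mx]; rewrite leNgt Mx.
Qed.

Lemma test_function_bounded phi : test_function Omega phi -> exists B, forall x, `|phi x| <= B.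
Proof.
move=> tp; have [sp _ _] := tp; have [M M0 hM] := domain_radius.
apply: zero_outside_bounded (smooth_continuous sp) _; apply: hM => x nO.
exact: test_function_out tp nO.
Qed.

Lemma test_function_measurable phi (D : set V) : measurable D -> test_function Omega phi
  -> measurable_fun D phi.
Proof.
move=> mD [sp _ _]; apply: (@measurable_funS _ _ _ _ setT) => //.
by apply: continuous_measurable_rV; [exact: openT|move=> x _; exact: smooth_continuous].
Qed.

Lemma test_function_L2 phi : test_function Omega phi -> L2 leb Omega phi.
Proof.
move=> tp; have [B hB] := test_function_bounded tp.
apply: (L2_bounded mO domain_fin (B := B)) => //; exact: test_function_measurable.
Qed.

Lemma integral_out f : (forall x, ~ Omega x -> f x = 0) ->
  (\int[leb]_(x in Omega) f x = \int[leb]_x f x)%R.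
Proof.
move=> f0; congr fine; rewrite integral_mkcond; apply: eq_integral => x _.
by rewrite patchE; case: ifPn => //; rewrite notin_setE => /f0 ->.
Qed.

(** The product vanishes outside a box, so its partial derivative has integral 0. *)
Lemma test_function_ibp phi psi i : test_function Omega phi -> test_function Omega psi ->
  (\int[leb]_(x in Omega) (phi x * partial i psi x))%R =
  - (\int[leb]_(x in Omega) (partial i phi x * psi x))%R.
Proof.
move=> t1 t2; have [s1 _ _] := t1; have [s2 _ _] := t2; have [M M0 hM] := domain_radius.
pose w x := phi x * psi x.
have dw x : derivable w x (basis_vec i).
  by apply: derivableM; exact: smooth_derivable.
have pw : partial i w = (fun x => phi x * partial i psi x + partial i phi x * psi x).
  apply/funext => x; rewrite /partial /w.
  rewrite deriveM; [|exact: smooth_derivable|exact: smooth_derivable].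
  by rewrite /GRing.scale/= [psi x * _]mulrC.
have c1 : continuous (fun x => phi x * partial i psi x).
  by move=> x; apply: continuousM; [|have := smooth_partial i s2];
    [exact: smooth_continuous|move=> h; exact: smooth_continuous].
have c2 : continuous (fun x => partial i phi x * psi x).
  by move=> x; apply: continuousM; [have := smooth_partial i s1; move=> h|];
    exact: smooth_continuous.
have z1 x : ~ Omega x -> phi x * partial i psi x = 0.
  by move=> nO; rewrite (test_function_out t1 nO) mul0r.
have z2 x : ~ Omega x -> partial i phi x * psi x = 0.
  by move=> nO; rewrite (test_function_out t2 nO) mulr0.
have := @integral_partial0 R n M w i M0 dw.
rewrite pw => /(_ _ _ _)/(congr1 fine) /= h.
apply/eqP; rewrite -addr_eq0 !integral_out// -RintegralD//.
- apply/eqP; apply: h.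
  + by move=> x; apply: continuousM; exact: smooth_continuous.
  + by move=> x; exact: (continuousD (c1 x) (c2 x)).
  + by apply: hM => x nO; rewrite /w (test_function_out t1 nO) mul0r.
- by apply: (zero_outside_integrable (M := M)) => //; exact: hM.
- by apply: (zero_outside_integrable (M := M)) => //; exact: hM.
Qed.

Lemma in_Lp2P f : in_Lp Omega 2 f <-> L2 leb Omega f.
Proof.
split=> [[mf h]|[mf h]]; split => //; last exact/(Lnorm2_L2 leb mO mf).
exact/(Lnorm2_L2 leb mO mf).
Qed.

Lemma test_function_weak_gradient phi : test_function Omega phi ->
  L2_weak_gradient Omega phi (fun x => \row_i partial i phi x).
Proof.
move=> tp; split => [i|i psi tpsi].
  apply/in_Lp2P; have := test_function_L2 (test_function_partial i tp).
  by congr L2; apply/funext => x; rewrite mxE.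
rewrite (test_function_ibp i tp tpsi); congr (- _).
by apply: eq_Rintegral => x _; rewrite mxE.
Qed.

(** The difference of the components is orthogonal to all test functions, and it is integrable
    because the domain has finite measure; the fundamental lemma applies. *)
Lemma L2_weak_gradient_unique f (G G' : V -> V) : L2_weak_gradient Omega f G ->
  L2_weak_gradient Omega f G' ->
  forall i, {ae leb, forall x, Omega x -> G x ord0 i = G' x ord0 i}.
Proof.
move=> [LG wG] [LG' wG'] i; have LGi := (in_Lp2P _).1 (LG i); have LGi' := (in_Lp2P _).1 (LG' i).
have Lg := L2B mO LGi LGi'.
have Ig := L2_rintegrable mO domain_fin Lg.
suff : {ae leb, forall x, Omega x -> G x ord0 i - G' x ord0 i = 0}.
  by apply: filterS => x h /h /eqP; rewrite subr_eq0 => /eqP.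
apply: ae_eq0_oboxes => // a b ab; apply: integral_obox_0 ab => // phi tp.
have Lp := test_function_L2 tp.
have Ip := L2_mul mO Lg Lp.
rewrite -(fineK (integrable_fin_num mO Ip)); congr EFin.
have : ip2 leb Omega (fun x => G x ord0 i) phi - ip2 leb Omega (fun x => G' x ord0 i) phi = 0.
  by have := wG i phi tp; rewrite (wG' i phi tp) !ip2E => /oppr_inj ->; rewrite subrr.
rewrite -(formBl (subspace_L2 leb mO) (form_ip2 leb mO) Lp LGi LGi') ip2E => h.
exact: h.
Qed.

Lemma L2_weak_gradientB f g (G G' : V -> V) : L2 leb Omega f -> L2 leb Omega g ->
  L2_weak_gradient Omega f G ->
  L2_weak_gradient Omega g G' -> L2_weak_gradient Omega (f - g) (fun x => G x - G' x).
Proof.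
move=> Lf Lg [LG wG] [LG' wG'].
have LGi i := (in_Lp2P _).1 (LG i); have LGi' i := (in_Lp2P _).1 (LG' i).
have E i : (fun x => (G x - G' x) ord0 i) = (fun x => G x ord0 i) - (fun x => G' x ord0 i).
  by apply/funext => x; rewrite !mxE.
split=> [i|i phi tp]; first by apply/in_Lp2P; rewrite E; exact: L2B.
have Lp := test_function_L2 tp; have Lpp := test_function_L2 (test_function_partial i tp).
have := formBl (subspace_L2 leb mO) (form_ip2 leb mO) Lpp Lf Lg.
have := formBl (subspace_L2 leb mO) (form_ip2 leb mO) Lp (LGi i) (LGi' i).
rewrite -E !ip2E => -> ->; rewrite (wG i phi tp) (wG' i phi tp); ring.
Qed.

Lemma L2_weak_gradientZ c f (G : V -> V) : L2 leb Omega f ->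
  L2_weak_gradient Omega f G -> L2_weak_gradient Omega (c *: f) (fun x => c *: G x).
Proof.
move=> Lf [LG wG]; have LGi i := (in_Lp2P _).1 (LG i).
have E i : (fun x => (c *: G x) ord0 i) = c *: (fun x => G x ord0 i).
  by apply/funext => x; rewrite !mxE.
split=> [i|i phi tp]; first by apply/in_Lp2P; rewrite E; exact: L2Z.
have Lp := test_function_L2 tp; have Lpp := test_function_L2 (test_function_partial i tp).
have := formZl (subspace_L2 leb mO) (form_ip2 leb mO) c Lpp Lf.
have := formZl (subspace_L2 leb mO) (form_ip2 leb mO) c Lp (LGi i).
rewrite -E !ip2E => -> ->; rewrite (wG i phi tp); ring.
Qed.

Lemma L2_weak_gradient_ae f g (G : V -> V) : L2 leb Omega f -> L2 leb Omega g ->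
  ae_eq_on Omega f g -> L2_weak_gradient Omega f G -> L2_weak_gradient Omega g G.
Proof.
move=> Lf Lg fg [LG wG]; split => // i phi tp; rewrite -(wG i phi tp).
have Lpp := test_function_L2 (test_function_partial i tp).
apply: eq_Rintegral_ae => //.
- by apply: measurable_funM; [exact: Lg.1|exact: Lpp.1].
- by apply: measurable_funM; [exact: Lf.1|exact: Lpp.1].
- by apply: filterS fg => x h /h ->.
Qed.

(** Both functions have the same set of weak gradients, so the choice made by [get] is the same: a
    true equality, not only one almost everywhere. *)
Lemma wgrad_ae f g : L2 leb Omega f -> L2 leb Omega g ->
  ae_eq_on Omega f g -> wgrad Omega f = wgrad Omega g.
Proof.
move=> Lf Lg fg; rewrite /wgrad; congr get; apply/seteqP; split => G /= h.
  exact: L2_weak_gradient_ae fg h.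
apply: L2_weak_gradient_ae h => //; by apply: filterS fg => x h /h ->.
Qed.

Local Notation H1 := (in_H1 Omega).
Local Notation L2O := (L2 leb Omega).
Local Notation ip := (ip2 leb Omega).
Let fip := form_ip2 leb mO.

Definition wpartial := locked (fun i f (x : V) => wgrad Omega f x ord0 i).

Lemma wpartialE i f x : wpartial i f x = wgrad Omega f x ord0 i.
Proof. by rewrite /wpartial -lock. Qed.

Lemma wpartialEf i f : wpartial i f = (fun x => wgrad Omega f x ord0 i).
Proof. by rewrite /wpartial -lock. Qed.

Lemma in_H1_L2 f : H1 f -> L2O f.
Proof. by move=> [/in_Lp2P]. Qed.

Lemma wgradP f : H1 f -> L2_weak_gradient Omega f (wgrad Omega f).
Proof. by move=> [_ h]; exact: getPex. Qed.

Lemma wpartial_L2 i f : H1 f -> L2O (wpartial i f).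
Proof. by move=> /wgradP[h _]; rewrite wpartialEf; exact: ((in_Lp2P _).1 (h i)). Qed.

Lemma in_H1P f G : L2O f -> L2_weak_gradient Omega f G -> H1 f /\
  forall i, {ae leb, forall x, Omega x -> wpartial i f x = G x ord0 i}.
Proof.
move=> Lf hG; have Hf : H1 f by split; [exact/in_Lp2P|exists G].
split => // i; rewrite wpartialEf; apply: L2_weak_gradient_unique hG _; exact: wgradP.
Qed.

(** The weak gradient is a choice within a class, so it is linear only up to null sets. *)
Lemma wpartialB f g i : H1 f -> H1 g -> H1 (f - g) /\
  {ae leb, forall x, Omega x -> wpartial i (f - g) x = (wpartial i f - wpartial i g) x}.
Proof.
move=> Hf Hg; have Lf := in_H1_L2 Hf; have Lg := in_H1_L2 Hg.
have [h1 h2] := in_H1P (L2B mO Lf Lg) (L2_weak_gradientB Lf Lg (wgradP Hf) (wgradP Hg)).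
by split => //; apply: filterS (h2 i) => x h /h ->; rewrite !fctE !wpartialE !mxE.
Qed.

Lemma wpartialZ c f i : H1 f -> H1 (c *: f) /\
  {ae leb, forall x, Omega x -> wpartial i (c *: f) x = (c *: wpartial i f) x}.
Proof.
move=> Hf; have Lf := in_H1_L2 Hf.
have [h1 h2] := in_H1P (L2Z mO c Lf) (L2_weak_gradientZ c Lf (wgradP Hf)).
by split => //; apply: filterS (h2 i) => x h /h ->; rewrite !fctE !wpartialE !mxE.
Qed.

Lemma subspace_H1 : subspace H1.
Proof.
split=> [f g Hf Hg|c f Hf].
  exact: (in_H1P (L2B mO (in_H1_L2 Hf) (in_H1_L2 Hg))
    (L2_weak_gradientB (in_H1_L2 Hf) (in_H1_L2 Hg) (wgradP Hf) (wgradP Hg))).1.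
exact: (in_H1P (L2Z mO c (in_H1_L2 Hf)) (L2_weak_gradientZ c (in_H1_L2 Hf) (wgradP Hf))).1.
Qed.

Lemma ip_ae f g f' g' : L2O f -> L2O g -> L2O f' -> L2O g' ->
  ae_eq_on Omega f f' -> ae_eq_on Omega g g' -> ip f g = ip f' g'.
Proof.
move=> Lf Lg Lf' Lg' ff gg; rewrite !ip2E; apply: eq_Rintegral_ae => //.
- by apply: measurable_funM; [exact: Lf.1|exact: Lg.1].
- by apply: measurable_funM; [exact: Lf'.1|exact: Lg'.1].
- by apply: filterS2 ff gg => x h1 h2 Ox; rewrite h1// h2.
Qed.

Definition h1form :=
  locked (fun f g => ip f g + \sum_(i < n) ip (wpartial i f) (wpartial i g)).

Lemma h1formE f g :
  h1form f g = ip f g + \sum_(i < n) ip (wpartial i f) (wpartial i g).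
Proof. by rewrite /h1form -lock. Qed.

Lemma form_h1form : form_on H1 h1form.
Proof.
split.
- move=> f Hf; split => [g h Hg Hh|c g Hg]; rewrite !h1formE.
    rewrite (formBr fip)//; try exact: in_H1_L2.
    rewrite opprD addrACA; congr (_ + _).
    rewrite -sumrN -big_split/=; apply: eq_bigr => i _.
    have [HB hB] := wpartialB i Hg Hh.
    rewrite -(formBr fip)//; try exact: wpartial_L2.
    apply: (ip_ae (wpartial_L2 i Hf) (wpartial_L2 i HB) (wpartial_L2 i Hf) _ _ hB).
      by apply: (L2B mO); exact: wpartial_L2.
    by apply: aeW.
  rewrite (formZr fip)//; try exact: in_H1_L2.
  rewrite mulrDr mulr_sumr; congr (_ + _); apply: eq_bigr => i _.
  have [HB hB] := wpartialZ c i Hg.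
  rewrite -(formZr fip)//; try exact: wpartial_L2.
  apply: (ip_ae (wpartial_L2 i Hf) (wpartial_L2 i HB) (wpartial_L2 i Hf) _ _ hB).
    by apply: (L2Z mO); exact: wpartial_L2.
  by apply: aeW.
- move=> f g Hf Hg; rewrite !h1formE (form_onC fip (in_H1_L2 Hf) (in_H1_L2 Hg)).
  have -> : \sum_(i < n) ip (wpartial i f) (wpartial i g)
    = \sum_(i < n) ip (wpartial i g) (wpartial i f).
    apply: eq_bigr => i _; exact: (form_onC fip (wpartial_L2 i Hf) (wpartial_L2 i Hg)).
  by [].
- move=> f Hf; rewrite !h1formE addr_ge0 ?(form_on_ge0 fip) ?sumr_ge0//; first exact: in_H1_L2.
  by move=> i _; apply: (form_on_ge0 fip); exact: wpartial_L2.
Qed.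

End test_functions.

Section form_seminorm.
Context {R : realType} {X : lmodType R} {H : X -> Prop} (hH : subspace H).
Context {b : X -> X -> R} (hb : form_on H b).

Lemma form_sqrtB_le x y : H x -> H y ->
  Num.sqrt (b (x - y) (x - y)) <= Num.sqrt (b x x) + Num.sqrt (b y y).
Proof.
move=> Hx Hy; have Hxy := subspaceB hH Hx Hy.
have sx := sqrtr_ge0 (b x x); have sy := sqrtr_ge0 (b y y).
rewrite -[leRHS]ger0_norm ?addr_ge0// -sqrtr_sqr ler_sqrt ?sqr_ge0// (formB2 hH hb)// sqrrD.
rewrite !sqr_sqrtr ?(form_on_ge0 hb)//.
by have := lerNnormlW (form_CS_sqrt hH hb Hx Hy); rewrite -mulr_natr; lra.
Qed.

Lemma form_seminorm : norm_on H (fun x => Num.sqrt (b x x)).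
Proof.
split=> [x|x y|c x Hx]; [exact: sqrtr_ge0|exact: form_sqrtB_le|].
rewrite (formZl hH hb)//; last exact: subspaceZ.
by rewrite (formZr hb)// mulrA -expr2 sqrtrM ?sqr_ge0// sqrtr_sqr.
Qed.

End form_seminorm.

Section sobolev_space.
Context {R : realType} {n : nat}.
Local Notation V := 'rV[R]_n.
Local Notation leb := (@lebesgue_rV R n).
Variable Omega : set V.
Hypothesis (oO : open Omega) (bO : bounded_set Omega).
Implicit Types (f g phi psi : V -> R).
Let mO := measurable_domain oO.
Local Notation H1 := (in_H1 Omega).
Local Notation H01 := (in_H01 Omega).
Local Notation L2O := (L2 leb Omega).
Local Notation ip := (ip2 leb Omega).
Let sL2 := subspace_L2 leb mO.
Let fip := form_ip2 leb mO.
Let sH1 := subspace_H1 oO bO.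
Let fh1 := form_h1form oO bO.

Definition h1norm f := Num.sqrt (h1form Omega f f).

Lemma norm_h1norm : norm_on H1 h1norm.
Proof. exact: form_seminorm. Qed.

Lemma ip_wpartial_ge0 i f : H1 f -> 0 <= ip (wpartial Omega i f) (wpartial Omega i f).
Proof. by move=> Hf; apply: (form_on_ge0 fip); exact: wpartial_L2. Qed.

Lemma L2norm_le_h1norm f : H1 f -> Num.sqrt (ip f f) <= h1norm f.
Proof.
move=> Hf; rewrite ler_sqrt ?(form_on_ge0 fh1)// h1formE lerDl sumr_ge0// => i _.
exact: ip_wpartial_ge0.
Qed.

Lemma wpartial_le_h1norm i f : H1 f ->
  Num.sqrt (ip (wpartial Omega i f) (wpartial Omega i f)) <= h1norm f.
Proof.
move=> Hf; rewrite ler_sqrt ?(form_on_ge0 fh1)// h1formE (bigD1 i)//= addrCA lerDl.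
rewrite addr_ge0 ?(form_on_ge0 fip) ?sumr_ge0//; first exact: in_H1_L2.
by move=> j _; exact: ip_wpartial_ge0.
Qed.

Lemma Lpnorm2E f : L2O f -> Lpnorm Omega 2 f = (Num.sqrt (ip f f))%:E.
Proof. exact: Lnorm2E. Qed.

Lemma grad_normE f : H1 f -> grad_norm Omega f =
  (Num.sqrt (\sum_(i < n) ip (wpartial Omega i f) (wpartial Omega i f)))%:E.
Proof.
move=> Hf; have E : (fun x => enorm (wgrad Omega f x) ^+ 2)
    = (fun x => \sum_(i < n) (wpartial Omega i f x * wpartial Omega i f x)).
  apply/funext => x; rewrite sqr_sqrtr; last by apply: sumr_ge0 => i _; exact: sqr_ge0.
  by apply: eq_bigr => i _; rewrite -expr2 wpartialE.
have I i : rintegrable leb Omega (fun x => wpartial Omega i f x * wpartial Omega i f x).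
  by apply: L2_mul => //; exact: wpartial_L2.
have LG : L2O (fun x => enorm (wgrad Omega f x)).
  split; last by rewrite E; exact: rintegrable_sum.
  apply: (measurableT_comp (continuous_measurable_fun (@sqrt_continuous R))).
  apply: measurable_sum => i; apply: measurable_funX; have := (wpartial_L2 oO i Hf).1.
  by rewrite wpartialEf.
rewrite /grad_norm Lpnorm2E//; congr (Num.sqrt _)%:E.
rewrite ip2E; under eq_Rintegral do rewrite -expr2 [_ ^+ 2](congr1 (@^~ _) E).
by rewrite Rintegral_sum//; apply: eq_bigr => i _; rewrite ip2E.
Qed.

Lemma H1normE f : H1 f -> H1norm Omega f = (h1norm f)%:E.
Proof.
move=> Hf; rewrite /H1norm (grad_normE Hf) Lpnorm2E; last exact: in_H1_L2.
have s0 : 0 <= \sum_(i < n) ip (wpartial Omega i f) (wpartial Omega i f).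
  by apply: sumr_ge0 => i _; exact: ip_wpartial_ge0.
have f0 : 0 <= ip f f by apply: (form_on_ge0 fip); exact: in_H1_L2.
transitivity (((Num.sqrt (ip f f) `^ 2
  + Num.sqrt (\sum_(i < n) ip (wpartial Omega i f) (wpartial Omega i f)) `^ 2) `^ 2^-1)%:E);
    first by [].
by rewrite /h1norm h1formE !powR_mulrn ?sqrtr_ge0// !sqr_sqrtr// powR12_sqrt ?addr_ge0.
Qed.

Lemma test_function_H1 phi : test_function Omega phi -> H1 phi.
Proof.
move=> tp.
exact: (in_H1P oO bO (test_function_L2 oO bO tp) (test_function_weak_gradient oO bO tp)).1.
Qed.

Lemma in_H01P f : H01 f <-> H1 f /\
  forall e, 0 < e -> exists2 phi, test_function Omega phi & h1norm (f - phi) <= e.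
Proof.
split=> [[Hf [phi [tp cv]]]|[Hf h]]; split => //.
  move=> e e0; have : \forall k \near \oo, (H1norm Omega (f \- phi k)%R < e%:E)%E.
    exact: cvge0_near cv e0.
  case=> k _ /(_ k (leqnn k)) hk; exists (phi k) => //.
  move: hk; rewrite (_ : (f \- phi k)%R = f - phi k)// H1normE.
    by rewrite lte_fin => /ltW.
  by apply: (subspaceB sH1) => //; exact: test_function_H1.
have h' (k : nat) : exists phi, test_function Omega phi /\ h1norm (f - phi) <= k.+1%:R^-1.
  by have [|phi tp ph] := h (k.+1%:R^-1); [rewrite invr_gt0 ltr0n|exists phi].
have [phi hphi] := choice h'; exists phi; split; first by move=> k; exact: (hphi k).1.
have E k : H1norm Omega (f \- phi k) = (h1norm (f - phi k))%:E.
  rewrite (_ : (f \- phi k)%R = f - phi k)// H1normE//.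
  by apply: (subspaceB sH1) => //; apply: test_function_H1; exact: (hphi k).1.
under eq_cvg do rewrite E.
apply: cvg_EFin; first exact: nearW.
apply: (@squeeze_cvgr _ _ _ _ (cst 0) (@harmonic R)); last exact: cvg_harmonic.
  by apply: nearW => k; rewrite sqrtr_ge0/= (hphi k).2.
exact: cvg_cst.
Qed.

Lemma subspace_H01 : subspace H01.
Proof.
split=> [f g /in_H01P[Hf hf] /in_H01P[Hg hg]|c f /in_H01P[Hf hf]]; apply/in_H01P.
  split; first exact: (subspaceB sH1).
  move=> e e0; have e2 : 0 < e / 2 by rewrite divr_gt0.
  have [phi tp hp] := hf _ e2; have [psi tq hq] := hg _ e2.
  exists (phi - psi); first exact: test_functionB.
  have Hp := test_function_H1 tp; have Hq := test_function_H1 tq.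
  have -> : f - g - (phi - psi) = (f - phi) - (g - psi) by apply/funext => x; rewrite !fctE; ring.
  have := norm_onB norm_h1norm (subspaceB sH1 Hf Hp) (subspaceB sH1 Hg Hq); lra.
split; first exact: (subspaceZ sH1).
move=> e e0; have e2 : 0 < e / (1 + `|c|) by rewrite divr_gt0// ltr_pwDl.
have [phi tp hp] := hf _ e2; exists (c *: phi); first exact: test_functionZ.
have Hp := test_function_H1 tp.
rewrite -scalerBr (norm_onZ norm_h1norm); last exact: (subspaceB sH1).
apply: le_trans (ler_wpM2l (normr_ge0 _) hp) _.
rewrite mulrCA ger_pMr// ler_pdivrMr ?mul1r ?lerDr// ltr_pwDl//.
Qed.

(* The H1 product with a test function phi is the L2 product with phi - Laplacian phi. *)
Lemma h1form_test_function phi : test_function Omega phi ->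
  exists2 psi, L2O psi & forall f, H1 f -> h1form Omega f phi = ip f psi.
Proof.
move=> tp; have Lp := test_function_L2 oO bO tp.
pose d i := partial i (partial i phi).
have tdi i : test_function Omega (partial i phi) by exact: test_function_partial.
have Ld i : L2O (d i) by apply: test_function_L2 => //; exact: test_function_partial.
have E f i : H1 f -> ip (wpartial Omega i f) (wpartial Omega i phi) = - ip f (d i).
  move=> Hf; have [_ hi] := in_H1P oO bO Lp (test_function_weak_gradient oO bO tp).
  have [_ hw] := wgradP Hf; have := hw i _ (tdi i); rewrite -!ip2E -wpartialEf => ->;
    rewrite opprK.
  have Hphi := test_function_H1 tp.
  apply: (ip_ae oO (wpartial_L2 oO i Hf) (wpartial_L2 oO i Hphi) (wpartial_L2 oO i Hf)).
  - exact: test_function_L2.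
  - by apply: aeW.
  - by apply: filterS (hi i) => x h /h ->; rewrite mxE.
have Ls (s : seq 'I_n) : exists2 psi, L2O psi & forall f, H1 f ->
    ip f phi + \sum_(i <- s) ip (wpartial Omega i f) (wpartial Omega i phi) = ip f psi.
  elim: s => [|i s [psi Lpsi ih]].
    by exists phi => // f _; rewrite big_nil addr0.
  exists (psi - d i); first exact: (subspaceB sL2).
  move=> f Hf; rewrite big_cons addrCA (ih _ Hf) (E _ _ Hf).
  by rewrite (formBr fip (in_H1_L2 oO Hf) Lpsi (Ld i)) addrC.
have [psi Lpsi h] := Ls (index_enum 'I_n).
by exists psi => // f Hf; rewrite h1formE (h _ Hf).
Qed.

End sobolev_space.

(** * The elliptic form *)

Section elliptic_form.
Context {R : realType} {n : nat}.
Local Notation V := 'rV[R]_n.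
Local Notation leb := (@lebesgue_rV R n).
Variable Omega : set V.
Hypothesis (oO : open Omega) (bO : bounded_set Omega).
Variables (A : V -> 'M[R]_n) (a0 : R).
Hypothesis hA : elliptic_matrix Omega A a0.
Implicit Types (f g phi psi : V -> R).
Let mO := measurable_domain oO.
Local Notation H1 := (in_H1 Omega).
Local Notation L2O := (L2 leb Omega).
Local Notation ip := (ip2 leb Omega).
Let sL2 := subspace_L2 leb mO.
Let fip := form_ip2 leb mO.
Let sH1 := subspace_H1 oO bO.

Lemma closure_bounded_continuous f : {within closure Omega, continuous f} ->
  exists B, forall x, Omega x -> `|f x| <= B.
Proof.
move=> cf; have bC : bounded_set (closure Omega).
  have [M hM] := bounded_rV_cbox bO.
  have [K [Kr hK]] := bounded_cbox (fun _ : 'I_n => - M) (fun _ => M).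
  exists K; split => // y Ky x Ox; apply: (hK y Ky).
  rewrite [X in X x](closure_id _).1; [exact: closureS Ox|exact: closed_cbox].
have [B [_ hB]] := compact_bounded (continuous_compact cf (bounded_closed_compact bC
  (@closed_closure _ _))).
exists (B + 1) => x Ox; apply: (hB (B + 1)); first by rewrite ltrDl.
by exists x => //; exact: subset_closure.
Qed.

Lemma coefficient_measurable i j : measurable_fun Omega (fun x => A x i j).
Proof.
have [_ _ hC _] := hA; have [cA _] := hC i j.
apply: continuous_measurable_rV => // x Ox.
have cO : {within Omega, continuous (fun x => A x i j)}.
  by apply: continuous_subspaceW cA; exact: subset_closure.
by move: cO; rewrite continuous_open_subspace// => /(_ x); apply; rewrite inE.
Qed.

Lemma coefficient_bounded : exists2 B, 0 <= B & forall i j x, Omega x -> `|A x i j| <= B.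
Proof.
have h (k : 'I_n * 'I_n) : exists B, forall x, Omega x -> `|A x k.1 k.2| <= B.
  have [_ _ hC _] := hA; have [cA _] := hC k.1 k.2; exact: closure_bounded_continuous cA.
have [B hB] := choice h; exists (\sum_k `|B k|); first by apply: sumr_ge0.
move=> i j x Ox; apply: le_trans (hB (i, j) x Ox) _.
rewrite (bigD1 (i, j))//=; apply: le_trans (ler_norm _) _.
by rewrite lerDl; apply: sumr_ge0.
Qed.

Lemma L2_mul_coefficient i j f : L2O f -> L2O (fun x => A x i j * f x).
Proof.
move=> [mf If]; have [B B0 hB] := coefficient_bounded.
have mA := coefficient_measurable i j.
split; first exact: measurable_funM.
apply: (rintegrable_le mO _ (rintegrableZ mO (B ^+ 2) If)).
  by apply: measurable_funX; exact: measurable_funM.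
move=> x Ox; rewrite normrX normrM exprMn !real_normK ?num_real//.
apply: ler_wpM2r; first exact: sqr_ge0.
by rewrite -[leLHS]real_normK ?num_real// lerXn2r ?nnegrE// hB.
Qed.

Lemma L2_coefficient_le i j f B : 0 <= B -> (forall x, Omega x -> `|A x i j| <= B) -> L2O f ->
  Num.sqrt (ip (fun x => A x i j * f x) (fun x => A x i j * f x)) <= B * Num.sqrt (ip f f).
Proof.
move=> B0 hB Lf; have LA := L2_mul_coefficient i j Lf.
rewrite -{1}(ger0_norm B0) -sqrtr_sqr -sqrtrM ?sqr_ge0// ler_sqrt; last first.
  by rewrite mulr_ge0 ?sqr_ge0 ?(form_on_ge0 fip).
rewrite !ip2E -RintegralZl//; last exact: L2_mul.
apply: le_Rintegral => //; [exact: L2_mul|by apply: rintegrableZ => //; exact: L2_mul|].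
move=> x Ox; rewrite -!expr2 exprMn; apply: ler_wpM2r; first exact: sqr_ge0.
by rewrite -[leLHS]real_normK ?num_real// lerXn2r ?nnegrE// hB.
Qed.

Lemma a_formE f g : H1 f -> H1 g -> a_form Omega A f g =
  \sum_(i < n) \sum_(j < n)
    ip (fun x => A x i j * wpartial Omega j f x) (wpartial Omega i g).
Proof.
move=> Hf Hg.
have I i j : rintegrable leb Omega
    (fun x => A x i j * wpartial Omega j f x * wpartial Omega i g x).
  by apply: L2_mul => //; [apply: L2_mul_coefficient|]; exact: wpartial_L2.
rewrite /a_form; under eq_Rintegral do under eq_bigr do under eq_bigr do rewrite -!wpartialE.
rewrite Rintegral_sum//; last by move=> i; exact: rintegrable_sum.
apply: eq_bigr => i _; rewrite Rintegral_sum//.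
by apply: eq_bigr => j _; rewrite ip2E.
Qed.

Lemma form_a_form : form_on H1 (a_form Omega A).
Proof.
have LA f i j : H1 f -> L2O (fun x => A x i j * wpartial Omega j f x).
  by move=> Hf; apply: L2_mul_coefficient; exact: wpartial_L2.
have LW := wpartial_L2 oO.
split.
- move=> f Hf; split => [g h Hg Hh|c g Hg].
    have Hgh := subspaceB sH1 Hg Hh.
    rewrite !a_formE// -sumrB; apply: eq_bigr => i _.
    rewrite -sumrB; apply: eq_bigr => j _.
    rewrite -(formBr fip (LA _ i j Hf) (LW i _ Hg) (LW i _ Hh)).
    apply: (ip_ae oO (LA _ i j Hf) (LW i _ Hgh) (LA _ i j Hf) (L2B mO (LW i _ Hg) (LW i _ Hh))).
      by apply: aeW.
    exact: (wpartialB oO bO i Hg Hh).2.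
  have Hcg := subspaceZ sH1 c Hg.
  rewrite !a_formE// mulr_sumr; apply: eq_bigr => i _.
  rewrite mulr_sumr; apply: eq_bigr => j _.
  rewrite -(formZr fip _ (LA _ i j Hf) (LW i _ Hg)).
  apply: (ip_ae oO (LA _ i j Hf) (LW i _ Hcg) (LA _ i j Hf) (L2Z mO c (LW i _ Hg))).
    by apply: aeW.
  exact: (wpartialZ oO bO c i Hg).2.
- move=> f g Hf Hg; rewrite !a_formE// exchange_big/=; apply: eq_bigr => i _.
  apply: eq_bigr => j _; rewrite !ip2E; apply: eq_Rintegral => x; rewrite inE => Ox.
  have [_ sA _ _] := hA; have /(congr1 (fun M : 'M[R]_n => M i j)) := sA _ (subset_closure Ox).
  by rewrite mxE => ->; ring.
- move=> f Hf; apply: Rintegral_ge0 => x Ox; have [a0p _ _ eA] := hA.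
  have := eA _ (subset_closure Ox) (wgrad Omega f x).
  have h0 : 0 <= a0 * enorm (wgrad Omega f x) ^+ 2 by rewrite mulr_ge0 ?sqr_ge0// ltW.
  move=> /(le_trans h0); congr (_ <= _).
  by apply: eq_bigr => i _; apply: eq_bigr => j _; rewrite mulrAC.
Qed.

Lemma a_form_bounded : exists2 CA, 0 <= CA & forall f g, H1 f -> H1 g ->
  `|a_form Omega A f g| <= CA * h1norm Omega f * h1norm Omega g.
Proof.
have [B B0 hB] := coefficient_bounded.
exists (\sum_(i < n) \sum_(j < n) B).
  by apply: sumr_ge0 => i _; apply: sumr_ge0.
move=> f g Hf Hg; rewrite a_formE// !mulr_suml.
apply: le_trans (ler_norm_sum _ _ _) _; apply: ler_sum => i _.
apply: le_trans (ler_norm_sum _ _ _) _; apply: ler_sum => j _.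
have Lf := wpartial_L2 oO j Hf; have Lg := wpartial_L2 oO i Hg.
apply: le_trans (form_CS_sqrt sL2 fip (L2_mul_coefficient i j Lf) Lg) _.
apply: ler_pM; rewrite ?sqrtr_ge0//.
  apply: le_trans (L2_coefficient_le B0 (hB i j) Lf) _.
  by apply: ler_wpM2l => //; exact: wpartial_le_h1norm.
exact: wpartial_le_h1norm.
Qed.

Lemma a_form_ae f g f' g' : H1 f -> H1 g -> H1 f' -> H1 g' ->
  ae_eq_on Omega f f' -> ae_eq_on Omega g g' -> a_form Omega A f g = a_form Omega A f' g'.
Proof.
move=> Hf Hg Hf' Hg' ff gg; rewrite /a_form; have L := in_H1_L2 oO.
by rewrite (wgrad_ae oO bO (L _ Hf) (L _ Hf') ff) (wgrad_ae oO bO (L _ Hg) (L _ Hg') gg).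
Qed.

End elliptic_form.

(** * The logarithmic source *)

Section log_source_bounds.
Context {R : realType}.
Variables (q s : R).
Hypotheses (q2 : 2 < q) (qs : q < s).
Implicit Types (a b c m x y : R).
Local Ltac slra := generalize q2 qs; lra.

Definition log_weight x := `|x| `^ (q - 2) * ln `|x|.

(** The primitive |x|^q log|x| / q - |x|^q / q^2 of the source, written with a factor x^2 so that
    the bounds on [log_weight] apply to it. *)
Definition log_potential x :=
  log_weight x * x ^+ 2 / q - `|x| `^ (q - 2) * x ^+ 2 / q ^+ 2.

Lemma log_sourceE x : log_source q x = log_weight x * x.
Proof. by rewrite /log_source /log_weight mulrAC. Qed.

Lemma powR_sqr x : `|x| `^ (q - 2) * x ^+ 2 = `|x| `^ q.
Proof.
have [->|x0] := eqVneq x 0; first by rewrite normr0 expr0n mulr0 powR0// gt_eqF//; slra.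
rewrite -[x ^+ 2]real_normK ?num_real// -powR_mulrn// -powRD_gt0 ?normr_gt0//.
by congr (_ `^ _); ring.
Qed.

Lemma log_source_mul x : log_source q x * x = `|x| `^ q * ln `|x|.
Proof. by rewrite log_sourceE /log_weight -powR_sqr; ring. Qed.

Lemma log_potentialE x :
  log_potential x = log_source q x * x / q - `|x| `^ q / q ^+ 2.
Proof. by rewrite log_source_mul /log_potential /log_weight -powR_sqr; congr (_ / _ - _);
  ring. Qed.

Lemma powR_le_weight m x r : `|x| <= m -> 0 <= r -> r <= s - 2 -> `|x| `^ r <= (1 + m) `^ (s - 2).
Proof.
move=> xm r0 rs; have x0 := normr_ge0 x.
apply: (@le_trans _ _ ((1 + m) `^ r)).
  by apply: ge0_ler_powR; rewrite ?nnegrE//; slra.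
by apply: ler_powR => //; slra.
Qed.

Lemma weight_ge1 m : 0 <= m -> 1 <= (1 + m) `^ (s - 2).
Proof. by move=> m0; rewrite -[leLHS](powRr0 (1 + m)); apply: ler_powR; slra. Qed.

Definition log_weight_cst := (s - q)^-1 + (q - 2)^-1.

Lemma log_weight_cst_ge0 : 0 <= log_weight_cst.
Proof. by rewrite addr_ge0// invr_ge0; slra. Qed.

Lemma ln_le_powR x r : 0 < x -> 0 < r -> ln x <= x `^ r / r.
Proof.
move=> x0 r0; rewrite ler_pdivlMr// mulrC -ln_powR.
by apply: ltW; apply: ln_sublinear; exact: powR_gt0.
Qed.

(** For |x| >= 1 the logarithm is at most |x|^(s-q) / (s-q). For |x| < 1 its absolute value is at
    most |x|^(-(q-2)) / (q-2), and the factor |x|^(q-2) cancels the singularity. These are the two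
    terms of [log_weight_cst]. *)
Lemma log_weight_le m x : `|x| <= m -> `|log_weight x| <= log_weight_cst * (1 + m) `^ (s - 2).
Proof.
move=> xm; have m0 : 0 <= m by exact: le_trans xm.
have w1 := weight_ge1 m0; have C0 : 0 <= (s - q)^-1 by rewrite invr_ge0; slra.
have C1 : 0 <= (q - 2)^-1 by rewrite invr_ge0; slra.
rewrite /log_weight /log_weight_cst normrM (ger0_norm (powR_ge0 _ _)) mulrDl.
have [->|x0] := eqVneq x 0.
  by rewrite normr0 ln0// normr0 mulr0 addr_ge0// mulr_ge0//; slra.
have xp : 0 < `|x| by rewrite normr_gt0.
have [x1|x1] := leP 1 `|x|.
  rewrite (ger0_norm (ln_ge0 x1)); apply: ler_wpDr; first by rewrite mulr_ge0//; slra.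
  have sq0 : 0 < s - q by slra.
  apply: le_trans (ler_wpM2l (powR_ge0 _ _) (ln_le_powR xp sq0)) _.
  rewrite mulrA -powRD_gt0// mulrC; apply: ler_wpM2l => //.
  have -> : q - 2 + (s - q) = s - 2 by ring.
  by apply: powR_le_weight => //; slra.
apply: ler_wpDl; first by rewrite mulr_ge0//; slra.
have lx : ln `|x| <= 0 by apply: ln_le0; exact: ltW.
rewrite (ler0_norm lx) -lnV ?posrE//.
have q20 : 0 < q - 2 by slra.
have xi : 0 < `|x|^-1 by rewrite invr_gt0.
apply: le_trans (ler_wpM2l (powR_ge0 _ _) (ln_le_powR xi q20)) _.
rewrite mulrA -powRM ?(ltW xp) ?(ltW xi)// mulfV ?gt_eqF// powR1 mul1r.
by rewrite ler_peMr.
Qed.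

Lemma is_derive_log_source x : 0 < x ->
  is_derive x 1 (fun x : R => x `^ (q - 1) * ln x) ((q - 1) * log_weight x + x `^ (q - 2)).
Proof.
move=> x0; have h1 := @is_derive1_powR R (q - 1) x x0; have h2 := is_derive1_ln x0.
have := is_deriveM h1 h2; congr is_derive.
rewrite /log_weight gtr0_norm// /GRing.scale/=.
have -> : x `^ (q - 1) = x `^ (q - 2) * x.
  by rewrite -[in X in _ = _ * X](powRr1 (ltW x0)) -powRD_gt0//; congr (_ `^ _); ring.
have -> : q - 1 - 1 = q - 2 by ring.
by field; rewrite gt_eqF.
Qed.

Lemma is_derive_log_potential x : 0 < x ->
  is_derive x 1 (fun x : R => x `^ q * ln x / q - x `^ q / q ^+ 2) (log_source q x).
Proof.
move=> x0; have h1 := @is_derive1_powR R q x x0; have h2 := is_derive1_ln x0.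
have h3 := is_deriveM h1 h2.
have h4 := is_deriveB (is_deriveZ q^-1 h3) (is_deriveZ (q ^+ 2)^-1 h1).
have -> : (fun x : R => x `^ q * ln x / q - x `^ q / q ^+ 2)
    = q^-1 *: ((@powR R)^~ q * @ln R) - (q ^+ 2)^-1 *: ((@powR R)^~ q).
  by apply/funext => y; rewrite !fctE /GRing.scale/=; ring.
move: h4; congr is_derive.
rewrite /log_source gtr0_norm// /GRing.scale/=.
have -> : x `^ q = x `^ (q - 2) * x * x.
  by rewrite -[in X in _ * X * X](powRr1 (ltW x0)) -!powRD_gt0//; congr (_ `^ _); ring.
have -> : x `^ (q - 1) = x `^ (q - 2) * x.
  by rewrite -[in X in _ = _ * X](powRr1 (ltW x0)) -powRD_gt0//; congr (_ `^ _); ring.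
by field; rewrite !gt_eqF//; slra.
Qed.

Lemma log_source_gt0 x : 0 < x -> log_source q x = x `^ (q - 1) * ln x.
Proof.
move=> x0; rewrite /log_source gtr0_norm//; congr (_ * _).
by rewrite -[in X in _ * X](powRr1 (ltW x0)) -powRD_gt0//; congr (_ `^ _); ring.
Qed.

Lemma log_potential_gt0 x : 0 < x ->
  log_potential x = x `^ q * ln x / q - x `^ q / q ^+ 2.
Proof. by move=> x0; rewrite log_potentialE log_source_mul gtr0_norm. Qed.

Lemma log_sourceN x : log_source q (- x) = - log_source q x.
Proof. by rewrite /log_source normrN; ring. Qed.

Lemma log_potentialN x : log_potential (- x) = log_potential x.
Proof. by rewrite /log_potential /log_weight normrN sqrrN. Qed.

Definition log_source_cst := (q - 1) * log_weight_cst + 1.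

Lemma log_source_cst_ge : 0 <= log_source_cst /\ log_weight_cst <= log_source_cst.
Proof.
have C0 := log_weight_cst_ge0.
have : 0 <= (q - 2) * log_weight_cst by rewrite mulr_ge0//; slra.
by rewrite /log_source_cst; move: q2 C0; slra.
Qed.

Lemma log_source_lip_gt0 m a b : 0 < a -> 0 < b -> a <= m -> b <= m ->
  `|log_source q b - log_source q a| <= log_source_cst * (1 + m) `^ (s - 2) * `|b - a|.
Proof.
wlog ab : a b / a <= b.
  move=> h a0 b0 am bm; have [ab|/ltW ba] := leP a b; first exact: h.
  by rewrite distrC [`|b - a|]distrC; apply: h.
move=> a0 b0 am bm; rewrite !log_source_gt0//.
have hd z : z \in `]a, b[ -> is_derive z 1 (fun x : R => x `^ (q - 1) * ln x)
     ((q - 1) * log_weight z + z `^ (q - 2)).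
  by rewrite in_itv/= => /andP[az _]; apply: is_derive_log_source; slra.
have [|c + ->] := MVT_segment ab hd.
  apply: derivable_within_continuous => z; rewrite in_itv/= => /andP[az _].
  by have [] := is_derive_log_source (lt_le_trans a0 az).
rewrite in_itv/= => /andP[ac cb]; rewrite normrM; apply: ler_wpM2r => //.
have cm : `|c| <= m by rewrite gtr0_norm; slra.
apply: le_trans (ler_normD _ _) _; rewrite /log_source_cst [leRHS]mulrDl [X in _ <= _ + X]mul1r;
  apply: lerD.
  rewrite normrM gtr0_norm; last slra.
  by rewrite -mulrA; apply: ler_wpM2l; [slra|exact: log_weight_le].
rewrite (ger0_norm (powR_ge0 _ _)) -{1}(gtr0_norm (lt_le_trans a0 ac)).
by apply: powR_le_weight => //; slra.
Qed.

Lemma log_source_le m a : `|a| <= m -> `|log_source q a| <= log_source_cst * (1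
  + m) `^ (s - 2) * `|a|.
Proof.
move=> am; rewrite log_sourceE normrM; apply: ler_wpM2r => //.
apply: le_trans (log_weight_le am) _; apply: ler_wpM2r; first exact: powR_ge0.
by have [] := log_source_cst_ge.
Qed.

Lemma log_potential_le m a : `|a| <= m ->
  `|log_potential a| <= log_source_cst * (1 + m) `^ (s - 2) * a ^+ 2.
Proof.
move=> am; have w0 := powR_ge0 (1 + m) (s - 2).
have -> : log_potential a = (log_weight a / q - `|a| `^ (q - 2) / q ^+ 2) * a ^+ 2.
  by rewrite /log_potential; ring.
rewrite normrM (ger0_norm (sqr_ge0 a)); apply: ler_wpM2r; first exact: sqr_ge0.
apply: le_trans (ler_normB _ _) _;
  rewrite (normrM (log_weight a)) (normrM (`|a| `^ (q - 2)) (q ^+ 2)^-1).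
rewrite [X in _ + X * _](ger0_norm (powR_ge0 _ _)).
have q1 : q^-1 <= 1 by rewrite invf_le1; slra.
have q0 : 0 < q^-1 by rewrite invr_gt0; slra.
have qq : (q ^+ 2)^-1 <= 1 by rewrite invf_le1 ?exprn_gt0 ?expr_ge1//; slra.
have qq0 : 0 < (q ^+ 2)^-1 by rewrite invr_gt0 exprn_gt0//; slra.
rewrite (gtr0_norm q0) (gtr0_norm qq0).
have h1 := log_weight_le am.
have h2 : `|a| `^ (q - 2) <= (1 + m) `^ (s - 2) by apply: powR_le_weight => //; slra.
have h3 : `|log_weight a| / q <= `|log_weight a| by rewrite ler_piMr.
have h4 : `|a| `^ (q - 2) / q ^+ 2 <= `|a| `^ (q - 2) by rewrite ler_piMr// powR_ge0.
have h5 : 0 <= (q - 2) * log_weight_cst * (1 + m) `^ (s - 2).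
  by rewrite !mulr_ge0 ?log_weight_cst_ge0//; slra.
by rewrite /log_source_cst; move: h1 h2 h3 h4 h5; slra.
Qed.

(* Points of opposite signs: |a| + |b| = |a - b|, so the bounds at 0 suffice. *)
Lemma opposite_norm a b : a * b <= 0 -> `|a| <= `|b - a| /\ `|b| <= `|b - a|.
Proof.
move=> ab; have h x y : x * y <= 0 -> `|x| <= `|y - x|.
  move=> xy; rewrite -ler_sqr ?nnegrE// !real_normK ?num_real// sqrrB.
  by have := sqr_ge0 y; rewrite -mulr_natr [y * x]mulrC; slra.
by split; [exact: h|rewrite distrC; apply: h; rewrite mulrC].
Qed.

Lemma log_source_lip m a b : `|a| <= m -> `|b| <= m ->
  `|log_source q b - log_source q a| <= 2 * log_source_cst * (1 + m) `^ (s - 2) * `|b - a|.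
Proof.
move=> am bm; have [C0 _] := log_source_cst_ge; have w0 := powR_ge0 (1 + m) (s - 2).
have key x y : 0 < x -> 0 < y -> `|x| <= m -> `|y| <= m ->
    `|log_source q y - log_source q x| <= 2 * log_source_cst * (1 + m) `^ (s - 2) * `|y - x|.
  move=> x0 y0; rewrite (gtr0_norm x0) (gtr0_norm y0) => xm ym;
    apply: le_trans (log_source_lip_gt0 x0 y0 xm ym) _.
  by rewrite -!mulrA ler_peMl ?mulr_ge0// ler1n.
have [ab|ab] := leP (a * b) 0.
  have [h1 h2] := opposite_norm ab.
  have C : 0 <= log_source_cst * (1 + m) `^ (s - 2) by rewrite mulr_ge0.
  apply: le_trans (ler_normB _ _) _.
  have := le_trans (log_source_le am) (ler_wpM2l C h1).
  have := le_trans (log_source_le bm) (ler_wpM2l C h2).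
  by slra.
have [a0|a0] := leP a 0.
  have a0' : 0 < - a by rewrite oppr_gt0 lt_neqAle a0 andbT; apply: contraTneq ab => ->;
    rewrite mul0r ltxx.
  have b0' : 0 < - b by rewrite -(pmulr_rgt0 _ a0') mulrNN.
  have := key _ _ a0' b0'; rewrite !normrN !log_sourceN => /(_ am bm).
  have N x y : - y - - x = - (y - x) by ring.
  by rewrite !N !normrN.
by apply: key => //; rewrite -(pmulr_rgt0 _ a0).
Qed.

Lemma log_potential_MVT a b : 0 < a -> 0 < b ->
  exists2 c, Num.min a b <= c <= Num.max a b &
    log_potential b - log_potential a = log_source q c * (b - a).
Proof.
wlog ab : a b / a <= b.
  move=> h a0 b0; have /orP[ab|ba] := le_total a b; first exact: h.
  have [c cab E] := h _ _ ba b0 a0; exists c; first by rewrite minC maxC.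
  by rewrite -opprB E; ring.
move=> a0 b0; rewrite (min_idPl ab) (max_idPr ab) !log_potential_gt0//.
have hd z : z \in `]a, b[ -> is_derive z 1 (fun x : R => x `^ q * ln x / q - x `^ q / q ^+ 2)
  (log_source q z).
  by rewrite in_itv/= => /andP[az _]; apply: is_derive_log_potential; slra.
have [|c + ->] := MVT_segment ab hd.
  apply: derivable_within_continuous => z; rewrite in_itv/= => /andP[az _].
  by have [] := is_derive_log_potential (lt_le_trans a0 az).
by rewrite in_itv/=; exists c.
Qed.

(** For equal signs the mean value theorem produces the source at an intermediate point, and its
    Lipschitz bound makes the remainder quadratic. For opposite signs each term is bounded
    separately by the square of b - a. *)
Lemma log_potential_taylor m a b : `|a| <= m -> `|b| <= m ->
  `|log_potential b - log_potential a - log_source q a * (b - a)|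
    <= 3 * log_source_cst * (1 + m) `^ (s - 2) * (b - a) ^+ 2.
Proof.
move=> am bm; have [C0 _] := log_source_cst_ge; have w0 := powR_ge0 (1 + m) (s - 2).
have C : 0 <= log_source_cst * (1 + m) `^ (s - 2) by rewrite mulr_ge0.
have key x y : 0 < x -> 0 < y -> `|x| <= m -> `|y| <= m ->
    `|log_potential y - log_potential x - log_source q x * (y - x)|
    <= 3 * log_source_cst * (1 + m) `^ (s - 2) * (y - x) ^+ 2.
  move=> x0 y0 xm ym; have [c /andP[c1 c2] ->] := log_potential_MVT x0 y0.
  have c0 : 0 < c by apply: lt_le_trans c1; rewrite lt_min x0.
  have cm : `|c| <= m.
    by rewrite gtr0_norm//; apply: le_trans c2 _;
      rewrite ge_max -(gtr0_norm x0) xm -(gtr0_norm y0).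
  have cx : `|c - x| <= `|y - x|.
    move: c1 c2; rewrite /Num.min /Num.max; case: (ltgtP x y) => xy.
    - by move=> c1 c2; rewrite !ger0_norm; slra.
    - by move=> c1 c2; rewrite !ler0_norm; slra.
    - by rewrite xy => c1 c2; have -> : c = y by slra.
  rewrite -mulrBl normrM; apply: le_trans (ler_wpM2r (normr_ge0 _) (log_source_lip xm cm)) _.
  have h := ler_wpM2l C (ler_wpM2r (normr_ge0 (y - x)) cx).
  move: h; rewrite -!expr2 real_normK ?num_real//.
  have : 0 <= log_source_cst * (1 + m) `^ (s - 2) * (y - x) ^+ 2 by rewrite mulr_ge0 ?sqr_ge0.
  by slra.
have [ab|ab] := leP (a * b) 0.
  have [h1 h2] := opposite_norm ab.
  have sq x y : `|x| <= `|y| -> x ^+ 2 <= y ^+ 2.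
    by move=> h; rewrite -[x ^+ 2]real_normK ?num_real// -[y ^+ 2]real_normK ?num_real//
      lerXn2r ?nnegrE.
  apply: le_trans (ler_normB _ _) _; rewrite normrM.
  have e1 := le_trans (log_potential_le am) (ler_wpM2l C (sq _ _ h1)).
  have e2 := le_trans (log_potential_le bm) (ler_wpM2l C (sq _ _ h2)).
  have e3 := ler_wpM2r (normr_ge0 (b - a)) (le_trans (log_source_le am) (ler_wpM2l C h1)).
  have e4 := ler_normB (log_potential b) (log_potential a).
  have e5 : `|b - a| * `|b - a| = (b - a) ^+ 2 by rewrite -expr2 real_normK ?num_real.
  by move: e1 e2 e3 e4; rewrite -[_ * _ * `|b - a|]mulrA e5; slra.
have [a0|a0] := leP a 0.
  have a0' : 0 < - a by rewrite oppr_gt0 lt_neqAle a0 andbT; apply: contraTneq ab => ->;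
    rewrite mul0r ltxx.
  have b0' : 0 < - b by rewrite -(pmulr_rgt0 _ a0') mulrNN.
  have := key _ _ a0' b0'; rewrite !normrN !log_potentialN log_sourceN => /(_ am bm).
  have -> : - b - - a = - (b - a) by ring.
  by rewrite mulrNN sqrrN.
by apply: key => //; rewrite -(pmulr_rgt0 _ a0).
Qed.

(** With y = |x|^(s-q) this is log y <= y/e, an equality at y = e; the factor 1/(e gamma) is the one
    that appears in [r_star]. *)
Lemma powR_ln_le x : `|x| `^ q * ln `|x| <= (expR 1 * (s - q))^-1 * `|x| `^ s.
Proof.
have g0 : 0 < s - q by slra.
have [->|x0] := eqVneq x 0.
  by rewrite normr0 !powR0 ?gt_eqF//; slra.
have xp : 0 < `|x| by rewrite normr_gt0.
have -> : s = q + (s - q) by ring.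
rewrite powRD_gt0// mulrCA ler_wpM2l ?powR_ge0//.
have -> : q + (s - q) - q = s - q by ring.
rewrite invfM [leRHS]mulrC mulrA ler_pdivlMr// [leLHS]mulrC -ln_powR.
set y := _ `^ _; have y0 : 0 < y by exact: powR_gt0.
(* The tangent inequality log(1 + z) <= z at z = y/e - 1. *)
have := @le_ln1Dx R (y / expR 1 - 1).
rewrite addrCA subrr addr0 ln_div ?posrE ?expR_gt0// expRK.
have : 0 < y / expR 1 by rewrite divr_gt0 ?expR_gt0.
by move=> h /(_ ltac:(slra)); slra.
Qed.

(** For |x| >= e the logarithm is at least 1. Below e the power is at most e^q, while the
    logarithmic term is at least -1/q, hence at least -1. *)
Lemma powR_le_ln x : `|x| `^ q <= (expR 1 `^ q + 1) + `|x| `^ q * ln `|x|.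
Proof.
have e0 := expR_gt0 (1 : R).
have [ex|xe] := leP (expR 1) `|x|.
  have h : 1 <= ln `|x| by rewrite -[1]expRK ler_ln ?posrE//; exact: lt_le_trans ex.
  have := ler_wpM2l (powR_ge0 `|x| q) h; rewrite mulr1.
  by have := powR_ge0 (expR (1 : R)) q; slra.
have h1 : `|x| `^ q <= expR 1 `^ q.
  by apply: ge0_ler_powR; rewrite ?nnegrE//; slra.
suff : - 1 <= `|x| `^ q * ln `|x| by slra.
have [->|x0] := eqVneq x 0; first by rewrite normr0 ln0// mulr0; slra.
have xp : 0 < `|x| by rewrite normr_gt0.
have [x1|x1] := leP 1 `|x|.
  by apply: (@le_trans _ _ 0); [slra|rewrite mulr_ge0 ?powR_ge0 ?ln_ge0].
have q0 : 0 < q by slra.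
have xi : 0 < `|x|^-1 by rewrite invr_gt0.
rewrite lerNl -mulrN -lnV ?posrE//.
apply: le_trans (ler_wpM2l (powR_ge0 _ _) (ln_le_powR xi q0)) _.
rewrite mulrA -powRM ?(ltW xp) ?(ltW xi)// mulfV ?gt_eqF// powR1 mul1r invf_le1//; slra.
Qed.

(** The first term accounts for |x| <= l, the second for |x| > l. *)
Lemma powR_interpolation l x r : 0 < l -> 0 < r -> r <= q ->
  `|x| `^ r <= l `^ r + l `^ (r - q) * `|x| `^ q.
Proof.
move=> l0 r0 rq; have [xl|lx] := leP `|x| l.
  apply: ler_wpDr; first by rewrite mulr_ge0 ?powR_ge0.
  by apply: ge0_ler_powR; rewrite ?nnegrE// ltW.
have xp : 0 < `|x| by exact: lt_trans lx.
apply: ler_wpDl; first exact: powR_ge0.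
have -> : `|x| `^ r = `|x| `^ (r - q) * `|x| `^ q.
  by rewrite -powRD_gt0//; congr (_ `^ _); ring.
apply: ler_wpM2r; first exact: powR_ge0.
have -> : r - q = - (q - r) by ring.
rewrite !powRN lef_pV2 ?posrE ?powR_gt0//.
by apply: ge0_ler_powR; rewrite ?nnegrE ?(ltW l0) ?(ltW xp) ?(ltW lx)//; slra.
Qed.

End log_source_bounds.

Lemma powR_mul_sqr {R : realType} (s x : R) : 2 < s -> 0 <= x -> x `^ (s - 2) * x ^+ 2 = x `^ s.
Proof. by move=> s2 x0; have := @powR_sqr _ s (s + 1) s2 ltac:(lra) x; rewrite ger0_norm. Qed.

(** Every factor is at most the largest of the three numbers, whose power s is one of the summands;
    a Young inequality with crude constants. *)
Lemma powR_young3 {R : realType} (s x y z : R) : 2 < s -> 0 <= x -> 0 <= y -> 0 <= z ->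
  x `^ (s - 2) * (y * z) <= x `^ s + y `^ s + z `^ s.
Proof.
move=> s2 x0 y0 z0; set M := Num.max x (Num.max y z).
have [xM yM zM] : [/\ x <= M, y <= M & z <= M] by rewrite !le_max !lexx !orbT.
have M0 : 0 <= M by exact: le_trans xM.
apply: (@le_trans _ _ (M `^ (s - 2) * M ^+ 2)).
  apply: ler_pM; rewrite ?powR_ge0 ?mulr_ge0//.
    by apply: ge0_ler_powR; rewrite ?nnegrE//; lra.
  by rewrite expr2; apply: ler_pM.
rewrite powR_mul_sqr//; have px := powR_ge0 x s; have py := powR_ge0 y s; have pz := powR_ge0 z s.
by rewrite /M /Num.max; case: ifP => _; [case: ifP => _|]; lra.
Qed.

Lemma powR_add3 {R : realType} (s x y : R) : 0 <= s -> 0 <= x -> 0 <= y ->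
  (1 + (x + y)) `^ s <= 3 `^ s * (1 + (x `^ s + y `^ s)).
Proof.
move=> s0 x0 y0; set M := Num.max 1 (Num.max x y).
have [M1 xM yM] : [/\ 1 <= M, x <= M & y <= M] by rewrite !le_max !lexx !orbT.
apply: (@le_trans _ _ ((3 * M) `^ s)).
  by apply: ge0_ler_powR; rewrite ?nnegrE//; lra.
rewrite powRM//; last lra.
apply: ler_wpM2l; first exact: powR_ge0.
have px := powR_ge0 x s; have py := powR_ge0 y s.
by rewrite /M /Num.max; case: ifP => _; [case: ifP => _|]; rewrite ?powR1; lra.
Qed.

Lemma powR_div {R : realType} (s a b : R) : 0 <= a -> 0 < b ->
  (b `^ s)^-1 * a `^ s = (a / b) `^ s.
Proof.
move=> a0 b0; rewrite powRM ?invr_ge0 ?(ltW b0)// mulrC; congr (_ * _).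
by rewrite -powRN -(powR_inv1 (ltW b0)) -powRrM mulN1r.
Qed.

(** * Integrals against a power weight *)

Section weighted_integrals.
Context {d : measure_display} {T : measurableType d} {R : realType}.
Variables (mu : {measure set T -> \bar R}) (D : set T).
Hypothesis mD : measurable D.
Hypothesis Dfin : (mu D < +oo)%E.
Variable s : R.
Hypothesis s2 : 2 < s.
Implicit Types f g m z w : T -> R.
Local Notation I f := (\int[mu]_(x in D) f x)%R.
Local Ltac slra := generalize s2; clear -mD Dfin s2; lra.
Let s0 : 0 <= s. Proof. by slra. Qed.
Let s20 : 0 <= s - 2. Proof. by slra. Qed.

Lemma measurable_norm_powR f r : measurable_fun D f -> measurable_fun D (fun x => `|f x| `^ r).
Proof.
by move=> mf; apply: (measurableT_comp (measurable_powR r)); exact: measurableT_comp.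
Qed.

Lemma rintegrable_norm_powR_le f r : 0 < r -> r <= s -> measurable_fun D f ->
  rintegrable mu D (fun x => `|f x| `^ s) -> rintegrable mu D (fun x => `|f x| `^ r).
Proof.
move=> r0 rs mf If; apply: (rintegrable_le mD _ (rintegrableD mD (rintegrable_cst mD Dfin 1) If)).
  exact: measurable_norm_powR.
move=> x _; rewrite ger0_norm ?powR_ge0//.
have [h|h] := leP 1 `|f x|; first by apply: ler_wpDl => //; exact: ler_powR.
apply: ler_wpDr; first exact: powR_ge0.
have <- : 1 `^ r = 1 :> R by rewrite powR1.
by apply: ge0_ler_powR; rewrite ?nnegrE ?(ltW h)// ltW.
Qed.

(** Hölder's inequality with the exponents s/(s-2), s and s, up to constants: [powR_young3] is
    integrated for the normalized functions. *)
Lemma weighted_integral m z w (Ms Z W : R) : (forall x, 0 <= m x) -> 0 <= Z -> 0 <= W ->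
  measurable_fun D m -> measurable_fun D z -> measurable_fun D w ->
  rintegrable mu D (fun x => (1 + m x) `^ s) -> I (fun x => (1 + m x) `^ s) <= Ms ->
  rintegrable mu D (fun x => `|z x| `^ s) -> I (fun x => `|z x| `^ s) <= Z `^ s ->
  rintegrable mu D (fun x => `|w x| `^ s) -> I (fun x => `|w x| `^ s) <= W `^ s ->
  rintegrable mu D (fun x => (1 + m x) `^ (s - 2) * (`|z x| * `|w x|)) /\
  I (fun x => (1 + m x) `^ (s - 2) * (`|z x| * `|w x|)) <= (Ms + 2) * (Z * W).
Proof.
move=> m0 Z0 W0 mm mz mw Im hm Iz hz Iw hw.
have I1 : rintegrable mu D (fun x => (1 + m x) `^ (s - 2) * (`|z x| * `|w x|)).
  apply: (rintegrable_le mD _ (rintegrableD mD (rintegrableD mD Im Iz) Iw)).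
    apply: measurable_funM; last by apply: measurable_funM; exact: measurableT_comp.
    apply: (measurableT_comp (measurable_powR (s - 2))).
    by apply: measurable_funD.
  move=> x _; rewrite ger0_norm ?mulr_ge0 ?powR_ge0//.
  by apply: powR_young3 => //; rewrite addr_ge0.
split => //.
have Ms0 : 0 <= Ms by apply: le_trans hm; apply: Rintegral_ge0 => x _; exact: powR_ge0.
(* [Z] and [W] may vanish, so the functions are normalized by [Z + e] and [W + e]. *)
apply: (@le_of_small _ _ _ ((Ms + 2) * (Z + W + 1))).
  by rewrite mulr_ge0 ?addr_ge0.
move=> e e0 e1.
have Ze : 0 < Z + e by rewrite ltr_wpDl.
have We : 0 < W + e by rewrite ltr_wpDl.
have Zs : 0 < (Z + e) `^ s by exact: powR_gt0.
have Ws : 0 < (W + e) `^ s by exact: powR_gt0.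
pose B x := (Z + e) * (W + e) * ((1 + m x) `^ s + ((Z + e) `^ s)^-1 * `|z x| `^ s
    + ((W + e) `^ s)^-1 * `|w x| `^ s).
have IB : rintegrable mu D B.
  by apply: rintegrableZ => //; apply: rintegrableD => //; [apply: rintegrableD => //|];
    exact: rintegrableZ.
apply: (@le_trans _ _ (I B)).
  apply: le_Rintegral => // x _; rewrite /B.
  have zE : `|z x| = (Z + e) * (`|z x| / (Z + e)) by rewrite mulrCA mulfV ?mulr1// gt_eqF.
  have wE : `|w x| = (W + e) * (`|w x| / (W + e)) by rewrite mulrCA mulfV ?mulr1// gt_eqF.
  rewrite {1}zE {1}wE.
  have -> : (1 + m x) `^ (s - 2) * ((Z + e) * (`|z x| / (Z + e)) * ((W + e) * (`|w x| / (W + e))))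
    = (Z + e) * (W + e) * ((1 + m x) `^ (s - 2) * ((`|z x| / (Z + e)) * (`|w x| / (W + e))))
      by ring.
  apply: ler_wpM2l; first by rewrite mulr_ge0// ltW.
    rewrite !powR_div//; apply: powR_young3; rewrite ?divr_ge0 ?(ltW Ze) ?(ltW We)//.
  by rewrite addr_ge0.
have -> : I B = (Z + e) * (W + e) * (I (fun x => (1 + m x) `^ s)
    + ((Z + e) `^ s)^-1 * I (fun x => `|z x| `^ s) + ((W
      + e) `^ s)^-1 * I (fun x => `|w x| `^ s)).
  rewrite /B RintegralZl//; last first.
    by apply: rintegrableD => //; [apply: rintegrableD => //|]; exact: rintegrableZ.
  congr (_ * _); rewrite RintegralD//; [|by apply: rintegrableD => //;
    exact: rintegrableZ|exact: rintegrableZ].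
  rewrite RintegralD//; last exact: rintegrableZ.
  by rewrite !RintegralZl.
have hZ : ((Z + e) `^ s)^-1 * I (fun x => `|z x| `^ s) <= 1.
  rewrite mulrC ler_pdivrMr// mul1r; apply: le_trans hz _.
  by apply: ge0_ler_powR; rewrite ?nnegrE ?(ltW Ze) ?(ltW We) ?lerDl ?(ltW e0).
have hW : ((W + e) `^ s)^-1 * I (fun x => `|w x| `^ s) <= 1.
  rewrite mulrC ler_pdivrMr// mul1r; apply: le_trans hw _.
  by apply: ge0_ler_powR; rewrite ?nnegrE ?(ltW Ze) ?(ltW We) ?lerDl ?(ltW e0).
apply: (@le_trans _ _ ((Z + e) * (W + e) * (Ms + 2))).
  apply: ler_wpM2l; first by rewrite mulr_ge0// ltW.
  by apply: le_trans (lerD (lerD hm hZ) hW) _; rewrite -addrA.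
have : (Ms + 2) * (e * e) <= (Ms + 2) * (e * 1).
  apply: ler_wpM2l; first by rewrite addr_ge0.
  by apply: ler_wpM2l => //; exact: ltW.
by slra.
Qed.

End weighted_integrals.

Section source_form.
Context {d : measure_display} {T : measurableType d} {R : realType}.
Variables (mu : {measure set T -> \bar R}) (D : set T).
Hypothesis mD : measurable D.
Hypothesis Dfin : (mu D < +oo)%E.
Variables q s : R.
Hypotheses (q2 : 2 < q) (qs : q < s).
Local Notation I f := (\int[mu]_(x in D) f x)%R.

Variables (H : (T -> R) -> Prop) (nh : (T -> R) -> R) (Ce : R).
Hypotheses (sH : subspace H) (nhN : norm_on H nh) (Ce0 : 0 <= Ce).
Hypothesis Hm : forall w, H w -> measurable_fun D w.
Hypothesis Hs : forall w, H w -> rintegrable mu D (fun x => `|w x| `^ s).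
Hypothesis Hemb : forall w, H w -> I (fun x => `|w x| `^ s) <= (Ce * nh w) `^ s.
Implicit Types f g phi : T -> R.
Local Ltac slra := generalize q2 qs; clear -mD Dfin q2 qs sH nhN Ce0 Hm Hs Hemb; lra.
Let s2 : 2 < s. Proof. by slra. Qed.
Let s0 : 0 <= s. Proof. by slra. Qed.
Let q0 : 0 < q. Proof. exact: lt_trans q2. Qed.
Let qs' : q <= s. Proof. exact: ltW. Qed.
Let nh0 x : 0 <= Ce * nh x. Proof. by rewrite mulr_ge0 ?(norm_on_ge0 nhN). Qed.

Definition source f : T -> R := fun t => log_source q (f t).
Definition source_form := ip2 mu D \o source.
Definition source_energy f := I (fun t => log_potential q (f t)).

Lemma measurable_log_source : measurable_fun setT (@log_source R q).
Proof.
have mn := @normr_measurable R setT.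
rewrite (_ : @log_source R q = (fun x => `|x| `^ (q - 2) * x) \* (@ln R \o Num.norm))//.
apply: measurable_funM; last exact: (measurableT_comp (@measurable_ln R) mn).
by apply: measurable_funM => //; exact: (measurableT_comp (measurable_powR (q - 2)) mn).
Qed.

Lemma measurable_log_potential : measurable_fun setT (@log_potential R q).
Proof.
have mn := @normr_measurable R setT.
have mp : measurable_fun setT (fun x : R => `|x| `^ (q - 2)).
  exact: (measurableT_comp (measurable_powR (q - 2)) mn).
apply: measurable_funB; apply: measurable_funM => //; apply: measurable_funM => //.
rewrite (_ : @log_weight R q = (fun x => `|x| `^ (q - 2)) \* (@ln R \o Num.norm))//.
apply: measurable_funM => //.
exact: (measurableT_comp (@measurable_ln R) mn).
Qed.

Lemma source_measurable f : measurable_fun D f -> measurable_fun D (source f).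
Proof. exact: measurableT_comp measurable_log_source. Qed.

Lemma source_weight f g (B : R) : H f -> H g -> nh f <= B -> nh g <= B -> 0 <= B ->
  rintegrable mu D (fun x => (1 + (`|f x| + `|g x|)) `^ s) /\
  I (fun x => (1 + (`|f x| + `|g x|)) `^ s)
    <= 3 `^ s * (fine (mu D) + ((Ce * B) `^ s + (Ce * B) `^ s)).
Proof.
move=> Hf Hg fB gB B0.
have I2 : rintegrable mu D (fun x => `|f x| `^ s + `|g x| `^ s).
  by apply: rintegrableD => //; exact: Hs.
have I3 : rintegrable mu D (fun x => 3 `^ s * (1 + (`|f x| `^ s + `|g x| `^ s))).
  by apply: rintegrableZ => //; apply: rintegrableD => //; exact: rintegrable_cst.
have h x : (1 + (`|f x| + `|g x|)) `^ s <= 3 `^ s * (1 + (`|f x| `^ s + `|g x| `^ s)).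
  by apply: powR_add3.
have I1 : rintegrable mu D (fun x => (1 + (`|f x| + `|g x|)) `^ s).
  apply: (rintegrable_le mD _ I3); last first.
    by move=> x _; rewrite ger0_norm ?powR_ge0.
  apply: (measurableT_comp (measurable_powR s)); apply: measurable_funD => //.
  by apply: measurable_funD; apply: measurableT_comp => //; exact: Hm.
split => //; apply: (@le_trans _ _ _ _ _ (le_Rintegral mD I1 I3 (fun x _ => h x))).
have E w : H w -> nh w <= B -> I (fun x => `|w x| `^ s) <= (Ce * B) `^ s.
  move=> Hw wB; apply: le_trans (Hemb Hw) _.
  apply: ge0_ler_powR; rewrite ?nnegrE ?mulr_ge0 ?(norm_on_ge0 nhN)//.
  by apply: ler_wpM2l.
rewrite RintegralZl//; last by apply: rintegrableD => //; exact: rintegrable_cst.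
apply: ler_wpM2l; first exact: powR_ge0.
rewrite RintegralD//; [|exact: rintegrable_cst].
rewrite RintegralD//; try exact: Hs.
by rewrite Rintegral_cst// mul1r lerD2l lerD ?E.
Qed.

Definition weight_cst B := 3 `^ s * (fine (mu D) + ((Ce * B) `^ s + (Ce * B) `^ s)) + 2.

Lemma weight_cst_ge0 B : 0 <= weight_cst B.
Proof.
rewrite addr_ge0// mulr_ge0 ?powR_ge0// !addr_ge0 ?powR_ge0// fine_ge0.
Qed.

(** The common estimate behind the integrability, Lipschitz and Taylor bounds: there the pointwise
    constant is a multiple of the weight (1 + |f| + |g|)^(s-2). *)
Lemma source_weighted f g z w (B : R) : H f -> H g -> H z -> H w -> nh f <= B -> nh g <= B ->
  rintegrable mu D (fun x => (1 + (`|f x| + `|g x|)) `^ (s - 2) * (`|z x| * `|w x|)) /\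
  I (fun x => (1 + (`|f x| + `|g x|)) `^ (s - 2) * (`|z x| * `|w x|))
    <= weight_cst B * ((Ce * nh z) * (Ce * nh w)).
Proof.
move=> Hf Hg Hz Hw fB gB.
have B0 : 0 <= B by apply: le_trans fB; exact: norm_on_ge0 nhN _.
have [I1 h1] := source_weight Hf Hg fB gB B0.
apply: weighted_integral => //; try exact: Hm; try exact: Hs; try exact: Hemb.
by apply: measurable_funD; apply: measurableT_comp => //; exact: Hm.
Qed.

Lemma source_mul_integrable f phi : H f -> H phi ->
  rintegrable mu D (fun x => source f x * phi x).
Proof.
move=> Hf Hp; have [I1 _] := source_weighted Hf Hf Hf Hp (lexx _) (lexx _).
apply: (rintegrable_le mD _ (rintegrableZ mD (log_source_cst q s) I1)).
  by apply: measurable_funM; [apply: source_measurable|]; exact: Hm.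
move=> x _; have := @log_source_le _ _ _ q2 qs (`|f x| + `|f x|) (f x).
rewrite lerDl normr_ge0 => /(_ isT) h; rewrite normrM.
by apply: le_trans (ler_wpM2r (normr_ge0 _) h) _; rewrite !mulrA.
Qed.

Lemma source_form_linear f : H f -> linear_on H (source_form f).
Proof.
move=> Hf; split => [g h Hg Hh|c g Hg]; rewrite /source_form /= !ip2E.
  rewrite -RintegralB//; [|exact: source_mul_integrable|exact: source_mul_integrable].
  by apply: eq_Rintegral => x _; rewrite !fctE mulrBr.
rewrite -RintegralZl//; last exact: source_mul_integrable.
by apply: eq_Rintegral => x _; rewrite !fctE /GRing.scale/= mulrCA.
Qed.

Lemma source_form0 phi : source_form 0 phi = 0.
Proof.
rewrite /source_form /= ip2E -[RHS](Rintegral_set0 mu (fun=> 0)) /Rintegral integral_set0.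
by congr fine; apply: integral0_eq => x _; rewrite /source /log_source mulr0 !mul0r.
Qed.

Lemma source_form_lip B : exists2 Lam, 0 <= Lam & forall f g phi, H f -> H g -> H phi ->
  nh f <= B -> nh g <= B ->
  `|source_form f phi - source_form g phi| <= Lam * nh (f - g) * nh phi.
Proof.
have [C0 _] := log_source_cst_ge q2 qs.
exists (2 * log_source_cst q s * (weight_cst B * (Ce * Ce))).
  by rewrite !mulr_ge0 ?weight_cst_ge0.
move=> f g phi Hf Hg Hp fB gB; have Hfg := subspaceB sH Hf Hg.
have [I1 h1] := source_weighted Hf Hg Hfg Hp fB gB.
have I2 : rintegrable mu D (fun x => source f x * phi x - source g x * phi x).
  by apply: rintegrableB => //; exact: source_mul_integrable.
rewrite /source_form /= !ip2E -RintegralB//; try exact: source_mul_integrable.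
apply: le_trans (le_normr_Rintegral mD I2) _.
have C1 : 0 <= 2 * log_source_cst q s by rewrite mulr_ge0.
apply: (@le_trans _ _ (2 * log_source_cst q s *
  I (fun x => (1 + (`|f x| + `|g x|)) `^ (s - 2) * (`|(f - g) x| * `|phi x|)))).
  rewrite -RintegralZl//; apply: le_Rintegral => //.
  - exact: integrable_norm.
  - exact: rintegrableZ.
  move=> x _; rewrite -mulrBl normrM.
  have := @log_source_lip _ _ _ q2 qs (`|f x| + `|g x|) (g x) (f x).
  rewrite lerDr lerDl !normr_ge0 => /(_ isT isT) h.
  by apply: le_trans (ler_wpM2r (normr_ge0 _) h) _; rewrite !mulrA.
apply: le_trans (ler_wpM2l C1 h1) _; rewrite le_eqVlt; apply/orP; left; apply/eqP; ring.
Qed.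

Lemma potential_integrable f : H f -> rintegrable mu D (fun x => log_potential q (f x)).
Proof.
move=> Hf; have [I1 _] := source_weighted Hf Hf Hf Hf (lexx _) (lexx _).
apply: (rintegrable_le mD _ (rintegrableZ mD (log_source_cst q s) I1)).
  by apply: (measurableT_comp measurable_log_potential); exact: Hm.
move=> x _; have := @log_potential_le _ _ _ q2 qs (`|f x| + `|f x|) (f x).
rewrite lerDl normr_ge0 => /(_ isT) h; apply: le_trans h _.
by rewrite -expr2 real_normK ?num_real// !mulrA.
Qed.

Lemma source_energy_taylor B : exists2 Lam, 0 <= Lam & forall f g, H f -> H g ->
  nh f <= B -> nh g <= B ->
  `|source_energy g - source_energy f - source_form f (g - f)| <= Lam * nh (g - f) ^+ 2.
Proof.
have [C0 _] := log_source_cst_ge q2 qs.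
exists (3 * log_source_cst q s * (weight_cst B * (Ce * Ce))).
  by rewrite !mulr_ge0 ?weight_cst_ge0.
move=> f g Hf Hg fB gB; have Hgf := subspaceB sH Hg Hf.
have [I1 h1] := source_weighted Hf Hg Hgf Hgf fB gB.
have If := potential_integrable Hf; have Ig := potential_integrable Hg.
have Is := source_mul_integrable Hf Hgf.
have I2 : rintegrable mu D (fun x => log_potential q (g x) - log_potential q (f x) - source f x
  * (g - f) x).
  by apply: rintegrableB => //; exact: rintegrableB.
rewrite /source_form /source_energy /= ip2E -RintegralB// -RintegralB//; last exact: rintegrableB.
apply: le_trans (le_normr_Rintegral mD I2) _.
have C1 : 0 <= 3 * log_source_cst q s by rewrite mulr_ge0.
apply: (@le_trans _ _ (3 * log_source_cst q s *
  I (fun x => (1 + (`|f x| + `|g x|)) `^ (s - 2) * (`|(g - f) x| * `|(g - f) x|)))).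
  rewrite -RintegralZl//; apply: le_Rintegral => //.
  - exact: integrable_norm.
  - exact: rintegrableZ.
  move=> x _; have := @log_potential_taylor _ _ _ q2 qs (`|f x| + `|g x|) (f x) (g x).
  rewrite lerDr lerDl !normr_ge0 => /(_ isT isT) h; apply: le_trans h _.
  by rewrite -expr2 real_normK ?num_real// !mulrA.
apply: le_trans (ler_wpM2l C1 h1) _; rewrite le_eqVlt; apply/orP; left; apply/eqP; ring.
Qed.

Lemma norm_powR_integrable f r : H f -> 0 < r -> r <= s
  -> rintegrable mu D (fun x => `|f x| `^ r).
Proof.
by move=> Hf r0 rs; apply: (rintegrable_norm_powR_le mD Dfin r0 rs); [exact: Hm|exact: Hs].
Qed.

Lemma source_energyE f : H f ->
  source_energy f = source_form f f / q - I (fun x => `|f x| `^ q) / q ^+ 2.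
Proof.
move=> Hf; have I1 := source_mul_integrable Hf Hf.
have I2 : rintegrable mu D (fun x => `|f x| `^ q) by exact: norm_powR_integrable.
rewrite /source_energy /source_form /= ip2E [_ / q]mulrC [_ / _ ^+ 2]mulrC.
rewrite -!RintegralZl// -RintegralB//; try exact: rintegrableZ.
by apply: eq_Rintegral => x _; rewrite (log_potentialE q2 qs) [_ / q]mulrC [_ / q ^+ 2]mulrC.
Qed.

Lemma source_form_le f : H f ->
  source_form f f <= (expR 1 * (s - q))^-1 * I (fun x => `|f x| `^ s).
Proof.
move=> Hf; rewrite /source_form /= ip2E -RintegralZl//; last exact: Hs.
apply: le_Rintegral => //; [exact: source_mul_integrable|by apply: rintegrableZ => //;
  exact: Hs|].
by move=> x _; rewrite /source (log_source_mul q2 qs); exact: (powR_ln_le q2 qs).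
Qed.

Lemma norm_powR_le_source f : H f ->
  I (fun x => `|f x| `^ q) <= fine (mu D) * (expR 1 `^ q + 1) + source_form f f.
Proof.
move=> Hf; have I1 := source_mul_integrable Hf Hf.
have I2 : rintegrable mu D (fun x => `|f x| `^ q) by exact: norm_powR_integrable.
have -> : fine (mu D) * (expR 1 `^ q + 1) = I (fun=> expR 1 `^ q + 1).
  by rewrite Rintegral_cst// mulrC.
rewrite /source_form /= ip2E -RintegralD//; last exact: rintegrable_cst.
apply: le_Rintegral => //; first by apply: rintegrableD => //; exact: rintegrable_cst.
by move=> x _; rewrite /source (log_source_mul q2 qs); exact: (powR_le_ln q2 qs).
Qed.

Lemma norm_powR_interpolation f l r : H f -> 0 < l -> 0 < r -> r <= q ->
  I (fun x => `|f x| `^ r) <= fine (mu D) * l `^ r + l `^ (r - q) * I (fun x => `|f x| `^ q).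
Proof.
move=> Hf l0 r0 rq.
have I2 : rintegrable mu D (fun x => `|f x| `^ q) by exact: norm_powR_integrable.
have I3 : rintegrable mu D (fun x => `|f x| `^ r).
  by apply: norm_powR_integrable => //; exact: le_trans rq (ltW qs).
have -> : fine (mu D) * l `^ r = I (fun=> l `^ r) by rewrite Rintegral_cst// mulrC.
rewrite -RintegralZl// -RintegralD//; [|exact: rintegrable_cst|exact: rintegrableZ].
apply: le_Rintegral => //.
  by apply: rintegrableD => //; [exact: rintegrable_cst|exact: rintegrableZ].
by move=> x _; apply: (powR_interpolation q2 qs).
Qed.

End source_form.

(** * Time integration *)

Section ae_integral.
Context {d : measure_display} {T : measurableType d} {R : realType}.
Variable mu : {measure set T -> \bar R}.
Local Open Scope ereal_scope.
Import HBNNSimple.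

(** A simple function below [f], set to 0 on the exceptional null set, lies below [g] and keeps its
    integral. *)
Lemma le_nnintegral_ae (f g : T -> \bar R) : (forall x, 0 <= f x) -> (forall x, 0 <= g x) ->
  {ae mu, forall x, f x = g x} -> \int[mu]_x f x <= \int[mu]_x g x.
Proof.
move=> f0 g0 [N [mN N0 hN]].
rewrite !ge0_integralTE//; apply/ge_ereal_sup => _ [h /= hf <-].
have mNc : measurable (~` N) by exact: measurableC.
apply: (@le_trans _ _ (sintegral mu (proj_nnsfun h mNc))).
  rewrite -!integralT_nnsfun/=.
  rewrite (@ge0_ae_eq_integral _ _ _ mu setT (EFin \o h) (EFin \o proj_nnsfun h mNc))//.
  - exact/measurable_EFinP.
  - exact/measurable_EFinP.
  - by move=> x _; rewrite lee_fin.
  - by move=> x _; rewrite lee_fin.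
  - exists N; split => // x /= /existsNP[] _ hx; apply: contrapT => nN; apply: hx.
    by rewrite mindicE mem_set// mulr1.
apply: ereal_sup_ubound; exists (proj_nnsfun h mNc) => //= x.
rewrite mindicE; case: (boolP (x \in _)) => [|_]; rewrite ?mulr1 ?mulr0//.
rewrite inE/= => nNx; apply: le_trans (hf x) _.
suff -> : f x = g x by [].
by apply: contrapT => fg; apply: nNx; exact: hN.
Qed.

(* No measurability is assumed: the integral is a supremum over simple functions. *)
Lemma ae_eq_integral_nonmeasurable (D : set T) (f g : T -> \bar R) :
  {ae mu, forall x, D x -> f x = g x} -> \int[mu]_(x in D) f x = \int[mu]_(x in D) g x.
Proof.
move=> fg; have E : {ae mu, forall x, (f \_ D) x = (g \_ D) x}.
  apply: filterS fg => x h; rewrite !patchE; case: ifP => //; rewrite inE => Dx; exact: h.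
have E' : {ae mu, forall x, (g \_ D) x = (f \_ D) x} by apply: filterS E => x ->.
rewrite (integralE _ D f) (integralE _ D g).
have P (f1 f2 : T -> \bar R) : {ae mu, forall x, (f1 \_ D) x = (f2 \_ D) x} ->
    \int[mu]_(x in D) (f1^\+) x <= \int[mu]_(x in D) (f2^\+) x /\
    \int[mu]_(x in D) (f1^\-) x <= \int[mu]_(x in D) (f2^\-) x.
  move=> h; rewrite !(integral_mkcond D) -!funepos_restrict -!funeneg_restrict.
  split; apply: le_nnintegral_ae => //; apply: filterS h => x hx.
    by rewrite !funeposE hx.
  by rewrite !funenegE hx.
have [p1 n1] := P _ _ E; have [p2 n2] := P _ _ E'.
by congr (_ - _); apply/eqP; rewrite eq_le ?p1 ?p2 ?n1 ?n2.
Qed.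

End ae_integral.

Section real_time.
Context {R : realType}.
Local Notation leb1 := (@lebesgue_measure R).
Implicit Types (f g : R -> R).

Lemma ae1_imply (P Q : R -> Prop) : (forall t, P t -> Q t) ->
  {ae leb1, forall t : R, P t} -> {ae leb1, forall t : R, Q t}.
Proof.
move=> PQ [N [mN N0 hN]]; exists N; split => //.
by apply: subset_trans hN => t /= nQ Pt; apply: nQ; exact: PQ.
Qed.

Lemma ae1_and (P Q : R -> Prop) : {ae leb1, forall t : R, P t} ->
  {ae leb1, forall t : R, Q t} -> {ae leb1, forall t : R, P t /\ Q t}.
Proof.
move=> [N [mN N0 hN]] [M [mM M0 hM]]; exists (N `|` M); split.
- exact: measurableU.
- by apply: null_set_setU.
- move=> t /= nPQ; apply: contrapT => /not_orP[nN nM]; apply: nPQ.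
  by split; apply: contrapT => h; [apply: nN; exact: hN|apply: nM; exact: hM].
Qed.

(** A null set contains no interval. Together with continuity this carries statements about almost
    every time to every time. *)
Lemma ae_dense (P : R -> Prop) a b : {ae leb1, forall t : R, P t} -> a < b ->
  exists2 t, a < t < b & P t.
Proof.
move=> [N [mN N0 hN]] ab; apply: contrapT => h.
have sub : `]a, b[%classic `<=` N.
  move=> t; rewrite /= in_itv/= => tab; apply: hN => /= Pt; apply: h; by exists t.
have L : ((b - a)%:E <= leb1 N)%E.
  have <- : leb1 `]a, b[%classic = (b - a)%:E by rewrite lebesgue_measure_itv/= lte_fin ab.
  by apply: le_measure => //; rewrite inE//; exact: measurable_itv.
by move: L; rewrite N0 lee_fin leNgt subr_gt0 ab.
Qed.

(** Compactness of the segment makes the local tolerances uniform. Only symmetry and the triangle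
    inequality of [dist] enter, so norms of u t - u s are covered. *)
Lemma heine_modulus (a b : R) (dist : R -> R -> R) :
  (forall x y, a <= x <= b -> a <= y <= b -> dist x y = dist y x) ->
  (forall x y z, a <= x <= b -> a <= y <= b -> a <= z <= b -> dist x z <= dist x y + dist y z) ->
  (forall x e, a <= x <= b -> 0 < e -> exists2 d, 0 < d &
    forall y, a <= y <= b -> `|y - x| < d -> dist x y <= e) ->
  modulus_on a b dist.
Proof.
move=> sym tri loc e e0.
have := @segment_compact R a b.
move=> /compact_near_coveringP/(_ R (0^'+)
  (fun d x => a <= x <= b -> forall y, a <= y <= b -> `|y - x| < d -> dist x y <= e) _) [].
  move=> x; rewrite /= in_itv/= => xab.
  have [d d0 hd] := loc x (e / 2) xab ltac:(by rewrite divr_gt0).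
  have d2 : 0 < d / 2 by rewrite divr_gt0.
  exists ((ball x (d / 2)), [set r : R | r < d / 2]).
    by split; [exact: nbhsx_ballx|exact: nbhs_right_lt].
  move=> [x' r] /= [xx' rd] x'ab y yab yx'.
  have h1 : dist x x' <= e / 2 by apply: hd => //; rewrite distrC; move: xx'; rewrite /ball/=;
    lra.
  have h2 : dist x y <= e / 2.
    apply: hd => //; have := ler_normD (y - x') (x' - x).
    by rewrite addrA subrK; move: xx'; rewrite /ball/= [`|x - x'|]distrC; lra.
  by have := tri x' x y x'ab xab yab; rewrite (sym x' x)//; lra.
move=> d0 /= d00 hd; have d2 : 0 < d0 / 2 by rewrite divr_gt0.
exists (d0 / 2) => // s t sab tab st.
have := hd (d0 / 2); rewrite /= sub0r normrN gtr0_norm//.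
move=> /(_ ltac:(lra) d2 s); rewrite /= in_itv/=; apply => //.
Qed.

Lemma continuous_modulus (a b : R) f : {within `[a, b], continuous f} ->
  modulus_on a b (fun s t => `|f t - f s|).
Proof.
move=> cf; apply: heine_modulus.
- by move=> x y _ _; rewrite distrC.
- move=> x y z _ _ _; have := ler_normD (f z - f y) (f y - f x).
  by rewrite addrA subrK; lra.
- move=> x e xab e0; move/subspace_continuousP : cf => /(_ x).
  rewrite /= in_itv/= => /(_ xab)/cvgrPdist_le/(_ _ e0).
  rewrite near_withinE => /nbhs_ballP[d d0 hd]; exists d => // y yab yx.
  have := hd y; rewrite /ball/= [`|x - y|]distrC in_itv/= => /(_ yx yab).
  by rewrite distrC.
Qed.

Lemma is_derive_eps f (t l : R) :
  (forall e, 0 < e -> exists2 d, 0 < d &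
    forall h, h != 0 -> `|h| < d -> `|h^-1 * (f (t + h) - f t) - l| <= e) ->
  is_derive t 1 f l.
Proof.
move=> hf.
have cv : h^-1 *: ((f \o shift t) (h *: (1 : R)) - f t) @[h --> 0^'] --> l.
  apply/cvgrPdist_le => e e0; have [d d0 hd] := hf e e0.
  apply/nbhs_ballP; exists d => // h /= h0 hn0; rewrite distrC.
  have := hd h hn0; rewrite /GRing.scale/= mulr1 [h + t]addrC; apply.
  by move: h0; rewrite /ball/= sub0r normrN.
split; first by apply/cvg_ex; exists l.
exact/cvg_lim.
Qed.

Lemma eq_continuous_ae (T : R) f g : 0 < T ->
  {within `[0, T], continuous f} -> {within `[0, T], continuous g} ->
  {ae leb1, forall t : R, 0 <= t <= T -> f t = g t} ->
  forall t, 0 <= t <= T -> f t = g t.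
Proof.
move=> T0 /continuous_modulus mf /continuous_modulus mg fg t tT.
apply/eqP; rewrite -subr_eq0 -normr_le0; apply/ler_addgt0Pr => e e0.
have e2 : 0 < e / 2 by rewrite divr_gt0.
have [d1 d10 h1] := mf _ e2; have [d2 d20 h2] := mg _ e2.
pose d := Num.min (Num.min d1 d2) T.
have d0 : 0 < d by rewrite !lt_min d10 d20.
have [dd1 dd2 dT] : [/\ d <= d1, d <= d2 & d <= T] by rewrite !ge_min !lexx !orbT.
have [t' [t'1 t'2] E] : exists2 t', 0 <= t' <= T /\ `|t' - t| < d & f t' = g t'.
  (* The neighbouring time is taken on the side of [t] on which [0, T] leaves room. *)
  have [ht|ht] := leP t (T / 2).
    have [t' /andP[a1 a2] E] := ae_dense fg (a := t) (b := t + d / 2) ltac:(lra).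
    have t'T : 0 <= t' <= T by case/andP : tT => *; apply/andP; split; lra.
    by exists t'; [split => //; rewrite ger0_norm; lra|exact: E].
  have [t' /andP[a1 a2] E] := ae_dense fg (a := t - d / 2) (b := t) ltac:(lra).
  have t'T : 0 <= t' <= T by case/andP : tT => *; apply/andP; split; lra.
  by exists t'; [split => //; rewrite ltr0_norm; lra|exact: E].
have a1 := h1 t' t t'1 tT; have a2 := h2 t t' tT t'1.
have {a1} := a1 ltac:(rewrite distrC; lra); have {a2} := a2 ltac:(lra).
have := ler_normD (f t - f t') (g t' - g t).
by rewrite E addrA subrK; lra.
Qed.

Lemma continuous_rintegrable (a b : R) f : {within `[a, b], continuous f} ->
  rintegrable leb1 `[a, b] f.
Proof. by move=> cf; apply: continuous_compact_integrable => //; exact: segment_compact. Qed.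

Lemma ftc_Rintegral (a b : R) f g : a <= b ->
  {within `[a, b], continuous f} -> {within `[a, b], continuous g} ->
  (forall t, t \in `]a, b[ -> is_derive t 1 f (g t)) ->
  (\int[leb1]_(t in `[a, b]) g t)%R = f b - f a.
Proof.
rewrite le_eqVlt => /predU1P[<- _ _ _|ab cf cg df].
  by rewrite set_itv1 Rintegral_set1 subrr.
rewrite /Rintegral (continuous_FTC2 ab cg (F := f))//.
  have [cf1 cf2 cf3] := (continuous_within_itvP _ ab).1 cf.
  by split => // t tab; have [] := df t tab.
by move=> t tab; rewrite derive1E; have [_ ->] := df t tab.
Qed.

Lemma primitive_modulus (T : R) f : 0 <= T -> rintegrable leb1 `[0, T] f ->
  modulus_on 0 T (fun s t => `|(\int[leb1]_(r in `[0%R, t]) f r)%R - (\int[leb1]_(r in `[0%R, s])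
    f r)%R|).
Proof. by move=> T0 If; apply: continuous_modulus; exact: parameterized_integral_continuous. Qed.

Lemma primitive_mean_value (T : R) f : {within `[0, T], continuous f} ->
  forall s t, 0 <= s -> s <= t -> t <= T -> exists2 r, s <= r <= t &
  (\int[leb1]_(r in `[0%R, t]) f r)%R - (\int[leb1]_(r in `[0%R, s]) f r)%R = (t - s) * f r.
Proof.
move=> cf s t s0 st tT; have If := continuous_rintegrable cf.
have T0 : 0 <= T by exact: le_trans s0 (le_trans st tT).
have hd r : r \in `]s, t[ ->
    is_derive r 1 (fun t => \int[leb1]_(r in `[0%R, t]) f r)%R (f r).
  rewrite in_itv/= => /andP[sr rt].
  have cr : {for r, continuous f}.
    have T0' : 0 < T by lra.
    have [cfi _ _] := (continuous_within_itvP f T0').1 cf.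
    by apply: cfi; rewrite in_itv/=; apply/andP; split; lra.
  have [||] := @continuous_FTC1_closed R f 0 r T _ If _ cr; [lra|lra|].
  by move=> h1 h2; split; [exact: h1|rewrite -derive1E; exact: h2].
have [|r] := MVT_segment st hd.
  apply: continuous_subspaceW (parameterized_integral_continuous T0 If).
  by move=> r /=; rewrite !in_itv/= => /andP[sr rt]; apply/andP; split; lra.
by rewrite in_itv/= => rst E; exists r => //; rewrite mulrC.
Qed.

End real_time.

Section sections.
Context {d1 d2 : measure_display} {X : measurableType d1} {Y : measurableType d2} {R : realType}.
Variables (m1 : {sigma_finite_measure set X -> \bar R}) (m2 : {sigma_finite_measure set Y
  -> \bar R}).
Variables (A : set X) (B : set Y).
Hypotheses (mA : measurable A) (mB : measurable B).
Local Notation m12 := (m1 \x m2)%E.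

Definition section_int (F : X * Y -> R) (r : X) : R := (\int[m2]_(y in B) F (r, y))%R.

(** The integral over a section may be infinite for a null set of [r]; there [fine] returns 0, which
    changes no integral in time. *)
Lemma rintegrable_section F : rintegrable m12 (A `*` B) F ->
  rintegrable m1 A (section_int F) /\
  (\int[m12]_(z in A `*` B) F z = \int[m1]_(r in A) section_int F r)%R.
Proof.
move=> IF; have mAB : measurable (A `*` B) by exact: measurableX.
pose f := (EFin \o F) \_ (A `*` B).
have If : m12.-integrable setT f by apply/(integrable_mkcond _ mAB).
pose h r := (\int[m2]_(y in B) (F (r, y))%:E)%E.
have fE : fubini_F m2 f = h \_ A.
  apply/funext => r; rewrite /fubini_F patchE; case: ifPn => rA.
    rewrite /h [RHS]integral_mkcond; apply: eq_integral => y _.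
    rewrite /f !patchE in_setX rA/=; by case: ifP.
  by apply: integral0_eq => y _; rewrite /f patchE in_setX (negbTE rA).
have Ih : m1.-integrable A h.
  by apply/(integrable_mkcond _ mA); rewrite -fE; exact: integrable_fubini_F.
have hfin : {ae m1, forall r, A r -> (EFin \o section_int F) r = h r}.
  apply: filterS (integrable_ae mA Ih) => r /[apply] hr.
  by rewrite /= /section_int /Rintegral fineK.
have ms : measurable_fun A (section_int F).
  apply: (measurableT_comp (fine_measurable measurableT)); exact: measurable_int Ih.
split.
  apply/integrableP; split; first exact/measurable_EFinP.
  have /integrableP[_] := Ih; congr (_ < _)%E; apply/esym; apply: ae_eq_integral_nonmeasurable.
  by apply: filterS hfin => r /[apply] ->.
rewrite /Rintegral; congr fine.
rewrite (ae_eq_integral_nonmeasurable hfin) [LHS]integral_mkcond -(integral12_prod_meas1 If) fE.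
by rewrite -integral_mkcond.
Qed.

End sections.

(** * The damping *)

Section damping_bounds.
Context {R : realType}.
Variable p : R.
Hypothesis p0 : 0 < p.
Implicit Types (l m v x : R).

Lemma damping_mul v : damping p v * v = `|v| `^ (p + 2).
Proof.
have [->|v0] := eqVneq v 0; first by rewrite mulr0 normr0 powR0// gt_eqF// addr_gt0.
by rewrite /damping -mulrA -expr2 -[v ^+ 2]real_normK ?num_real// -powR_mulrn// -powRD_gt0//
  normr_gt0.
Qed.

Lemma damping_norm v : `|damping p v| = `|v| `^ (p + 1).
Proof.
rewrite /damping normrM (ger0_norm (powR_ge0 _ _)).
have [->|v0] := eqVneq v 0; first by rewrite normr0 mulr0 powR0// gt_eqF// addr_gt0.
by rewrite -[X in _ * X](powRr1 (normr_ge0 v)) -powRD_gt0// normr_gt0.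
Qed.

Lemma powR_mul_norm v : `|v| `^ (p + 1) * `|v| = `|v| `^ (p + 2).
Proof. by rewrite -damping_norm -normrM damping_mul ger0_norm ?powR_ge0. Qed.

(** Split at |v| = k |x|, where k^(p+1) = l^(p+2): up to there the first term suffices, beyond it
    the second. *)
Lemma damping_young l v x : 0 < l ->
  `|damping p v * x| <= l `^ (p + 2) * `|x| `^ (p + 2)
     + l `^ (- ((p + 2) / (p + 1))) * `|v| `^ (p + 2).
Proof.
move=> l0; have p10 : 0 < p + 1 by rewrite addr_gt0.
rewrite normrM damping_norm; set k := l `^ ((p + 2) / (p + 1)).
have k0 : 0 < k by exact: powR_gt0.
have kE : k `^ (p + 1) = l `^ (p + 2) by rewrite -powRrM divfK// gt_eqF.
have [h|h] := leP `|v| (k * `|x|).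
  apply: ler_wpDr; first by rewrite mulr_ge0 ?powR_ge0.
  rewrite -powR_mul_norm mulrA -kE -powRM ?(ltW k0)//.
  by apply: ler_wpM2r => //; apply: ge0_ler_powR; rewrite ?nnegrE ?mulr_ge0 ?(ltW k0) ?(ltW p10).
apply: ler_wpDl; first by rewrite mulr_ge0 ?powR_ge0.
rewrite -powR_mul_norm powRN -/k mulrCA; apply: ler_wpM2l; first exact: powR_ge0.
by rewrite mulrC ler_pdivlMr// mulrC ltW.
Qed.

Definition tail_cst l := 1 + (l `^ ((p + 2)^-1)) `^ (- ((p + 2) / (p + 1))).

(** For |v| <= m the error damping(v) (x - v) is at most m^(p+1) |x - v|, which is split into [l]
    and a multiple of (x - v)^2. For |v| > m only the Young inequality with parameter l^(1/(p+2)) is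
    available, and the loss is charged to the tail of |v|^(p+2). *)
Lemma damping_lower l m v x : 0 < l -> 0 <= m ->
  `|v| `^ (p + 2) - (l + (m `^ (p + 1)) ^+ 2 / l * (x - v) ^+ 2 + l * `|x| `^ (p + 2))
   - tail_cst l * (`|v| `^ (p + 2) * (m < `|v|)%R%:R) <= damping p v * x.
Proof.
move=> l0 m0; have V0 := powR_ge0 `|v| (p + 2); have X0 := powR_ge0 `|x| (p + 2).
have lX : 0 <= l * `|x| `^ (p + 2) by rewrite mulr_ge0// ltW.
have c0 : 0 <= (m `^ (p + 1)) ^+ 2 / l * (x - v) ^+ 2.
  by rewrite mulr_ge0 ?divr_ge0 ?sqr_ge0// ltW.
case: (ltP m `|v|) => mv; last first.
  rewrite mulr0 mulr0 subr0.
  have -> : damping p v * x = `|v| `^ (p + 2) + damping p v * (x - v).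
    by rewrite -damping_mul; ring.
  have h : `|damping p v * (x - v)| <= m `^ (p + 1) * `|x - v|.
    rewrite normrM damping_norm; apply: ler_wpM2r => //.
    by apply: ge0_ler_powR; rewrite ?nnegrE ?addr_ge0 ?(ltW p0).
  have h2 : m `^ (p + 1) * `|x - v| <= l + (m `^ (p + 1)) ^+ 2 / l * (x - v) ^+ 2.
    set a := m `^ (p + 1); have -> : a ^+ 2 / l * (x - v) ^+ 2 = (a * `|x - v|) ^+ 2 / l.
      by rewrite exprMn real_normK ?num_real//; ring.
    set y := a * _; have y0 : 0 <= y by rewrite mulr_ge0// powR_ge0.
    rewrite -(ler_pM2l l0) mulrDr [l * (_ / _)]mulrCA mulfV ?gt_eqF// mulr1.
    by have := sqr_ge0 (l - y); rewrite sqrrB -mulr_natr; have := sqr_ge0 l;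
      have := mulr_ge0 (ltW l0) y0; rewrite expr2; lra.
  by have := lerNnormlW h; lra.
rewrite mulr1 /tail_cst; set L := l `^ _.
have L0 : 0 < L by exact: powR_gt0.
have LE : L `^ (p + 2) = l.
  by rewrite -powRrM mulVf ?powRr1 ?ltW// gt_eqF// addr_gt0.
have := lerNnormlW (damping_young v x L0); rewrite LE.
by move: V0 c0 lX l0; clear; lra.
Qed.

(** Split at |v| = |x| / 2. The factor 1/2 in front of the term in [x] allows this term to be
    absorbed later. *)
Lemma damping_jensen v x : `|v * damping p x| <= 2^-1 * `|x| `^ (p + 2) + 2 `^ (p
  + 1) * `|v| `^ (p + 2).
Proof.
rewrite normrM damping_norm -!powR_mul_norm.
have [h|h] := leP `|v| (2^-1 * `|x|).
  apply: ler_wpDr; first by rewrite !mulr_ge0 ?powR_ge0.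
  by rewrite mulrC [leRHS]mulrCA; apply: ler_wpM2l; first exact: powR_ge0.
apply: ler_wpDl; first by rewrite !mulr_ge0 ?powR_ge0.
rewrite mulrC mulrA; apply: ler_wpM2r => //; rewrite -powRM//.
apply: ge0_ler_powR; rewrite ?nnegrE ?mulr_ge0 ?addr_ge0 ?(ltW p0)//.
by move: h; clear; lra.
Qed.

Lemma measurable_damping : measurable_fun setT (@damping R p).
Proof.
apply: measurable_funM => //.
exact: (measurableT_comp (measurable_powR p) (@normr_measurable R setT)).
Qed.

End damping_bounds.

Lemma measurable_itvR {R : realType} (i : interval R) :
  measurable ([set` i] : set (measurableTypeR R)).
Proof. exact: measurable_itv. Qed.

(** * Integrals over space-time cylinders *)

Section cylinder.
Context {d : measure_display} {Y : measurableType d} {R : realType}.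
Local Notation leb1 := (@lebesgue_measure R).
Variables (m2 : {sigma_finite_measure set Y -> \bar R}) (B : set Y) (T : R).
Hypotheses (mB : measurable B) (Bfin : (m2 B < +oo)%E).
Local Notation m12 := (leb1 \x m2)%E.
Local Notation cyl S := (S `*` B).
Implicit Types (F G : measurableTypeR R * Y -> R) (f : Y -> R).

Lemma measurable_snd_cyl f (S : set (measurableTypeR R)) : measurable S -> measurable_fun B f ->
  measurable_fun (cyl S) (fun z => f z.2).
Proof.
move=> mS mf; apply: (measurable_comp mB _ mf) => [_ [z [_ Bz] <-]//|].
exact: measurable_funTS measurable_snd.
Qed.

Lemma rintegrable_snd f (S : set (measurableTypeR R)) : measurable S -> (leb1 S < +oo)%E ->
  rintegrable m2 B f -> rintegrable m12 (cyl S) (fun z => f z.2).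
Proof.
move=> mS Sfin If; have mSB : measurable (cyl S) by exact: measurableX.
have mf := measurable_snd_cyl mS (rintegrable_measurable If).
apply/(integrable_mkcond _ mSB); apply/integrable12ltyP.
  by apply/(measurable_restrictT _ mSB); exact/measurable_EFinP.
have -> : (fun x : R => \int[m2]_y `|((EFin \o (fun z => f z.2)) \_ (cyl S)) (x, y)|)%E
    = (fun=> \int[m2]_(y in B) `|(f y)%:E|)%E \_ S.
  apply/funext => x; rewrite patchE; case: ifPn => xS.
    rewrite [RHS]integral_mkcond; apply: eq_integral => y _.
    by rewrite !patchE in_setX xS/=; case: ifP => // _; rewrite abse0.
  by apply: integral0_eq => y _; rewrite patchE in_setX (negbTE xS) abse0.
rewrite -integral_mkcond integral_cst//.
have /integrableP[_ h] := If.
by apply: lte_mul_pinfty; rewrite ?ge0_fin_numE ?integral_ge0.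
Qed.

Lemma leb1_itv_fin (s t : R) : (leb1 `]s, t]%classic < +oo)%E.
Proof. by rewrite lebesgue_measure_itv/=; case: ifP => _; rewrite ltry. Qed.

Lemma leb1_itv (s t : R) : s <= t -> fine (leb1 `]s, t]%classic) = t - s.
Proof.
by rewrite le_eqVlt lebesgue_measure_itv/= lte_fin => /predU1P[->|->]; rewrite ?ltxx ?subrr.
Qed.

Hypothesis T0 : 0 < T.

Lemma cyl_sub F (s t : R) : rintegrable m12 (cyl `[0, T]) F -> 0 <= s -> t <= T ->
  rintegrable m12 (cyl `]s, t]) F.
Proof.
move=> IF s0 tT; apply: integrableS IF.
- by apply: measurableX.
- by apply: measurableX.
- move=> z [h1 h2]; split => //; move: h1; rewrite /= !in_itv/= => /andP[a b].
  by rewrite (le_trans b tT) ltW// (le_lt_trans s0 a).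
Qed.

Lemma cyl_sub0 F (t : R) : rintegrable m12 (cyl `[0, T]) F -> t <= T ->
  rintegrable m12 (cyl `[0, t]) F.
Proof.
move=> IF tT; apply: integrableS IF.
- by apply: measurableX.
- by apply: measurableX.
- move=> z [h1 h2]; split => //; move: h1; rewrite /= !in_itv/= => /andP[a b].
  by rewrite a (le_trans b tT).
Qed.

Definition cyl_int F (t : R) := (\int[m12]_(z in cyl `[0%R, t]) F z)%R.

Lemma cyl_intB F (s t : R) : rintegrable m12 (cyl `[0, T]) F -> 0 <= s -> s <= t -> t <= T ->
  cyl_int F t - cyl_int F s = (\int[m12]_(z in cyl `]s, t]) F z)%R.
Proof.
move=> IF s0 st tT; rewrite /cyl_int.
have E : cyl `[0, t] = cyl `[0, s] `|` cyl `]s, t] :> set (measurableTypeR R * Y).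
  apply/seteqP; split => -[r y] /=; rewrite !in_itv/=.
    by move=> [/andP[h1 h2] By]; case: (leP r s) => h; [left|right]; split => //; apply/andP.
  by move=> [[/andP[h1 h2] By]|[/andP[h1 h2] By]]; split => //; apply/andP; split => //;
    [exact: le_trans st|rewrite ltW// (le_lt_trans s0)].
rewrite E Rintegral_setU; [by rewrite addrC addKr| | | |].
- by apply: measurableX.
- by apply: measurableX.
- by rewrite -E; exact: cyl_sub0.
- apply/disj_setPRL => z [/= h1 _] [/= h2 _]; move: h1 h2; rewrite !in_itv/=.
  by move=> /andP[h _] /andP[_]; rewrite leNgt h.
Qed.

Lemma cyl_int_homo F (s t : R) : rintegrable m12 (cyl `[0, T]) F -> (forall z, 0 <= F z) ->
  0 <= s -> s <= t -> t <= T -> cyl_int F s <= cyl_int F t.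
Proof.
move=> IF F0 s0 st tT; rewrite -subr_ge0 (cyl_intB IF)//.
by apply: Rintegral_ge0 => z _.
Qed.

Lemma cyl_int_time F (t : R) : rintegrable m12 (cyl `[0, T]) F -> t <= T ->
  cyl_int F t = (\int[leb1]_(r in `[0%R, t]) section_int m2 B F r)%R.
Proof.
move=> IF tT; rewrite /cyl_int.
by have [_ ->] := rintegrable_section (measurable_itvR _) mB (cyl_sub0 IF tT).
Qed.

Lemma cyl_int_modulus F : rintegrable m12 (cyl `[0, T]) F ->
  modulus_on 0 T (fun s t => `|cyl_int F t - cyl_int F s|).
Proof.
move=> IF; have [h _] := rintegrable_section (measurable_itvR _) mB IF.
apply: modulus_onW ler01 _ (primitive_modulus (ltW T0) h) => s t /andP[_ sT] /andP[_ tT].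
by rewrite mul1r !cyl_int_time.
Qed.

Lemma cyl_section_le F (s t c : R) : rintegrable m12 (cyl `[0, T]) F -> 0 <= s -> s <= t -> t
  <= T ->
  {ae leb1, forall r : R, s <= r <= t -> section_int m2 B F r <= c} ->
  (\int[m12]_(z in cyl `]s, t]) F z)%R <= (t - s) * c.
Proof.
move=> IF s0 st tT Fc.
have [h ->] := rintegrable_section (measurable_itvR _) mB (cyl_sub IF s0 tT).
have -> : (t - s) * c = (\int[leb1]_(r in `]s, t]) c)%R.
  by rewrite Rintegral_cst// leb1_itv// mulrC.
apply: le_Rintegral_ae => //.
- by apply: rintegrable_cst => //; exact: leb1_itv_fin.
- apply: ae1_imply Fc => r hr; rewrite /= in_itv/= => /andP[a b]; apply: hr.
  by rewrite (ltW a).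
Qed.

Lemma cyl_snd f (s t : R) : rintegrable m2 B f -> s <= t ->
  (\int[m12]_(z in cyl `]s, t]) f z.2)%R = (t - s) * (\int[m2]_(y in B) f y)%R.
Proof.
move=> If st; have I1 := rintegrable_snd (measurable_itvR `]s, t]) (leb1_itv_fin s t) If.
have [_ ->] := rintegrable_section (measurable_itvR _) mB I1.
transitivity (\int[leb1]_(r in `]s, t]) (\int[m2]_(y in B) f y))%R; first by [].
by rewrite Rintegral_cst// leb1_itv// mulrC.
Qed.

End cylinder.

Lemma sqr_sub_le {R : realType} (a b c : R) : b ^+ 2 <= c -> (a - b) ^+ 2 <= 2 * (a ^+ 2 + c).
Proof. by move=> h; have := sqr_ge0 (a + b); rewrite sqrrD sqrrB; lra. Qed.

Section power_tail.
Context {d : measure_display} {X : measurableType d} {R : realType}.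
Variables (mu : {measure set X -> \bar R}) (D : set X) (f : X -> R) (r : R).
Hypotheses (mD : measurable D) (mf : measurable_fun D f).
Hypothesis If : rintegrable mu D (fun z => `|f z| `^ r).

Definition power_tail m z := `|f z| `^ r * (m < `|f z|)%R%:R.

Lemma power_tail_le m z : 0 <= power_tail m z <= `|f z| `^ r.
Proof.
rewrite /power_tail; have h := powR_ge0 `|f z| r.
by case: (m < _); rewrite ?mulr1 ?mulr0 ?lexx h.
Qed.

Lemma measurable_gt_norm m : measurable_fun D (fun z => (m < `|f z|)%R%:R : R).
Proof.
have -> : (fun z => (m < `|f z|)%R%:R : R) = (fun z => \1_`]m, +oo[%classic `|f z|).
  by apply/funext => z; rewrite indicE mem_setE in_itv/= andbT.
have mi : measurable_fun [set: R] (\1_(`]m, +oo[%classic : set R) : R -> R).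
  by apply: measurable_indic; exact: measurable_itv.
by apply: (measurableT_comp mi); exact: measurableT_comp.
Qed.

Lemma measurable_power_tail m : measurable_fun D (power_tail m).
Proof.
apply: measurable_funM; last exact: measurable_gt_norm.
exact: measurable_norm_powR.
Qed.

Lemma power_tail_integrable m : rintegrable mu D (power_tail m).
Proof.
apply: (rintegrable_le mD (measurable_power_tail m) If) => z _.
by have /andP[a b] := power_tail_le m z; rewrite ger0_norm.
Qed.

(** For each point the tail vanishes once the threshold exceeds |f|; dominated convergence does the
    rest. *)
Lemma power_tail_small e : 0 < e ->
  exists2 m : R, 0 <= m & (\int[mu]_(z in D) power_tail m z)%R <= e.
Proof.
move=> e0.
have [||||||_ cv] := @real_dominated_convergence _ _ R mu D (fun k => power_tail k%:R) (fun=> 0)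
  (fun z => `|f z| `^ r).
- exact: mD.
- by move=> k; exact: measurable_power_tail.
- exact: measurable_cst.
- move=> z _; apply: cvg_near_cst; exists (Num.bound `|f z|) => // k /= hk.
  rewrite /power_tail ltNge (le_trans _ (_ : (Num.bound `|f z|)%:R <= k%:R)) ?mulr0 ?ler_nat//.
  by rewrite ltW// archi_boundP.
- exact: If.
- by move=> k z _; have /andP[a b] := power_tail_le k%:R z; rewrite ger0_norm.
have : \forall k \near \oo, ((\int[mu]_(z in D) (power_tail k%:R z)%:E) < e%:E)%E.
  apply: cvge0_near e0; move: cv; congr (_ --> _).
  by apply: integral0_eq.
case=> k _ /(_ k (leqnn k)) /= hk; exists k%:R => //.
have It := power_tail_integrable k%:R.
by rewrite /Rintegral -lee_fin fineK ?(integrable_fin_num mD It)// ltW.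
Qed.

End power_tail.

Section damped_cylinder.
Context {d : measure_display} {Y : measurableType d} {R : realType}.
Local Notation leb1 := (@lebesgue_measure R).
Variables (m2 : {sigma_finite_measure set Y -> \bar R}) (B : set Y) (T p : R).
Hypotheses (mB : measurable B) (Bfin : (m2 B < +oo)%E) (T0 : 0 < T) (p0 : 0 < p).
Local Notation m12 := (leb1 \x m2)%E.
Local Notation cyl S := (S `*` B).
Variable w : measurableTypeR R * Y -> R.
Hypothesis mw : measurable_fun (cyl `[0, T]) w.
Hypothesis Iw : rintegrable m12 (cyl `[0, T]) (fun z => `|w z| `^ (p + 2)).
Variable v : R -> Y -> R.
Hypothesis hv : {ae leb1, forall t : R, 0 <= t <= T ->
  {ae m2, forall y, B y -> w (t, y) = v t y}}.
Implicit Types (phi : Y -> R) (F G : measurableTypeR R * Y -> R).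

Definition powint phi := (\int[m2]_(y in B) (`|phi y| `^ (p + 2)))%R.
Definition powint_ok phi := measurable_fun B phi /\ rintegrable m2 B (fun y => `|phi y| `^ (p
  + 2)).
(** Taken over the jointly measurable representative [w], so that Fubini and additivity in time are
    available; [damping_work_time] returns to the velocity. *)
Definition damping_work t phi := cyl_int m2 B (fun z => damping p (w z) * phi z.2) t.
Definition dissipation t := cyl_int m2 B (fun z => `|w z| `^ (p + 2)) t.

Let mI := @measurable_itvR R.
Let mcyl (i : interval R) : measurable (cyl ([set` i] : set (measurableTypeR R))).
Proof. by apply: measurableX. Qed.
Let C := (cyl `[0, T] : set (measurableTypeR R * Y)).
Let Cfin : (leb1 `[0%R, T]%classic < +oo)%E.
Proof. by rewrite lebesgue_measure_itv/=; case: ifP => _; rewrite ltry. Qed.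

Lemma rintegrable_cyl_snd (f : Y -> R) : rintegrable m2 B f -> rintegrable m12 C (fun z => f z.2).
Proof. by move=> If; exact: rintegrable_snd. Qed.

Lemma damping_work_integrable phi : powint_ok phi ->
  rintegrable m12 C (fun z => damping p (w z) * phi z.2).
Proof.
move=> [mphi Iphi].
have I2 := rintegrable_cyl_snd Iphi.
apply: (rintegrable_le (mcyl _) _ (rintegrableD (mcyl _)
  (rintegrableZ (mcyl _) (1 `^ (p + 2)) I2)
  (rintegrableZ (mcyl _) (1 `^ (- ((p + 2) / (p + 1)))) Iw))).
  apply: measurable_funM; last exact: measurable_snd_cyl.
  exact: (measurableT_comp (measurable_damping p) mw).
by move=> z _; apply: damping_young.
Qed.

Lemma damping_work_le l phi s t : 0 < l -> powint_ok phi -> 0 <= s -> s <= t -> t <= T ->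
  damping_work t phi - damping_work s phi
    <= (t - s) * (l `^ (p + 2) * powint phi)
       + l `^ (- ((p + 2) / (p + 1))) * (dissipation t - dissipation s).
Proof.
move=> l0 hphi s0 st tT; have I1 := damping_work_integrable hphi.
have [mphi Iphi] := hphi; have I2 := rintegrable_cyl_snd Iphi.
rewrite /damping_work /dissipation (cyl_intB mB I1 s0 st tT) (cyl_intB mB Iw s0 st tT).
have -> : (t - s) * (l `^ (p + 2) * powint phi) = l `^ (p + 2) * ((t - s) * powint phi) by ring.
rewrite /powint -(cyl_snd mB Iphi st).
have J1 := cyl_sub mB I1 s0 tT; have J2 := cyl_sub mB I2 s0 tT; have J3 := cyl_sub mB Iw s0 tT.
rewrite -!RintegralZl// -RintegralD//; [|exact: rintegrableZ|exact: rintegrableZ].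
apply: le_Rintegral => //.
  by apply: rintegrableD => //; exact: rintegrableZ.
move=> z _; apply: le_trans (ler_norm _) _; exact: damping_young.
Qed.

Local Notation tail := (power_tail w (p + 2)).
Let tail_le := power_tail_le w (p + 2).
Let tail_integrable := power_tail_integrable (mcyl `[0, T]) mw Iw.
Let tail_small := power_tail_small (mcyl `[0, T]) mw Iw.

Lemma w_sqr_integrable phi : L2 m2 B phi -> rintegrable m12 C (fun z => (phi z.2 - w z) ^+ 2).
Proof.
move=> [mphi Iphi].
have I1 := rintegrable_cyl_snd Iphi.
have I0 := rintegrable_cyl_snd (rintegrable_cst mB Bfin 1).
have I2 := rintegrableD (mcyl _) I0 Iw.
apply: (rintegrable_le (mcyl _) _ (rintegrableZ (mcyl _) 2 (rintegrableD (mcyl _) I1 I2))).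
  by apply: measurable_funX; apply: measurable_funB => //; exact: measurable_snd_cyl.
move=> z _; rewrite ger0_norm ?sqr_ge0//=.
have h : w z ^+ 2 <= 1 + `|w z| `^ (p + 2).
  rewrite -[leLHS]real_normK ?num_real// -powR_mulrn//.
  have [h|h] := leP 1 `|w z|.
    by apply: ler_wpDl => //; apply: ler_powR => //; rewrite lerDr ltW.
  apply: ler_wpDr; first exact: powR_ge0.
  by rewrite powR_mulrn// exprn_ile1// ltW.
exact: sqr_sub_le.
Qed.

Lemma section_velocity phi (f : R -> R -> R) :
  {ae leb1, forall r : R, 0 <= r <= T ->
    section_int m2 B (fun z => f (w z) (phi z.2)) r = (\int[m2]_(y in B) f (v r y) (phi y))%R}.
Proof.
apply: ae1_imply hv => r h rT; rewrite /section_int; congr fine.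
apply: ae_eq_integral_nonmeasurable; apply: filterS (h rT) => y hy By.
by rewrite /= hy.
Qed.

Lemma damping_work_time phi t : powint_ok phi -> t <= T ->
  damping_work t phi = (\int[leb1]_(r in `[0%R, t]) (\int[m2]_(y in B) (damping p (v r y) * phi
    y)))%R.
Proof.
move=> hphi tT; have I1 := damping_work_integrable hphi.
rewrite /damping_work (cyl_int_time mB I1 tT); congr fine.
apply: ae_eq_integral_nonmeasurable.
apply: ae1_imply (section_velocity phi (fun a b => damping p a * b)) => r h.
by rewrite /= in_itv/= => /andP[r0 rt]; rewrite h// r0 (le_trans rt tT).
Qed.

(** The pointwise bound [damping_lower] is integrated over the cylinder between [s] and [t]. The
    error [rho] is [tail_cst p l] times the tail integral up to time t, for a threshold at which its
    total is at most [e]. *)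
Lemma damping_dissipation e : 0 < e -> exists K (rho : R -> R),
  [/\ 0 <= K,
      forall s t, 0 <= s -> s <= t -> t <= T -> rho s <= rho t,
      rho T - rho 0 <= e &
      forall phi s t th, powint_ok phi -> L2 m2 B phi -> 0 <= s -> s <= t -> t <= T ->
        (forall r, s <= r <= t -> ip2 m2 B (phi - v r) (phi - v r) <= th) ->
        dissipation t - dissipation s - (t - s) * (e + K * th + e * powint phi) - (rho t - rho s)
          <= damping_work t phi - damping_work s phi].
Proof.
move=> e0; have b0 : 0 <= fine (m2 B) by rewrite fine_ge0.
pose l := e / (1 + fine (m2 B)).
have l0 : 0 < l by rewrite divr_gt0// ltr_pwDl.
have lB : l * fine (m2 B) <= e.
  by rewrite /l mulrAC ler_pdivrMr ?ltr_pwDl// mulrDr mulr1 lerDr ltW.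
have le : l <= e by rewrite ler_pdivrMr ?ltr_pwDl// mulrDr mulr1 lerDl mulr_ge0// ltW.
have K0 : 0 < tail_cst p l by rewrite /tail_cst ltr_pwDl// powR_ge0.
have [m m0 hm] := tail_small (divr_gt0 e0 K0).
have It := tail_integrable m.
exists ((m `^ (p + 1)) ^+ 2 / l), (fun t => tail_cst p l * cyl_int m2 B (tail m) t); split.
- by rewrite divr_ge0 ?sqr_ge0// ltW.
- move=> s t s0 st tT; apply: ler_wpM2l; first exact: ltW.
  by apply: (cyl_int_homo mB It) => // z; have /andP[] := tail_le m z.
- rewrite -mulrBr -ler_pdivlMl// mulrC; apply: le_trans hm.
  rewrite lerBlDr lerDl; apply: Rintegral_ge0 => z _; by have /andP[] := tail_le m z.
move=> phi s t th hphi Lphi s0 st tT hth; set c := _ / l.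
have c0 : 0 <= c by rewrite divr_ge0 ?sqr_ge0// ltW.
have [mphi Iphi] := hphi.
have I1 := damping_work_integrable hphi; have I2 := rintegrable_cyl_snd Iphi.
have I3 := w_sqr_integrable Lphi.
have Icst := rintegrable_cst mB Bfin l; have I0 := rintegrable_cyl_snd Icst.
have J1 := cyl_sub mB I1 s0 tT; have J2 := cyl_sub mB I2 s0 tT; have J3 := cyl_sub mB I3 s0 tT.
have Jw := cyl_sub mB Iw s0 tT; have Jt := cyl_sub mB It s0 tT; have J0 := cyl_sub mB I0 s0 tT.
have S3 : (\int[m12]_(z in cyl `]s, t]) (phi z.2 - w z) ^+ 2)%R <= (t - s) * th.
  apply: (cyl_section_le mB I3 s0 st tT).
  apply: ae1_imply (section_velocity phi (fun a b => (b - a) ^+ 2)) => r h rst.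
  have rT : 0 <= r <= T by case/andP: rst => a b; rewrite (le_trans s0 a) (le_trans b tT).
  rewrite (h rT); apply: le_trans (hth r rst); rewrite ip2E.
  by rewrite le_eqVlt; apply/orP; left; apply/eqP; apply: eq_Rintegral => y _; rewrite expr2.
have S2 := cyl_snd mB Iphi st.
have S0 : (\int[m12]_(z in cyl `]s, t]) (fun=> l) z.2)%R = (t - s) * (l * fine (m2 B)).
  by rewrite (cyl_snd mB Icst st) Rintegral_cst.
rewrite -!mulrBr /damping_work /dissipation (cyl_intB mB I1 s0 st tT) (cyl_intB mB Iw s0 st tT).
rewrite (cyl_intB mB It s0 st tT).
have M : (\int[m12]_(z in cyl `]s, t]) (`|w z| `^ (p + 2)
      - (l + c * (phi z.2 - w z) ^+ 2 + l * `|phi z.2| `^ (p + 2)) - tail_cst p l * tail m z))%R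
    <= (\int[m12]_(z in cyl `]s, t]) (damping p (w z) * phi z.2))%R.
  apply: le_Rintegral => //.
    by apply: rintegrableB => //; [apply: rintegrableB => //; apply: rintegrableD => //;
      [apply: rintegrableD => //|]|]; exact: rintegrableZ.
  by move=> z _; exact: damping_lower.
apply: le_trans M.
rewrite RintegralB//; [|by apply: rintegrableB => //; apply: rintegrableD => //;
  [apply: rintegrableD => //|]; exact: rintegrableZ|exact: rintegrableZ].
rewrite RintegralB//; last by apply: rintegrableD => //; [apply: rintegrableD => //|];
  exact: rintegrableZ.
rewrite RintegralD//; [|by apply: rintegrableD => //; exact: rintegrableZ|exact: rintegrableZ].
rewrite RintegralD//; last exact: rintegrableZ.
rewrite (RintegralZl c (mcyl _) J3) (RintegralZl l (mcyl _) J2) (RintegralZl (tail_cst p l) (mcyl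
  _) Jt) S2 S0.
rewrite lerD2r lerD2l lerN2.
have P0 : 0 <= powint phi by apply: Rintegral_ge0 => y _; exact: powR_ge0.
have ts0 : 0 <= t - s by rewrite subr_ge0.
have -> : (t - s) * (e + c * th + e * powint phi) = (t - s) * e + c * ((t - s) * th) + (t - s)
  * (e * powint phi) by ring.
apply: lerD; first by apply: lerD; apply: ler_wpM2l.
by rewrite mulrCA; apply: ler_wpM2l => //; apply: ler_wpM2r.
Qed.

(** The cutoff makes the damping of [phi] bounded, hence an L^2 element against which [u] has a
    derivative in time. *)
Definition truncated_damping phi m y := damping p (phi y) * (1 - (m < `|phi y|)%R%:R).

Lemma truncated_damping_bounded phi m y : 0 <= m -> `|truncated_damping phi m y| <= m `^ (p + 1).
Proof.
move=> m0; rewrite /truncated_damping; case: ltP => h /=.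
  by rewrite subrr mulr0 normr0 powR_ge0.
rewrite subr0 mulr1 damping_norm//.
by apply: ge0_ler_powR; rewrite ?nnegrE ?addr_ge0 ?(ltW p0).
Qed.

Lemma measurable_truncated_damping phi m : measurable_fun B phi ->
  measurable_fun B (truncated_damping phi m).
Proof.
move=> mphi; apply: measurable_funM; first exact: (measurableT_comp (measurable_damping p) mphi).
by apply: measurable_funB => //; exact: measurable_gt_norm.
Qed.

Lemma truncated_damping_L2 phi m : 0 <= m -> measurable_fun B phi
  -> L2 m2 B (truncated_damping phi m).
Proof.
move=> m0 mphi; apply: (L2_bounded mB Bfin (B := m `^ (p + 1))).
  exact: measurable_truncated_damping.
by move=> y _; exact: truncated_damping_bounded.
Qed.

Lemma mul_truncated_damping phi m y :
  phi y * truncated_damping phi m y = `|phi y| `^ (p + 2) - power_tail phi (p + 2) m y.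
Proof. by rewrite /truncated_damping /power_tail -(damping_mul p0); ring. Qed.

Lemma ip_truncated_damping phi m : powint_ok phi ->
  ip2 m2 B phi (truncated_damping phi m)
    = powint phi - (\int[m2]_(y in B) power_tail phi (p + 2) m y)%R.
Proof.
move=> [mphi Iphi]; rewrite ip2E -RintegralB//; last exact: power_tail_integrable.
by apply: eq_Rintegral => y _; exact: mul_truncated_damping.
Qed.

(** Where [phi] is below the cutoff this is [damping_jensen] for [w] and [phi], integrated;
    elsewhere the test function is 0. *)
Lemma velocity_truncated_le phi m s t : powint_ok phi -> 0 <= s -> s <= t -> t <= T ->
  (\int[leb1]_(r in `[s, t]) ip2 m2 B (v r) (truncated_damping phi m))%R
    <= 2^-1 * ((t - s) * ip2 m2 B phi (truncated_damping phi m))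
       + 2 `^ (p + 1) * (dissipation t - dissipation s).
Proof.
move=> hphi s0 st tT; have [mphi Iphi] := hphi.
pose psi := truncated_damping phi m; have mpsi := measurable_truncated_damping m mphi.
pose F (z : measurableTypeR R * Y) := w z * psi z.2.
have h (z : measurableTypeR R * Y) :
    `|F z| <= 2^-1 * (phi z.2 * psi z.2) + 2 `^ (p + 1) * `|w z| `^ (p + 2).
  rewrite /F /psi mul_truncated_damping /truncated_damping /power_tail.
  case: ltP => hm /=.
    rewrite subrr !mulr0 normr0 mulr1 subrr mulr0 add0r mulr_ge0 ?powR_ge0//.
  by rewrite subr0 !mulr1 mulr0 subr0; exact: damping_jensen.
have Ipp : rintegrable m2 B (fun y => phi y * psi y).
  have := rintegrableB mB Iphi (power_tail_integrable mB mphi Iphi m).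
  by congr rintegrable; apply/funext => y; rewrite /psi mul_truncated_damping.
have Ipc := rintegrable_cyl_snd Ipp.
have IF : rintegrable m12 C F.
  apply: (rintegrable_le (mcyl _) _ (rintegrableD (mcyl _)
    (rintegrableZ (mcyl _) 2^-1 Ipc) (rintegrableZ (mcyl _) (2 `^ (p + 1)) Iw))).
    by apply: measurable_funM => //; exact: measurable_snd_cyl.
  by move=> z _; exact: h.
have IFst := cyl_sub mB IF s0 tT.
have [Isec Esec] := rintegrable_section (mI `]s, t]) mB IFst.
have -> : (\int[leb1]_(r in `[s, t]) ip2 m2 B (v r) psi)%R = (\int[m12]_(z in cyl `]s, t]) F z)%R.
  rewrite Esec (Rintegral_itv_obnd_cbnd Isec); congr fine.
  apply: ae_eq_integral_nonmeasurable.
  apply: ae1_imply (section_velocity psi (fun a b => a * b)) => r hr.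
  rewrite /= in_itv/= => /andP[sr rt]; rewrite ip2E; congr EFin; rewrite -hr//.
  by rewrite (le_trans s0 sr) (le_trans rt tT).
rewrite /dissipation (cyl_intB mB Iw s0 st tT) ip2E -(cyl_snd mB Ipp st).
have Jp := cyl_sub mB Ipc s0 tT; have Jw := cyl_sub mB Iw s0 tT.
rewrite -(RintegralZl 2^-1 (mcyl _) Jp) -(RintegralZl (2 `^ (p + 1)) (mcyl _) Jw).
rewrite -RintegralD//; [|exact: rintegrableZ|exact: rintegrableZ].
apply: le_Rintegral => //; first by apply: rintegrableD => //; exact: rintegrableZ.
by move=> z _; apply: le_trans (ler_norm _) (h z).
Qed.

End damped_cylinder.

(** * From weak solutions to evolutions *)

Section stiffness.
Context {R : realType}.
Variables (mu : R -> R) (mu0 : R).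
Hypothesis hmu : admissible_mu mu mu0.

Lemma mu_continuous T : 0 < T -> {within `[0, T], continuous mu}.
Proof.
move=> T0; have [dmu _ _ mu_0 _] := hmu.
have c t : 0 < t -> {for t, continuous mu}.
  move=> t0; have [d _] := dmu t t0.
  by apply: differentiable_continuous; exact/derivable1_diffP.
apply/(continuous_within_itvP _ T0); split.
- by move=> t; rewrite in_itv/= => /andP[t0 _]; exact: c.
- exact: mu_0.
- by apply: cvg_at_left_filter; exact: c.
Qed.

(** By continuity of the derivative a positive value would persist on an interval, against its sign
    almost everywhere. *)
Lemma mu_derive1_le0 t : 0 < t -> derive1 mu t <= 0.
Proof.
move=> t0; have [dmu _ _ _ [_ hae]] := hmu; rewrite leNgt; apply/negP => dt.
have [_ cd] := dmu t t0.
have : \forall y \near t, 0 < derive1 mu y by apply: (cvgr_gt _ cd).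
move=> /nbhs_ballP[d /= d0 hd].
have [y /andP[ty yd] hy] := ae_dense hae (a := t) (b := t + d) ltac:(lra).
have [_] := hy ltac:(lra); apply/negP; rewrite -leNgt ltW//; apply: hd.
by rewrite /ball/= ltr0_norm; lra.
Qed.

Lemma mu_nonincreasing s t : 0 <= s -> s <= t -> mu t <= mu s.
Proof.
move=> s0 st; have T0 : 0 < t + 1 by lra.
have [dmu _ _ _ _] := hmu.
apply: (ler0_derive1_le_cc (a := 0) (b := t + 1)) => //.
- by move=> x; rewrite in_itv/= => /andP[x0 _]; exact: (dmu x x0).1.
- by move=> x; rewrite in_itv/= => /andP[x0 _]; exact: mu_derive1_le0.
- exact: mu_continuous.
- by rewrite in_itv/=; apply/andP; split; lra.
- by rewrite in_itv/=; apply/andP; split; lra.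
Qed.

Lemma mu_ge t : 0 <= t -> mu0 <= mu t.
Proof.
move=> t0; have [_ _ _ _ [_ hae]] := hmu.
have [y /andP[ty _] hy] := ae_dense hae (a := t) (b := t + 1) ltac:(lra).
have [h _] := hy ltac:(lra); apply: le_trans h _; apply: mu_nonincreasing => //; exact: ltW.
Qed.

End stiffness.

Section form_sum.
Context {R : realType} {X : lmodType R} {H : X -> Prop} (hH : subspace H).
Context {b : X -> X -> R} (hb : form_on H b).

Lemma subspace0 x : H x -> H 0.
Proof. by move=> Hx; rewrite -(subrr x); exact: subspaceB. Qed.

Lemma subspace_sum m (c : 'I_m -> R) (f : 'I_m -> X) x : H x -> (forall i, H (f i)) ->
  forall s : seq 'I_m, H (\sum_(i <- s) c i *: f i).
Proof.
move=> Hx Hf; elim=> [|i s ih]; first by rewrite big_nil; exact: subspace0 Hx.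
by rewrite big_cons; apply: (subspaceD hH) => //; apply: (subspaceZ hH).
Qed.

Lemma formDr x y z : H x -> H y -> H z -> b x (y + z) = b x y + b x z.
Proof.
move=> Hx Hy Hz; have HNz := subspaceZ hH (-1) Hz.
have -> : y + z = y - (-1 *: z) by rewrite scaleN1r opprK.
by rewrite (formBr hb Hx Hy HNz) (formZr hb _ Hx Hz) mulN1r opprK.
Qed.

Lemma form_sumr m (c : 'I_m -> R) (f : 'I_m -> X) x : H x -> (forall i, H (f i)) ->
  forall s : seq 'I_m, b x (\sum_(i <- s) c i *: f i) = \sum_(i <- s) c i * b x (f i).
Proof.
move=> Hx Hf; elim=> [|i s ih].
  by rewrite !big_nil -(scale0r x) (formZr hb)// mul0r.
rewrite !big_cons formDr//; [|exact: (subspaceZ hH)|exact: subspace_sum Hx Hf s].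
by rewrite ih (formZr hb).
Qed.

Lemma form_sum2 m (c : 'I_m -> R) (f : 'I_m -> X) x : H x -> (forall i, H (f i)) ->
  b (\sum_(i < m) c i *: f i) (\sum_(i < m) c i *: f i)
    = \sum_(i < m) c i * \sum_(j < m) c j * b (f i) (f j).
Proof.
move=> Hx Hf; have Hs := subspace_sum c Hx Hf (index_enum 'I_m).
rewrite (form_sumr c Hs Hf); apply: eq_bigr => i _; congr (_ * _).
rewrite (form_onC hb Hs (Hf i)) (form_sumr c (Hf i) Hf).
by apply: eq_bigr => j _.
Qed.

End form_sum.

Section continuous_in_norm.
Context {R : realType} {n : nat}.
Local Notation V := 'rV[R]_n.
Variables (H : (V -> R) -> Prop) (N : (V -> R) -> \bar R) (nr : (V -> R) -> R).
Hypotheses (sH : subspace H) (hnr : norm_on H nr).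
Hypothesis NE : forall f, H f -> N f = (nr f)%:E.

Lemma norm_on_sym x y : H x -> H y -> nr (x - y) = nr (y - x).
Proof.
move=> Hx Hy; have -> : x - y = -1 *: (y - x) by rewrite scaleN1r opprB.
by rewrite (norm_onZ hnr) ?normrN1 ?mul1r//; exact: (subspaceB sH).
Qed.

Lemma norm_on_triangle x y z : H x -> H y -> H z -> nr (x - z) <= nr (x - y) + nr (y - z).
Proof.
move=> Hx Hy Hz; have -> : x - z = (x - y) - (z - y) by rewrite opprB addrA subrK.
by rewrite (norm_on_sym Hy Hz); apply: (norm_onB hnr); exact: (subspaceB sH).
Qed.

Lemma C_into_modulus T (u : R -> V -> R) : C_into H N T u ->
  modulus_on 0 T (fun s t => nr (u t - u s)).
Proof.
move=> hu; have Hu t : 0 <= t <= T -> H (u t) by move=> /hu[].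
apply: heine_modulus.
- by move=> x y xT yT; apply: norm_on_sym; exact: Hu.
- by move=> x y z xT yT zT; rewrite [leRHS]addrC; apply: norm_on_triangle; exact: Hu.
- move=> t e tT e0; have [_ cv] := hu t tT.
  have : nbhs t (fun y => `[0, T]%classic y -> (N (u y \- u t)%R < e%:E)%E)
    by exact: cvge0_near cv e0.
  move=> /nbhs_ballP[d d0 hd].
  exists d => // y yT yt; have := hd y; rewrite /ball/= distrC in_itv/= => /(_ yt yT).
  rewrite (_ : (u y \- u t)%R = u y - u t)// NE ?lte_fin => [/ltW//|].
  by apply: (subspaceB sH); exact: Hu.
Qed.

End continuous_in_norm.

(** * Time regularity of a weak solution *)

Section velocity.
Context {R : realType} {n : nat}.
Local Notation V := 'rV[R]_n.
Local Notation leb := (@lebesgue_rV R n).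
Local Notation leb1 := (@lebesgue_measure R).
Variable Omega : set V.
Hypothesis (oO : open Omega) (bO : bounded_set Omega).
Let mO := measurable_domain oO.
Local Notation H1 := (in_H1 Omega).
Local Notation H01 := (in_H01 Omega).
Local Notation L2O := (L2 leb Omega).
Local Notation ip := (ip2 leb Omega).
Local Notation nh := (h1norm Omega).
Let sL2 := subspace_L2 leb mO.
Let fip := form_ip2 leb mO.
Let sH1 := subspace_H1 oO bO.
Let fh1 := form_h1form oO bO.
Let sH01 := subspace_H01 oO bO.
Let nhN := norm_h1norm oO bO.
Variables (T : R) (u v : R -> V -> R).
Hypothesis T0 : 0 < T.
Hypothesis hu : C_into H01 (H1norm Omega) T u.
Hypothesis hv : C_into (in_Lp Omega 2) (Lpnorm Omega 2) T v.
Hypothesis hd : L2_time_derivative Omega T u v.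
Hypothesis hB : in_L2_H01 Omega T v.

Lemma norm_h01 : norm_on H01 nh.
Proof.
have [h1 h2 h3] := nhN; split => // [x y|c x] [Hx _]; last exact: h3.
by move=> [Hy _]; exact: h2.
Qed.

Lemma sol_H01 t : 0 <= t <= T -> H01 (u t).
Proof. by move=> /hu[]. Qed.

Lemma sol_L2 t : 0 <= t <= T -> L2O (u t).
Proof. by move=> /sol_H01[/(in_H1_L2 oO)]. Qed.

Lemma vel_L2 t : 0 <= t <= T -> L2O (v t).
Proof. by move=> /hv[/(in_Lp2P oO)]. Qed.

Lemma sol_modulus : modulus_on 0 T (fun s t => nh (u t - u s)).
Proof.
apply: (C_into_modulus sH01 norm_h01 _ hu) => f [Hf _]; exact: H1normE.
Qed.

Lemma vel_modulus : modulus_on 0 T (fun s t => Num.sqrt (ip (v t - v s) (v t - v s))).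
Proof.
apply: (C_into_modulus sL2 (form_seminorm sL2 fip) (N := Lpnorm Omega 2)); first exact: Lpnorm2E.
by move=> t tT; have [h1 h2] := hv tT; split => //; exact/(in_Lp2P oO).
Qed.

Lemma ip_sol_derive psi t : L2O psi -> t \in `]0, T[ ->
  is_derive t 1 (fun t => ip (u t) psi) (ip (v t) psi).
Proof.
move=> Lpsi; rewrite in_itv/= => /andP[t0 tT].
have tI : 0 <= t <= T by rewrite !ltW.
apply: is_derive_eps => e e0.
set M := Num.sqrt (ip psi psi); have M0 : 0 <= M := sqrtr_ge0 _.
have e'0 : 0 < e / (1 + M) by rewrite divr_gt0// ltr_pwDl.
have : nbhs t (fun s => s != t -> `[0, T]%classic s ->
    (Lpnorm Omega 2 (fun x => (s - t)^-1 * (u s x - u t x) - v t x)%R < (e / (1 + M))%:E)%E).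
  exact: cvge0_near (hd tI) e'0.
move=> /nbhs_ballP[d /= d0 hd'].
exists (Num.min d (Num.min t (T - t))).
  by rewrite !lt_min d0 t0 subr_gt0.
move=> h h0; rewrite !lt_min => /andP[hdd /andP[ht hT]].
have hI : 0 <= t + h <= T.
  have := ler_norm h; have := ler_norm (- h); rewrite normrN.
  by move=> *; apply/andP; split; lra.
have := hd' (t + h); rewrite /ball/= opprD addNKr normrN in_itv/= => /(_ hdd).
have hne : t + h != t by rewrite -subr_eq0 addrAC subrr add0r.
move=> /(_ hne hI); have -> : t + h - t = h by ring.
set z : V -> R := fun x => _.
have zE : z = h^-1 *: (u (t + h) - u t) - v t by [].
have Lu := sol_L2 tI; have Lu' := sol_L2 hI; have Lv := vel_L2 tI.
have Luu := subspaceB sL2 Lu' Lu.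
have Lz : L2O z by rewrite zE; apply: (subspaceB sL2) => //; exact: (subspaceZ sL2).
rewrite Lpnorm2E// lte_fin => /ltW hz.
have -> : h^-1 * (ip (u (t + h)) psi - ip (u t) psi) - ip (v t) psi = ip z psi.
  by rewrite zE (formBl sL2 fip)// ?(formZl sL2 fip)// ?(formBl sL2 fip)//;
    exact: (subspaceZ sL2).
apply: le_trans (form_CS_sqrt sL2 fip Lz Lpsi) _.
apply: le_trans (ler_wpM2r M0 hz) _.
by rewrite -/M mulrAC -mulrA ger_pMr// ler_pdivrMr ?ltr_pwDl// mul1r lerDr.
Qed.

Lemma ip_sol_continuous psi : L2O psi -> {within `[0, T], continuous (fun t => ip (u t) psi)}.
Proof.
move=> Lpsi; apply: modulus_continuous.
apply: (modulus_onW (sqrtr_ge0 (ip psi psi))) _ sol_modulus => s t sT tT.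
have Hst := subspaceB sH01 (sol_H01 tT) (sol_H01 sT).
have Ls := sol_L2 sT; have Lt := sol_L2 tT.
rewrite -(formBl sL2 fip Lpsi Lt Ls).
apply: le_trans (form_CS_sqrt sL2 fip (subspaceB sL2 Lt Ls) Lpsi) _.
by rewrite mulrC; apply: ler_wpM2l; [exact: sqrtr_ge0|exact: (L2norm_le_h1norm oO bO Hst.1)].
Qed.

Lemma ip_vel_continuous psi : L2O psi -> {within `[0, T], continuous (fun t => ip (v t) psi)}.
Proof.
move=> Lpsi; apply: modulus_continuous.
apply: (modulus_onW (sqrtr_ge0 (ip psi psi))) _ vel_modulus => s t sT tT.
have Ls := vel_L2 sT; have Lt := vel_L2 tT.
rewrite -(formBl sL2 fip Lpsi Lt Ls) mulrC.
exact: (form_CS_sqrt sL2 fip (subspaceB sL2 Lt Ls) Lpsi).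
Qed.

Lemma ip_sol_increment psi s t : L2O psi -> 0 <= s -> s <= t -> t <= T ->
  ip (u t - u s) psi = (\int[leb1]_(r in `[s, t]) ip (v r) psi)%R.
Proof.
move=> Lpsi s0 st tT.
have sub : `[s, t] `<=` `[0, T].
  by move=> r /=; rewrite !in_itv/= => /andP[a b]; rewrite (le_trans s0 a) (le_trans b tT).
have hdr r : r \in `]s, t[ -> is_derive r 1 (fun t => ip (u t) psi) (ip (v r) psi).
  rewrite in_itv/= => /andP[a b]; apply: ip_sol_derive => //.
  by rewrite in_itv/= (le_lt_trans s0 a) (lt_le_trans b tT).
have := ftc_Rintegral st (continuous_subspaceW sub (ip_sol_continuous Lpsi))
  (continuous_subspaceW sub (ip_vel_continuous Lpsi)) hdr.
move=> ->; apply: (formBl sL2 fip Lpsi); apply: sol_L2.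
  by rewrite tT andbT (le_trans s0 st).
by rewrite s0 (le_trans st tT).
Qed.

(** The squared norm is a quadratic polynomial in finitely many indicators of measurable sets of
    times. *)
Lemma H01_simple_norm_measurable (S : R -> V -> R) : H01_simple Omega T S ->
  (forall t, 0 <= t <= T -> H01 (S t)) /\
  exists2 N : R -> R, measurable_fun [set: measurableTypeR R] N &
    forall t, 0 <= t <= T -> N t = nh (S t).
Proof.
move=> [m [B [f [hBf hS]]]].
have SE t : 0 <= t <= T -> S t = \sum_(i < m) \1_(B i) t *: f i.
  move=> tT; apply/funext => x; rewrite hS//.
  by elim/big_ind2 : _ => // a b c d -> ->.
have [x0 Hx0] : exists x, H01 x by exists (u 0); apply: sol_H01; rewrite lexx ltW.
have Hf i : H01 (f i) by exact: (hBf i).2.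
split=> [t tT|].
  rewrite (SE t tT); exact: (subspace_sum sH01 _ Hx0 Hf).
exists (fun t => Num.sqrt (\sum_(i < m) \1_(B i) t * \sum_(j < m) \1_(B j) t * h1form Omega (f i)
  (f j))).
  apply: (measurableT_comp (continuous_measurable_fun (@sqrt_continuous R))).
  apply: measurable_sum => i; apply: measurable_funM.
    exact: (measurable_indic (hBf i).1).
  apply: measurable_sum => j; apply: measurable_funM => //.
  exact: (measurable_indic (hBf j).1).
move=> t tT; rewrite /h1norm (SE t tT); congr Num.sqrt; apply/esym.
exact: (form_sum2 sH1 fh1 _ Hx0.1 (fun i => (Hf i).1)).
Qed.

(** The norm of [v t] is the limit of norms of simple functions for almost every time only; their
    upper limit is measurable and agrees with it there. The square is integrable by the Bochner
    condition, and 1 + x^2 bounds x. *)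
Lemma velocity_bound : exists2 k : R -> R, rintegrable leb1 `[0, T] k &
  {ae leb1, forall t : R, 0 <= t <= T -> H1 (v t) /\ nh (v t) <= k t}.
Proof.
have [hH [S [hS hcv]] hfin] := hB.
have hN k : exists N : R -> R, measurable_fun [set: measurableTypeR R] N /\
    forall t, 0 <= t <= T -> N t = nh (S k t).
  by have [_ [N mN NE]] := H01_simple_norm_measurable (hS k); exists N.
have [N {}hN] := choice hN.
have HS k t : 0 <= t <= T -> H01 (S k t).
  by have [h _] := H01_simple_norm_measurable (hS k); exact: h.
pose K (t : measurableTypeR R) : \bar R := limn_esup (fun k => (N k t)%:E).
have mK : measurable_fun setT K.
  by apply: measurable_fun_limn_esup => k; apply/measurable_EFinP; exact: (hN k).1.
have KE : {ae leb1, forall t : R, 0 <= t <= T -> H1 (v t) /\ K t = (nh (v t))%:E}.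
  apply: ae1_imply (ae1_and hH hcv) => t [Hvt cvt] tT.
  have Hv := (Hvt tT).1; split => //.
  have cN : N k t @[k --> \oo] --> nh (v t).
    apply/cvgrPdist_le => e e0; have hn : \forall k \near \oo, (H1norm Omega (S k t \- v t)%R <
      e%:E)%E.
      exact: cvge0_near (cvt tT) e0.
    apply: filterS hn => k; have HSk := (HS k t tT).1.
    rewrite (_ : (S k t \- v t)%R = S k t - v t)// H1normE//; last exact: (subspaceB sH1).
    rewrite lte_fin (hN k).2// distrC => /ltW h; apply: le_trans h.
    exact: (form_sqrtB sH1 fh1 HSk Hv).
  have cE : (N k t)%:E @[k --> \oo] --> (nh (v t))%:E.
    by apply: cvg_EFin; [exact: nearW|exact: cN].
  rewrite /K is_cvg_limn_esupE; first exact/cvg_lim.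
  by apply/cvg_ex; exists (nh (v t))%:E.
pose k t := 1 + fine (K t) ^+ 2.
have mk : measurable_fun `[0, T] (fun t => fine (K t) ^+ 2).
  apply: measurable_funX; apply: (measurableT_comp (fine_measurable measurableT)).
  exact: measurable_funTS.
have I2 : rintegrable leb1 `[0, T] (fun t => fine (K t) ^+ 2).
  apply/integrableP; split; first exact/measurable_EFinP.
  move: hfin; congr (_ < _)%E; apply: ae_eq_integral_nonmeasurable.
  apply: ae1_imply KE => t h; rewrite /= in_itv/= => tT; have [Hv ->] := h tT.
  by rewrite H1normE// ger0_norm ?sqr_ge0//= -powR_mulrn// sqrtr_ge0.
exists k.
  apply: rintegrableD => //; apply: rintegrable_cst => //.
  have lf : (leb1 `[0%R, T]%classic < +oo)%E.
    by rewrite lebesgue_measure_itv/=; case: ifP => _; rewrite ltry.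
  exact: lf.
apply: ae1_imply KE => t h tT; have [Hv E] := h tT; split => //.
rewrite /k E/=; have := sqr_ge0 (nh (v t) - 1); have := norm_on_ge0 nhN (v t).
by rewrite sqrrB; lra.
Qed.

(** Test functions are dense in [H01], so the norm can be tested on them, and there the H^1 product
    reduces to an L^2 product. *)
Lemma h1norm_dual w M : H01 w -> 0 <= M ->
  (forall phi, test_function Omega phi -> h1form Omega w phi <= M * nh phi) -> nh w <= M.
Proof.
move=> Hw M0 hM; have [Hw1 happ] := (in_H01P oO bO w).1 Hw.
have w0 : 0 <= nh w := sqrtr_ge0 _.
have ww : h1form Omega w w = nh w ^+ 2 by rewrite sqr_sqrtr// (form_on_ge0 fh1).
suff : nh w ^+ 2 <= M * nh w.
  have [->|wn] := eqVneq (nh w) 0; first by [].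
  by rewrite expr2 ler_pM2r// lt_neqAle eq_sym wn.
apply: (@le_of_small _ _ _ (nh w + M)); first exact: addr_ge0.
move=> e e0 _; have [phi tp hp] := happ e e0.
have Hp := test_function_H1 oO bO tp; have Hwp := subspaceB sH1 Hw1 Hp.
have E : h1form Omega w w = h1form Omega w (w - phi) + h1form Omega w phi.
  by rewrite (formBr fh1 Hw1 Hw1 Hp) subrK.
have h1 := le_trans (ler_norm _) (form_CS_sqrt sH1 fh1 Hw1 Hwp).
have h2 : nh phi <= nh w + e.
  have -> : phi = w - (w - phi) by rewrite opprB addrC subrK.
  by apply: le_trans (norm_onB nhN Hw1 Hwp) _; rewrite lerD2l.
have h3 := le_trans (hM phi tp) (ler_wpM2l M0 h2).
have h4 : Num.sqrt (h1form Omega w w) * Num.sqrt (h1form Omega (w - phi) (w - phi)) <= nh w * e.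
  by apply: ler_wpM2l.
rewrite -ww E; apply: le_trans (lerD (le_trans h1 h4) h3) _.
by rewrite le_eqVlt; apply/orP; left; apply/eqP; ring.
Qed.

(** The time derivative of [u] exists in L^2 only. Paired in H^1 with a test function, the increment
    of [u] is an L^2 pairing, hence the time integral of pairings of [v]. These are bounded by the
    H^1 norm of [v], and duality makes a primitive of the bound [k] serve as [K]. *)
Lemma sol_increment_bound : exists K : R -> R,
  forall s t, 0 <= s -> s <= t -> t <= T -> nh (u t - u s) <= K t - K s.
Proof.
have [k Ik hk] := velocity_bound.
exists (fun t => \int[leb1]_(r in `[0%R, t]) k r)%R => s t s0 st tT.
have T0' : 0 <= T by exact: ltW.
have sT : 0 <= s <= T by rewrite s0 (le_trans st tT).
have tT' : 0 <= t <= T by rewrite tT (le_trans s0 st).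
have sub : `[s, t] `<=` `[0, T].
  by move=> r /=; rewrite !in_itv/= => /andP[a b]; rewrite (le_trans s0 a) (le_trans b tT).
have sub0 : `[0, t] `<=` `[0, T].
  by move=> r /=; rewrite !in_itv/= => /andP[a b]; rewrite a (le_trans b tT).
have Ik0 : rintegrable leb1 `[0, t] k by exact: integrableS Ik.
have Ist : rintegrable leb1 `[s, t] k by exact: integrableS Ik.
have -> : (\int[leb1]_(r in `[0%R, t]) k r - \int[leb1]_(r in `[0%R, s]) k r)%R
    = (\int[leb1]_(r in `[s, t]) k r)%R.
  rewrite Rintegral_itvB ?bnd_simp//.
  rewrite Rintegral_itv_obnd_cbnd//; apply: integrableS Ist => //.
  by move=> r /=; rewrite !in_itv/= => /andP[a b]; rewrite ltW.
have k0 : {ae leb1, forall r : R, 0 <= r <= T -> 0 <= k r}.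
  by apply: ae1_imply hk => r h /h[_]; apply: le_trans; exact: sqrtr_ge0.
apply: h1norm_dual.
- exact: (subspaceB sH01 (sol_H01 tT') (sol_H01 sT)).
- have I0 : rintegrable leb1 `[s, t] (fun=> 0 : R).
    have := rintegrableZ (measurable_itvR _) 0 Ist.
    by congr (rintegrable _ _ _); apply/funext => r; rewrite mul0r.
  have := le_Rintegral_ae (measurable_itvR _) I0 Ist.
  rewrite (_ : (\int[leb1]_(x in `[s, t]) 0)%R = 0); last first.
    by rewrite /Rintegral integral0_eq.
  apply; apply: ae1_imply k0 => r h rst; apply: h.
  by have := sub _ rst; rewrite /= in_itv.
move=> phi tp; have [psi Lpsi hpsi] := h1form_test_function oO bO tp.
have Hphi := test_function_H1 oO bO tp.
rewrite hpsi; last exact: (subspaceB sH1 (sol_H01 tT').1 (sol_H01 sT).1).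
rewrite (ip_sol_increment Lpsi s0 st tT) mulrC -RintegralZl//.
have Iv : rintegrable leb1 `[s, t] (fun r => ip (v r) psi).
  apply: continuous_rintegrable; exact: continuous_subspaceW sub (ip_vel_continuous Lpsi).
apply: le_Rintegral_ae => //; first exact: rintegrableZ.
apply: ae1_imply hk => r h rst.
have [Hv vk] := h ltac:(by have := sub _ rst; rewrite /= in_itv).
rewrite -hpsi// mulrC; apply: le_trans (le_trans (ler_norm _) (form_CS_sqrt sH1 fh1 Hv Hphi)) _.
by apply: ler_wpM2r => //; exact: sqrtr_ge0.
Qed.

End velocity.

Lemma half_absorb {R : realType} (x y a b : R) :
  a <= b -> x <= 2^-1 * x + y -> x + a <= 2 * y + b.
Proof. lra. Qed.

Lemma within_continuousM {R : realType} (B : set R) (f g : R -> R) :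
  {within B, continuous f} -> {within B, continuous g} ->
  {within B, continuous (fun x => f x * g x)}.
Proof.
move=> /subspace_continuousP cf /subspace_continuousP cg.
by apply/subspace_continuousP => x Bx; apply: cvgM; [exact: cf|exact: cg].
Qed.

Section weak_solution_evolution.
Context {R : realType} {n : nat}.
Local Notation V := 'rV[R]_n.
Local Notation leb := (@lebesgue_rV R n).
Local Notation leb1 := (@lebesgue_measure R).
Variable Omega : set V.
Hypothesis (oO : open Omega) (bO : bounded_set Omega).
Let mO := measurable_domain oO.
Let fO := domain_fin oO bO.
Local Notation H01 := (in_H01 Omega).
Local Notation L2O := (L2 leb Omega).
Local Notation ip := (ip2 leb Omega).
Local Notation nh := (h1norm Omega).
Let sL2 := subspace_L2 leb mO.
Let fip := form_ip2 leb mO.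
Let sH1 := subspace_H1 oO bO.
Let sH01 := subspace_H01 oO bO.
Let nhN := norm_h01 oO bO.
Variables (A : V -> 'M[R]_n) (a0 : R).
Hypothesis hA : elliptic_matrix Omega A a0.
Variables (mu : R -> R) (mu0 : R).
Hypothesis hmu : admissible_mu mu mu0.
Variables (p q s Ce : R).
Hypotheses (p0 : 0 < p) (q2 : 2 < q) (pq : p + 2 < q) (qs : q < s) (Ce0 : 0 <= Ce).
Hypothesis Hs : forall w, H01 w -> rintegrable leb Omega (fun x => `|w x| `^ s).
Hypothesis Hemb : forall w, H01 w ->
  (\int[leb]_(x in Omega) (`|w x| `^ s))%R <= (Ce * nh w) `^ s.
Variables (u0 u1 : V -> R) (T : R) (u v : R -> V -> R).
Hypothesis T0 : 0 < T.
Hypothesis ws : weak_solution_deriv Omega A mu p q u0 u1 T u v.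

Let aa := a_form Omega A.
Let ff := source_form leb Omega q.
Let Hm w : H01 w -> measurable_fun Omega w.
Proof. by move=> [/(in_H1_L2 oO)[]]. Qed.
Let aaF : form_on H01 aa.
Proof.
have [h1 h2 h3] := form_a_form oO bO hA.
split=> [x [Hx _]|x y [Hx _] [Hy _]|x [Hx _]]; [|exact: h2|exact: h3].
have [l1 l2] := h1 x Hx; split=> [y z [Hy _] [Hz _]|c y [Hy _]]; [exact: l1|exact: l2].
Qed.
Let ffL x : H01 x -> linear_on H01 (ff x).
Proof. exact: (source_form_linear mO fO q2 qs nhN Ce0 Hm Hs Hemb). Qed.
Let hu := ws_C_H01 ws.
Let hv := ws_C_L2 ws.
Let Hu := sol_H01 hu.
Let Lv := vel_L2 oO hv.
Let mu_ := sol_modulus oO bO hu.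

Lemma H01_powint_ok phi : H01 phi -> powint_ok leb Omega p phi.
Proof.
move=> Hp; split; first exact: Hm.
apply: (norm_powR_integrable mO fO Hm Hs Hp); first by rewrite addr_gt0.
by apply: ltW; exact: lt_trans qs.
Qed.

Lemma velocity_representative : exists w : measurableTypeR R * V -> R,
  [/\ measurable_fun (`[0, T] `*` Omega) w,
      rintegrable (leb1 \x leb)%E (`[0, T] `*` Omega) (fun z => `|w z| `^ (p + 2)) &
      {ae leb1, forall t : R, 0 <= t <= T ->
        {ae leb, forall y, Omega y -> w (t, y) = v t y}}].
Proof.
have [w [mw Nw hw]] := ws_Lp ws; exists w; split => //.
have p2 : 0 < p + 2 by rewrite addr_gt0.
have mC : measurable ((`[0, T]%classic : set (measurableTypeR R)) `*` Omega).
  by apply: measurableX => //; exact: measurable_itvR.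
exact/(Lnorm_fin_rintegrable _ mC p2 mw).
Qed.

Lemma a_form_continuous phi : H01 phi -> {within `[0, T], continuous (fun t => aa (u t) phi)}.
Proof.
move=> Hp; have [CA CA0 hCA] := a_form_bounded oO bO hA.
have n0 : 0 <= nh phi := sqrtr_ge0 _.
apply: modulus_continuous; apply: (modulus_onW (mulr_ge0 CA0 n0)) _ mu_ => r t rT tT.
have Ht := Hu tT; have Hr := Hu rT.
rewrite -(formBl sH01 aaF Hp Ht Hr) mulrAC; apply: hCA; last exact: Hp.1.
exact: (subspaceB sH1 Ht.1 Hr.1).
Qed.

Lemma sol_bounded : exists M, forall t, 0 <= t <= T -> nh (u t) <= M.
Proof.
have [K hK] := sol_increment_bound oO bO T0 hu hv (ws_deriv ws) (ws_L2_H01 ws).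
exists (nh (u 0) + (K T - K 0)) => t /andP[t0 tT].
have H0 : H01 (u 0) by apply: Hu; rewrite lexx ltW.
have Ht : H01 (u t) by apply: Hu; rewrite t0.
have HT : H01 (u T) by apply: Hu; rewrite lexx ltW.
have := norm_on_triangle sH01 nhN Ht H0 (subspace0 sH01 Ht).
rewrite !subr0 => h.
have h1 := hK 0 t (lexx 0) t0 tT.
have h2 := hK t T t0 tT (lexx T).
have h3 : 0 <= nh (u T - u t) := sqrtr_ge0 _.
by move: h h1 h2 h3; lra.
Qed.

Lemma source_continuous phi : H01 phi -> {within `[0, T], continuous (fun t => ff (u t) phi)}.
Proof.
move=> Hp; have [M hM] := sol_bounded.
have [Lam L0 hL] := source_form_lip mO fO q2 qs sH01 nhN Ce0 Hm Hs Hemb M.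
have n0 : 0 <= nh phi := sqrtr_ge0 _.
apply: modulus_continuous; apply: (modulus_onW (mulr_ge0 L0 n0)) _ mu_ => r t rT tT.
rewrite mulrAC; exact: (hL _ _ _ (Hu tT) (Hu rT) Hp (hM _ tT) (hM _ rT)).
Qed.

Section representative.
Variable w : measurableTypeR R * V -> R.
Hypothesis mw : measurable_fun (`[0, T] `*` Omega) w.
Hypothesis Iw : rintegrable (leb1 \x leb)%E (`[0, T] `*` Omega) (fun z => `|w z| `^ (p + 2)).
Hypothesis hw : {ae leb1, forall t : R, 0 <= t <= T ->
   {ae leb, forall y, Omega y -> w (t, y) = v t y}}.
Let P := damping_work leb Omega p w.
Let D := dissipation leb Omega p w.

Definition sol_load phi r := - (mu r * aa (u r) phi) + ff (u r) phi.

Lemma sol_load_continuous phi : H01 phi -> {within `[0, T], continuous (sol_load phi)}.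
Proof.
move=> Hp.
rewrite (_ : sol_load phi = (fun t => ff (u t) phi) - (fun r => mu r * aa (u r) phi)).
  exact: within_continuousB (source_continuous Hp)
    (within_continuousM (mu_continuous hmu T0) (a_form_continuous Hp)).
by apply/funext => r; rewrite /sol_load !fctE addrC.
Qed.

(** For a fixed [phi] the equation is given for almost every time; both sides are continuous in
    time. *)
Lemma weak_equation phi t : H01 phi -> 0 <= t <= T ->
  ip (v t) phi - ip u1 phi + P t phi = (\int[leb1]_(r in `[0%R, t]) sol_load phi r)%R.
Proof.
move=> Hp; have okp := H01_powint_ok Hp.
have Lp := in_H1_L2 oO Hp.1.
have T0' := ltW T0.
have cm : {within `[0, T], continuous (fun r => mu r * aa (u r) phi)}.
  exact: within_continuousM (mu_continuous hmu T0) (a_form_continuous Hp).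
have Im := continuous_rintegrable cm.
have Is := continuous_rintegrable (source_continuous Hp).
have If := continuous_rintegrable (sol_load_continuous Hp).
move: t; apply: (eq_continuous_ae T0).
- have cP : {within `[0, T], continuous (P^~ phi)}.
    apply: modulus_continuous.
    exact: (cyl_int_modulus mO T0 (damping_work_integrable mO p0 mw Iw okp)).
  have cc : {within `[0, T], continuous (fun=> ip u1 phi : R)}
    by apply: continuous_subspaceT => x; exact: cst_continuous.
  exact: (within_continuousD (within_continuousB (ip_vel_continuous oO hv Lp) cc) cP).
- exact: (parameterized_integral_continuous T0' If).
apply: ae1_imply (ws_eq ws Hp) => t h tT; have {}h := h tT.
have /andP[t0 tT'] := tT.
have sub : `[0, t] `<=` `[0, T].
  by move=> r /=; rewrite !in_itv/= => /andP[a b]; rewrite a (le_trans b tT').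
have -> : (\int[leb1]_(r in `[0%R, t]) sol_load phi r)%R =
    - (\int[leb1]_(r in `[0%R, t]) (mu r * aa (u r) phi))%R
      + (\int[leb1]_(r in `[0%R, t]) ff (u r) phi)%R.
  have Im' : rintegrable leb1 `[0, t] (fun r => mu r * aa (u r) phi) by exact: integrableS Im.
  have Is' : rintegrable leb1 `[0, t] (fun r => ff (u r) phi) by exact: integrableS Is.
  rewrite addrC -(RintegralB _ Is' Im')//; apply: eq_Rintegral => r _.
  by rewrite /sol_load addrC.
rewrite /P (damping_work_time mO p0 mw Iw hw okp tT') !ip2E.
have -> : (\int[leb1]_(r in `[0%R, t]) ff (u r) phi)%R =
    (\int[leb1]_(r in `[0%R, t]) (\int[leb]_(x in Omega) (log_source q (u r x) * phi x)))%R.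
  by apply: eq_Rintegral => r _; rewrite /ff /source_form /= ip2E.
by rewrite -h; ring.
Qed.

Lemma weak_equation_mean phi r t : H01 phi -> 0 <= r -> r <= t -> t <= T ->
  exists2 m, r <= m <= t & ip (v t - v r) phi + (P t phi - P r phi)
    = (t - r) * (- (mu m * aa (u m) phi) + ff (u m) phi).
Proof.
move=> Hp r0 rt tT.
have rT : 0 <= r <= T by rewrite r0 (le_trans rt tT).
have tT' : 0 <= t <= T by rewrite tT (le_trans r0 rt).
have [m hm E] := primitive_mean_value (sol_load_continuous Hp) r0 rt tT.
exists m => //; rewrite -[RHS]E -(weak_equation Hp tT') -(weak_equation Hp rT).
by rewrite (formBl sL2 fip (in_H1_L2 oO Hp.1) (Lv tT') (Lv rT)); ring.
Qed.

(** Jensen's inequality by duality, up to a constant. The increment of [u] is paired with the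
    truncated damping of its own quotient, which gives the integral of the quotient up to a small
    tail. [velocity_truncated_le] bounds the pairing by half of itself plus dissipation, and the
    half is absorbed. *)
Lemma powint_difference_quotient r t : 0 <= r -> r < t -> t <= T ->
  (t - r) * powint leb Omega p ((t - r)^-1 *: (u t - u r))
    <= 2 * 2 `^ (p + 1) * (D t - D r).
Proof.
move=> r0 rt tT; have rT : 0 <= r <= T by rewrite r0 (le_trans (ltW rt) tT).
have tT' : 0 <= t <= T by rewrite tT (le_trans r0 (ltW rt)).
have tr0 : 0 < t - r by rewrite subr_gt0.
set phi := _ *: _.
have Hd := subspaceB sH01 (Hu tT') (Hu rT).
have Hp : H01 phi by exact: (subspaceZ sH01).
have okp := H01_powint_ok Hp; have [mphi Iphi] := okp.
apply: (@le_of_small _ _ _ (t - r)); first exact: ltW.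
move=> e e0 _; have [m m0 hm] := power_tail_small mO mphi Iphi e0.
have Lpsi := truncated_damping_L2 mO fO p0 m0 mphi.
have := velocity_truncated_le mO p0 mw Iw hw m okp r0 (ltW rt) tT.
rewrite -(ip_sol_increment oO bO hu hv (ws_deriv ws) Lpsi r0 (ltW rt) tT).
have -> : ip (u t - u r) (truncated_damping p phi m)
  = (t - r) * ip phi (truncated_damping p phi m).
  rewrite (formZl sL2 fip _ Lpsi (in_H1_L2 oO Hd.1)) mulrA mulfV ?mul1r//.
  by rewrite gt_eqF.
rewrite (ip_truncated_damping mO p0 m okp) -/D.
set J := (\int[_]_(_ in _) _)%R in hm *.
have : (t - r) * J <= (t - r) * e by apply: ler_wpM2l => //; exact: ltW.
move: (powint leb Omega p phi) => I0.
set X := (t - r) * (I0 - J); have -> : (t - r) * I0 = X + (t - r) * J by rewrite /X; ring.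
move: (2 `^ (p + 1) * (D t - D r)) (mulrA 2 (2 `^ (p + 1)) (D t - D r)) => Y <-.
exact: half_absorb.
Qed.

Lemma dissipation0 : D 0 = 0.
Proof.
have T0' := ltW T0.
by rewrite /D /dissipation (cyl_int_time mO Iw T0') set_itv1 Rintegral_set1.
Qed.

Theorem evolution_of_weak_solution : exists CA K,
  evolution H01 L2O ip nh aa CA ff (source_energy leb Omega q) (powint leb Omega p)
    mu T u v P D K (2 * 2 `^ (p + 1)).
Proof.
have [CA CA0 hCA] := a_form_bounded oO bO hA.
have [K hK] := sol_increment_bound oO bO T0 hu hv (ws_deriv ws) (ws_L2_H01 ws).
exists CA, K; split.
- exact: sH01.
- exact: sL2.
- by move=> x [/(in_H1_L2 oO)].
- exact: fip.
- exact: nhN.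
- exact: aaF.
- exact: CA0.
- by move=> x y [Hx _] [Hy _]; exact: hCA.
- exact: ffL.
- by move=> x _; exact: source_form0.
- exact: (source_form_lip mO fO q2 qs sH01 nhN Ce0 Hm Hs Hemb).
- exact: (source_energy_taylor mO fO q2 qs sH01 nhN Ce0 Hm Hs Hemb).
- exact: T0.
- exact: Hu.
- exact: Lv.
- exact: mu_.
- exact: (vel_modulus oO hv).
- exact: (continuous_modulus (mu_continuous hmu T0)).
- by move=> r t r0 rt _; exact: (mu_nonincreasing hmu).
- move=> t /andP[t0 _]; apply: le_trans (mu_ge hmu t0).
  by have [_ _ _ _ [/ltW]] := hmu.
- exact: hK.
- by move=> psi Lpsi t; exact: (ip_sol_derive oO hu hv (ws_deriv ws)).
- by move=> psi; exact: (ip_sol_continuous oO bO hu).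
- exact: weak_equation_mean.
- move=> r t r0 rt tT; apply: (cyl_int_homo mO Iw) => // z; exact: powR_ge0.
- exact: (cyl_int_modulus mO T0 Iw).
- move=> e e0; have [C [rho [C0 h1 h2 h3]]] := damping_dissipation mO fO p0 mw Iw hw e0.
  exists C, rho; split => // phi r t th Hp; apply: h3; first exact: H01_powint_ok.
  exact: (in_H1_L2 oO Hp.1).
- by rewrite mulr_ge0 ?powR_ge0.
- exact: powint_difference_quotient.
Qed.

End representative.

End weak_solution_evolution.

(** * The potential well *)

Section well_depth.
Context {R : realType} {n : nat}.
Variables (q mu0 : R) (K0 : R -> R).
Hypotheses (q2 : 2 < q) (m0 : 0 < mu0).

Definition r_gamma (g : R) := (mu0 * expR 1 * g / K0 g `^ (q + g)) `^ ((q + g - 2)^-1).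

(** The inequality with M is strict, so some element of the set of radii is close enough to the
    supremum. *)
Lemma well_depth_attained E : 0 < E -> E < M_const n q mu0 K0 ->
  exists2 g, gamma_range n q g &
    E < (q - 2) / (2 * q) * mu0 * r_gamma g ^+ 2 /\ r_gamma g ^+ 2 <= r_star n q mu0 K0 ^+ 2.
Proof.
move=> E0 EM; set S := [set r_gamma g | g in gamma_range n q].
have rE : r_star n q mu0 K0 = sup S by [].
have c0 : 0 < (q - 2) / (2 * q) * mu0 by rewrite mulr_gt0// divr_gt0//; generalize q2; lra.
have hS : has_sup S.
  (* Without a supremum, [sup] takes its default value 0 and M would be 0, against 0 < E < M. *)
  apply: contrapT => nS; move: EM; rewrite /M_const rE (sup_out nS) expr0n/= mulr0.
  by move=> /(lt_trans E0); rewrite ltxx.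
have r0 : 0 <= sup S.
  have [[r Sr] ub] := hS; apply: le_trans (ub_le_sup ub Sr).
  by have [g _ <-] := Sr; exact: powR_ge0.
(* The radius whose well depth is exactly [E]. *)
pose x := Num.sqrt (E / ((q - 2) / (2 * q) * mu0)).
have xr : x < sup S.
  rewrite -(ger0_norm r0) -sqrtr_sqr ltr_sqrt; last first.
    move: EM; rewrite /M_const rE => /(lt_trans E0); rewrite pmulr_rgt0//.
  by rewrite ltr_pdivrMr// mulrC; move: EM; rewrite /M_const rE.
have d0 : 0 < sup S - x by rewrite subr_gt0.
have [_ [g hg <-]] := sup_adherent d0 hS; rewrite subKr => xg.
have g0 : 0 <= r_gamma g := powR_ge0 _ _.
exists g => //; split; last first.
  rewrite rE lerXn2r ?nnegrE//; apply: ub_le_sup; first by case: hS.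
  by exists g.
have x0 : 0 <= x := sqrtr_ge0 _.
have : x ^+ 2 < r_gamma g ^+ 2 by rewrite ltrXn2r ?nnegrE.
rewrite sqr_sqrtr; last by rewrite divr_ge0 ?(ltW E0) ?(ltW c0).
by rewrite ltr_pdivrMr// mulrC.
Qed.

(** This characterizes the radius: there the bound (K0 r)^(q+g) / (e g) of the source term equals
    mu0 r^2. *)
Lemma r_gamma_critical g : 0 < g -> 0 < K0 g ->
  (expR 1 * g)^-1 * (K0 g * r_gamma g) `^ (q + g) = mu0 * r_gamma g ^+ 2.
Proof.
move=> g0 k0; have e0 := expR_gt0 (1 : R).
have Ks : 0 < K0 g `^ (q + g) by exact: powR_gt0.
have B0 : 0 < mu0 * expR 1 * g / K0 g `^ (q + g) by rewrite divr_gt0 ?mulr_gt0.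
have r0 : 0 < r_gamma g by exact: powR_gt0.
have s2 : q + g - 2 != 0 by rewrite gt_eqF//; generalize q2; lra.
have E : r_gamma g `^ (q + g - 2) = mu0 * expR 1 * g / K0 g `^ (q + g).
  by rewrite /r_gamma -powRrM mulVf ?powRr1// ltW.
rewrite powRM ?(ltW k0) ?(ltW r0)//.
have -> : r_gamma g `^ (q + g) = r_gamma g `^ (q + g - 2) * r_gamma g ^+ 2.
  rewrite -powR_mulrn ?(ltW r0)// -powRD_gt0//; congr (_ `^ _); ring.
by rewrite E; field; rewrite !gt_eqF.
Qed.

End well_depth.

Section embedding.
Context {R : realType} {n : nat}.
Local Notation V := 'rV[R]_n.
Local Notation leb := (@lebesgue_rV R n).
Variable Omega : set V.
Hypothesis (oO : open Omega) (bO : bounded_set Omega).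
Let mO := measurable_domain oO.
Local Notation H01 := (in_H01 Omega).

Lemma H01_measurable w : H01 w -> measurable_fun Omega w.
Proof. by move=> [/(in_H1_L2 oO)[]]. Qed.

Lemma Lpnorm_le (s c : R) w : 0 < s -> measurable_fun Omega w ->
  (Lpnorm Omega s w <= c%:E)%E ->
  rintegrable leb Omega (fun x => `|w x| `^ s) /\
  (\int[leb]_(x in Omega) (`|w x| `^ s))%R <= c `^ s.
Proof.
move=> s0 mw hc.
have I1 : rintegrable leb Omega (fun x => `|w x| `^ s).
  by apply/(Lnorm_fin_rintegrable _ mO s0 mw); apply: le_lt_trans hc (ltry _).
split => //; move: hc; rewrite /Lpnorm (Lnorm_rintegrable mO s0 I1) lee_fin => hc.
have J0 : 0 <= (\int[leb]_(x in Omega) (`|w x| `^ s))%R.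
  by apply: Rintegral_ge0 => x _; exact: powR_ge0.
have c0 : 0 <= c by apply: le_trans hc; exact: powR_ge0.
have := ge0_ler_powR (ltW s0) _ _ hc; rewrite !nnegrE powR_ge0 => /(_ isT c0).
by rewrite -powRrM mulVf ?gt_eqF// powRr1.
Qed.

(** The gradient norm is part of [h1norm]; the absolute value covers a constant [c] of unknown
    sign. *)
Lemma embedding_h1norm (s c : R) w : 0 < s -> H01 w ->
  (Lpnorm Omega s w <= c%:E * grad_norm Omega w)%E ->
  rintegrable leb Omega (fun x => `|w x| `^ s) /\
  (\int[leb]_(x in Omega) (`|w x| `^ s))%R <= (`|c| * h1norm Omega w) `^ s.
Proof.
move=> s0 Hw hc; apply: (Lpnorm_le s0 (H01_measurable Hw)).
apply: le_trans hc _; rewrite (grad_normE oO Hw.1) -EFinM lee_fin.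
apply: le_trans (ler_norm _) _; rewrite normrM (ger0_norm (sqrtr_ge0 _)).
apply: ler_wpM2l => //; apply: ler_wsqrtr; rewrite h1formE lerDr.
by apply: (form_on_ge0 (form_ip2 leb mO)); exact: in_H1_L2 Hw.1.
Qed.

End embedding.

Section initial_data.
Context {R : realType} {n : nat}.
Local Notation V := 'rV[R]_n.
Local Notation leb := (@lebesgue_rV R n).
Variable Omega : set V.
Hypothesis (oO : open Omega) (bO : bounded_set Omega).
Let mO := measurable_domain oO.
Let fO := domain_fin oO bO.
Local Notation H01 := (in_H01 Omega).
Local Notation ip := (ip2 leb Omega).
Variables (A : V -> 'M[R]_n) (mu : R -> R) (q s : R).
Hypotheses (q2 : 2 < q) (qs : q < s).
Hypothesis Hs : forall w, H01 w -> rintegrable leb Omega (fun x => `|w x| `^ s).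
Variables (nr : (V -> R) -> R) (Ce : R).
Hypotheses (nrN : norm_on H01 nr) (Ce0 : 0 <= Ce).
Hypothesis Hemb : forall w, H01 w ->
  (\int[leb]_(x in Omega) (`|w x| `^ s))%R <= (Ce * nr w) `^ s.

Lemma energyE t u v : H01 u -> L2 leb Omega v ->
  energy Omega A mu q t u v = 2^-1 * ip v v
    + (2^-1 * mu t * a_form Omega A u u - source_energy leb Omega q u).
Proof.
move=> Hu Lv; have Hm w : H01 w -> measurable_fun Omega w := @H01_measurable R n Omega oO w.
have q0 : 0 < q by exact: lt_trans q2.
have Iq : rintegrable leb Omega (fun x => `|u x| `^ q).
  by apply: (norm_powR_integrable mO fO Hm Hs Hu) => //; exact: ltW.
rewrite (source_energyE mO fO q2 qs nrN Ce0 Hm Hs Hemb Hu) /energy Lpnorm2E//=.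
rewrite sqr_sqrtr; last exact: (form_on_ge0 (form_ip2 leb mO)).
rewrite /Lpnorm (Lnorm_rintegrable mO q0 Iq)/=.
have J0 : 0 <= (\int[leb]_(x in Omega) (`|u x| `^ q))%R.
  by apply: Rintegral_ge0 => x _; exact: powR_ge0.
rewrite -powRrM mulVf ?gt_eqF// powRr1//.
have -> : (\int[leb]_(x in Omega) (`|u x| `^ q * ln `|u x|))%R = source_form leb Omega q u u.
  by rewrite /source_form /= ip2E; apply: eq_Rintegral => x _;
    rewrite /source (log_source_mul q2 qs).
by ring.
Qed.

Lemma source_energy_ae u u' : ae_eq_on Omega u u' ->
  source_energy leb Omega q u = source_energy leb Omega q u'.
Proof.
move=> h; congr fine; apply: ae_eq_integral_nonmeasurable.
by apply: filterS h => x /[apply] ->.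
Qed.

End initial_data.

(** * Blow-up of weak solutions *)

Lemma ip2_powR2 (R : realType) n (D : set 'rV[R]_n) f :
  ip2 (@lebesgue_rV R n) D f f = (\int[@lebesgue_rV R n]_(x in D) (`|f x| `^ 2))%R.
Proof.
by rewrite ip2E; apply: eq_Rintegral => y _; rewrite powR_mulrn// real_normK ?num_real// expr2.
Qed.

Theorem theorem2p5 (R : realType) (n : nat) (n_gt0 : (0 < n)%N)
  (Omega : set 'rV[R]_n) (hOmega : smooth_bounded_domain Omega)
  (A : 'rV[R]_n -> 'M[R]_n) (a0 : R) (hA : elliptic_matrix Omega A a0)
  (mu : R -> R) (mu0 : R) (hmu : admissible_mu mu mu0)
  (q : R) (q_gt2 : 2 < q) (q_subcritical : (q%:E < critical_exponent n)%E)
  (C K0 : R -> R) (hK0 : embedding_constants Omega A q C K0)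
  (p : R) (p_gt0 : 0 < p) (p_lt_q : p + 2 < q)
  (u0 u1 : 'rV[R]_n -> R) (hu0 : in_H01 Omega u0) (hu1 : in_Lp Omega 2 u1)
  (a_u0 : r_star n q mu0 K0 ^+ 2 < a_form Omega A u0 u0)
  (E0_gt0 : 0 < energy Omega A mu q 0 u0 u1)
  (E0_ltM : energy Omega A mu q 0 u0 u1 < M_const n q mu0 K0)
  (B7 : R) (hB7 : best_poincare_constant Omega B7)
  (eps : R) (eps_gt0 : 0 < eps) (eps_lt1 : eps < 1)
  (radicand_gt0 : 0 < a0 * mu0 / B7 * (1 + q * (1 - eps) / 2)
                        * (q * (1 - eps) / 2 - 1))
  (eps_eq :
     (p + 1) / (p + 2) * (B7 ^+ 2 / (2 * eps * a0 * mu0)) `^ ((p + 1)^-1) =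
     q * (1 - eps) /
     (2 * Num.sqrt (a0 * mu0 / B7 * (1 + q * (1 - eps) / 2)
                      * (q * (1 - eps) / 2 - 1))))
  (u0u1 :
     (p + 1) / (p + 2) * (B7 ^+ 2 / (2 * eps * a0 * mu0)) `^ ((p + 1)^-1)
       * energy Omega A mu q 0 u0 u1
     < (\int[lebesgue_rV n]_(x in Omega) (u0 x * u1 x))%R)
  (T : R) (T_gt0 : 0 < T) (u : R -> 'rV[R]_n -> R)
  (hu : weak_solution Omega A mu p q u0 u1 T u) :
  blows_up_in_finite_time Omega A mu p q u0 u1 T u.
Proof.
have [_ oO _ bO _] := hOmega.
have mO := measurable_domain oO; have fO := domain_fin oO bO.
pose leb := @lebesgue_rV R n.
have m0 : 0 < mu0 by have [_ _ _ _ []] := hmu.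
set E0 := energy _ _ _ _ _ _ _ in E0_gt0 E0_ltM u0u1.
pose N0 := (\int[lebesgue_rV n]_(x in Omega) (u0 x * u1 x))%R.
have N0_gt0 : 0 < N0.
  apply: le_lt_trans u0u1; rewrite mulr_ge0 ?(ltW E0_gt0)// mulr_ge0 ?powR_ge0//.
  by rewrite divr_ge0// addr_ge0// ltW.
have [g [g0 gcrit] [E0g rg]] := well_depth_attained q_gt2 m0 E0_gt0 E0_ltM.
set r := r_gamma q mu0 K0 g in E0g rg.
pose s := q + g.
have qs : q < s by rewrite ltrDl.
have sg : s - q = g by rewrite /s addrC addKr.
have q0 : 0 < q by exact: lt_trans q_gt2.
have s0 : 0 < s by exact: lt_trans qs.
have a_u0g : r ^+ 2 < a_form Omega A u0 u0 by exact: le_lt_trans a_u0.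
have emb w (Hw : in_H01 Omega w) := hK0 g (conj g0 gcrit) w Hw.
have embC w (Hw : in_H01 Omega w) := embedding_h1norm oO s0 Hw (emb w Hw).1.
have Hs w (Hw : in_H01 Omega w) := (embC w Hw).1.
have Hemb w (Hw : in_H01 Omega w) := (embC w Hw).2.
have Ce0 : 0 <= `|C g| by [].
have Hm w : in_H01 Omega w -> measurable_fun Omega w := @H01_measurable R n Omega oO w.
have nhN := norm_h01 oO bO.
have embK w (Hw : in_H01 Omega w) := Lpnorm_le oO s0 (Hm w Hw) (le_trans (emb w Hw).1 (emb w
  Hw).2).
have r_ge0 : 0 <= r := powR_ge0 _ _.
have r_gt0 : 0 < r.
  rewrite lt_neqAle r_ge0 andbT eq_sym; apply/eqP => r_eq0.
  by move: E0g; rewrite r_eq0 expr0n/= mulr0 => /(lt_trans E0_gt0); rewrite ltxx.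
have r2_gt0 : 0 < r ^+ 2 by rewrite exprn_gt0.
(* The embedding inequality for [u0], whose form is positive, gives a nonnegative constant. The
   value 0 would mean a division by zero in [r_gamma], whose result is 0, against 0 < r. *)
have K_gt0 : 0 < K0 g.
  have K_ge0 : 0 <= K0 g.
    have := le_trans (emb _ hu0).1 (emb _ hu0).2.
    move=> /(le_trans (Lnorm_ge0 _ _ _)); rewrite lee_fin pmulr_lge0// sqrtr_gt0.
    exact: lt_trans a_u0g.
  rewrite lt_neqAle K_ge0 andbT eq_sym; apply/eqP => K_eq0.
  move: r_gt0; rewrite /r /r_gamma K_eq0 powR0 ?gt_eqF// invr0 mulr0 powR0 ?ltxx//.
  by rewrite invr_eq0 gt_eqF// -[q + g]/s; lra.
have ce_ge0 : 0 <= (expR 1 * g)^-1 by rewrite invr_ge0 mulr_ge0 ?expR_ge0// ltW.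
have V0 : 0 <= fine (leb Omega) by rewrite fine_ge0.
have C10 : 0 <= fine (leb Omega) * (expR 1 `^ q + 1).
  by rewrite mulr_ge0// addr_ge0// powR_ge0.
have [Tmax hT] := no_long_evolution q_gt2 p_gt0 p_lt_q m0 r2_gt0 V0 C10 E0g N0_gt0.
move=> [U [gU _]].
(* A time beyond [Tmax]; the maximum with 1 makes it positive whatever the sign of [Tmax]. *)
pose T' := Num.max 1 (Tmax + 1).
have T'0 : 0 < T' by rewrite lt_max ltr01.
have [v ws] := gU T' T'0.
have [w [mw Iw hw]] := velocity_representative oO p_gt0 ws.
have [CA [K ev]] := evolution_of_weak_solution oO bO hA hmu p_gt0 q_gt2 p_lt_q qs Ce0 Hs Hemb T'0
  ws mw Iw hw.
have [iu iv] := ws_init ws.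
have I0 : (0:R) <= 0 <= T' by rewrite lexx ltW.
have HU0 : in_H01 Omega (U 0) := ev_u ev I0.
have LV0 : L2 leb Omega (v 0) := ev_v ev I0.
have Lu0 := in_H1_L2 oO hu0.1; have Lu1 := (in_Lp2P oO _).1 hu1.
have LU0 := in_H1_L2 oO HU0.1.
have aE := a_form_ae oO bO A HU0.1 HU0.1 hu0.1 hu0.1 iu iu.
have : T' <= Tmax.
  apply: (hT _ _ _ _ _ _ _ _ _ _ _ _ _ _ _ _ _ _ (fun x => \int[leb]_(y in Omega) (`|x y| `^
    q))%R ev).
  - exact: (dissipation0 oO T'0 Iw).
  - rewrite /evol_energy /potential /E0 (energyE oO bO A mu q_gt2 qs Hs nhN Ce0 Hemb 0 hu0 Lu1).
    rewrite aE (source_energy_ae q iu); congr (_ * _ + _).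
    exact: (ip_ae oO LV0 LV0 Lu1 Lu1 iv iv).
  - rewrite (ip_ae oO LU0 LV0 Lu0 Lu1 iu iv) ip2E; exact: erefl.
  - by rewrite aE.
  - by move=> t /andP[t0 _]; exact: (mu_ge hmu).
  - by move=> x _; apply: Rintegral_ge0 => y _; exact: powR_ge0.
  - by move=> x Hx; exact: (source_energyE mO fO q_gt2 qs nhN Ce0 Hm Hs Hemb Hx).
  - by move=> x Hx; exact: (norm_powR_le_source mO fO q_gt2 qs nhN Ce0 Hm Hs Hemb Hx).
  - move=> x Hx l l0.
    exact: (norm_powR_interpolation mO fO q_gt2 qs Hm Hs Hx l0 (addr_gt0 p_gt0 (ltr0Sn _ 1)) (ltW
      p_lt_q)).
  - move=> x Hx l l0.
    rewrite ip2_powR2.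
    exact: (norm_powR_interpolation mO fO q_gt2 qs Hm Hs Hx l0 (ltr0Sn _ 1) (ltW q_gt2)).
  - move=> x Hx xr; apply: le_trans (source_form_le mO fO q_gt2 qs nhN Ce0 Hm Hs Hemb Hx) _.
    rewrite sg -(r_gamma_critical q_gt2 m0 g0 K_gt0); apply: (ler_wpM2l ce_ge0).
    by have := (embK x Hx).2; rewrite xr sqrtr_sqr (ger0_norm r_ge0).
  - move=> phi a b l Hphi a_ge0 ab bT l0.
    apply: (damping_work_le mO p_gt0 mw Iw l0 _ a_ge0 ab bT).
    exact: (H01_powint_ok oO bO p_gt0 p_lt_q qs Hs Hphi).
by rewrite leNgt lt_max ltrDl ltr01 orbT.
Qed.
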